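(* Let $\psi:\mathbb{R}\to\mathbb{C}$ be a $2\pi$-periodic function satisfying $|\psi(u)-\psi(v)|\le C|u-v|$ for all $u,v\in[-\pi,\pi]$, with some constant $C>0$. Put $\varphi(u)=\psi(u)\sinh(2u)$ and let $$f(x)=\int_{-\pi}^{\pi}\left[x\,\mathbf{K}_0\big(2x\cosh u\big)-\frac{1}{\pi\cosh u}\right]\varphi(u)\,du,\qquad x>0.$$ Define, for $n\in\mathbb{N}$, $$a_n=\frac{1}{\sinh(\pi n/2)}\int_0^\infty\mathrm{Im}\left[J^2_{in/2}(x)\right]f(x)\,dx,$$ and $$\Omega_n(x)=\int_0^\pi\left[x\,\mathbf{K}_0\big(2x\cosh u\big)-\frac{1}{\pi\cosh u}\right]\sinh(2u)\sin(nu)\,du,\qquad x>0.$$ Then for all $x>0$, $$f(x)=\sum_{n=1}^\infty\sinh(\pi n)\,\Omega_n(x)\,a_n.$$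
   Context: $J_{in/2}$ is the Bessel function of the first kind of imaginary order $in/2$; $\mathrm{Im}$ denotes the imaginary part. $\mathbf{K}_0$ is the Struve-type function $\mathbf{K}_0=\mathbf{H}_0-Y_0$, given for $x>0$ by $\mathbf{K}_0(x)=\frac{2}{\pi}\int_0^\infty e^{-x\sinh t}\,dt$. *)

(* Defs.v *)
From Stdlib Require Import Reals Arith.
From Coquelicot Require Import Coquelicot.
Open Scope R_scope.

Definition cexp (z : C) : C := (exp (Re z) * cos (Im z), exp (Re z) * sin (Im z)).
Definition cpow (t : R) (z : C) : C := cexp (Cmult z (RtoC (ln t))).

Definition CSeries (a : nat -> C) : C := @iota C_R_CompleteNormedModule (fun l : C => @is_series R_AbsRing C_R_NormedModule a l).

Definition CGamma (z : C) : C :=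
  @RInt_gen C_R_CompleteNormedModule (fun t => Cmult (cpow t (Cminus z 1)) (RtoC (exp (- t))))
           (at_right 0) (Rbar_locally p_infty).

Definition BesselJ (nu : C) (x : R) : C :=
  CSeries (fun k => Cdiv (Cmult (RtoC ((-1) ^ k)) (cpow (x / 2) (Cplus (RtoC (2 * INR k)) nu)))
                         (Cmult (RtoC (INR (fact k))) (CGamma (Cplus (RtoC (INR k + 1)) nu)))).

(* Struve-type function K_0 = H_0 - Y_0, for x > 0:
   K_0(x) = (2/pi) int_0^oo exp(-x sinh t) dt *)
Definition StruveK0 (x : R) : R :=
  2 / PI * RInt_gen (fun t => exp (- (x * sinh t))) (at_point 0) (Rbar_locally p_infty).

Definition kern (x u : R) : R := x * StruveK0 (2 * x * cosh u) - 1 / (PI * cosh u).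

Definition f_of (psi : R -> C) (x : R) : C :=
  @RInt C_R_CompleteNormedModule (fun u => Cmult (RtoC (kern x u)) (Cmult (psi u) (RtoC (sinh (2 * u))))) (- PI) PI.

Definition a_coef (psi : R -> C) (n : nat) : C :=
  Cmult (RtoC (/ sinh (PI * INR n / 2)))
    (@RInt_gen C_R_CompleteNormedModule (fun x => Cmult (RtoC (Im (Cmult (BesselJ (0, INR n / 2) x) (BesselJ (0, INR n / 2) x))))
                              (f_of psi x))
              (at_right 0) (Rbar_locally p_infty)).

Definition Omega (n : nat) (x : R) : R :=
  RInt (fun u => kern x u * sinh (2 * u) * sin (INR n * u)) 0 PI.

(* Main.v *)
Require Import Defs.
From Stdlib Require Import Reals Arith ZArith Lra Lia Psatz.
From Coquelicot Require Import Coquelicot.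
Open Scope R_scope.

(* Put k(y) = y K_0(2y) - 1/pi, H(x,u) = 2 sinh u k(x cosh u), tau = n/2 and W = Im J_(i tau)^2. Then f(x) is the integral
   of H(x,u) psi(u), 2 Omega_n(x) is the n-th sine coefficient of the odd function H(x,.), and everything reduces to the index integral
     int_0^oo W(x) H(x,U) dx = sin(n U) / (pi cosh(pi tau)).
   By Fubini it turns a_n into a multiple of the n-th sine coefficient of psi, and the expansion of f(x) becomes Parseval's identity
   for H(x,.) and psi: both have sine coefficients O(1/n), and the Cesaro means are Fejer convolutions.

   For the index integral, Bessel's and Struve's equations make W (H_UU + 4 tau^2 H) an exact x-derivative, so by Duhamel's formula
   the integral is a combination of sin(2 tau U) and one further function of U; the coefficients are found as U -> oo,
   where the integral only feels J ~ (x/2)^(i tau) / Gamma(1 + i tau) and is a Mellin transform of k.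
   Its value involves b_q = int_0^oo w^(-2 i tau) (1 + w^2)^(-q) dw at q = 3/2 together with Gamma(1 + 2 i tau) / Gamma(1 + i tau)^2;
   the recurrences q -> q + 1 and z -> z + 1 with the asymptotics of both sides relate this product to b_1 = pi / (2 cosh(pi tau)). *)

(** * Improper integrals over the half line *)

(** Subtracting 1/(pi cosh u) makes the index integral absolutely convergent: k is bounded near 0
    and O(y^(-2)) at infinity, while W is bounded. The obstacle is the boundary term at infinity of
    the exact x-derivative. It is governed by x Im (J^2 + J'^2), whose vanishing classically rests
    on Hankel's asymptotics of J. Only the energy bound J = O(x^(-1/2)) is proved here, under which
    this quantity is merely bounded. It is carried along as an unknown mean value and shown to tend
    to 0 by testing at points U with sin(2 tau U) = 0, where every other term is small but the
    factor of the mean value is not. The identity between b_(3/2) and the Gamma values is Legendre's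
    duplication formula joined to the reflection formula: b_(3/2) = Gamma(1/2 - i tau) Gamma(1 + i
    tau) / sqrt pi. Comparing limits along the integers asks only for Gamma(N + 1 + i s) ~ N! N^(i
    s), in place of Stirling's formula. In Parseval's identity H(x,.) contains sinh u and does not
    extend periodically in a continuous way; hence all convolutions act on psi. *)

Definition cont_pos (f : R -> R) : Prop := forall x, 0 < x -> continuous f x.

Definition has_int (f : R -> R) (l : R) : Prop :=
  is_RInt_gen f (at_right 0) (Rbar_locally p_infty) l.

Lemma ex_RInt_cont (f : R -> R) a b :
  a <= b -> (forall x, a <= x <= b -> continuous f x) -> ex_RInt f a b.
Proof.
  intros Hab Hf. apply (ex_RInt_continuous (V := R_CompleteNormedModule)).
  intros z. rewrite Rmin_left, Rmax_right by lra. apply Hf.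
Qed.

Lemma cont_pos_ex_RInt (f : R -> R) a b : cont_pos f -> 0 < a -> 0 < b -> ex_RInt f a b.
Proof.
  intros Hf Ha Hb. apply (ex_RInt_continuous (V := R_CompleteNormedModule)).
  intros z Hz. apply Hf. apply Rlt_le_trans with (2 := proj1 Hz). now apply Rmin_pos.
Qed.

Lemma RInt_abs_le (f g : R -> R) a b :
  a <= b -> ex_RInt f a b -> ex_RInt g a b ->
  (forall x, a <= x <= b -> Rabs (f x) <= g x) -> Rabs (RInt f a b) <= RInt g a b.
Proof.
  intros Hab Hf Hg H.
  apply (norm_RInt_le f g a b); trivial; now apply (RInt_correct (V := R_CompleteNormedModule)).
Qed.

Lemma RInt_FTC (F f : R -> R) a b :
  a <= b -> (forall x, a <= x <= b -> is_derive F x (f x)) ->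
  (forall x, a <= x <= b -> continuous f x) -> is_RInt f a b (F b - F a).
Proof.
  intros Hab H1 H2. apply (is_RInt_derive F f); intros x; rewrite Rmin_left, Rmax_right by lra; auto.
Qed.

Lemma RInt_Chasles_R (f : R -> R) a b c :
  ex_RInt f a b -> ex_RInt f b c -> RInt f a b + RInt f b c = RInt f a c.
Proof. exact (RInt_Chasles f a b c). Qed.

Lemma RInt_minus_R (f g : R -> R) a b :
  ex_RInt f a b -> ex_RInt g a b -> RInt (fun x => f x - g x) a b = RInt f a b - RInt g a b.
Proof. exact (RInt_minus f g a b). Qed.

Lemma RInt_plus_R (f g : R -> R) a b :
  ex_RInt f a b -> ex_RInt g a b -> RInt (fun x => f x + g x) a b = RInt f a b + RInt g a b.
Proof. exact (RInt_plus f g a b). Qed.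

Lemma RInt_scal_R (f : R -> R) a b k :
  ex_RInt f a b -> RInt (fun x => k * f x) a b = k * RInt f a b.
Proof. exact (RInt_scal f a b k). Qed.

(* Coquelicot leaves equations typed in a normed module, which [ring] and [field] reject. *)
Ltac eq_in_R := lazymatch goal with |- @eq _ ?a ?b => change (@eq R a b) end.

Lemma RInt_ext_R (f g : R -> R) a b : a <= b -> (forall x, a < x < b -> f x = g x) -> RInt f a b = RInt g a b.
Proof.
  intros Hab H. apply (RInt_ext (V := R_CompleteNormedModule)). intros x. rewrite Rmin_left, Rmax_right by lra. apply H.
Qed.

Lemma cont_scal (k : R) (f : R -> R) x : continuous f x -> continuous (fun x => k * f x) x.
Proof. intros H. apply (continuous_scal_r k f x H). Qed.

Lemma cont_mult (f g : R -> R) x : continuous f x -> continuous g x -> continuous (fun x => f x * g x) x.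
Proof. intros H1 H2. apply (continuous_mult f g x H1 H2). Qed.

Lemma cont_plus (f g : R -> R) x : continuous f x -> continuous g x -> continuous (fun x => f x + g x) x.
Proof. intros H1 H2. apply (continuous_plus f g x H1 H2). Qed.

Lemma cont_minus (f g : R -> R) x : continuous f x -> continuous g x -> continuous (fun x => f x - g x) x.
Proof. intros H1 H2. apply (continuous_minus f g x H1 H2). Qed.

Lemma cont_of_derive (f : R -> R) x l : is_derive f x l -> continuous f x.
Proof. intros H. apply (ex_derive_continuous f). now exists l. Qed.

Lemma cont_ex_derive (f : R -> R) x : ex_derive f x -> continuous f x.
Proof. exact (ex_derive_continuous f x). Qed.

(** * Limits at the two ends of the half line, in epsilon form *)

Lemma at_right_lt (d : R) : 0 < d -> at_right 0 (fun x => 0 < x < d).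
Proof.
  intros Hd. exists (mkposreal d Hd). intros y Hy Hy0. split; trivial.
  unfold ball in Hy; simpl in Hy; unfold AbsRing_ball, abs, minus, plus, opp in Hy; simpl in Hy.
  apply Rabs_def2 in Hy. lra.
Qed.

Lemma p_infty_gt (M : R) : Rbar_locally p_infty (fun x => M < x).
Proof. now exists M. Qed.

Lemma at_right_elim (P : R -> Prop) : at_right 0 P -> exists d, 0 < d /\ forall x, 0 < x < d -> P x.
Proof.
  intros [d Hd]. exists d. split. apply cond_pos. intros x Hx. apply Hd; [|lra].
  unfold ball; simpl; unfold AbsRing_ball, abs, minus, plus, opp; simpl.
  rewrite Ropp_0, Rplus_0_r, Rabs_pos_eq; lra.
Qed.

Lemma p_infty_elim (P : R -> Prop) : Rbar_locally p_infty P -> exists M, 0 < M /\ forall x, M < x -> P x.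
Proof.
  intros [M HM]. exists (Rmax M 1). split. apply Rlt_le_trans with (2 := Rmax_r _ _); lra.
  intros x Hx. apply HM. apply Rle_lt_trans with (2 := Hx). apply Rmax_l.
Qed.

Lemma lim_zero_elim F L : filterlim F (at_right 0) (locally L) ->
  forall eps, 0 < eps -> exists d, 0 < d /\ forall x, 0 < x < d -> Rabs (F x - L) < eps.
Proof.
  intros H eps He. apply at_right_elim.
  exact (H _ (locally_ball L (mkposreal eps He))).
Qed.

Lemma lim_infty_elim F L : filterlim F (Rbar_locally p_infty) (locally L) ->
  forall eps, 0 < eps -> exists M, 0 < M /\ forall x, M < x -> Rabs (F x - L) < eps.
Proof.
  intros H eps He. apply p_infty_elim.
  exact (H _ (locally_ball L (mkposreal eps He))).
Qed.

Lemma lim_bound_intro {T : Type} (Fl : (T -> Prop) -> Prop) (FF : Filter Fl) (F : T -> R) L :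
  (forall eps, 0 < eps -> Fl (fun x => Rabs (F x - L) < eps)) -> filterlim F Fl (locally L).
Proof.
  intros H. apply filterlim_locally. intros eps. exact (H eps (cond_pos eps)).
Qed.

Lemma lim_zero_rate F L C : (forall x, 0 < x < 1 -> Rabs (F x - L) <= C * x) ->
  filterlim F (at_right 0) (locally L).
Proof.
  intros H. apply lim_bound_intro. apply at_right_proper_filter. intros eps He.
  set (d := Rmin 1 (eps / (Rabs C + 1))).
  assert (HC : 0 < Rabs C + 1) by (generalize (Rabs_pos C); lra).
  assert (Hd : 0 < d) by (apply Rmin_pos; [lra | now apply Rdiv_lt_0_compat]).
  apply filter_imp with (2 := at_right_lt d Hd). intros x Hx.
  assert (H1 : x < 1) by (apply Rlt_le_trans with (1 := proj2 Hx); apply Rmin_l).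
  assert (H2 : x < eps / (Rabs C + 1)) by (apply Rlt_le_trans with (1 := proj2 Hx); apply Rmin_r).
  apply Rle_lt_trans with (1 := H x (conj (proj1 Hx) H1)).
  apply Rle_lt_trans with ((Rabs C + 1) * x).
  - generalize (Rle_abs C); nra.
  - apply Rmult_lt_compat_l with (1 := HC) in H2.
    replace ((Rabs C + 1) * (eps / (Rabs C + 1))) with eps in H2; trivial. field. lra.
Qed.

Lemma lim_infty_rate F L C : (forall x, 1 < x -> Rabs (F x - L) <= C / x) ->
  filterlim F (Rbar_locally p_infty) (locally L).
Proof.
  intros H. apply lim_bound_intro. apply Rbar_locally_filter. intros eps He.
  assert (HC : 0 < Rabs C + 1) by (generalize (Rabs_pos C); lra).
  apply filter_imp with (2 := p_infty_gt (Rmax 1 ((Rabs C + 1) / eps))). intros x Hx.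
  assert (H1 : 1 < x) by (apply Rle_lt_trans with (2 := Hx); apply Rmax_l).
  assert (H2 : (Rabs C + 1) / eps < x) by (apply Rle_lt_trans with (2 := Hx); apply Rmax_r).
  apply Rle_lt_trans with (1 := H x H1).
  apply Rlt_div_l; [lra|].
  apply Rlt_div_l in H2; [|lra]. generalize (Rle_abs C); nra.
Qed.

(** Unfolds the product filter: the two endpoints move independently, and continuity on the open
    half line makes every truncation integrable. *)
Lemma has_int_intro f l :
  cont_pos f ->
  (forall eps, 0 < eps -> exists d M, 0 < d /\ 0 < M /\
     forall a b, 0 < a < d -> M < b -> Rabs (RInt f a b - l) < eps) ->
  has_int f l.
Proof.
  intros Hc H P [eps HP].
  destruct (H eps (cond_pos eps)) as (d & M & Hd & HM & Hab).
  apply Filter_prod with (Q := fun a => 0 < a < d) (R := fun b => M < b).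
  now apply at_right_lt. now apply p_infty_gt.
  intros a b Ha Hb. exists (RInt f a b). split.
  - apply (RInt_correct (V := R_CompleteNormedModule)). simpl. apply cont_pos_ex_RInt; trivial; lra.
  - apply HP. exact (Hab a b Ha Hb).
Qed.

Lemma has_int_elim f l : has_int f l ->
  forall eps, 0 < eps -> exists d M, 0 < d /\ 0 < M /\
     forall a b, 0 < a < d -> M < b -> Rabs (RInt f a b - l) < eps.
Proof.
  intros H eps He.
  destruct (H _ (locally_ball l (mkposreal eps He))) as [Q R0 HQ HR HH].
  destruct (at_right_elim _ HQ) as (d & Hd & Hd').
  destruct (p_infty_elim _ HR) as (M & HM & HM').
  exists d, M. split; trivial. split; trivial. intros a b Ha Hb.
  destruct (HH a b (Hd' a Ha) (HM' b Hb)) as (y & Hy1 & Hy2). simpl in Hy1.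
  rewrite (is_RInt_unique _ _ _ _ Hy1). exact Hy2.
Qed.

Lemma has_int_unique f l1 l2 : has_int f l1 -> has_int f l2 -> l1 = l2.
Proof.
  intros H1 H2.
  rewrite <- (is_RInt_gen_unique (V := R_CompleteNormedModule) f l1 H1).
  exact (is_RInt_gen_unique (V := R_CompleteNormedModule) f l2 H2).
Qed.

Lemma has_int_ext f g l : (forall x, 0 < x -> f x = g x) -> has_int f l -> has_int g l.
Proof.
  intros H. apply is_RInt_gen_ext; try typeclasses eauto.
  apply Filter_prod with (Q := fun a => 0 < a < 1) (R := fun b => 1 < b).
  apply at_right_lt; lra. apply p_infty_gt.
  simpl. intros a b Ha Hb x. rewrite Rmin_left, Rmax_right by lra. intros Hx. apply H. lra.
Qed.

Lemma has_int_plus f g l1 l2 : has_int f l1 -> has_int g l2 -> has_int (fun x => f x + g x) (l1 + l2).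
Proof. intros H1 H2. exact (is_RInt_gen_plus (V := R_NormedModule) f g l1 l2 H1 H2). Qed.

Lemma has_int_minus f g l1 l2 : has_int f l1 -> has_int g l2 -> has_int (fun x => f x - g x) (l1 - l2).
Proof. intros H1 H2. exact (is_RInt_gen_minus (V := R_NormedModule) f g l1 l2 H1 H2). Qed.

Lemma has_int_scal f k l : has_int f l -> has_int (fun x => k * f x) (k * l).
Proof. intros H. exact (is_RInt_gen_scal (V := R_NormedModule) f k l H). Qed.

Lemma has_int_FTC (F f : R -> R) L0 L1 :
  (forall x, 0 < x -> is_derive F x (f x)) -> cont_pos f ->
  filterlim F (at_right 0) (locally L0) -> filterlim F (Rbar_locally p_infty) (locally L1) ->
  has_int f (L1 - L0).
Proof.
  intros HF Hf H0 H1. apply has_int_intro; trivial. intros eps He.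
  destruct (lim_zero_elim _ _ H0 (eps / 2)) as (d & Hd & Hd'); [lra|].
  destruct (lim_infty_elim _ _ H1 (eps / 2)) as (M & HM & HM'); [lra|].
  exists (Rmin d 1), (Rmax M 1).
  split; [|split].
  - now apply Rmin_pos; [|lra].
  - apply Rlt_le_trans with (2 := Rmax_r _ _). lra.
  - intros a b Ha Hb.
    assert (a < d /\ a < 1) by (split; apply Rlt_le_trans with (1 := proj2 Ha); [apply Rmin_l|apply Rmin_r]).
    assert (M < b /\ 1 < b) by (split; apply Rle_lt_trans with (2 := Hb); [apply Rmax_l|apply Rmax_r]).
    rewrite (is_RInt_unique _ _ _ _ (RInt_FTC F f a b ltac:(lra) (fun x Hx => HF x ltac:(lra)) (fun x Hx => Hf x ltac:(lra)))).
    specialize (Hd' a ltac:(lra)). specialize (HM' b ltac:(lra)).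
    replace (F b - F a - (L1 - L0)) with ((F b - L1) - (F a - L0)) by ring.
    unfold Rminus at 1. eapply Rle_lt_trans. apply Rabs_triang. rewrite Rabs_Ropp. lra.
Qed.

(** Both values are approximated on one common truncation, where the pointwise bound integrates.
    Most estimates of improper integrals below are instances, often with a difference of two
    integrands as [f]. *)
Lemma has_int_le_abs f g l lg : cont_pos f -> cont_pos g ->
  (forall x, 0 < x -> Rabs (f x) <= g x) -> has_int f l -> has_int g lg -> Rabs l <= lg.
Proof.
  intros Hf Hg H H1 H2.
  apply le_epsilon. intros eps He.
  destruct (has_int_elim _ _ H1 (eps / 2)) as (d & M & Hd & HM & K); [lra|].
  destruct (has_int_elim _ _ H2 (eps / 2)) as (d' & M' & Hd' & HM' & K'); [lra|].
  set (a := Rmin (Rmin d d') 1 / 2). set (b := Rmax (Rmax M M') 1 + 1).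
  assert (Ha : 0 < a /\ a < d /\ a < d' /\ a < 1).
  { assert (0 < Rmin (Rmin d d') 1) by (repeat apply Rmin_pos; lra).
    generalize (Rmin_l (Rmin d d') 1) (Rmin_r (Rmin d d') 1) (Rmin_l d d') (Rmin_r d d').
    unfold a; lra. }
  assert (Hb : M < b /\ M' < b /\ 1 < b).
  { generalize (Rmax_l (Rmax M M') 1) (Rmax_r (Rmax M M') 1) (Rmax_l M M') (Rmax_r M M').
    unfold b; lra. }
  specialize (K a b ltac:(lra) ltac:(lra)). specialize (K' a b ltac:(lra) ltac:(lra)).
  assert (K2 : Rabs (RInt f a b) <= RInt g a b).
  { apply RInt_abs_le. lra. apply cont_pos_ex_RInt; trivial; lra. apply cont_pos_ex_RInt; trivial; lra.
    intros x Hx. apply H. lra. }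
  apply Rabs_def2 in K'.
  replace l with (RInt f a b - (RInt f a b - l)) by ring.
  eapply Rle_trans. apply Rabs_triang. rewrite Rabs_Ropp. lra.
Qed.

(** The majorant is given through its primitive [G]: increments of the integral of [f] are dominated
    by increments of [G], so both ends are Cauchy. The last clause is the explicit tail bound; it is
    what makes truncations uniform in a parameter later. *)
Lemma has_int_dom (f g G : R -> R) G0 G1 :
  cont_pos f -> cont_pos g -> (forall x, 0 < x -> Rabs (f x) <= g x) ->
  (forall x, 0 < x -> is_derive G x (g x)) ->
  filterlim G (at_right 0) (locally G0) -> filterlim G (Rbar_locally p_infty) (locally G1) ->
  exists l, has_int f l /\ Rabs l <= G1 - G0 /\
    forall a b, 0 < a -> a <= b -> Rabs (RInt f a b - l) <= (G a - G0) + (G1 - G b).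
Proof.
  intros Hf Hg Hfg HG H0 H1.
  assert (key : forall a b, 0 < a -> a <= b -> Rabs (RInt f a b) <= G b - G a).
  { intros a b Ha Hab.
    rewrite <- (is_RInt_unique _ _ _ _ (RInt_FTC G g a b Hab (fun x Hx => HG x ltac:(lra)) (fun x Hx => Hg x ltac:(lra)))).
    apply RInt_abs_le; trivial; try (apply cont_pos_ex_RInt; trivial; lra).
    intros x Hx. apply Hfg. lra. }
  set (F := fun x => RInt f 1 x).
  assert (key2 : forall a b, 0 < a -> 0 < b -> Rabs (F b - F a) <= Rabs (G b - G a)).
  { intros a b Ha Hb. unfold F.
    assert (E : RInt f 1 b - RInt f 1 a = RInt f a b).
    { rewrite <- (RInt_Chasles_R f 1 a b). ring. apply cont_pos_ex_RInt; trivial; lra. apply cont_pos_ex_RInt; trivial; lra. }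
    rewrite E. destruct (Rle_dec a b) as [Hab|Hab].
    - rewrite (Rabs_pos_eq (G b - G a)). now apply key. specialize (key a b Ha Hab). generalize (Rabs_pos (RInt f a b)); lra.
    - rewrite <- (opp_RInt_swap f b a) by (apply cont_pos_ex_RInt; trivial; lra).
      unfold opp; simpl. rewrite Rabs_Ropp, Rabs_minus_sym.
      assert (Hba : b <= a) by lra. specialize (key b a Hb Hba).
      rewrite (Rabs_pos_eq (G a - G b)); trivial. generalize (Rabs_pos (RInt f b a)); lra. }
  assert (E0 : exists y : R, filterlim F (at_right 0) (locally y)).
  { apply (filterlim_locally_cauchy (U := R_CompleteSpace) (F := at_right 0) F). intros eps.
    destruct (lim_zero_elim _ _ H0 (eps / 2)) as (d & Hd & Hd'). generalize (cond_pos eps); lra.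
    exists (fun x => 0 < x < d). split. now apply at_right_lt.
    intros u v Hu Hv. unfold ball; simpl; unfold AbsRing_ball, abs, minus, plus, opp; simpl.
    apply Rle_lt_trans with (1 := key2 u v ltac:(lra) ltac:(lra)).
    generalize (Hd' u Hu) (Hd' v Hv). intros A B.
    replace (G v - G u) with ((G v - G0) - (G u - G0)) by ring.
    unfold Rminus at 1. eapply Rle_lt_trans. apply Rabs_triang. rewrite Rabs_Ropp. lra. }
  assert (E1 : exists y : R, filterlim F (Rbar_locally p_infty) (locally y)).
  { apply (filterlim_locally_cauchy (U := R_CompleteSpace) (F := Rbar_locally p_infty) F). intros eps.
    destruct (lim_infty_elim _ _ H1 (eps / 2)) as (d & Hd & Hd'). generalize (cond_pos eps); lra.
    exists (fun x => d < x). split. now apply p_infty_gt.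
    intros u v Hu Hv. unfold ball; simpl; unfold AbsRing_ball, abs, minus, plus, opp; simpl.
    apply Rle_lt_trans with (1 := key2 u v ltac:(lra) ltac:(lra)).
    generalize (Hd' u Hu) (Hd' v Hv). intros A B.
    replace (G v - G u) with ((G v - G1) - (G u - G1)) by ring.
    unfold Rminus at 1. eapply Rle_lt_trans. apply Rabs_triang. rewrite Rabs_Ropp. lra. }
  destruct E0 as (F0 & E0). destruct E1 as (F1 & E1).
  assert (EF : forall a b, 0 < a -> 0 < b -> F b - F a = RInt f a b).
  { intros a b Ha Hb. unfold F.
    rewrite <- (RInt_Chasles_R f 1 a b). ring. apply cont_pos_ex_RInt; trivial; lra. apply cont_pos_ex_RInt; trivial; lra. }
  assert (HI : has_int f (F1 - F0)).
  { apply has_int_FTC with F; trivial. intros x Hx.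
    apply (is_derive_RInt f F 1 x).
    - exists (mkposreal x Hx). intros y Hy. apply (RInt_correct (V := R_CompleteNormedModule)).
      apply cont_pos_ex_RInt; trivial. lra.
      unfold ball in Hy; simpl in Hy; unfold AbsRing_ball, abs, minus, plus, opp in Hy; simpl in Hy.
      apply Rabs_def2 in Hy. lra.
    - now apply Hf. }
  assert (T0 : forall a, 0 < a -> Rabs (F a - F0) <= G a - G0).
  { intros a Ha. apply le_epsilon. intros eps He.
    destruct (lim_zero_elim _ _ H0 (eps / 2)) as (d & Hd & Hd'); [lra|].
    destruct (lim_zero_elim _ _ E0 (eps / 2)) as (d2 & Hd2 & Hd2'); [lra|].
    set (x := Rmin (Rmin d d2) a / 2).
    assert (Hx : 0 < x /\ x < d /\ x < d2 /\ x < a).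
    { assert (0 < Rmin (Rmin d d2) a) by (repeat apply Rmin_pos; lra).
      generalize (Rmin_l (Rmin d d2) a) (Rmin_r (Rmin d d2) a) (Rmin_l d d2) (Rmin_r d d2).
      unfold x; lra. }
    specialize (Hd' x ltac:(lra)). specialize (Hd2' x ltac:(lra)).
    specialize (key x a ltac:(lra) ltac:(lra)). rewrite <- EF in key by lra.
    replace (F a - F0) with ((F a - F x) + (F x - F0)) by ring.
    eapply Rle_trans. apply Rabs_triang. apply Rabs_def2 in Hd'. lra. }
  assert (T1 : forall b, 0 < b -> Rabs (F1 - F b) <= G1 - G b).
  { intros b Hb. apply le_epsilon. intros eps He.
    destruct (lim_infty_elim _ _ H1 (eps / 2)) as (d & Hd & Hd'); [lra|].
    destruct (lim_infty_elim _ _ E1 (eps / 2)) as (d2 & Hd2 & Hd2'); [lra|].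
    set (x := Rmax (Rmax d d2) b + 1).
    assert (Hx : d < x /\ d2 < x /\ b < x).
    { generalize (Rmax_l (Rmax d d2) b) (Rmax_r (Rmax d d2) b) (Rmax_l d d2) (Rmax_r d d2).
      unfold x; lra. }
    specialize (Hd' x ltac:(lra)). specialize (Hd2' x ltac:(lra)).
    specialize (key b x ltac:(lra) ltac:(lra)). rewrite <- EF in key by lra.
    replace (F1 - F b) with ((F x - F b) - (F x - F1)) by ring.
    unfold Rminus at 1. eapply Rle_trans. apply Rabs_triang. rewrite Rabs_Ropp. apply Rabs_def2 in Hd'. lra. }
  exists (F1 - F0). split; trivial. split.
  - replace (F1 - F0) with ((F 1 - F0) + (F1 - F 1)) by ring.
    eapply Rle_trans. apply Rabs_triang. generalize (T0 1 Rlt_0_1) (T1 1 Rlt_0_1). lra.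
  - intros a b Ha Hab. rewrite <- EF by lra.
    replace (F b - F a - (F1 - F0)) with (- ((F a - F0) + (F1 - F b))) by ring.
    rewrite Rabs_Ropp. eapply Rle_trans. apply Rabs_triang.
    generalize (T0 a Ha) (T1 b ltac:(lra)). lra.
Qed.

Lemma RInt_scale (f : R -> R) c a b : (forall x, Rmin (c * a) (c * b) <= x <= Rmax (c * a) (c * b) -> continuous f x) ->
  0 < c -> RInt (fun x => f (c * x)) a b = / c * RInt f (c * a) (c * b).
Proof.
  intros Hf Hc.
  assert (Ex : ex_RInt f (c * a + 0) (c * b + 0)).
  { rewrite 2!Rplus_0_r. apply (ex_RInt_continuous (V := R_CompleteNormedModule)). exact Hf. }
  apply is_RInt_unique. destruct Ex as [l Hl].
  assert (El : RInt f (c * a) (c * b) = l).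
  { apply is_RInt_unique. rewrite 2!Rplus_0_r in Hl. exact Hl. }
  rewrite El.
  apply is_RInt_ext with (fun y => scal (/ c) (scal c (f (c * y + 0)))).
  - intros x _. unfold scal; simpl; unfold mult; simpl. rewrite Rplus_0_r. field; lra.
  - apply (is_RInt_scal (V := R_NormedModule)). now apply (is_RInt_comp_lin (V := R_NormedModule) f c 0).
Qed.

Lemma has_int_scale f c l : 0 < c -> cont_pos f -> has_int f l -> has_int (fun x => f (c * x)) (/ c * l).
Proof.
  intros Hc Hf H. apply has_int_intro.
  - intros x Hx. apply (continuous_comp (fun x => c * x) f).
    + apply cont_scal. apply continuous_id.
    + apply Hf. now apply Rmult_lt_0_compat.
  - intros eps He. destruct (has_int_elim _ _ H (c * eps)) as (d & M & Hd & HM & K). nra.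
    exists (/ c * d), (/ c * M).
    assert (Hc' : 0 < / c) by now apply Rinv_0_lt_compat.
    split; [nra|]. split; [nra|]. intros a b Ha Hb.
    assert (A1 : c * a < d). { replace d with (c * (/ c * d)) by (field; lra). apply Rmult_lt_compat_l; lra. }
    assert (A2 : M < c * b). { replace M with (c * (/ c * M)) by (field; lra). apply Rmult_lt_compat_l; lra. }
    rewrite RInt_scale; trivial.
    2: { intros x Hx. apply Hf. apply Rlt_le_trans with (2 := proj1 Hx). apply Rmin_pos; nra. }
    replace (/ c * RInt f (c * a) (c * b) - / c * l) with (/ c * (RInt f (c * a) (c * b) - l)) by ring.
    rewrite Rabs_mult, (Rabs_pos_eq (/ c)) by lra.
    replace eps with (/ c * (c * eps)) by (field; lra).
    apply Rmult_lt_compat_l; trivial. apply K; nra.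
Qed.

Lemma has_int_zero f : (forall x, 0 < x -> f x = 0) -> has_int f 0.
Proof.
  intros H. apply has_int_ext with (fun _ => 0). intros x Hx. now rewrite H.
  assert (E : has_int (fun _ => 0) (0 - 0)).
  { apply has_int_FTC with (fun _ => 0).
    - intros x _. apply (is_derive_const (V := R_NormedModule) 0 x).
    - intros x _. apply (continuous_const (V := R_UniformSpace)).
    - apply filterlim_const.
    - apply filterlim_const. }
  now rewrite Rminus_0_r in E.
Qed.

(** * The Gamma function on vertical lines *)

Lemma le_div a b c : 0 < c -> a * c <= b -> a <= b / c.
Proof. intros Hc H. now apply Rle_div_r. Qed.

Lemma div_le a b c : 0 < c -> a <= b * c -> a / c <= b.
Proof. intros Hc H. now apply Rle_div_l. Qed.

Lemma nonneg_derive_le (F f : R -> R) a b : a <= b ->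
  (forall x, a <= x <= b -> is_derive F x (f x)) -> (forall x, a <= x <= b -> 0 <= f x) -> F a <= F b.
Proof.
  intros Hab HF Hf.
  destruct (MVT_gen F a b f) as (c & Hc & E).
  - intros x. rewrite Rmin_left, Rmax_right by lra. intros Hx. apply HF. lra.
  - intros x. rewrite Rmin_left, Rmax_right by lra. intros Hx. apply continuity_pt_filterlim.
    apply (cont_of_derive F x (f x)). now apply HF.
  - rewrite Rmin_left, Rmax_right in Hc by lra. specialize (Hf c Hc). nra.
Qed.

Lemma bounded_derive_lip (F f : R -> R) K : (forall x, is_derive F x (f x)) -> (forall x, Rabs (f x) <= K) ->
  forall a b, Rabs (F b - F a) <= K * Rabs (b - a).
Proof.
  intros HF Hf a b. destruct (MVT_gen F a b f) as (c & Hc & E).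
  - intros x _. apply HF.
  - intros x _. apply continuity_pt_filterlim. apply (cont_of_derive F x (f x)). apply HF.
  - rewrite E, Rabs_mult. apply Rmult_le_compat_r. apply Rabs_pos. apply Hf.
Qed.

Lemma Rabs_cos_le x : Rabs (cos x) <= 1.
Proof. apply Rabs_le. generalize (COS_bound x); lra. Qed.

Lemma Rabs_sin_le x : Rabs (sin x) <= 1.
Proof. apply Rabs_le. generalize (SIN_bound x); lra. Qed.

Lemma cos_lip a b : Rabs (cos b - cos a) <= Rabs (b - a).
Proof.
  rewrite <- (Rmult_1_l (Rabs (b - a))). apply (bounded_derive_lip cos (fun x => - sin x)).
  intros x. apply is_derive_Reals, derivable_pt_lim_cos.
  intros x. rewrite Rabs_Ropp. apply Rabs_sin_le.
Qed.

Lemma sin_lip a b : Rabs (sin b - sin a) <= Rabs (b - a).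
Proof.
  rewrite <- (Rmult_1_l (Rabs (b - a))). apply (bounded_derive_lip sin cos).
  intros x. apply is_derive_Reals, derivable_pt_lim_sin.
  intros x. apply Rabs_cos_le.
Qed.

Lemma sinh_ge x : 0 <= x -> x <= sinh x.
Proof.
  intros Hx.
  assert (H : sinh 0 - 0 <= sinh x - x).
  { apply (nonneg_derive_le (fun x => sinh x - x) (fun x => cosh x - 1)); trivial.
    - intros y _. apply is_derive_Reals. apply derivable_pt_lim_minus. apply derivable_pt_lim_sinh. apply derivable_pt_lim_id.
    - intros y _. unfold cosh. generalize (exp_ineq1_le y) (exp_ineq1_le (- y)). lra. }
  rewrite sinh_0 in H. lra.
Qed.

(** With y = e^(2s) the right-hand side is (2 sinh s)^2, and sinh s >= s for s >= 0. *)
Lemma ln_sqr_le y : 0 < y -> ln y * ln y <= y - 2 + / y.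
Proof.
  intros Hy.
  assert (K : forall s, 0 <= s -> (2 * s) * (2 * s) <= exp (2 * s) - 2 + exp (- (2 * s))).
  { intros s Hs. generalize (sinh_ge s Hs). unfold sinh. intros H.
    replace (exp (2 * s) - 2 + exp (- (2 * s))) with ((exp s - exp (- s)) * (exp s - exp (- s))).
    apply Rmult_le_compat; lra.
    replace (2 * s) with (s + s) by ring. rewrite Ropp_plus_distr, 2!exp_plus.
    assert (exp s * exp (- s) = 1) by (rewrite <- exp_plus, Rplus_opp_r; apply exp_0). nra. }
  replace (/ y) with (exp (- ln y)) by (rewrite exp_Ropp, exp_ln; trivial).
  rewrite <- (exp_ln y Hy) at 3. set (t := ln y).
  destruct (Rle_dec 0 t) as [Ht|Ht].
  - specialize (K (t / 2) ltac:(lra)). replace (2 * (t / 2)) with t in K by field. exact K.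
  - specialize (K (- t / 2) ltac:(lra)). replace (2 * (- t / 2)) with (- t) in K by field.
    rewrite Ropp_involutive in K. lra.
Qed.

(** A single term of the exponential series is at most e^x. *)
Lemma pow_exp_le (m : nat) x : 0 <= x -> x ^ m * exp (- x) <= INR (fact m).
Proof.
  intros Hx. rewrite exp_Ropp. apply div_le. apply exp_pos.
  assert (H : x ^ m / INR (fact m) <= exp x).
  { apply Rle_trans with (2 := exp_ge_taylor x m Hx).
    destruct m. simpl; lra. rewrite tech5.
    assert (0 <= sum_f_R0 (fun k => x ^ k / INR (fact k)) m).
    { apply cond_pos_sum. intros k. apply Rdiv_le_0_compat. now apply pow_le. apply INR_fact_lt_0. }
    lra. }
  apply Rle_div_l in H. 2: apply INR_fact_lt_0. rewrite Rmult_comm. exact H.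
Qed.

Lemma Cmod_le_abs (z : C) : Cmod z <= Rabs (fst z) + Rabs (snd z).
Proof.
  unfold Cmod. apply Rsqr_incr_0_var. rewrite Rsqr_sqrt.
  rewrite <- (pow2_abs (fst z)), <- (pow2_abs (snd z)). unfold Rsqr.
  generalize (Rabs_pos (fst z)) (Rabs_pos (snd z)). nra.
  nra. generalize (Rabs_pos (fst z)) (Rabs_pos (snd z)). lra.
Qed.

Lemma Rabs_fst_le_Cmod (z : C) : Rabs (fst z) <= Cmod z.
Proof. apply Rle_trans with (2 := Rmax_Cmod z). apply Rmax_l. Qed.

Lemma Rabs_snd_le_Cmod (z : C) : Rabs (snd z) <= Cmod z.
Proof. apply Rle_trans with (2 := Rmax_Cmod z). apply Rmax_r. Qed.

(* [gam m s z] says that Gamma (m + 1 + i s) = z. *)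
Definition gam (m : nat) (s : R) (z : C) : Prop :=
  has_int (fun x => x ^ m * exp (- x) * cos (s * ln x)) (fst z) /\
  has_int (fun x => x ^ m * exp (- x) * sin (s * ln x)) (snd z).

Lemma RInt_gen_C (f : R -> C) (f1 f2 : R -> R) (l1 l2 : R) : (forall x, 0 < x -> f x = (f1 x, f2 x)) ->
  has_int f1 l1 -> has_int f2 l2 ->
  @RInt_gen C_R_CompleteNormedModule f (at_right 0) (Rbar_locally p_infty) = (l1, l2).
Proof.
  intros E H1 H2.
  apply (is_RInt_gen_unique (V := C_R_CompleteNormedModule)).
  intros P HP.
  assert (HP' : exists e : posreal, forall a b : R, Rabs (a - l1) < e -> Rabs (b - l2) < e -> P (a, b)).
  { destruct HP as [e He]. exists e. intros a b Ha Hb. apply He. split; simpl; assumption. }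
  destruct HP' as (e & He).
  destruct (H1 _ (locally_ball l1 e)) as [Q R0 HQ HR HH].
  destruct (H2 _ (locally_ball l2 e)) as [Q' R0' HQ' HR' HH'].
  apply Filter_prod with (Q := fun a => (Q a /\ Q' a) /\ 0 < a < 1) (R := fun b => (R0 b /\ R0' b) /\ 1 < b).
  { apply filter_and; [now apply filter_and | apply at_right_lt; lra]. }
  { apply filter_and; [now apply filter_and | apply p_infty_gt]. }
  intros a b ((Ha & Ha') & Ha0) ((Hb & Hb') & Hb0).
  destruct (HH a b Ha Hb) as (y & Hy & By). destruct (HH' a b Ha' Hb') as (y' & Hy' & By').
  exists (y, y'). split. 2: apply He; assumption.
  cbn [fst snd] in *.
  apply (is_RInt_fct_extend_pair (U := R_NormedModule) (V := R_NormedModule)).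
  - apply is_RInt_ext with (2 := Hy). intros x. rewrite Rmin_left, Rmax_right by lra. intros Hx.
    now rewrite E by lra.
  - apply is_RInt_ext with (2 := Hy'). intros x. rewrite Rmin_left, Rmax_right by lra. intros Hx.
    now rewrite E by lra.
Qed.

Lemma RInt_C (f : R -> C) (f1 f2 : R -> R) a b : (forall x, f x = (f1 x, f2 x)) ->
  ex_RInt f1 a b -> ex_RInt f2 a b ->
  @RInt C_R_CompleteNormedModule f a b = (RInt f1 a b, RInt f2 a b).
Proof.
  intros E H1 H2. apply (is_RInt_unique (V := C_R_CompleteNormedModule)).
  apply (is_RInt_fct_extend_pair (U := R_NormedModule) (V := R_NormedModule)).
  - apply is_RInt_ext with f1. intros x _. now rewrite E. exact (RInt_correct (V := R_CompleteNormedModule) _ _ _ H1).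
  - apply is_RInt_ext with f2. intros x _. now rewrite E. exact (RInt_correct (V := R_CompleteNormedModule) _ _ _ H2).
Qed.

Lemma gam_CGamma m s z : gam m s z -> CGamma (Cplus (RtoC (INR m + 1)) (0, s)) = z.
Proof.
  intros (H1 & H2). unfold CGamma. rewrite (surjective_pairing z).
  apply RInt_gen_C with (2 := H1) (3 := H2). intros x Hx. unfold cpow, cexp.
  assert (E : Cmult (Cminus (Cplus (RtoC (INR m + 1)) (0, s)) 1) (RtoC (ln x)) = (INR m * ln x, s * ln x)).
  { unfold Cmult, Cminus, Cplus, Copp, RtoC; simpl. f_equal; ring. }
  rewrite E. unfold Re, Im. cbn [fst snd].
  replace (exp (INR m * ln x)) with (x ^ m) by (symmetry; exact (Rpower_pow m x Hx)).
  unfold Cmult, RtoC; simpl. f_equal; ring.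
Qed.

Ltac cont_by_derive :=
  intros ?x ?Hx; apply cont_ex_derive; auto_derive; repeat split; try assumption; try lra.

(** Half of the exponential absorbs the power: x^m e^(-x/2) <= 2^m m!, which leaves a multiple of
    e^(-x/2) as majorant. *)
Lemma gam_dom m (h : R -> R) : cont_pos h -> (forall x, 0 < x -> Rabs (h x) <= 1) ->
  exists l, has_int (fun x => x ^ m * exp (- x) * h x) l.
Proof.
  intros Hc Hh.
  destruct (has_int_dom (fun x => x ^ m * exp (- x) * h x) (fun x => 2 ^ m * INR (fact m) * exp (- (x / 2)))
    (fun x => - 2 * (2 ^ m * INR (fact m) * exp (- (x / 2)))) (- 2 * (2 ^ m * INR (fact m))) 0) as (l & Hl & _).
  - intros x Hx. apply cont_mult; [|now apply Hc]. apply cont_ex_derive. auto_derive. trivial.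
  - intros x Hx. apply cont_ex_derive. auto_derive. trivial.
  - intros x Hx. rewrite Rabs_mult, Rabs_pos_eq.
    2: { apply Rmult_le_pos. apply pow_le; lra. apply Rlt_le, exp_pos. }
    apply Rle_trans with (x ^ m * exp (- x)).
    + rewrite <- (Rmult_1_r (x ^ m * exp (- x))) at 2. apply Rmult_le_compat_l.
      apply Rmult_le_pos. apply pow_le; lra. apply Rlt_le, exp_pos. now apply Hh.
    + replace x with (2 * (x / 2)) at 1 by field. rewrite Rpow_mult_distr.
      replace (- x) with (- (x / 2) + - (x / 2)) by field. rewrite exp_plus.
      generalize (pow_exp_le m (x / 2) ltac:(lra)). intros K.
      assert (0 < 2 ^ m) by (apply pow_lt; lra). generalize (exp_pos (- (x / 2))). intros Hp.
      replace (2 ^ m * (x / 2) ^ m * (exp (- (x / 2)) * exp (- (x / 2)))) with (2 ^ m * exp (- (x / 2)) * ((x / 2) ^ m * exp (- (x / 2)))) by ring.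
      replace (2 ^ m * INR (fact m) * exp (- (x / 2))) with (2 ^ m * exp (- (x / 2)) * INR (fact m)) by ring.
      apply Rmult_le_compat_l; trivial. apply Rmult_le_pos; lra.
  - intros x Hx. auto_derive. trivial. unfold Rdiv. field.
  - apply lim_zero_rate with (2 ^ m * INR (fact m)). intros x Hx.
    assert (0 < 2 ^ m * INR (fact m)). { apply Rmult_lt_0_compat. apply pow_lt; lra. apply INR_fact_lt_0. }
    set (c := 2 ^ m * INR (fact m)) in *.
    replace (-2 * (c * exp (- (x / 2))) - -2 * c) with (2 * c * (1 - exp (- (x / 2)))) by ring.
    assert (0 <= 1 - exp (- (x / 2)) <= x / 2).
    { generalize (exp_ineq1_le (- (x / 2))). assert (exp (- (x / 2)) <= 1). rewrite <- exp_0. left. apply exp_increasing. lra. lra. }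
    rewrite Rabs_pos_eq; nra.
  - apply lim_infty_rate with (4 * (2 ^ m * INR (fact m))). intros x Hx.
    assert (0 < 2 ^ m * INR (fact m)). { apply Rmult_lt_0_compat. apply pow_lt; lra. apply INR_fact_lt_0. }
    set (c := 2 ^ m * INR (fact m)) in *.
    generalize (pow_exp_le 1 (x / 2) ltac:(lra)) (exp_pos (- (x / 2))). simpl. intros K Hp.
    replace (-2 * (c * exp (- (x / 2))) - 0) with (- (2 * c * exp (- (x / 2)))) by ring.
    rewrite Rabs_Ropp, Rabs_pos_eq by nra.
    apply le_div. lra. apply (Rmult_le_compat_l c) in K; lra.
  - now exists l.
Qed.

Lemma gam_ex m s : exists z, gam m s z.
Proof.
  destruct (gam_dom m (fun x => cos (s * ln x))) as (a & Ha).
  - cont_by_derive.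
  - intros; apply Rabs_cos_le.
  - destruct (gam_dom m (fun x => sin (s * ln x))) as (b & Hb).
    + cont_by_derive.
    + intros; apply Rabs_sin_le.
    + exists (a, b). now split.
Qed.

Lemma pow_exp_lim m (h : R -> R) : (forall x, 0 < x -> Rabs (h x) <= 1) ->
  filterlim (fun x => x ^ S m * exp (- x) * h x) (at_right 0) (locally 0) /\
  filterlim (fun x => x ^ S m * exp (- x) * h x) (Rbar_locally p_infty) (locally 0).
Proof.
  intros Hh.
  assert (K : forall x, 0 < x -> Rabs (x ^ S m * exp (- x) * h x - 0) <= x ^ S m * exp (- x)).
  { intros x Hx. rewrite Rminus_0_r, Rabs_mult, Rabs_pos_eq.
    rewrite <- (Rmult_1_r (x ^ S m * exp (- x))) at 2. apply Rmult_le_compat_l; [|now apply Hh].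
    all: apply Rmult_le_pos; [apply pow_le; lra | apply Rlt_le, exp_pos]. }
  split.
  - apply lim_zero_rate with (INR (fact m)). intros x Hx. apply Rle_trans with (1 := K x ltac:(lra)).
    simpl. generalize (pow_exp_le m x ltac:(lra)). nra.
  - apply lim_infty_rate with (INR (fact (S (S m)))). intros x Hx. apply Rle_trans with (1 := K x ltac:(lra)).
    apply le_div. lra. generalize (pow_exp_le (S (S m)) x ltac:(lra)).
    replace (x ^ S m * exp (- x) * x) with (x ^ S (S m) * exp (- x)) by (simpl; ring). trivial.
Qed.

(** The functional equation of Gamma: the derivative of x^(m+1+is) e^(-x), split into real and
    imaginary part, integrates to 0 over the half line. *)
Lemma gam_rec m s z : gam m s z -> gam (S m) s (Cmult (INR (S m), s) z).
Proof.
  intros (H1 & H2).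
  destruct (gam_ex (S m) s) as (z' & H3 & H4).
  assert (E1 : has_int (fun x => INR (S m) * (x ^ m * exp (- x) * cos (s * ln x)) - s * (x ^ m * exp (- x) * sin (s * ln x)) - x ^ S m * exp (- x) * cos (s * ln x)) (0 - 0)).
  { apply has_int_FTC with (fun x => x ^ S m * exp (- x) * cos (s * ln x)).
    - intros x Hx. auto_derive. assumption. rewrite <- tech_pow_Rmult. change (match m with O => 1 | S _ => INR m + 1 end) with (INR (S m)).
      simpl pred. field. lra.
    - cont_by_derive.
    - apply pow_exp_lim. intros; apply Rabs_cos_le.
    - apply pow_exp_lim. intros; apply Rabs_cos_le. }
  assert (E2 : has_int (fun x => INR (S m) * (x ^ m * exp (- x) * sin (s * ln x)) + s * (x ^ m * exp (- x) * cos (s * ln x)) - x ^ S m * exp (- x) * sin (s * ln x)) (0 - 0)).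
  { apply has_int_FTC with (fun x => x ^ S m * exp (- x) * sin (s * ln x)).
    - intros x Hx. auto_derive. assumption. rewrite <- tech_pow_Rmult. change (match m with O => 1 | S _ => INR m + 1 end) with (INR (S m)).
      simpl pred. field. lra.
    - cont_by_derive.
    - apply pow_exp_lim. intros; apply Rabs_sin_le.
    - apply pow_exp_lim. intros; apply Rabs_sin_le. }
  assert (F1 := has_int_unique _ _ _ E1 (has_int_minus _ _ _ _ (has_int_minus _ _ _ _ (has_int_scal _ (INR (S m)) _ H1) (has_int_scal _ s _ H2)) H3)).
  assert (F2 := has_int_unique _ _ _ E2 (has_int_minus _ _ _ _ (has_int_plus _ _ _ _ (has_int_scal _ (INR (S m)) _ H2) (has_int_scal _ s _ H1)) H4)).
  replace (Cmult (INR (S m), s) z) with z'. now split.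
  rewrite (surjective_pairing z'). unfold Cmult. cbn [fst snd]. f_equal; lra.
Qed.

Lemma gam_fact m : gam m 0 (RtoC (INR (fact m))).
Proof.
  induction m as [|m IH].
  - split.
    + replace (fst (RtoC (INR (fact 0)))) with (0 - - 1) by (simpl; ring).
      apply has_int_FTC with (fun x => - exp (- x)).
      * intros x Hx. auto_derive; trivial. rewrite Rmult_0_l, cos_0. simpl. ring.
      * cont_by_derive.
      * apply lim_zero_rate with 1. intros x Hx. generalize (exp_ineq1_le (- x)).
        assert (exp (- x) < 1). rewrite <- exp_0. apply exp_increasing. lra.
        intros. rewrite Rabs_pos_eq; lra.
      * apply lim_infty_rate with 1. intros x Hx. generalize (pow_exp_le 1 x ltac:(lra)) (exp_pos (- x)). simpl. intros.
        rewrite Rminus_0_r, Rabs_Ropp, Rabs_pos_eq by lra. apply le_div; lra.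
    + apply has_int_zero. intros x _. rewrite Rmult_0_l, sin_0. ring.
  - apply gam_rec in IH. replace (RtoC (INR (fact (S m)))) with (Cmult (INR (S m), 0) (RtoC (INR (fact m)))); trivial.
    change (fact (S m)) with ((S m) * fact m)%nat. rewrite mult_INR. unfold Cmult, RtoC; cbn [fst snd]. f_equal; ring.
Qed.

Lemma has_int_pow_exp m : has_int (fun x => x ^ m * exp (- x)) (INR (fact m)).
Proof.
  apply has_int_ext with (2 := proj1 (gam_fact m)). intros x _. rewrite Rmult_0_l, cos_0. ring.
Qed.

(* Concentration of [x^N e^-x] around [N], measured through [ln^2 y <= y - 2 + 1/y]. *)
Lemma gam_asymp_aux N s (h : R -> R) l : (1 <= N)%nat -> (forall a b, Rabs (h b - h a) <= Rabs (b - a)) ->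
  cont_pos (fun x => h (s * ln x)) ->
  has_int (fun x => x ^ N * exp (- x) * h (s * ln x)) l ->
  Rabs (l - INR (fact N) * h (s * ln (INR N))) <= Rabs s * INR (fact N) / sqrt (INR N).
Proof.
  intros HN Hlip Hc Hl.
  destruct N as [|m]; [lia|]. set (N := S m) in *.
  assert (HN0 : 0 < INR N) by (apply lt_0_INR; lia).
  set (r := sqrt (INR N)). assert (Hr : 0 < r) by now apply sqrt_lt_R0.
  assert (Hrr : r * r = INR N) by (apply sqrt_sqrt; lra).
  assert (H1 := has_int_minus _ _ _ _ Hl (has_int_scal _ (h (s * ln (INR N))) _ (has_int_pow_exp N))).
  (* The majorant x^N e^(-x) (1/r + r (y - 2 + 1/y)) |s|/2 with y = x/N. Multiplying by y or 1/y
     only shifts the exponent, so its integral is a combination of the factorials of N, N + 1 and m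
     = N - 1, and the main parts cancel. *)
  assert (H2 := has_int_scal _ (Rabs s / 2) _
    (has_int_plus _ _ _ _ (has_int_scal _ (/ r - 2 * r) _ (has_int_pow_exp N))
      (has_int_plus _ _ _ _ (has_int_scal _ (r / INR N) _ (has_int_pow_exp (S N))) (has_int_scal _ (r * INR N) _ (has_int_pow_exp m))))).
  assert (K := fun A B D => has_int_le_abs _ _ _ _ A B D H1 H2).
  rewrite (Rmult_comm (INR (fact N))).
  eapply Rle_trans. apply K. 4: { apply Req_le.
  change (fact (S N)) with ((S N) * fact N)%nat. rewrite mult_INR, S_INR.
  assert (EN : INR (fact N) = INR N * INR (fact m)) by (unfold N; rewrite <- mult_INR; reflexivity).
  rewrite EN. rewrite <- Hrr. field. lra. }
  - intros x Hx. apply cont_minus. apply cont_mult. apply cont_ex_derive; auto_derive; trivial. now apply Hc.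
    apply cont_ex_derive; auto_derive; trivial.
  - cont_by_derive.
  - intros x Hx. cbv beta.
    assert (P : 0 < x ^ m * exp (- x)). { apply Rmult_lt_0_compat. apply pow_lt; lra. apply exp_pos. }
    assert (E : x ^ N * exp (- x) = x * (x ^ m * exp (- x))) by (unfold N; simpl; ring).
    assert (E' : x ^ S N * exp (- x) = x * x * (x ^ m * exp (- x))) by (unfold N; simpl; ring).
    replace (x ^ N * exp (- x) * h (s * ln x) - h (s * ln (INR N)) * (x ^ N * exp (- x))) with ((x ^ N * exp (- x)) * (h (s * ln x) - h (s * ln (INR N)))) by ring.
    rewrite E', E. set (p := x ^ m * exp (- x)) in *.
    rewrite Rabs_mult, (Rabs_pos_eq (x * p)) by nra.
    set (t := ln (x / INR N)).
    assert (Et : s * ln x - s * ln (INR N) = s * t) by (unfold t; rewrite ln_div by lra; ring).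
    apply Rle_trans with (x * p * (Rabs s * Rabs t)).
    { apply Rmult_le_compat_l. nra. rewrite <- Rabs_mult, <- Et. apply Hlip. }
    (* Weighted arithmetic-geometric mean inequality. The weight r = sqrt N is the balanced one,
       because y - 2 + 1/y has mean 1/N against x^N e^(-x) / N!. *)
    assert (Ht : Rabs t <= (/ r + r * (t * t)) / 2).
    { rewrite <- (Rabs_pos_eq (t * t)) by nra. rewrite Rabs_mult. generalize (Rabs_pos t). set (a := Rabs t). intros Ha.
      assert (Q0 : 0 < / r) by now apply Rinv_0_lt_compat.
      assert (Q1 : r * / r = 1) by (field; lra).
      assert (Q2 : 0 <= / r * Rsqr (1 - r * a)) by (apply Rmult_le_pos; [lra | apply Rle_0_sqr]).
      replace (/ r * Rsqr (1 - r * a)) with (/ r - 2 * (r * / r) * a + r * (r * / r) * (a * a)) in Q2 by (unfold Rsqr; ring).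
      rewrite Q1 in Q2. lra. }
    assert (Hx' : 0 < x / INR N) by now apply Rdiv_lt_0_compat.
    assert (Htt := ln_sqr_le _ Hx'). fold t in Htt.
    apply Rle_trans with (x * p * (Rabs s * ((/ r + r * (x / INR N - 2 + / (x / INR N))) / 2))).
    { apply Rmult_le_compat_l. nra. apply Rmult_le_compat_l. apply Rabs_pos.
      apply (Rmult_le_compat_l r) in Htt; lra. }
    apply Req_le. field. lra.
Qed.

(** Gamma(N + 1 + i s) / N! behaves like N^(i s), with an explicit rate: the probability density x^N
    e^(-x) / N! sits near x = N, where x^(i s) is nearly constant. *)
Lemma gam_asymp N s z : (1 <= N)%nat -> gam N s z ->
  Cmod (Cminus (Cdiv z (RtoC (INR (fact N)))) (cos (s * ln (INR N)), sin (s * ln (INR N)))) <= 2 * Rabs s / sqrt (INR N).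
Proof.
  intros HN (H1 & H2).
  assert (HN0 : 0 < INR N) by (apply lt_0_INR; lia).
  assert (Hr : 0 < sqrt (INR N)) by now apply sqrt_lt_R0.
  apply (gam_asymp_aux N s cos) in H1; trivial. 2: apply cos_lip. 2: cont_by_derive.
  apply (gam_asymp_aux N s sin) in H2; trivial. 2: apply sin_lip. 2: cont_by_derive.
  assert (Hf := INR_fact_lt_0 N). set (F := INR (fact N)) in *.
  set (c := cos (s * ln (INR N))) in *. set (d := sin (s * ln (INR N))) in *.
  replace (Cminus (Cdiv z (RtoC F)) (c, d)) with (((fst z - F * c) / F, (snd z - F * d) / F) : C).
  2: { rewrite (surjective_pairing z). unfold Cminus, Cdiv, Cplus, Copp, Cmult, Cinv, RtoC. cbn [fst snd]. f_equal; field; lra. }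
  eapply Rle_trans. apply Cmod_le_abs. cbn [fst snd]. unfold Rdiv. rewrite 2!Rabs_mult, (Rabs_pos_eq (/ F)).
  2: left; now apply Rinv_0_lt_compat.
  assert (HF : 0 < / F) by now apply Rinv_0_lt_compat.
  apply Rle_trans with (Rabs s * F / sqrt (INR N) * / F + Rabs s * F / sqrt (INR N) * / F).
  - apply Rplus_le_compat; apply Rmult_le_compat_r; lra.
  - apply Req_le. field. lra.
Qed.

(** * The integrals b_q *)

(** Up to pi/3 the cosine is at least 1/2; beyond it x/2 - sin x increases to pi/4 - 1, which is at
    most 0. *)
Lemma sin_ge_half x : 0 <= x <= PI / 2 -> x / 2 <= sin x.
Proof.
  intros Hx. destruct (Rle_dec x (PI / 3)) as [H|H].
  - assert (K : sin 0 - 0 / 2 <= sin x - x / 2).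
    { apply (nonneg_derive_le (fun y => sin y - y / 2) (fun y => cos y - / 2)). lra.
      - intros y Hy. auto_derive. trivial. field.
      - intros y Hy. assert (cos (PI / 3) <= cos y). { apply cos_decr_1; lra. }
        rewrite cos_PI3 in H0. lra. }
    rewrite sin_0 in K. lra.
  - assert (K : x / 2 - sin x <= PI / 2 / 2 - sin (PI / 2)).
    { apply (nonneg_derive_le (fun y => y / 2 - sin y) (fun y => / 2 - cos y)). lra.
      - intros y Hy. auto_derive. trivial. field.
      - intros y Hy. assert (cos y <= cos (PI / 3)). { apply cos_decr_1; lra. }
        rewrite cos_PI3 in H0. lra. }
    rewrite sin_PI2 in K.
    generalize PI_4. lra.
Qed.

Lemma atan_lim0 : filterlim atan (at_right 0) (locally 0).
Proof.
  apply lim_zero_rate with 1. intros x Hx. rewrite Rminus_0_r, Rabs_pos_eq.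
  - assert (H : 0 - atan 0 <= x - atan x).
    { apply (nonneg_derive_le (fun y => y - atan y) (fun y => 1 - / (1 + y * y))). lra.
      - intros y Hy. auto_derive. trivial. unfold Rsqr. field. nra.
      - intros y Hy. assert (/ (1 + y * y) <= / 1) by (apply Rinv_le_contravar; nra). lra. }
    rewrite atan_0 in H. lra.
  - rewrite <- atan_0. left. apply atan_increasing. lra.
Qed.

Lemma atan_le x : 0 < x -> 0 < atan x <= x.
Proof.
  intros Hx. split. rewrite <- atan_0. apply atan_increasing; lra.
  assert (H : 0 - atan 0 <= x - atan x).
  { apply (nonneg_derive_le (fun y => y - atan y) (fun y => 1 - / (1 + y * y))). lra.
    - intros y Hy. auto_derive. trivial. unfold Rsqr. field. nra.
    - intros y Hy. assert (/ (1 + y * y) <= / 1) by (apply Rinv_le_contravar; nra). lra. }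
  rewrite atan_0 in H. lra.
Qed.

Lemma atan_ge x : 0 < x -> PI / 2 - / x <= atan x < PI / 2.
Proof.
  intros Hx. generalize (atan_inv x Hx) (atan_le (/ x) (Rinv_0_lt_compat x Hx)). lra.
Qed.

Lemma atan_limoo : filterlim atan (Rbar_locally p_infty) (locally (PI / 2)).
Proof.
  apply lim_infty_rate with 1. intros x Hx. generalize (atan_ge x ltac:(lra)). intros H.
  rewrite Rabs_minus_sym, Rabs_pos_eq; unfold Rdiv in *; lra.
Qed.

(** Domination by the derivative of C arctan. The tails follow from arctan a <= a and pi/2 - arctan
    b <= 1/b. *)
Lemma has_int_atan (f : R -> R) C : 0 <= C -> cont_pos f -> (forall x, 0 < x -> Rabs (f x) <= C / (1 + x * x)) ->
  exists l, has_int f l /\ Rabs l <= C * (PI / 2) /\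
    forall a b, 0 < a -> a <= b -> Rabs (RInt f a b - l) <= C * a + C / b.
Proof.
  intros HC Hf H.
  destruct (has_int_dom f (fun x => C / (1 + x * x)) (fun x => C * atan x) (C * 0) (C * (PI / 2))) as (l & H1 & H2 & H3); trivial.
  - intros x Hx. apply cont_ex_derive. auto_derive. nra.
  - intros x Hx. auto_derive. trivial. unfold Rsqr. field. nra.
  - apply (filterlim_comp _ _ _ atan (fun x => C * x) _ (locally 0)). apply atan_lim0.
    apply (filterlim_scal_r (V := R_NormedModule) C 0).
  - apply (filterlim_comp _ _ _ atan (fun x => C * x) _ (locally (PI / 2))). apply atan_limoo.
    apply (filterlim_scal_r (V := R_NormedModule) C (PI / 2)).
  - exists l. split; trivial. split. lra. intros a b Ha Hab. apply Rle_trans with (1 := H3 a b Ha Hab).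
    generalize (atan_le a Ha) (atan_ge b ltac:(lra)). intros A B. unfold Rdiv in *. nra.
Qed.

(* [beta_int q s z] says that int_0^oo w^(i s) (1 + w^2)^(-q) dw = z. *)
Definition beta_int (q s : R) (z : C) : Prop :=
  has_int (fun w => Rpower (1 + w * w) (- q) * cos (s * ln w)) (fst z) /\
  has_int (fun w => Rpower (1 + w * w) (- q) * sin (s * ln w)) (snd z).

Lemma Rpower_pos x y : 0 < Rpower x y.
Proof. apply exp_pos. Qed.

Lemma Rpower_le_inv q w : 1 <= q -> Rpower (1 + w * w) (- q) <= / (1 + w * w).
Proof.
  intros Hq. rewrite <- (Rpower_1 (1 + w * w)) at 2 by nra. rewrite <- Rpower_Ropp.
  apply Rle_Rpower. nra. lra.
Qed.

Lemma beta_ex_aux q (h : R -> R) : 1 <= q -> cont_pos h -> (forall x, 0 < x -> Rabs (h x) <= 1) ->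
  exists l, has_int (fun w => Rpower (1 + w * w) (- q) * h w) l.
Proof.
  intros Hq Hc Hh. destruct (has_int_atan (fun w => Rpower (1 + w * w) (- q) * h w) 1) as (l & Hl & _); [lra| | |now exists l].
  - intros x Hx. apply cont_mult. apply cont_ex_derive. unfold Rpower. auto_derive. nra. now apply Hc.
  - intros x Hx. rewrite Rabs_mult, Rabs_pos_eq by (left; apply Rpower_pos).
    generalize (Rpower_le_inv q x Hq) (Rpower_pos (1 + x * x) (- q)) (Hh x Hx) (Rabs_pos (h x)).
    unfold Rdiv. rewrite Rmult_1_l. intros. nra.
Qed.

Lemma beta_ex q s : 1 <= q -> exists z, beta_int q s z.
Proof.
  intros Hq.
  destruct (beta_ex_aux q (fun x => cos (s * ln x)) Hq) as (a & Ha). cont_by_derive. intros; apply Rabs_cos_le.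
  destruct (beta_ex_aux q (fun x => sin (s * ln x)) Hq) as (b & Hb). cont_by_derive. intros; apply Rabs_sin_le.
  exists (a, b). now split.
Qed.

Lemma beta_lim q (h : R -> R) : 1 <= q -> (forall x, 0 < x -> Rabs (h x) <= 1) ->
  filterlim (fun x => x * Rpower (1 + x * x) (- q) * h x) (at_right 0) (locally 0) /\
  filterlim (fun x => x * Rpower (1 + x * x) (- q) * h x) (Rbar_locally p_infty) (locally 0).
Proof.
  intros Hq Hh.
  assert (K : forall x, 0 < x -> Rabs (x * Rpower (1 + x * x) (- q) * h x - 0) <= x * / (1 + x * x)).
  { intros x Hx. rewrite Rminus_0_r, 2!Rabs_mult, (Rabs_pos_eq x), (Rabs_pos_eq (Rpower _ _)); try lra. 2: left; apply Rpower_pos.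
    generalize (Rpower_le_inv q x Hq) (Rpower_pos (1 + x * x) (- q)) (Hh x Hx) (Rabs_pos (h x)). intros.
    rewrite Rmult_assoc. apply Rmult_le_compat_l. lra. nra. }
  split.
  - apply lim_zero_rate with 1. intros x Hx. apply Rle_trans with (1 := K x ltac:(lra)).
    rewrite Rmult_comm. apply Rmult_le_compat_r. lra. rewrite <- Rinv_1. apply Rinv_le_contravar; nra.
  - apply lim_infty_rate with 1. intros x Hx. apply Rle_trans with (1 := K x ltac:(lra)).
    apply le_div. lra. replace (x * / (1 + x * x) * x) with (x * x / (1 + x * x)) by (unfold Rdiv; ring).
    apply div_le; nra.
Qed.

Lemma Rpower_shift x q : 0 < x -> Rpower x (- q) = x * Rpower x (- (q + 1)).
Proof.
  intros Hx. rewrite <- (Rpower_1 x Hx) at 2. rewrite <- Rpower_plus. f_equal. ring.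
Qed.

(** Integrate the derivative of w^(1+is) (1 + w^2)^(-q), writing w^2 = (1 + w^2) - 1 in the second
    term; the boundary values vanish because q >= 1. *)
Lemma beta_rec q s z : 1 <= q -> beta_int q s z -> beta_int (q + 1) s (Cmult (RtoC (/ (2 * q))) (Cmult (2 * q - 1, - s) z)).
Proof.
  intros Hq (H1 & H2).
  destruct (beta_ex (q + 1) s) as (z' & H3 & H4). lra.
  assert (E1 : has_int (fun x => (1 - 2 * q) * (Rpower (1 + x * x) (- q) * cos (s * ln x)) - s * (Rpower (1 + x * x) (- q) * sin (s * ln x)) + (2 * q) * (Rpower (1 + x * x) (- (q + 1)) * cos (s * ln x))) (0 - 0)).
  { apply has_int_FTC with (fun x => x * Rpower (1 + x * x) (- q) * cos (s * ln x)).
    - intros x Hx. evar_last. unfold Rpower. auto_derive. repeat split; nra. reflexivity.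
      change (exp (- q * ln (1 + x * x))) with (Rpower (1 + x * x) (- q)). rewrite Rpower_shift by nra. field. nra.
    - intros x Hx. apply cont_ex_derive. unfold Rpower. auto_derive. repeat split; nra.
    - apply beta_lim; trivial. intros; apply Rabs_cos_le.
    - apply beta_lim; trivial. intros; apply Rabs_cos_le. }
  assert (E2 : has_int (fun x => (1 - 2 * q) * (Rpower (1 + x * x) (- q) * sin (s * ln x)) + s * (Rpower (1 + x * x) (- q) * cos (s * ln x)) + (2 * q) * (Rpower (1 + x * x) (- (q + 1)) * sin (s * ln x))) (0 - 0)).
  { apply has_int_FTC with (fun x => x * Rpower (1 + x * x) (- q) * sin (s * ln x)).
    - intros x Hx. evar_last. unfold Rpower. auto_derive. repeat split; nra. reflexivity.
      change (exp (- q * ln (1 + x * x))) with (Rpower (1 + x * x) (- q)). rewrite Rpower_shift by nra. field. nra.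
    - intros x Hx. apply cont_ex_derive. unfold Rpower. auto_derive. repeat split; nra.
    - apply beta_lim; trivial. intros; apply Rabs_sin_le.
    - apply beta_lim; trivial. intros; apply Rabs_sin_le. }
  assert (F1 := has_int_unique _ _ _ E1 (has_int_plus _ _ _ _ (has_int_minus _ _ _ _ (has_int_scal _ (1 - 2 * q) _ H1) (has_int_scal _ s _ H2)) (has_int_scal _ (2 * q) _ H3))).
  assert (F2 := has_int_unique _ _ _ E2 (has_int_plus _ _ _ _ (has_int_plus _ _ _ _ (has_int_scal _ (1 - 2 * q) _ H2) (has_int_scal _ s _ H1)) (has_int_scal _ (2 * q) _ H4))).
  replace (Cmult (RtoC (/ (2 * q))) (Cmult (2 * q - 1, - s) z)) with z'. now split.
  rewrite (surjective_pairing z'). unfold Cmult, RtoC. cbn [fst snd]. f_equal.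
  - apply Rmult_eq_reg_l with (2 * q); [|lra].
    transitivity ((2 * q - 1) * fst z - - s * snd z). lra. field; lra.
  - apply Rmult_eq_reg_l with (2 * q); [|lra].
    transitivity ((2 * q - 1) * snd z + - s * fst z). lra. field; lra.
Qed.

Lemma beta_one : beta_int 1 0 (RtoC (PI / 2)).
Proof.
  split; cbn [fst snd RtoC].
  - replace (PI / 2) with (PI / 2 - 0) by ring. apply has_int_FTC with atan.
    + intros x Hx. rewrite Rmult_0_l, cos_0, Rpower_Ropp, Rpower_1 by nra. auto_derive. trivial. unfold Rsqr. field. nra.
    + intros x Hx. apply cont_ex_derive. unfold Rpower. auto_derive. repeat split; nra.
    + apply atan_lim0.
    + apply atan_limoo.
  - apply has_int_zero. intros x _. rewrite Rmult_0_l, sin_0. ring.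
Qed.

Lemma beta_three_halves : beta_int (3 / 2) 0 (RtoC 1).
Proof.
  split; cbn [fst snd RtoC].
  - enough (E : has_int (fun w => Rpower (1 + w * w) (- (3 / 2)) * cos (0 * ln w)) (1 - 0)) by (now rewrite Rminus_0_r in E).
    apply has_int_FTC with (fun w => w * Rpower (1 + w * w) (- (1 / 2))).
    + intros x Hx. evar_last. unfold Rpower. auto_derive. repeat split; nra. reflexivity.
      change (exp (- (1 / 2) * ln (1 + x * x))) with (Rpower (1 + x * x) (- (1 / 2))).
      change (exp (- (1 * / 2) * ln (1 + x * x))) with (Rpower (1 + x * x) (- (1 / 2))).
      rewrite Rpower_shift by nra. replace (1 / 2 + 1) with (3 / 2) by field. rewrite Rmult_0_l, cos_0. field. nra.
    + intros x Hx. apply cont_ex_derive. unfold Rpower. auto_derive. repeat split; nra.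
    + apply lim_zero_rate with 1. intros x Hx. rewrite Rminus_0_r, Rabs_mult, (Rabs_pos_eq x), Rabs_pos_eq.
      rewrite Rmult_comm. apply Rmult_le_compat_r. lra. apply Rle_trans with (Rpower (1 + x * x) 0). apply Rle_Rpower; nra. rewrite Rpower_O; nra.
      left; apply Rpower_pos. lra.
    + apply lim_infty_rate with 1. intros x Hx.
      replace (- (1 / 2)) with (- / 2) by field. rewrite Rpower_Ropp, Rpower_sqrt by nra.
      assert (Hs : 0 < sqrt (1 + x * x)) by (apply sqrt_lt_R0; nra).
      assert (Hss : sqrt (1 + x * x) * sqrt (1 + x * x) = 1 + x * x) by (apply sqrt_sqrt; nra).
      set (r := sqrt (1 + x * x)) in *.
      assert (x < r) by nra. assert (r < x + 1) by nra.
      replace (x * / r - 1) with (- ((r - x) / r)) by (field; lra). rewrite Rabs_Ropp, Rabs_pos_eq.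
      2: apply Rdiv_le_0_compat; lra.
      apply div_le. lra. unfold Rdiv. rewrite Rmult_1_l. apply Rle_trans with (/ x * x). rewrite Rinv_l; lra.
      apply Rmult_le_compat_l; [left; apply Rinv_0_lt_compat|]; lra.
  - apply has_int_zero. intros x _. rewrite Rmult_0_l, sin_0. ring.
Qed.

Lemma beta_real q z : beta_int q 0 z -> has_int (fun w => Rpower (1 + w * w) (- q)) (fst z) /\ snd z = 0.
Proof.
  intros (H1 & H2). split.
  - apply has_int_ext with (2 := H1). intros x _. rewrite Rmult_0_l, cos_0. ring.
  - apply has_int_unique with (1 := H2). apply has_int_zero. intros x _. rewrite Rmult_0_l, sin_0. ring.
Qed.

(** The recurrence moves q by whole steps only. Monotonicity in q encloses the half step from q to q
    + 1/2 in the whole step, whose cost without oscillation the recurrence at s = 0 computes. *)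
Lemma beta_diff_aux q (h : R -> R) l l' b b' :
  cont_pos h -> (forall x, 0 < x -> Rabs (h x) <= 1) ->
  has_int (fun w => Rpower (1 + w * w) (- q) * h w) l ->
  has_int (fun w => Rpower (1 + w * w) (- (q + 1 / 2)) * h w) l' ->
  has_int (fun w => Rpower (1 + w * w) (- q)) b ->
  has_int (fun w => Rpower (1 + w * w) (- (q + 1))) b' ->
  Rabs (l - l') <= b - b'.
Proof.
  intros Hc Hh H1 H2 H3 H4.
  refine (has_int_le_abs _ _ _ _ _ _ _ (has_int_minus _ _ _ _ H1 H2) (has_int_minus _ _ _ _ H3 H4)).
  - intros x Hx. apply cont_minus; (apply cont_mult; [|now apply Hc]); apply cont_ex_derive; unfold Rpower; auto_derive; nra.
  - intros x Hx. apply cont_ex_derive. unfold Rpower. auto_derive. repeat split; nra.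
  - intros x Hx.
    assert (Rpower (1 + x * x) (- (q + 1)) <= Rpower (1 + x * x) (- (q + 1 / 2)) <= Rpower (1 + x * x) (- q)).
    { split; apply Rle_Rpower; nra. }
    rewrite <- Rmult_minus_distr_r, Rabs_mult, Rabs_pos_eq by lra.
    generalize (Hh x Hx) (Rabs_pos (h x)). nra.
Qed.

Lemma beta_diff q s z z' b b' : beta_int q s z -> beta_int (q + 1 / 2) s z' ->
  beta_int q 0 b -> beta_int (q + 1) 0 b' -> Cmod (Cminus z z') <= 2 * (fst b - fst b').
Proof.
  intros (H1 & H2) (H3 & H4) Hb Hb'. apply beta_real in Hb. apply beta_real in Hb'.
  eapply Rle_trans. apply Cmod_le_abs. rewrite <- Rplus_diag. apply Rplus_le_compat.
  - apply (beta_diff_aux q (fun w => cos (s * ln w))); trivial; try apply Hb; try apply Hb'. cont_by_derive. intros; apply Rabs_cos_le.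
  - apply (beta_diff_aux q (fun w => sin (s * ln w))); trivial; try apply Hb; try apply Hb'. cont_by_derive. intros; apply Rabs_sin_le.
Qed.

Lemma beta_le_aux q (h : R -> R) l b :
  cont_pos h -> (forall x, 0 < x -> Rabs (h x) <= 1) ->
  has_int (fun w => Rpower (1 + w * w) (- q) * h w) l ->
  has_int (fun w => Rpower (1 + w * w) (- q)) b -> Rabs l <= b.
Proof.
  intros Hc Hh H1 H3.
  refine (has_int_le_abs _ _ _ _ _ _ _ H1 H3).
  - intros x Hx. apply cont_mult; [|now apply Hc]. apply cont_ex_derive; unfold Rpower; auto_derive; nra.
  - intros x Hx. apply cont_ex_derive. unfold Rpower. auto_derive. repeat split; nra.
  - intros x Hx. rewrite Rabs_mult, Rabs_pos_eq by (left; apply Rpower_pos).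
    generalize (Hh x Hx) (Rabs_pos (h x)) (Rpower_pos (1 + x * x) (- q)). nra.
Qed.

Lemma beta_le q s z b : beta_int q s z -> beta_int q 0 b -> Cmod z <= 2 * fst b.
Proof.
  intros (H1 & H2) Hb. apply beta_real in Hb.
  eapply Rle_trans. apply Cmod_le_abs. rewrite <- Rplus_diag. apply Rplus_le_compat.
  - apply (beta_le_aux q (fun w => cos (s * ln w))); trivial; try apply Hb. cont_by_derive. intros; apply Rabs_cos_le.
  - apply (beta_le_aux q (fun w => sin (s * ln w))); trivial; try apply Hb. cont_by_derive. intros; apply Rabs_sin_le.
Qed.

(** * The value of b_1 *)

Lemma cosh_ge_1 x : 1 <= cosh x.
Proof. unfold cosh. generalize (exp_ineq1_le x) (exp_ineq1_le (- x)). lra. Qed.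

Lemma cosh_sqr x : cosh x * cosh x = 1 + sinh x * sinh x.
Proof.
  unfold cosh, sinh. assert (exp x * exp (- x) = 1) by (rewrite <- exp_plus, Rplus_opp_r; apply exp_0). nra.
Qed.

Lemma is_derive_cosh x : is_derive cosh x (sinh x).
Proof. apply is_derive_Reals, derivable_pt_lim_cosh. Qed.

Lemma is_derive_sinh x : is_derive sinh x (cosh x).
Proof. apply is_derive_Reals, derivable_pt_lim_sinh. Qed.

(** [M] is the maximum over [0, pi/2] of the second derivative s^2 cosh(s x); integrating once and
    twice gives the bounds. They keep (cosh(s x) - 1) / sin x and its derivative bounded at 0. *)
Lemma cosh_small s : exists M, 0 <= M /\ forall x, 0 <= x <= PI / 2 ->
  0 <= s * sinh (s * x) <= M * x /\ 0 <= cosh (s * x) - 1 <= M * (x * x).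
Proof.
  set (M := s * s * cosh (s * (PI / 2))).
  assert (D1 : forall x, is_derive (fun x => cosh (s * x)) x (s * sinh (s * x))).
  { intros x. auto_derive. trivial. ring. }
  assert (D2 : forall x, is_derive (fun x => s * sinh (s * x)) x (s * s * cosh (s * x))).
  { intros x. replace (s * s * cosh (s * x)) with (s * (s * cosh (s * x))) by ring.
    apply (is_derive_scal (fun x => sinh (s * x)) x s).
    auto_derive. trivial. ring. }
  assert (Hc : forall x, 0 <= s * s * cosh (s * x)). { intros x. generalize (cosh_ge_1 (s * x)). nra. }
  assert (A1 : forall x, 0 <= x -> 0 <= s * sinh (s * x)).
  { intros x Hx. generalize (nonneg_derive_le _ _ 0 x Hx (fun y _ => D2 y) (fun y _ => Hc y)).
    rewrite Rmult_0_r, sinh_0. lra. }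
  assert (A2 : forall x y, 0 <= x <= y -> cosh (s * x) <= cosh (s * y)).
  { intros x y Hx. apply (nonneg_derive_le _ _ x y (proj2 Hx) (fun y _ => D1 y)). intros z Hz. apply A1. lra. }
  exists M. split. apply Hc. intros x Hx.
  assert (A3 : forall y, 0 <= y <= PI / 2 -> s * sinh (s * y) <= M * y).
  { intros y Hy.
    assert (K : M * 0 - s * sinh (s * 0) <= M * y - s * sinh (s * y)).
    { apply (nonneg_derive_le (fun y => M * y - s * sinh (s * y)) (fun y => M - s * s * cosh (s * y))). lra.
      - intros z _. apply (is_derive_minus (fun y => M * y) (fun y => s * sinh (s * y)) z M). auto_derive. trivial. ring. apply D2.
      - intros z Hz. unfold M. generalize (A2 z (PI / 2) ltac:(lra)) . nra. }
    rewrite 2!Rmult_0_r, sinh_0 in K. lra. }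
  split; [split|split].
  - apply A1; lra.
  - now apply A3.
  - generalize (cosh_ge_1 (s * x)); lra.
  - assert (K : M * (0 * 0) - cosh (s * 0) <= M * (x * x) - cosh (s * x)).
    { apply (nonneg_derive_le (fun y => M * (y * y) - cosh (s * y)) (fun y => M * (2 * y) - s * sinh (s * y))). lra.
      - intros z _. apply (is_derive_minus (fun y => M * (y * y)) (fun y => cosh (s * y)) z (M * (2 * z))). auto_derive. trivial. ring. apply D1.
      - intros z Hz. generalize (A3 z ltac:(lra)) (A1 z ltac:(lra)). lra. }
    rewrite 3!Rmult_0_r, cosh_0 in K. lra.
Qed.

(** * Odd cosine sums and the partial fractions of 1 / cosh *)

Definition oddcos (N : nat) (x : R) : R := sum_f_R0 (fun k => cos (INR (2 * k + 1) * x)) N.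

Lemma oddcos_closed N x : 2 * sin x * oddcos N x = sin (INR (2 * (N + 1)) * x).
Proof.
  induction N as [|N IH]; unfold oddcos in *.
  - simpl. replace ((1 + 1) * x) with (2 * x) by ring. rewrite sin_2a, Rmult_1_l. ring.
  - rewrite tech5, Rmult_plus_distr_l, IH.
    replace (2 * (S N + 1))%nat with (2 * (N + 1) + 2)%nat by lia.
    replace (2 * S N + 1)%nat with (2 * (N + 1) + 1)%nat by lia.
    rewrite 2!plus_INR. set (m := INR (2 * (N + 1))). simpl (INR 1). simpl (INR 2).
    replace ((m + (1 + 1)) * x) with (m * x + x + x) by ring. replace ((m + 1) * x) with (m * x + x) by ring.
    set (a := m * x). rewrite (sin_plus (a + x) x), (sin_plus a x), (cos_plus a x).
    generalize (sin2_cos2 x). unfold Rsqr. intros E.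
    replace ((sin a * cos x + cos a * sin x) * cos x) with (sin a * (1 - sin x * sin x) + cos a * sin x * cos x).
    ring. rewrite <- E. ring.
Qed.

Lemma continuous_oddcos N x : continuous (oddcos N) x.
Proof.
  induction N as [|N IH].
  - unfold oddcos; simpl. apply cont_ex_derive. auto_derive. trivial.
  - apply continuous_ext with (fun x => oddcos N x + cos (INR (2 * S N + 1) * x)). intros; unfold oddcos; now rewrite tech5.
    apply cont_plus; trivial. apply cont_ex_derive. auto_derive. trivial.
Qed.

Lemma oddcos_bound N x : Rabs (oddcos N x) <= INR N + 1.
Proof.
  induction N as [|N IH].
  - unfold oddcos; simpl. generalize (Rabs_cos_le (1 * x)). lra.
  - unfold oddcos in *. rewrite tech5, S_INR. eapply Rle_trans. apply Rabs_triang.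
    generalize (Rabs_cos_le (INR (2 * S N + 1) * x)). lra.
Qed.

(* The singularity of [1 / sin x] at 0 is removable against [cosh (s x) - 1], so that one integration by parts gains 1/N. *)
Lemma oddcos_cosh_decay s : exists C, forall N,
  Rabs (RInt (fun x => (cosh (s * x) - 1) * oddcos N x) 0 (PI / 2)) <= C / INR (N + 1).
Proof.
  destruct (cosh_small s) as (M & HM & HH).
  assert (HP := PI2_3_2).
  exists (M * 40). intros N.
  assert (HN : 0 < INR (N + 1)) by (apply lt_0_INR; lia).
  set (m := INR (2 * (N + 1))).
  assert (Hm : m = 2 * INR (N + 1)). { unfold m. rewrite mult_INR. simpl. ring. }
  set (f := fun x => (cosh (s * x) - 1) * oddcos N x).
  assert (Cch : forall x, continuous (fun x => cosh (s * x)) x).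
  { intros x. apply (cont_of_derive _ x (s * sinh (s * x))).
    auto_derive. trivial. ring. }
  assert (Csh : forall x, continuous (fun x => sinh (s * x)) x).
  { intros x. apply (cont_of_derive _ x (s * cosh (s * x))).
    auto_derive. trivial. ring. }
  assert (Hf : forall x, continuous f x).
  { intros x. apply cont_mult. apply cont_minus. apply Cch. apply continuous_const. apply continuous_oddcos. }
  set (eta := fun x => (cosh (s * x) - 1) / (2 * sin x)).
  set (deta := fun x => (s * sinh (s * x) * sin x - (cosh (s * x) - 1) * cos x) / (2 * (sin x * sin x))).
  assert (Hs : forall x, 0 < x <= PI / 2 -> x / 2 <= sin x /\ 0 < sin x). { intros x Hx. generalize (sin_ge_half x ltac:(lra)). lra. }
  assert (He : forall x, 0 < x <= PI / 2 -> Rabs (eta x) <= M * x).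
  { intros x Hx. destruct (Hs x Hx) as (S1 & S2). destruct (HH x ltac:(lra)) as (_ & H2).
    unfold eta. rewrite Rabs_pos_eq. apply div_le. lra. apply Rle_trans with (1 := proj2 H2).
    replace (M * x * (2 * sin x)) with (M * (x * (2 * sin x))) by ring. apply Rmult_le_compat_l; nra.
    apply Rdiv_le_0_compat; lra. }
  assert (Hd : forall x, 0 < x <= PI / 2 -> Rabs (deta x) <= M * 4).
  { intros x Hx. destruct (Hs x Hx) as (S1 & S2). destruct (HH x ltac:(lra)) as (H1 & H2).
    unfold deta, Rdiv. assert (0 < 2 * (sin x * sin x)) by nra. rewrite Rabs_mult, (Rabs_pos_eq (/ _)) by (left; now apply Rinv_0_lt_compat).
    apply div_le; trivial.
    apply Rle_trans with (M * x * sin x + M * (x * x)).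
    { unfold Rminus. eapply Rle_trans. apply Rabs_triang. rewrite Rabs_Ropp. apply Rplus_le_compat.
      - rewrite Rabs_mult, (Rabs_pos_eq (sin x)), Rabs_pos_eq by lra. apply Rmult_le_compat_r; lra.
      - rewrite Rabs_mult. rewrite <- (Rmult_1_r (M * (x * x))). apply Rmult_le_compat; try apply Rabs_pos. rewrite Rabs_pos_eq; unfold Rminus in *; lra. apply Rabs_cos_le. }
    replace (M * x * sin x + M * (x * x)) with (M * (x * sin x + x * x)) by ring. rewrite Rmult_assoc. apply Rmult_le_compat_l; nra. }
  assert (Dd : forall x, 0 < x <= PI / 2 -> is_derive eta x (deta x)).
  { intros x Hx. destruct (Hs x Hx) as (S1 & S2). unfold eta, deta.
    evar_last. apply (is_derive_div (fun x => cosh (s * x) - 1) (fun x => 2 * sin x) x (s * sinh (s * x)) (2 * cos x)).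
    - replace (s * sinh (s * x)) with (s * sinh (s * x) - 0) by ring.
      apply (is_derive_minus (fun x => cosh (s * x)) (fun _ => 1)).
      auto_derive. trivial. ring. apply (is_derive_const (V := R_NormedModule)).
    - auto_derive. trivial. ring.
    - lra.
    - simpl. field. lra. }
  assert (Cd : forall x, 0 < x <= PI / 2 -> continuous deta x).
  { intros x Hx. destruct (Hs x Hx) as (S1 & S2). unfold deta, Rdiv. apply cont_mult.
    - apply cont_minus; apply cont_mult. apply cont_mult. apply continuous_const. apply Csh. apply continuous_sin.
      apply cont_minus. apply Cch. apply continuous_const. apply continuous_cos.
    - apply cont_ex_derive. auto_derive. nra. }
  (* The integration by parts takes place on [d, pi/2], away from the zero of the sine, with a bound
     free of d. The piece [0, d] is then removed for each fixed N by the crude bound N + 1 on the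
     cosine sum. *)
  assert (key : forall d, 0 < d <= 1 -> Rabs (RInt f d (PI / 2)) <= M * 20 / INR (N + 1)).
  { intros d Hd0.
    assert (I1 : is_RInt (fun x => f x - deta x * (cos (m * x) / m)) d (PI / 2)
      (- (eta (PI / 2) * (cos (m * (PI / 2)) / m)) - - (eta d * (cos (m * d) / m)))).
    { apply (RInt_FTC (fun x => - (eta x * (cos (m * x) / m)))). lra.
      - intros x Hx. destruct (Hs x ltac:(lra)) as (S1 & S2).
        assert (Ef : f x = eta x * sin (m * x)).
        { unfold f, eta, m. rewrite <- oddcos_closed. field. lra. }
        evar_last. apply (is_derive_opp (fun x => eta x * (cos (m * x) / m)) x).
        apply (is_derive_mult eta (fun x => cos (m * x) / m)). apply Dd; lra.
        auto_derive. trivial. reflexivity. intros; apply Rmult_comm.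
        unfold opp, plus, mult; simpl. rewrite Ef. field. lra.
      - intros x Hx. apply cont_minus. apply Hf. apply cont_mult. apply Cd; lra.
        apply cont_ex_derive. auto_derive. lra. }
    assert (X2 : ex_RInt (fun x => deta x * (cos (m * x) / m)) d (PI / 2)).
    { apply ex_RInt_cont. lra. intros x Hx. apply cont_mult. apply Cd; lra. apply cont_ex_derive. auto_derive. lra. }
    assert (X1 : ex_RInt f d (PI / 2)) by (apply ex_RInt_cont; [lra | intros; apply Hf]).
    apply (is_RInt_unique (V := R_CompleteNormedModule)) in I1. rewrite RInt_minus_R in I1; trivial.
    assert (B2 : Rabs (RInt (fun x => deta x * (cos (m * x) / m)) d (PI / 2)) <= (PI / 2 - d) * (M * 4 / m)).
    { apply (norm_RInt_le_const (V := R_NormedModule) (fun x => deta x * (cos (m * x) / m)) d (PI / 2)). lra.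
      - intros x Hx. unfold norm; simpl; unfold abs; simpl. unfold Rdiv. rewrite Rabs_mult, Rabs_mult, (Rabs_pos_eq (/ m)).
        rewrite <- Rmult_assoc. apply Rmult_le_compat_r. left; apply Rinv_0_lt_compat; lra.
        rewrite <- (Rmult_1_r (M * 4)). apply Rmult_le_compat; try apply Rabs_pos. apply Hd; lra. apply Rabs_cos_le.
        left; apply Rinv_0_lt_compat; lra.
      - now apply (RInt_correct (V := R_CompleteNormedModule)). }
    assert (B3 : forall x, 0 < x <= PI / 2 -> Rabs (eta x * (cos (m * x) / m)) <= M * (PI / 2) / m).
    { intros x Hx. unfold Rdiv. rewrite Rabs_mult, Rabs_mult, (Rabs_pos_eq (/ m)).
      rewrite <- Rmult_assoc. apply Rmult_le_compat_r. left; apply Rinv_0_lt_compat; lra.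
      rewrite <- (Rmult_1_r (M * _)). apply Rmult_le_compat; try apply Rabs_pos. apply Rle_trans with (1 := He x Hx). unfold Rdiv in *; nra. apply Rabs_cos_le.
      left; apply Rinv_0_lt_compat; lra. }
    generalize (B3 (PI / 2) ltac:(lra)) (B3 d ltac:(lra)). intros B4 B5.
    set (e1 := eta (PI / 2) * (cos (m * (PI / 2)) / m)) in *. set (e2 := eta d * (cos (m * d) / m)) in *.
    set (i2 := RInt (fun x => deta x * (cos (m * x) / m)) d (PI / 2)) in *.
    replace (RInt f d (PI / 2)) with (- e1 + e2 + i2 : R).
    2: { transitivity (- e1 - - e2 + i2 : R). ring. rewrite <- I1. unfold i2; ring. }
    apply Rle_trans with (Rabs e1 + Rabs e2 + Rabs i2).
    { eapply Rle_trans. apply Rabs_triang. apply Rplus_le_compat_r. eapply Rle_trans. apply Rabs_triang. rewrite Rabs_Ropp. lra. }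
    apply Rle_trans with (M * 40 / m).
    - assert (0 <= M / m) by (apply Rdiv_le_0_compat; lra).
      assert (HP4 := PI_4).
      replace (M * (PI / 2) / m) with (M / m * (PI / 2)) in * by (unfold Rdiv; ring).
      replace (M * 4 / m) with (M / m * 4) in * by (unfold Rdiv; ring).
      replace (M * 40 / m) with (M / m * 40) in * by (unfold Rdiv; ring).
      assert ((PI / 2 - d) * (M / m * 4) <= 2 * (M / m * 4)) by (apply Rmult_le_compat_r; lra).
      assert (M / m * (PI / 2) <= M / m * 2) by (apply Rmult_le_compat_l; lra). lra.
    - rewrite Hm. apply Req_le. field. lra. }
  assert (Hne : 0 <= M * 20 / INR (N + 1)) by (apply Rdiv_le_0_compat; lra).
  assert (Hfb : forall x, 0 <= x <= PI / 2 -> Rabs (f x) <= M * 4 * (INR N + 1)).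
  { intros x Hx. unfold f. rewrite Rabs_mult. destruct (HH x Hx) as (_ & H2). rewrite (Rabs_pos_eq _ (proj1 H2)).
    apply Rmult_le_compat. lra. apply Rabs_pos. assert (HP4 := PI_4). apply Rle_trans with (1 := proj2 H2). apply Rmult_le_compat_l; nra. apply oddcos_bound. }
  apply le_epsilon. intros eps Heps.
  set (B := M * 4 * (INR N + 1)) in *.
  assert (HB : 0 <= B). { apply Rle_trans with (2 := Hfb 0 ltac:(lra)). apply Rabs_pos. }
  set (d := Rmin 1 (eps / (B + 1))).
  assert (Hd0 : 0 < d <= 1). { split. apply Rmin_pos. lra. apply Rdiv_lt_0_compat; lra. apply Rmin_l. }
  assert (Hd1 : d * B <= eps).
  { apply Rle_trans with (eps / (B + 1) * B). apply Rmult_le_compat_r; trivial. apply Rmin_r.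
    replace (eps / (B + 1) * B) with (eps * B / (B + 1)) by (field; lra). apply div_le; nra. }
  fold f. rewrite <- (RInt_Chasles_R f 0 d (PI / 2)) by (apply ex_RInt_cont; [lra | intros; apply Hf]).
  eapply Rle_trans. apply Rabs_triang.
  assert (Rabs (RInt f 0 d) <= (d - 0) * B).
  { apply (norm_RInt_le_const (V := R_NormedModule) f 0 d). lra. intros x Hx. apply Hfb. lra.
    apply (RInt_correct (V := R_CompleteNormedModule)). apply ex_RInt_cont. lra. intros; apply Hf. }
  specialize (key d Hd0).
  replace (M * 40 / INR (N + 1)) with (2 * (M * 20 / INR (N + 1))) by (field; lra). lra.
Qed.

(** Each product cosh(s x) cos((2k+1) x) has an elementary primitive. At pi/2 its cosine vanishes
    and its sine is (-1)^k, so cosh(s pi/2) factors out of every term. *)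
Lemma oddcos_cosh_int s N :
  RInt (fun x => cosh (s * x) * oddcos N x) 0 (PI / 2) =
  cosh (s * (PI / 2)) * sum_f_R0 (fun k => (-1) ^ k * (INR (2 * k + 1) / (INR (2 * k + 1) * INR (2 * k + 1) + s * s))) N.
Proof.
  assert (HP := PI2_3_2).
  set (term := fun k x => cosh (s * x) * cos (INR (2 * k + 1) * x)).
  assert (Ct : forall k x, continuous (term k) x).
  { intros k x. apply cont_mult. apply (cont_of_derive _ x (s * sinh (s * x))).
    auto_derive. trivial. ring.
    apply cont_ex_derive. auto_derive. trivial. }
  assert (It : forall k, RInt (term k) 0 (PI / 2) = cosh (s * (PI / 2)) * ((-1) ^ k * (INR (2 * k + 1) / (INR (2 * k + 1) * INR (2 * k + 1) + s * s)))).
  { intros k. set (m := INR (2 * k + 1)).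
    assert (Hm : 0 < m) by (apply lt_0_INR; lia).
    assert (Hd : 0 < m * m + s * s) by nra.
    apply is_RInt_unique.
    replace (cosh (s * (PI / 2)) * ((-1) ^ k * (m / (m * m + s * s)))) with
      ((m * (cosh (s * (PI / 2)) * sin (m * (PI / 2))) + s * (sinh (s * (PI / 2)) * cos (m * (PI / 2)))) / (m * m + s * s)
       - (m * (cosh (s * 0) * sin (m * 0)) + s * (sinh (s * 0) * cos (m * 0))) / (m * m + s * s)).
    - apply (RInt_FTC (fun x => (m * (cosh (s * x) * sin (m * x)) + s * (sinh (s * x) * cos (m * x))) / (m * m + s * s))). lra.
      + intros x _. unfold term. fold m.
        auto_derive. trivial. field. lra.
      + intros x _. apply Ct.
    - assert (Ek : m * (PI / 2) = PI / 2 + INR k * PI).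
      { unfold m. rewrite plus_INR, mult_INR. simpl. field. }
      assert (Esc : sin (m * (PI / 2)) = (-1) ^ k /\ cos (m * (PI / 2)) = 0).
      { rewrite Ek. clear. induction k as [|k [IH1 IH2]].
        - simpl. rewrite Rmult_0_l, Rplus_0_r, sin_PI2, cos_PI2. now split.
        - rewrite S_INR. replace (PI / 2 + (INR k + 1) * PI) with (PI / 2 + INR k * PI + PI) by ring.
          rewrite neg_sin, neg_cos, IH1, IH2. simpl. split; ring. }
      destruct Esc as (E1 & E2). rewrite E1, E2, !Rmult_0_r, sin_0, sinh_0. field. lra. }
  induction N as [|N IH].
  - transitivity (RInt (term 0%nat) 0 (PI / 2)). apply RInt_ext_R. lra. intros x _. reflexivity. exact (It 0%nat).
  - rewrite tech5, Rmult_plus_distr_l, <- IH, <- (It (S N)). rewrite <- RInt_plus_R.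
    + apply RInt_ext_R. lra. intros x _. unfold term, oddcos. rewrite tech5. ring.
    + apply ex_RInt_cont. lra. intros x _. apply cont_mult. 2: apply continuous_oddcos.
      apply (cont_of_derive _ x (s * sinh (s * x))).
      auto_derive. trivial. ring.
    + apply ex_RInt_cont. lra. intros x _. apply Ct.
Qed.

(** Partial sums of the partial fraction expansion of pi / (4 cosh(pi s / 2)); for s = 0 this is
    Leibniz's series. *)
Definition sech_sum (s : R) (N : nat) : R :=
  sum_f_R0 (fun k => (-1) ^ k * (INR (2 * k + 1) / (INR (2 * k + 1) * INR (2 * k + 1) + s * s))) N.

(** Expand 1 / (1 + w^2) as a finite geometric sum with remainder. The remainder contributes at most
    1/(2N+3), and each of the N + 1 terms at most 2b at its lower limit b. *)
Lemma sech_sum_int s N b : 0 < b < 1 ->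
  Rabs (RInt (fun w => cos (s * ln w) / (1 + w * w)) b 1 - sech_sum s N) <= / INR (2 * N + 3) + 2 * INR (N + 1) * b.
Proof.
  intros Hb.
  set (I := fun N => RInt (fun w => cos (s * ln w) * ((-1) ^ N * w ^ (2 * N)) / (1 + w * w)) b 1).
  assert (XI : forall n, ex_RInt (fun w => cos (s * ln w) * ((-1) ^ n * w ^ (2 * n)) / (1 + w * w)) b 1).
  { intros n. apply ex_RInt_cont. lra. intros w Hw. apply cont_ex_derive. auto_derive. split. lra. nra. }
  assert (J : forall k, is_RInt (fun w => cos (s * ln w) * ((-1) ^ k * w ^ (2 * k))) b 1
     ((-1) ^ k * (INR (2 * k + 1) / (INR (2 * k + 1) * INR (2 * k + 1) + s * s)) -
      (-1) ^ k * (b ^ (2 * k + 1) * (INR (2 * k + 1) * cos (s * ln b) + s * sin (s * ln b)) / (INR (2 * k + 1) * INR (2 * k + 1) + s * s)))).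
  { intros k. set (m := INR (2 * k + 1)). assert (Hm : 0 < m) by (apply lt_0_INR; lia).
    assert (Hd : 0 < m * m + s * s) by nra.
    replace ((-1) ^ k * (m / (m * m + s * s))) with
      ((-1) ^ k * (1 ^ (2 * k + 1) * (m * cos (s * ln 1) + s * sin (s * ln 1)) / (m * m + s * s))).
    2: { rewrite ln_1, Rmult_0_r, cos_0, sin_0, pow1. field. lra. }
    apply (RInt_FTC (fun w => (-1) ^ k * (w ^ (2 * k + 1) * (m * cos (s * ln w) + s * sin (s * ln w)) / (m * m + s * s)))). lra.
    - assert (Em : m = INR (S (2 * k))) by (unfold m; f_equal; lia). clearbody m.
      replace (2 * k + 1)%nat with (S (2 * k)) by lia. revert Em. generalize (2 * k)%nat. intros j Em x Hx.
      auto_derive. repeat split; lra.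
      change (match j with O => 1 | S _ => INR j + 1 end) with (INR (S j)). rewrite <- Em. simpl. field. split; lra.
    - intros w Hw. apply cont_ex_derive. auto_derive. lra. }
  assert (Irec : forall n, I n = I (S n) + ((-1) ^ n * (INR (2 * n + 1) / (INR (2 * n + 1) * INR (2 * n + 1) + s * s)) -
      (-1) ^ n * (b ^ (2 * n + 1) * (INR (2 * n + 1) * cos (s * ln b) + s * sin (s * ln b)) / (INR (2 * n + 1) * INR (2 * n + 1) + s * s)))).
  { intros n. rewrite <- (is_RInt_unique (V := R_CompleteNormedModule) _ _ _ _ (J n)). unfold I.
    rewrite <- RInt_plus_R. 2: apply XI. 2: eexists; apply J.
    apply RInt_ext_R. lra. intros x Hx. replace (2 * S n)%nat with (2 * n + 2)%nat by lia.
    rewrite pow_add. simpl. field. nra. }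
  assert (Imain : forall n, Rabs (I 0%nat - sech_sum s n - I (S n)) <= 2 * INR (n + 1) * b).
  { assert (Hk : forall k, Rabs ((-1) ^ k * (b ^ (2 * k + 1) * (INR (2 * k + 1) * cos (s * ln b) + s * sin (s * ln b)) / (INR (2 * k + 1) * INR (2 * k + 1) + s * s))) <= 2 * b).
    { intros k. set (m := INR (2 * k + 1)). assert (Hm : 1 <= m). { unfold m. rewrite plus_INR. simpl (INR 1). generalize (pos_INR (2 * k)); lra. }
      assert (Hd : 0 < m * m + s * s) by nra.
      rewrite Rabs_mult, pow_1_abs, Rmult_1_l. unfold Rdiv. rewrite 2!Rabs_mult, (Rabs_pos_eq (/ _)) by (left; now apply Rinv_0_lt_compat).
      apply div_le; trivial.
      assert (P : 0 <= b ^ (2 * k + 1) <= b).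
      { rewrite pow_add, pow_1. assert (0 <= b ^ (2 * k) <= 1). { split. apply pow_le; lra. rewrite <- (pow1 (2 * k)). apply pow_incr. lra. } nra. }
      rewrite (Rabs_pos_eq _ (proj1 P)).
      assert (Q : Rabs (m * cos (s * ln b) + s * sin (s * ln b)) <= m + Rabs s).
      { eapply Rle_trans. apply Rabs_triang. rewrite 2!Rabs_mult, (Rabs_pos_eq m) by lra.
        apply Rplus_le_compat.
        - rewrite <- (Rmult_1_r m) at 2. apply Rmult_le_compat_l. lra. apply Rabs_cos_le.
        - rewrite <- (Rmult_1_r (Rabs s)) at 2. apply Rmult_le_compat_l. apply Rabs_pos. apply Rabs_sin_le. }
      assert (Q2 : m + Rabs s <= 2 * (m * m + s * s)). { rewrite <- (Rabs_pos_eq (s * s)) by nra. rewrite Rabs_mult. generalize (Rle_0_sqr (Rabs s - 1)). unfold Rsqr. nra. }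
      apply Rle_trans with (b * (2 * (m * m + s * s))). 2: apply Req_le; ring.
      apply Rmult_le_compat; try lra. apply Rabs_pos. }
    induction n as [|n IHn].
    - set (u := (-1) ^ 0 * (INR (2 * 0 + 1) / (INR (2 * 0 + 1) * INR (2 * 0 + 1) + s * s))).
      change (sech_sum s 0) with u. rewrite (Irec 0%nat). fold u.
      set (t := (-1) ^ 0 * (b ^ (2 * 0 + 1) * _ / _)). generalize (Hk 0%nat). fold t. intros Ht.
      replace (I 1%nat + (u - t) - u - I 1%nat) with (- t) by ring. rewrite Rabs_Ropp. simpl INR. lra.
    - unfold sech_sum in *. rewrite (Irec (S n)) in IHn. rewrite tech5.
      set (t := (-1) ^ S n * (b ^ (2 * S n + 1) * _ / _)) in *. generalize (Hk (S n)). fold t. intros Ht.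
      set (u := (-1) ^ S n * (INR (2 * S n + 1) / _)) in *. set (S0 := sum_f_R0 _ n) in *.
      replace (I 0%nat - (S0 + u) - I (S (S n))) with ((I 0%nat - S0 - (I (S (S n)) + (u - t))) - t) by ring.
      unfold Rminus at 1. eapply Rle_trans. apply Rabs_triang. rewrite Rabs_Ropp.
      replace (INR (S n + 1)) with (INR (n + 1) + 1) by (rewrite <- S_INR; f_equal; lia). lra. }
  assert (Ilast : Rabs (I (S N)) <= / INR (2 * N + 3)).
  { assert (HM : 0 < INR (2 * N + 3)) by (apply lt_0_INR; lia).
    apply Rle_trans with (RInt (fun w => w ^ (2 * N + 2)) b 1).
    - apply RInt_abs_le. lra. apply XI. apply ex_RInt_cont. lra. intros; apply cont_ex_derive; auto_derive; trivial.
      intros w Hw. replace (2 * S N)%nat with (2 * N + 2)%nat by lia. unfold Rdiv.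
      rewrite 3!Rabs_mult, pow_1_abs, Rmult_1_l.
      assert (P : 0 <= w ^ (2 * N + 2)) by (apply pow_le; lra). rewrite (Rabs_pos_eq _ P).
      assert (Q : 0 < / (1 + w * w) <= 1). { split. apply Rinv_0_lt_compat; nra. rewrite <- Rinv_1. apply Rinv_le_contravar; nra. }
      rewrite (Rabs_pos_eq (/ _)) by lra.
      generalize (Rabs_cos_le (s * ln w)) (Rabs_pos (cos (s * ln w))). intros A B.
      apply Rle_trans with (1 * w ^ (2 * N + 2) * 1). 2: lra. apply Rmult_le_compat; try lra. apply Rmult_le_pos; lra. apply Rmult_le_compat; lra.
    - assert (E : is_RInt (fun w => w ^ (2 * N + 2)) b 1 (1 ^ (2 * N + 3) / INR (2 * N + 3) - b ^ (2 * N + 3) / INR (2 * N + 3))).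
      { apply (RInt_FTC (fun w => w ^ (2 * N + 3) / INR (2 * N + 3))). lra.
        - intros x Hx. revert HM. replace (2 * N + 3)%nat with (S (2 * N + 2)) by lia. generalize (2 * N + 2)%nat. intros j HM.
          auto_derive. trivial. change (match j with O => 1 | S _ => INR j + 1 end) with (INR (S j)). simpl pred. field. lra.
        - intros; apply cont_ex_derive; auto_derive; trivial. }
      rewrite (is_RInt_unique (V := R_CompleteNormedModule) _ _ _ _ E), pow1.
      assert (0 <= b ^ (2 * N + 3) / INR (2 * N + 3)). { apply Rdiv_le_0_compat; trivial. apply pow_le; lra. }
      unfold Rdiv at 1. lra. }
  replace (RInt (fun w => cos (s * ln w) / (1 + w * w)) b 1) with (I 0%nat : R).
  2: { unfold I. apply RInt_ext_R. lra. intros x Hx. simpl. field. nra. }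
  replace (I 0%nat - sech_sum s N) with ((I 0%nat - sech_sum s N - I (S N)) + I (S N)) by ring.
  eapply Rle_trans. apply Rabs_triang. specialize (Imain N). lra.
Qed.

Lemma le_of_le_inv_n (A B C : R) : (forall N : nat, A <= B + C / INR (N + 1)) -> A <= B.
Proof.
  intros H. apply le_epsilon. intros eps He.
  destruct (nfloor_ex (Rabs C / eps)) as (N & HN). apply Rdiv_le_0_compat. apply Rabs_pos. lra.
  specialize (H N). rewrite plus_INR in H. simpl (INR 1) in H. generalize (pos_INR N). intros HN0.
  assert (C / (INR N + 1) <= eps).
  { apply div_le. lra. apply Rle_trans with (1 := Rle_abs C). destruct HN as (_ & HN).
    apply Rlt_div_l in HN; lra. }
  lra.
Qed.

(** Subtract the case s = 0, known from arctan 1 = pi/4. The difference is the integral of cosh(s x)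
    - 1 against the cosine sum, which decays like 1/N. *)
Lemma sech_sum_lim s : exists C, forall N, Rabs (cosh (s * (PI / 2)) * sech_sum s N - PI / 4) <= C / INR (N + 1).
Proof.
  destruct (oddcos_cosh_decay s) as (C & HC).
  exists (C + 1). intros N.
  assert (HP := PI2_3_2).
  assert (HN : 0 < INR (N + 1)) by (apply lt_0_INR; lia).
  assert (E0 : Rabs (PI / 4 - sech_sum 0 N) <= / INR (2 * N + 3)).
  { apply le_epsilon. intros eps He.
    set (b := Rmin (1 / 2) (eps / (2 * INR (N + 1) + 1))).
    assert (Hb : 0 < b < 1). { split. apply Rmin_pos. lra. apply Rdiv_lt_0_compat; lra. apply Rle_lt_trans with (1 := Rmin_l _ _). lra. }
    assert (Hb2 : (2 * INR (N + 1) + 1) * b <= eps).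
    { apply Rle_trans with ((2 * INR (N + 1) + 1) * (eps / (2 * INR (N + 1) + 1))). apply Rmult_le_compat_l. lra. apply Rmin_r. apply Req_le; field; lra. }
    assert (K := sech_sum_int 0 N b Hb).
    assert (E : is_RInt (fun w => cos (0 * ln w) / (1 + w * w)) b 1 (atan 1 - atan b)).
    { apply (RInt_FTC atan). lra.
      - intros x Hx. rewrite Rmult_0_l, cos_0. auto_derive. trivial. unfold Rsqr. field. nra.
      - intros x Hx. apply cont_ex_derive. auto_derive. split. lra. nra. }
    rewrite (is_RInt_unique (V := R_CompleteNormedModule) _ _ _ _ E), atan_1 in K.
    generalize (atan_le b ltac:(lra)). intros Hab.
    replace (PI / 4 - sech_sum 0 N) with ((PI / 4 - atan b - sech_sum 0 N) + atan b) by ring.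
    eapply Rle_trans. apply Rabs_triang. rewrite (Rabs_pos_eq (atan b)) by lra. lra. }
  assert (E1 : cosh (s * (PI / 2)) * sech_sum s N - sech_sum 0 N = RInt (fun x => (cosh (s * x) - 1) * oddcos N x) 0 (PI / 2)).
  { unfold sech_sum at 1. rewrite <- oddcos_cosh_int.
    replace (sech_sum 0 N) with (cosh (0 * (PI / 2)) * sech_sum 0 N) by (rewrite Rmult_0_l, cosh_0; ring).
    unfold sech_sum. rewrite <- oddcos_cosh_int. rewrite <- RInt_minus_R.
    - apply RInt_ext_R. lra. intros x _. rewrite Rmult_0_l, cosh_0. ring.
    - apply ex_RInt_cont. lra. intros x _. apply cont_mult. 2: apply continuous_oddcos. apply cont_ex_derive. auto_derive. trivial.
    - apply ex_RInt_cont. lra. intros x _. apply cont_mult. 2: apply continuous_oddcos. apply cont_ex_derive. auto_derive. trivial. }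
  replace (cosh (s * (PI / 2)) * sech_sum s N - PI / 4) with ((cosh (s * (PI / 2)) * sech_sum s N - sech_sum 0 N) - (PI / 4 - sech_sum 0 N)) by ring.
  unfold Rminus at 1. eapply Rle_trans. apply Rabs_triang. rewrite Rabs_Ropp, E1.
  apply Rle_trans with (C / INR (N + 1) + / INR (N + 1)). 2: apply Req_le; field; lra.
  apply Rplus_le_compat. apply HC. apply Rle_trans with (1 := E0). apply Rinv_le_contravar; trivial. apply le_INR. lia.
Qed.

Lemma half_beta_one s a : 0 < a < 1 ->
  Rabs (RInt (fun w => cos (s * ln w) / (1 + w * w)) a 1 - PI / (4 * cosh (s * (PI / 2)))) <= a.
Proof.
  intros Ha. destruct (sech_sum_lim s) as (C & HC).
  assert (Hch := cosh_ge_1 (s * (PI / 2))). set (ch := cosh (s * (PI / 2))) in *.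
  apply (le_of_le_inv_n _ _ (1 + Rabs C)). intros N.
  assert (HN : 0 < INR (N + 1)) by (apply lt_0_INR; lia).
  apply le_epsilon. intros eps He.
  (* The cut-off b is chosen after N, since the error 2 (N + 1) b of the termwise integration grows
     with N. *)
  set (b := Rmin (a / 2) (eps / (2 * INR (N + 1)))).
  assert (Hb : 0 < b < a). { split. apply Rmin_pos. lra. apply Rdiv_lt_0_compat; lra. apply Rle_lt_trans with (1 := Rmin_l _ _). lra. }
  assert (Hb2 : 2 * INR (N + 1) * b <= eps).
  { apply Rle_trans with (2 * INR (N + 1) * (eps / (2 * INR (N + 1)))). apply Rmult_le_compat_l. lra. apply Rmin_r. apply Req_le; field; lra. }
  assert (K := sech_sum_int s N b ltac:(lra)).
  set (f := fun w => cos (s * ln w) / (1 + w * w)) in *.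
  assert (X : forall x y, 0 < x -> x <= y -> ex_RInt f x y).
  { intros x y Hx Hy. apply ex_RInt_cont. lra. intros w Hw. apply cont_ex_derive. unfold f. auto_derive. split. lra. nra. }
  assert (B1 : Rabs (RInt f b a) <= (a - b) * 1).
  { apply (norm_RInt_le_const (V := R_NormedModule) f b a). lra.
    - intros x Hx. unfold norm; simpl; unfold abs; simpl. unfold f, Rdiv. rewrite Rabs_mult.
      assert (Q : 0 < / (1 + x * x) <= 1). { split. apply Rinv_0_lt_compat; nra. rewrite <- Rinv_1. apply Rinv_le_contravar; nra. }
      rewrite (Rabs_pos_eq (/ _)) by lra. generalize (Rabs_cos_le (s * ln x)) (Rabs_pos (cos (s * ln x))). nra.
    - apply (RInt_correct (V := R_CompleteNormedModule)). apply X; lra. }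
  rewrite <- (RInt_Chasles_R f b a 1) in K by (apply X; lra).
  specialize (HC N).
  assert (B2 : Rabs (sech_sum s N - PI / (4 * ch)) <= Rabs C / INR (N + 1)).
  { replace (sech_sum s N - PI / (4 * ch)) with (/ ch * (ch * sech_sum s N - PI / 4)) by (field; lra).
    rewrite Rabs_mult, (Rabs_pos_eq (/ ch)) by (left; apply Rinv_0_lt_compat; lra).
    assert (/ ch <= 1) by (rewrite <- Rinv_1; apply Rinv_le_contravar; lra).
    assert (0 < / ch) by (apply Rinv_0_lt_compat; lra).
    apply Rle_trans with (1 * Rabs (ch * sech_sum s N - PI / 4)). apply Rmult_le_compat_r; trivial. apply Rabs_pos.
    rewrite Rmult_1_l. apply Rle_trans with (1 := HC). apply Rmult_le_compat_r. left; now apply Rinv_0_lt_compat. apply Rle_abs. }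
  assert (B3 : / INR (2 * N + 3) <= / INR (N + 1)) by (apply Rinv_le_contravar; trivial; apply le_INR; lia).
  replace (RInt f a 1 - PI / (4 * ch)) with ((RInt f b a + RInt f a 1 - sech_sum s N) + (sech_sum s N - PI / (4 * ch)) - RInt f b a) by ring.
  unfold Rminus at 1. eapply Rle_trans. apply Rabs_triang. rewrite Rabs_Ropp.
  eapply Rle_trans. apply Rplus_le_compat_r. apply Rabs_triang.
  unfold Rdiv in *. rewrite Rmult_plus_distr_r, Rmult_1_l. lra.
Qed.

Lemma small_ends d M e : 0 < d -> 0 < M -> 0 < e -> exists c, (0 < c < d /\ c < 1 /\ c < e) /\ M < / c.
Proof.
  intros Hd HM He. assert (HM' : 0 < / M) by now apply Rinv_0_lt_compat.
  exists (Rmin (Rmin d (/ M)) (Rmin 1 e) / 2). set (c := Rmin (Rmin d (/ M)) (Rmin 1 e) / 2).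
  assert (0 < Rmin (Rmin d (/ M)) (Rmin 1 e)) by (repeat apply Rmin_pos; lra).
  generalize (Rmin_l (Rmin d (/ M)) (Rmin 1 e)) (Rmin_r (Rmin d (/ M)) (Rmin 1 e)) (Rmin_l d (/ M)) (Rmin_r d (/ M)) (Rmin_l 1 e) (Rmin_r 1 e).
  intros. assert (Hc : 0 < c /\ c < d /\ c < / M /\ c < 1 /\ c < e) by (unfold c; lra).
  split. lra. rewrite <- (Rinv_inv M). apply Rinv_lt_contravar; [|lra]. apply Rmult_lt_0_compat; lra.
Qed.

(** The substitution w -> 1/w preserves dw / (1 + w^2) and reverses ln w: it doubles the cosine
    integral over (0, 1) and cancels the sine integral. Truncations are therefore taken symmetric,
    from c to 1/c. *)
Lemma beta_one_eq s : beta_int 1 s (RtoC (PI / (2 * cosh (s * (PI / 2))))).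
Proof.
  destruct (beta_ex 1 s (Rle_refl 1)) as (z & Hz).
  replace (RtoC (PI / (2 * cosh (s * (PI / 2))))) with z; trivial.
  destruct Hz as (H1 & H2).
  assert (E1 : has_int (fun w => cos (s * ln w) / (1 + w * w)) (fst z)).
  { apply has_int_ext with (2 := H1). intros x Hx. rewrite Rpower_Ropp, Rpower_1 by nra. field. nra. }
  assert (E2 : has_int (fun w => sin (s * ln w) / (1 + w * w)) (snd z)).
  { apply has_int_ext with (2 := H2). intros x Hx. rewrite Rpower_Ropp, Rpower_1 by nra. field. nra. }
  assert (Inv : forall h : R -> R, (forall x, continuous h x) -> forall a, 0 < a < 1 ->
     RInt (fun w => h (ln w) / (1 + w * w)) 1 (/ a) = RInt (fun w => h (- ln w) / (1 + w * w)) a 1).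
  { intros h Hh a Ha.
    assert (K := RInt_comp (V := R_CompleteNormedModule) (fun w => h (ln w) / (1 + w * w)) Rinv (fun x => - / (x * x)) a 1).
    rewrite Rinv_1 in K.
    assert (Hc : forall x, 0 < x -> continuous (fun w => h (ln w) / (1 + w * w)) x).
    { intros x Hx. apply cont_mult. apply (continuous_comp ln h). now apply continuous_ln. apply Hh. apply cont_ex_derive. auto_derive. nra. }
    rewrite <- (opp_RInt_swap (V := R_CompleteNormedModule) _ (/ a) 1).
    2: { apply (ex_RInt_continuous (V := R_CompleteNormedModule)). intros x Hx. apply Hc. apply Rlt_le_trans with (2 := proj1 Hx).
         apply Rmin_pos; [apply Rinv_0_lt_compat|]; lra. }
    rewrite <- K.
    - transitivity (RInt (fun y => -1 * (- / (y * y) * (h (ln (/ y)) / (1 + / y * / y)))) a 1).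
      + rewrite (RInt_scal_R (fun y => - / (y * y) * (h (ln (/ y)) / (1 + / y * / y))) a 1 (-1)).
        unfold opp; simpl. unfold scal; simpl; unfold mult; simpl. ring.
        apply ex_RInt_cont. lra. intros x Hx. apply cont_mult. apply cont_ex_derive. auto_derive. nra.
        apply (continuous_comp Rinv (fun w => h (ln w) / (1 + w * w))). apply cont_ex_derive. auto_derive. lra. apply Hc. apply Rinv_0_lt_compat; lra.
      + apply RInt_ext_R. lra. intros x Hx. rewrite ln_Rinv by lra. field. split; nra.
    - intros x. rewrite Rmin_left, Rmax_right by lra. intros Hx. apply Hc. apply Rinv_0_lt_compat; lra.
    - intros x. rewrite Rmin_left, Rmax_right by lra. intros Hx. split. auto_derive. lra. field. lra.
      apply cont_ex_derive. auto_derive. nra. }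
  assert (Xf : forall h : R -> R, (forall x, continuous h x) -> forall x y, 0 < x -> x <= y -> ex_RInt (fun w => h (ln w) / (1 + w * w)) x y).
  { intros h Hh x y Hx Hy. apply ex_RInt_cont. lra. intros w Hw. apply cont_mult. apply (continuous_comp ln h). apply continuous_ln; lra. apply Hh. apply cont_ex_derive. auto_derive. nra. }
  assert (Cc : forall x, continuous (fun t => cos (s * t)) x) by (intros; apply cont_ex_derive; auto_derive; trivial).
  assert (Cs : forall x, continuous (fun t => sin (s * t)) x) by (intros; apply cont_ex_derive; auto_derive; trivial).
  rewrite (surjective_pairing z). unfold RtoC. f_equal.
  - apply cond_eq. intros eps He.
    destruct (has_int_elim _ _ E1 (eps / 2)) as (d & M & Hd & HM & K); [lra|].
    destruct (small_ends d M (eps / 4) Hd HM) as (c & Hc & HcM); [lra|].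
    specialize (K c (/ c) ltac:(lra) HcM).
    assert (H1c : 1 < / c) by (rewrite <- Rinv_1; apply Rinv_lt_contravar; lra).
    rewrite <- (RInt_Chasles_R _ c 1 (/ c)) in K by (apply (Xf _ Cc); lra).
    rewrite (Inv _ Cc c ltac:(lra)) in K.
    rewrite (RInt_ext_R (fun w => cos (s * - ln w) / (1 + w * w)) (fun w => cos (s * ln w) / (1 + w * w)) c 1) in K by
      (try lra; intros x Hx; now rewrite <- Ropp_mult_distr_r, cos_neg).
    generalize (half_beta_one s c ltac:(lra)). intros L.
    replace (PI / (2 * cosh (s * (PI / 2)))) with (2 * (PI / (4 * cosh (s * (PI / 2))))).
    2: { field. generalize (cosh_ge_1 (s * (PI / 2))); lra. }
    set (i := RInt (fun w => cos (s * ln w) / (1 + w * w)) c 1) in *. set (p := PI / (4 * cosh (s * (PI / 2)))) in *.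
    replace (fst z - 2 * p) with (- (i + i - fst z) + 2 * (i - p)) by ring.
    eapply Rle_lt_trans. apply Rabs_triang. rewrite Rabs_Ropp, Rabs_mult, (Rabs_pos_eq 2) by lra. lra.
  - apply cond_eq. intros eps He.
    destruct (has_int_elim _ _ E2 eps He) as (d & M & Hd & HM & K).
    destruct (small_ends d M (eps / 4) Hd HM) as (c & Hc & HcM); [lra|].
    specialize (K c (/ c) ltac:(lra) HcM).
    assert (H1c : 1 < / c) by (rewrite <- Rinv_1; apply Rinv_lt_contravar; lra).
    rewrite <- (RInt_Chasles_R _ c 1 (/ c)) in K by (apply (Xf _ Cs); lra).
    rewrite (Inv _ Cs c ltac:(lra)) in K.
    rewrite (RInt_ext_R (fun w => sin (s * - ln w) / (1 + w * w)) (fun w => -1 * (sin (s * ln w) / (1 + w * w))) c 1) in K by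
      (try lra; intros x Hx; rewrite <- Ropp_mult_distr_r, sin_neg; field; nra).
    rewrite (RInt_scal_R (fun w => sin (s * ln w) / (1 + w * w))) in K by (apply (Xf _ Cs); lra).
    set (i := RInt (fun w => sin (s * ln w) / (1 + w * w)) c 1) in *.
    replace (snd z - 0) with (- (i + -1 * i - snd z)) by ring. now rewrite Rabs_Ropp.
Qed.

(** * A product of Gamma values *)

(** The product of z with the factors 1 + i r_j for j < k: the common shape of both recurrences once
    their real factors have been split off. *)
Fixpoint prodC (r : nat -> R) (z : C) (k : nat) : C :=
  match k with O => z | S j => Cmult (1, r j) (prodC r z j) end.

Lemma Cmod_one_plus_ge r : 1 <= Cmod (1, r).
Proof. apply Rle_trans with (2 := Rabs_fst_le_Cmod (1, r)). simpl. rewrite Rabs_R1. lra. Qed.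

(** Every factor 1 + i r_j has modulus at least 1, so such a product never shrinks. This bounds
    denominators from below uniformly in k. *)
Lemma Cmod_prodC_ge r z k : Cmod z <= Cmod (prodC r z k).
Proof.
  induction k as [|k IH]; simpl. lra. rewrite Cmod_mult. generalize (Cmod_one_plus_ge (r k)) (Cmod_ge_0 (prodC r z k)). nra.
Qed.

Lemma Cmod_unit t : Cmod (cos t, sin t) = 1.
Proof.
  unfold Cmod; simpl. transitivity (sqrt 1); [|apply sqrt_1]. f_equal. generalize (sin2_cos2 t). unfold Rsqr. lra.
Qed.

Lemma cis_add a b : Cmult (cos a, sin a) (cos b, sin b) = (cos (a + b), sin (a + b)).
Proof. unfold Cmult; simpl. rewrite cos_plus, sin_plus. f_equal; ring. Qed.

Lemma gam_prod s z k : gam 0 s z ->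
  gam k s (Cmult (RtoC (INR (fact k))) (prodC (fun j => s / INR (S j)) z k)).
Proof.
  intros H. induction k as [|k IH].
  - simpl. now rewrite Cmult_1_l.
  - apply gam_rec in IH. cbn [prodC].
    replace (Cmult (RtoC (INR (fact (S k)))) _) with (Cmult (INR (S k), s) (Cmult (RtoC (INR (fact k))) (prodC (fun j => s / INR (S j)) z k))); trivial.
    change (fact (S k)) with ((S k) * fact k)%nat. rewrite mult_INR.
    assert (0 < INR (S k)) by (apply lt_0_INR; lia).
    replace ((INR (S k), s) : C) with (Cmult (RtoC (INR (S k))) (1, s / INR (S k))).
    rewrite RtoC_mult. ring.
    unfold Cmult, RtoC; cbn [fst snd]. f_equal; field; lra.
Qed.

Lemma gam_prod_asymp s z k : (1 <= k)%nat -> gam 0 s z ->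
  Cmod (Cminus (prodC (fun j => s / INR (S j)) z k) (cos (s * ln (INR k)), sin (s * ln (INR k)))) <= 2 * Rabs s / sqrt (INR k).
Proof.
  intros Hk H. assert (K := gam_asymp k s _ Hk (gam_prod s z k H)).
  assert (INR (fact k) <> 0) by apply INR_fact_neq_0.
  assert (RtoC (INR (fact k)) <> 0%C). { intros E. apply H0. now injection E. }
  replace (Cdiv (Cmult (RtoC (INR (fact k))) (prodC (fun j => s / INR (S j)) z k)) (RtoC (INR (fact k)))) with (prodC (fun j => s / INR (S j)) z k) in K.
  exact K. field. exact H1.
Qed.

Lemma prodC_zero r k : prodC r 0%C k = 0%C.
Proof. induction k; simpl; trivial. rewrite IHk. ring. Qed.

Lemma sqrt_INR_large e : 0 < e -> exists K, forall k, (K <= k)%nat -> (1 <= k)%nat /\ / sqrt (INR k) < e.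
Proof.
  intros He. destruct (nfloor_ex (/ (e * e))) as (N & HN1 & HN2).
  { left. apply Rinv_0_lt_compat. nra. }
  exists (N + 1)%nat. intros k Hk. split. lia.
  apply le_INR in Hk. rewrite plus_INR in Hk. simpl (INR 1) in Hk.
  assert (H : / (e * e) < INR k) by lra.
  rewrite <- (Rinv_inv e). apply Rinv_lt_contravar.
  - apply Rmult_lt_0_compat. now apply Rinv_0_lt_compat. apply sqrt_lt_R0. apply Rlt_trans with (2 := H). apply Rinv_0_lt_compat. nra.
  - rewrite <- (sqrt_square (/ e)) by (left; now apply Rinv_0_lt_compat). apply sqrt_lt_1_alt. rewrite <- Rinv_mult.
    split; trivial. left. apply Rinv_0_lt_compat. nra.
Qed.

(** If Gamma(1 + i s) were 0, all normalised values Gamma(k + 1 + i s) / k! would be 0, although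
    they come arbitrarily close to numbers of modulus 1. *)
Lemma gam_neq_0 s z : gam 0 s z -> z <> 0%C.
Proof.
  intros H E. destruct (sqrt_INR_large (/ (4 * Rabs s + 1))) as (K & HK).
  { apply Rinv_0_lt_compat. generalize (Rabs_pos s); lra. }
  destruct (HK K (le_n _)) as (H1 & H2).
  assert (A := gam_prod_asymp s z K H1 H). rewrite E, prodC_zero in A.
  replace (Cminus 0%C (cos (s * ln (INR K)), sin (s * ln (INR K)))) with (Copp (cos (s * ln (INR K)), sin (s * ln (INR K)))) in A by ring.
  rewrite Cmod_opp, Cmod_unit in A. unfold Rdiv in A.
  assert (P := Rabs_pos s).
  assert (2 * Rabs s * / sqrt (INR K) <= 2 * Rabs s * / (4 * Rabs s + 1)) by (apply Rmult_le_compat_l; lra).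
  assert (2 * Rabs s * / (4 * Rabs s + 1) < 1). { apply Rlt_div_l; lra. }
  lra.
Qed.

(** Dividing by the value [bk] of the same integral at s = 0 removes the real factors of the
    recurrence and leaves a pure product of terms 1 + i r_j. *)
Lemma beta_prod s z b q k : 1 <= q -> b <> 0 -> beta_int q 0 (RtoC b) -> beta_int q s (Cmult (RtoC b) z) ->
  exists bk, bk <> 0 /\ beta_int (q + INR k) 0 (RtoC bk) /\
   beta_int (q + INR k) s (Cmult (RtoC bk) (prodC (fun j => - s / (2 * (q + INR j) - 1)) z k)).
Proof.
  intros Hq Hb H0 Hs. induction k as [|k (bk & N & IH1 & IH2)].
  - exists b. simpl. rewrite Rplus_0_r. repeat split; trivial; try apply H0; try apply Hs.
  - assert (Hk := pos_INR k). set (p := q + INR k) in *.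
    apply beta_rec in IH1; [|unfold p; lra]. apply beta_rec in IH2; [|unfold p; lra].
    rewrite S_INR. replace (q + (INR k + 1)) with (p + 1) by (unfold p; ring).
    assert (Hp : 1 <= p) by (unfold p; lra).
    exists (/ (2 * p) * (2 * p - 1) * bk). split; [|split].
    + apply Rmult_integral_contrapositive_currified; trivial. apply Rmult_integral_contrapositive_currified; [apply Rinv_neq_0_compat|]; lra.
    + replace (RtoC (/ (2 * p) * (2 * p - 1) * bk)) with (Cmult (RtoC (/ (2 * p))) (Cmult (2 * p - 1, - 0) (RtoC bk))); trivial.
      unfold Cmult, RtoC; cbn [fst snd]. f_equal; ring.
    + cbn [prodC]. fold p.
      match goal with |- beta_int _ _ ?x => match type of IH2 with beta_int _ _ ?y => replace x with y; trivial end end.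
      replace ((2 * p - 1, - s) : C) with (Cmult (RtoC (2 * p - 1)) (1, - s / (2 * p - 1))).
      2: { unfold Cmult, RtoC; cbn [fst snd]. f_equal; field; lra. }
      rewrite !RtoC_mult. ring.
Qed.

(** Write the two sides, up to the unit factor [E], as the first terms [U 0] and [V 0] of two
    sequences. One step of the recurrences multiplies [U] and [V] by the same factor, so their ratio
    is constant; the asymptotics make [E U k - V k] tend to 0 while |V k| stays bounded below. Hence
    the two sides agree already at k = 0. *)
Lemma gam_beta_const tau z1 z2 b : gam 0 tau z1 -> gam 0 (2 * tau) z2 -> beta_int (3 / 2) (- (2 * tau)) b ->
  Cmult (Cmult (cos (- (2 * tau * ln 2)), sin (- (2 * tau * ln 2))) z2) b = Cmult (RtoC (/ cosh (PI * tau))) (Cmult z1 z1).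
Proof.
  intros H1 H2 Hb.
  set (E := (cos (- (2 * tau * ln 2)), sin (- (2 * tau * ln 2))) : C).
  assert (HPI := PI_RGT_0).
  assert (Hch := cosh_ge_1 (PI * tau)).
  set (c1 := RtoC (/ cosh (PI * tau))).
  assert (B1 : beta_int 1 (- (2 * tau)) (Cmult (RtoC (PI / 2)) c1)).
  { unfold c1. rewrite <- RtoC_mult. replace (PI / 2 * / cosh (PI * tau)) with (PI / (2 * cosh (- (2 * tau) * (PI / 2)))). apply beta_one_eq.
    replace (- (2 * tau) * (PI / 2)) with (- (PI * tau)) by field. replace (cosh (- (PI * tau))) with (cosh (PI * tau)).
    field. lra. unfold cosh. rewrite Ropp_involutive. field. }
  assert (Hc1 : c1 <> 0%C). { intros X. injection X. apply Rinv_neq_0_compat. lra. }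
  assert (B3 : beta_int (3 / 2) (- (2 * tau)) (Cmult (RtoC 1) b)) by now rewrite Cmult_1_l.
  set (g1 := prodC (fun j => tau / INR (S j)) z1).
  set (g2 := prodC (fun j => 2 * tau / INR (S j)) z2).
  set (d1 := prodC (fun j => - (- (2 * tau)) / (2 * (1 + INR j) - 1)) c1).
  set (d3 := prodC (fun j => - (- (2 * tau)) / (2 * (3 / 2 + INR j) - 1)) b).
  set (U := fun k => Cmult (g2 (2 * k)%nat) (d3 k)). set (V := fun k => Cmult (Cmult (g1 k) (g1 k)) (d1 k)).
  assert (UV : forall k, Cmult (U k) (V 0%nat) = Cmult (V k) (U 0%nat)).
  { induction k as [|k IH]. unfold U, V. simpl Nat.mul. ring.
    assert (Hk := pos_INR k).
    (* One step in k is two steps for Gamma(1 + 2 i tau), with factors 1 + 2i tau/(2k+1) and 1 + i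
       tau/(k+1). The first equals the factor of b_(1+k), and the second, like the factor of
       b_(3/2+k), is the one of Gamma(1 + i tau). *)
    set (F := Cmult (1, 2 * tau / INR (S (2 * k))) (Cmult (1, tau / INR (S k)) (1, tau / INR (S k)))).
    assert (EU : U (S k) = Cmult F (U k)).
    { unfold U. replace (2 * S k)%nat with (S (S (2 * k))) by lia. unfold g2, d3, F. cbn [prodC].
      replace (2 * tau / INR (S (S (2 * k)))) with (tau / INR (S k)).
      replace (- - (2 * tau) / (2 * (3 / 2 + INR k) - 1)) with (tau / INR (S k)). ring.
      rewrite S_INR. field; repeat split; lra. rewrite !S_INR, mult_INR. simpl (INR 2). field; repeat split; lra. }
    assert (EV : V (S k) = Cmult F (V k)).
    { unfold V, g1, d1, F. cbn [prodC].
      replace (- - (2 * tau) / (2 * (1 + INR k) - 1)) with (2 * tau / INR (S (2 * k))). ring.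
      rewrite S_INR, mult_INR. simpl (INR 2). field; repeat split; lra. }
    rewrite EU, EV, <- Cmult_assoc, IH. ring. }
  assert (HV0 : 0 < Cmod (V 0%nat)).
  { apply Cmod_gt_0. unfold V. simpl. apply Cmult_neq_0; trivial. apply Cmult_neq_0; apply gam_neq_0 with tau; trivial. }
  assert (HVk : forall k, Cmod (V 0%nat) <= Cmod (V k)).
  { intros k. unfold V. rewrite !Cmod_mult.
    assert (A1 := Cmod_prodC_ge (fun j => tau / INR (S j)) z1 k). fold (g1 k) in A1. change (g1 0%nat) with z1.
    assert (A2 := Cmod_prodC_ge (fun j => - (- (2 * tau)) / (2 * (1 + INR j) - 1)) c1 k). fold (d1 k) in A2. change (d1 0%nat) with c1.
    generalize (Cmod_ge_0 z1) (Cmod_ge_0 c1). intros. apply Rmult_le_compat; trivial. nra. apply Rmult_le_compat; trivial. }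
  (* [d1 k] and [d3 k] are b_(1+k) and b_(3/2+k) divided by their values without oscillation. The
     half-step comparison makes them approach each other at rate 1/k. *)
  assert (D13 : forall k, Cmod (d3 k) <= 2 /\ Cmod (d1 k) <= 2 /\ Cmod (Cminus (d1 k) (d3 k)) <= 4 / INR (S k)).
  { intros k. assert (Hk := pos_INR k).
    destruct (beta_prod _ c1 (PI / 2) 1 (S k) ltac:(lra) ltac:(lra) beta_one B1) as (y1 & Y1 & Y2 & _).
    destruct (beta_prod _ c1 (PI / 2) 1 k ltac:(lra) ltac:(lra) beta_one B1) as (x1 & X1 & X2 & X3).
    destruct (beta_prod _ b 1 (3 / 2) k ltac:(lra) ltac:(lra) beta_three_halves B3) as (x3 & Z1 & Z2 & Z3).
    fold d1 in X3. fold d3 in Z3. fold (d1 k) in X3. fold (d3 k) in Z3.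
    assert (Ey : y1 = / (2 * (1 + INR k)) * (2 * (1 + INR k) - 1) * x1).
    { assert (W := beta_rec (1 + INR k) 0 _ ltac:(lra) X2). replace (1 + INR (S k)) with (1 + INR k + 1) in Y2 by (rewrite S_INR; ring).
      destruct W as (W & _). destruct Y2 as (Y2 & _). assert (Q := has_int_unique _ _ _ Y2 W). simpl in Q. rewrite Q. ring. }
    assert (P1 : forall q z, 1 <= q -> beta_int q 0 z -> 0 <= fst z).
    { intros q z Hq Hz. apply beta_real in Hz. destruct Hz as (Hz & _).
      apply Rle_trans with (Rabs (fst z)). apply Rabs_pos.
      apply (has_int_le_abs _ _ _ _) with (3 := fun x Hx => Req_le _ _ (Rabs_pos_eq _ (Rlt_le _ _ (Rpower_pos (1 + x * x) (- q))))) (4 := Hz) (5 := Hz);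
      intros x Hx; apply cont_ex_derive; unfold Rpower; auto_derive; nra. }
    assert (Px1 := P1 (1 + INR k) _ ltac:(lra) X2). assert (Px3 := P1 (3 / 2 + INR k) _ ltac:(lra) Z2). simpl in Px1, Px3.
    assert (Bd1 := beta_le _ _ _ _ X3 X2). assert (Bd3 := beta_le _ _ _ _ Z3 Z2).
    rewrite Cmod_mult, Cmod_R, Rabs_pos_eq in Bd1, Bd3 by lra. simpl in Bd1, Bd3.
    assert (Bd1' : Cmod (d1 k) <= 2) by nra. assert (Bd3' : Cmod (d3 k) <= 2) by nra.
    split; trivial. split; trivial.
    replace (3 / 2 + INR k) with (1 + INR k + 1 / 2) in Z2, Z3 by field.
    replace (1 + INR (S k)) with (1 + INR k + 1) in Y2 by (rewrite S_INR; ring).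
    assert (Df := beta_diff _ _ _ _ _ _ X3 Z3 X2 Y2).
    assert (X2r := proj1 (beta_real _ _ X2)). assert (Y2r := proj1 (beta_real _ _ Y2)). assert (Z2r := proj1 (beta_real _ _ Z2)).
    assert (Ec : forall q, cont_pos (fun w => Rpower (1 + w * w) (- q) * 1)).
    { intros q x Hx. apply cont_ex_derive. unfold Rpower; auto_derive; nra. }
    assert (Em1 : forall q l, has_int (fun w => Rpower (1 + w * w) (- q)) l -> has_int (fun w => Rpower (1 + w * w) (- q) * 1) l).
    { intros q l. apply has_int_ext. intros; ring. }
    assert (Df2 : Rabs (x1 - x3) <= x1 - y1).
    { apply (beta_diff_aux (1 + INR k) (fun _ => 1)); trivial. intros x _; apply continuous_const. intros; rewrite Rabs_R1; lra.
      now apply Em1. now apply Em1. }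
    simpl in Df.
    assert (Exy : x1 - y1 = x1 / (2 * (1 + INR k))). { rewrite Ey. field. lra. }
    rewrite Exy in Df, Df2. rewrite S_INR.
    assert (Hx : x1 * Cmod (Cminus (d1 k) (d3 k)) <= 4 * (x1 / (2 * (1 + INR k)))).
    { replace (x1 * Cmod (Cminus (d1 k) (d3 k))) with (Cmod (Cmult (RtoC x1) (Cminus (d1 k) (d3 k)))).
      2: { rewrite Cmod_mult, Cmod_R, Rabs_pos_eq; lra. }
      replace (Cmult (RtoC x1) (Cminus (d1 k) (d3 k))) with (Cplus (Cminus (Cmult (RtoC x1) (d1 k)) (Cmult (RtoC x3) (d3 k))) (Cmult (RtoC (x3 - x1)) (d3 k))).
      2: { rewrite RtoC_minus. ring. }
      eapply Rle_trans. apply Cmod_triangle. rewrite Cmod_mult, Cmod_R, (Rabs_minus_sym x3 x1).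
      generalize (Cmod_ge_0 (d3 k)) (Rabs_pos (x1 - x3)). nra. }
    assert (Px1' : 0 < x1) by lra.
    apply le_div. lra.
    apply Rmult_le_reg_l with x1; trivial.
    apply (Rmult_le_compat_r (INR k + 1)) in Hx; [|lra].
    replace (4 * (x1 / (2 * (1 + INR k))) * (INR k + 1)) with (2 * x1) in Hx by (field; lra). lra. }
  assert (Hlim : forall e, 0 < e -> exists k, Cmod (Cminus (Cmult E (U k)) (V k)) < e).
  { intros e He.
    set (A := 2 * Rabs tau). assert (HA : 0 <= A) by (unfold A; generalize (Rabs_pos tau); lra).
    set (Kst := 2 * (2 * A) + 2 * (A * (2 + A)) + 4).
    assert (HK : 0 < Kst) by (unfold Kst; nra).
    destruct (sqrt_INR_large (e / Kst)) as (k & Hk). now apply Rdiv_lt_0_compat.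
    exists k. destruct (Hk k (le_n _)) as (Hk1 & Hk2).
    assert (Hk0 : 1 <= INR k) by (apply (le_INR 1); trivial).
    assert (Hsq : 1 <= sqrt (INR k)) by (rewrite <- sqrt_1; apply sqrt_le_1_alt; lra).
    set (r := / sqrt (INR k)) in *.
    assert (Hr : 0 < r <= 1). { split. apply Rinv_0_lt_compat; lra. unfold r. rewrite <- Rinv_1. apply Rinv_le_contravar; lra. }
    assert (G1 := gam_prod_asymp tau z1 k Hk1 H1). fold (g1 k) in G1.
    assert (G2 := gam_prod_asymp (2 * tau) z2 (2 * k) ltac:(lia) H2). fold (g2 (2 * k)%nat) in G2.
    set (e1 := (cos (tau * ln (INR k)), sin (tau * ln (INR k))) : C) in *.
    set (e2 := (cos (2 * tau * ln (INR (2 * k))), sin (2 * tau * ln (INR (2 * k)))) : C) in *.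
    (* The factor [E] = 2^(-2i tau) compensates the doubled index: 2^(-2i tau) (2k)^(2i tau) = (k^(i
       tau))^2. *)
    assert (Ee : Cmult E e2 = Cmult e1 e1).
    { unfold E, e1, e2. rewrite !cis_add. rewrite mult_INR. simpl (INR 2). rewrite ln_mult by lra.
      replace (1 + 1) with 2 by ring. f_equal; f_equal; ring. }
    assert (G1' : Cmod (Cminus (g1 k) e1) <= A * r) by (unfold A, r; unfold Rdiv in G1; exact G1).
    assert (G2' : Cmod (Cminus (g2 (2 * k)%nat) e2) <= 2 * A * r).
    { apply Rle_trans with (1 := G2). rewrite Rabs_mult, (Rabs_pos_eq 2) by lra. unfold A, r. unfold Rdiv.
      apply Rmult_le_compat_l. generalize (Rabs_pos tau); lra.
      apply Rinv_le_contravar. lra. apply sqrt_le_1_alt. rewrite mult_INR. simpl (INR 2). lra. }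
    assert (He1 : Cmod e1 = 1) by apply Cmod_unit. assert (HE : Cmod E = 1) by apply Cmod_unit.
    assert (Hg1 : Cmod (g1 k) <= 1 + A).
    { replace (g1 k) with (Cplus e1 (Cminus (g1 k) e1)) by ring. eapply Rle_trans. apply Cmod_triangle. nra. }
    destruct (D13 k) as (D3 & D1 & D).
    assert (Dr : Cmod (Cminus (d1 k) (d3 k)) <= 4 * r).
    { apply Rle_trans with (1 := D). unfold Rdiv. apply Rmult_le_compat_l. lra. unfold r. apply Rinv_le_contravar. lra.
      rewrite S_INR. assert (sqrt (INR k) * sqrt (INR k) = INR k) by (apply sqrt_sqrt; lra). nra. }
    replace (Cminus (Cmult E (U k)) (V k)) with
      (Cminus (Cminus (Cmult (Cmult E (Cminus (g2 (2 * k)%nat) e2)) (d3 k))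
        (Cmult (Cmult (Cminus (g1 k) e1) (Cplus (g1 k) e1)) (d1 k))) (Cmult (Cmult e1 e1) (Cminus (d1 k) (d3 k)))).
    2: { unfold U, V. transitivity (Cplus (Cminus (Cmult (Cmult E (g2 (2 * k)%nat)) (d3 k)) (Cmult (Cmult (g1 k) (g1 k)) (d1 k))) (Cmult (Cminus (Cmult e1 e1) (Cmult E e2)) (d3 k))).
         ring. rewrite Ee. ring. }
    assert (T1 : Cmod (Cmult (Cmult E (Cminus (g2 (2 * k)%nat) e2)) (d3 k)) <= 2 * (2 * A) * r).
    { rewrite !Cmod_mult, HE. generalize (Cmod_ge_0 (Cminus (g2 (2 * k)%nat) e2)) (Cmod_ge_0 (d3 k)). intros Q1 Q2.
      apply Rle_trans with (1 * (2 * A * r) * 2). 2: apply Req_le; ring. apply Rmult_le_compat; lra. }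
    assert (T2 : Cmod (Cmult (Cmult (Cminus (g1 k) e1) (Cplus (g1 k) e1)) (d1 k)) <= 2 * (A * (2 + A)) * r).
    { rewrite !Cmod_mult. generalize (Cmod_ge_0 (Cminus (g1 k) e1)) (Cmod_ge_0 (d1 k)) (Cmod_ge_0 (Cplus (g1 k) e1)). intros Q1 Q2 Q3.
      assert (Q4 : Cmod (Cplus (g1 k) e1) <= 2 + A). { eapply Rle_trans. apply Cmod_triangle. lra. }
      apply Rle_trans with ((A * r) * (2 + A) * 2). 2: apply Req_le; ring. apply Rmult_le_compat; trivial. apply Rmult_le_pos; trivial. apply Rmult_le_compat; trivial. }
    assert (T3 : Cmod (Cmult (Cmult e1 e1) (Cminus (d1 k) (d3 k))) <= 4 * r) by (rewrite !Cmod_mult, He1; lra).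
    apply Rle_lt_trans with (Kst * r).
    - unfold Cminus at 1 2. eapply Rle_trans. apply Cmod_triangle. rewrite Cmod_opp.
      eapply Rle_trans. apply Rplus_le_compat_r. apply Cmod_triangle. rewrite Cmod_opp. unfold Kst. lra.
    - apply (Rmult_lt_compat_l Kst) in Hk2; trivial. replace (Kst * (e / Kst)) with e in Hk2 by (field; lra). exact Hk2. }
  assert (Fin : Cmult E (U 0%nat) = V 0%nat).
  { destruct (Req_dec (Cmod (Cminus (Cmult E (U 0%nat)) (V 0%nat))) 0) as [Z|Z].
    - apply Cmod_eq_0 in Z. replace (Cmult E (U 0%nat)) with (Cplus (Cminus (Cmult E (U 0%nat)) (V 0%nat)) (V 0%nat)) by ring. rewrite Z. ring.
    - exfalso. generalize (Cmod_ge_0 (Cminus (Cmult E (U 0%nat)) (V 0%nat))). intros Z'.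
      destruct (Hlim (Cmod (Cminus (Cmult E (U 0%nat)) (V 0%nat)))) as (k & Hk). lra.
      (* By the constancy of the ratio, the defect at k is the defect at 0 scaled by [V k] / [V 0],
         of modulus at least 1; a nonzero defect could not become small. *)
      assert (X : Cmult (Cminus (Cmult E (U k)) (V k)) (V 0%nat) = Cmult (Cminus (Cmult E (U 0%nat)) (V 0%nat)) (V k)).
      { transitivity (Cminus (Cmult E (Cmult (U k) (V 0%nat))) (Cmult (V k) (V 0%nat))). ring. rewrite UV. ring. }
      apply (f_equal Cmod) in X. rewrite 2!Cmod_mult in X. specialize (HVk k).
      generalize (Cmod_ge_0 (Cminus (Cmult E (U k)) (V k))). nra. }
  unfold U, V, g1, g2, d1, d3 in Fin. simpl in Fin. rewrite <- Cmult_assoc, Fin. ring.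
Qed.

(** * The Struve function K_0 *)

Lemma has_int_pow_exp_scale m c : 0 < c -> has_int (fun w => w ^ m * exp (- (c * w))) (INR (fact m) / c ^ S m).
Proof.
  intros Hc.
  assert (Hcm : 0 < c ^ m) by now apply pow_lt.
  assert (H := has_int_scal _ (/ c ^ m) _ (has_int_scale (fun x => x ^ m * exp (- x)) c _ Hc ltac:(cont_by_derive) (has_int_pow_exp m))).
  replace (INR (fact m) / c ^ S m) with (/ c ^ m * (/ c * INR (fact m))) by (simpl; field; lra).
  apply has_int_ext with (2 := H). intros x Hx. cbv beta. rewrite Rpow_mult_distr. field. lra.
Qed.

Lemma exp_taylor1 a : 0 <= exp a - 1 - a <= a * a * exp (Rabs a).
Proof.
  split. generalize (exp_ineq1_le a). lra.
  assert (H1 : exp a - 1 - a <= a * (exp a - 1)).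
  { generalize (exp_ineq1_le (- a)) (exp_pos a). intros H Hp.
    assert (exp a * (1 + - a) <= exp a * exp (- a)) by (apply Rmult_le_compat_l; lra).
    rewrite <- exp_plus, Rplus_opp_r, exp_0 in H0. nra. }
  apply Rle_trans with (1 := H1). destruct (Rle_dec 0 a) as [Ha|Ha].
  - rewrite Rabs_pos_eq by trivial. rewrite Rmult_assoc. apply Rmult_le_compat_l; trivial.
    generalize (exp_ineq1_le (- a)) (exp_pos a). intros H Hp.
    assert (exp a * (1 + - a) <= exp a * exp (- a)) by (apply Rmult_le_compat_l; lra).
    rewrite <- exp_plus, Rplus_opp_r, exp_0 in H0. nra.
  - rewrite Rabs_left by lra.
    assert (1 <= exp (- a)). { rewrite <- exp_0. left. apply exp_increasing. lra. }
    generalize (exp_ineq1_le a). nra.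
Qed.

(** Laplace transform at 2y of w^j phi(w). The substitution w = sinh t makes K_0(2y) equal to 2/pi
    times the case j = 0 with weight (1 + w^2)^(-1/2); raising j corresponds to differentiation in
    y. *)
Definition lap (phi : R -> R) (j : nat) (y : R) : R :=
  RInt_gen (fun w => w ^ j * phi w * exp (- (2 * y * w))) (at_right 0) (Rbar_locally p_infty).

Definition unit_weight (phi : R -> R) : Prop := (forall x, continuous phi x) /\ forall x, 0 <= phi x <= 1.

Lemma lap_correct phi j y : unit_weight phi -> 0 < y -> has_int (fun w => w ^ j * phi w * exp (- (2 * y * w))) (lap phi j y).
Proof.
  intros (Hc & Hb) Hy.
  assert (E : exists l, has_int (fun w => w ^ j * phi w * exp (- (2 * y * w))) l).
  { destruct (gam_dom j (fun x => phi (/ (2 * y) * x))) as (l & Hl).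
    - intros x _. apply (continuous_comp (fun x => / (2 * y) * x) phi). apply cont_scal, continuous_id. apply Hc.
    - intros x _. rewrite Rabs_pos_eq; apply Hb.
    - exists (/ (2 * y) ^ j * (/ (2 * y) * l)).
      assert (Hc2 : cont_pos (fun x => x ^ j * exp (- x) * phi (/ (2 * y) * x))).
      { intros x _. apply cont_mult. apply cont_ex_derive. auto_derive. trivial.
        apply (continuous_comp (fun x => / (2 * y) * x) phi). apply cont_scal, continuous_id. apply Hc. }
      apply has_int_ext with (2 := has_int_scal _ (/ (2 * y) ^ j) _ (has_int_scale _ (2 * y) _ ltac:(lra) Hc2 Hl)).
      intros x Hx. cbv beta. rewrite (Rpow_mult_distr (2 * y) x j). replace (/ (2 * y) * (2 * y * x)) with x by (field; lra).
      assert (0 < (2 * y) ^ j) by (apply pow_lt; lra). field. lra. }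
  destruct E as (l & Hl). unfold lap.
  now rewrite (is_RInt_gen_unique (V := R_CompleteNormedModule) _ _ Hl).
Qed.

Lemma lap_cont phi j y : unit_weight phi -> cont_pos (fun w => w ^ j * phi w * exp (- (2 * y * w))).
Proof.
  intros (Hc & _) x _. apply cont_mult. apply cont_mult. apply cont_ex_derive; auto_derive; trivial. apply Hc.
  apply cont_ex_derive; auto_derive; trivial.
Qed.

Lemma is_derive_quadratic (f : R -> R) x l d C : 0 < d ->
  (forall h, Rabs h < d -> Rabs (f (x + h) - f x - l * h) <= C * (h * h)) -> is_derive f x l.
Proof.
  intros Hd H. apply is_derive_Reals. intros eps He.
  assert (HC : 0 < Rabs C + 1) by (generalize (Rabs_pos C); lra).
  assert (Hd' : 0 < Rmin d (eps / (Rabs C + 1))) by (apply Rmin_pos; trivial; now apply Rdiv_lt_0_compat).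
  exists (mkposreal _ Hd'). intros h Hh Hhd. simpl in Hhd.
  assert (h1 : Rabs h < d) by (apply Rlt_le_trans with (1 := Hhd); apply Rmin_l).
  assert (h2 : Rabs h < eps / (Rabs C + 1)) by (apply Rlt_le_trans with (1 := Hhd); apply Rmin_r).
  specialize (H h h1). assert (Ph := Rabs_pos_lt h Hh).
  replace ((f (x + h) - f x) / h - l) with ((f (x + h) - f x - l * h) / h) by (field; trivial).
  unfold Rdiv. rewrite Rabs_mult, Rabs_inv. apply Rlt_div_l. lra.
  apply Rle_lt_trans with (1 := H). rewrite <- (Rabs_pos_eq (h * h)) by nra. rewrite Rabs_mult.
  rewrite <- Rmult_assoc. apply Rmult_lt_compat_r; trivial.
  apply Rlt_div_r in h2; trivial. generalize (Rle_abs C). nra.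
Qed.

(** Differentiation under the integral through a quadratic remainder. The restriction |h| < y/2
    turns exp(-2yw + 2|h|w) into at most exp(-yw), so the remainder is bounded by the moment of
    order j + 2. *)
Lemma lap_derive phi j y : unit_weight phi -> 0 < y -> is_derive (lap phi j) y (- 2 * lap phi (S j) y).
Proof.
  intros Hphi Hy.
  apply is_derive_quadratic with (d := y / 2) (C := 4 * (INR (fact (S (S j))) / y ^ S (S (S j)))). lra.
  intros h Hh.
  assert (Hyh : 0 < y + h) by (apply Rabs_def2 in Hh; lra).
  assert (A := has_int_plus _ _ _ _ (has_int_minus _ _ _ _ (lap_correct phi j (y + h) Hphi Hyh) (lap_correct phi j y Hphi Hy))
    (has_int_scal _ (2 * h) _ (lap_correct phi (S j) y Hphi Hy))).
  assert (B := has_int_scal _ (4 * (h * h)) _ (has_int_pow_exp_scale (S (S j)) y Hy)).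
  replace (lap phi j (y + h) - lap phi j y - -2 * lap phi (S j) y * h) with (lap phi j (y + h) - lap phi j y + 2 * h * lap phi (S j) y) by ring.
  replace (4 * (INR (fact (S (S j))) / y ^ S (S (S j))) * (h * h)) with (4 * (h * h) * (INR (fact (S (S j))) / y ^ S (S (S j)))) by ring.
  refine (has_int_le_abs _ _ _ _ _ _ _ A B).
  - intros x Hx. apply cont_plus. apply cont_minus; now apply lap_cont. apply cont_scal. now apply lap_cont.
  - intros x Hx. apply cont_ex_derive. auto_derive. trivial.
  - intros w Hw. cbv beta. destruct Hphi as (_ & Hb). specialize (Hb w).
    assert (Pw : 0 <= w ^ j) by (apply pow_le; lra).
    set (a := - (2 * h * w)).
    assert (Ea : exp (- (2 * (y + h) * w)) = exp (- (2 * y * w)) * exp a) by (rewrite <- exp_plus; f_equal; unfold a; ring).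
    rewrite Ea.
    replace (w ^ j * phi w * (exp (- (2 * y * w)) * exp a) - w ^ j * phi w * exp (- (2 * y * w)) + 2 * h * (w ^ S j * phi w * exp (- (2 * y * w))))
      with (w ^ j * phi w * exp (- (2 * y * w)) * (exp a - 1 - a)) by (unfold a; simpl; ring).
    generalize (exp_taylor1 a). intros (T1 & T2).
    assert (Pe := exp_pos (- (2 * y * w))).
    rewrite Rabs_pos_eq by (repeat apply Rmult_le_pos; lra).
    apply Rle_trans with (w ^ j * 1 * exp (- (2 * y * w)) * (a * a * exp (Rabs a))).
    + apply Rmult_le_compat; trivial. repeat apply Rmult_le_pos; lra.
      apply Rmult_le_compat_r. lra. apply Rmult_le_compat_l; lra.
    + assert (Ex : exp (- (2 * y * w)) * exp (Rabs a) <= exp (- (y * w))).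
      { rewrite <- exp_plus. destruct (Req_dec (- (2 * y * w) + Rabs a) (- (y * w))) as [e|e]. rewrite e; lra.
        left. apply exp_increasing. apply Rle_not_gt || idtac.
        assert (Rabs a <= y * w). { unfold a. rewrite Rabs_Ropp, 2!Rabs_mult, (Rabs_pos_eq 2), (Rabs_pos_eq w) by lra. nra. } lra. }
      replace (w ^ j * 1 * exp (- (2 * y * w)) * (a * a * exp (Rabs a))) with (4 * (h * h) * (w ^ j * (w * w)) * (exp (- (2 * y * w)) * exp (Rabs a))) by (unfold a; ring).
      replace (4 * (h * h) * (w ^ S (S j) * exp (- (y * w)))) with (4 * (h * h) * (w ^ j * (w * w)) * exp (- (y * w))) by (simpl; ring).
      apply Rmult_le_compat_l; trivial. apply Rmult_le_pos; [nra | apply Rmult_le_pos; nra].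
Qed.

Definition struve_weight (w : R) : R := Rpower (1 + w * w) (- (1 / 2)).

Lemma struve_unit_weight : unit_weight struve_weight.
Proof.
  split.
  - intros x. apply cont_ex_derive. unfold struve_weight, Rpower. auto_derive. nra.
  - intros x. split. left; apply Rpower_pos. apply Rle_trans with (Rpower (1 + x * x) 0). apply Rle_Rpower; nra. rewrite Rpower_O; nra.
Qed.

Definition struve_weight3 (w : R) : R := Rpower (1 + w * w) (- (3 / 2)).

Lemma struve_unit_weight3 : unit_weight struve_weight3.
Proof.
  split.
  - intros x. apply cont_ex_derive. unfold struve_weight3, Rpower. auto_derive. nra.
  - intros x. split. left; apply Rpower_pos. apply Rle_trans with (Rpower (1 + x * x) 0). apply Rle_Rpower; nra. rewrite Rpower_O; nra.
Qed.

Lemma struve_weight_3 w : struve_weight w = (1 + w * w) * struve_weight3 w.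
Proof.
  unfold struve_weight, struve_weight3. rewrite Rpower_shift by nra. do 2 f_equal. field.
Qed.

Lemma is_derive_struve_weight w : is_derive struve_weight w (- w * struve_weight3 w).
Proof.
  assert (H : is_derive struve_weight w (- (1 / 2) * (2 * w) * / (1 + w * w) * struve_weight w)).
  { unfold struve_weight, Rpower. auto_derive. nra. unfold Rdiv. ring. }
  rewrite struve_weight_3 in H. replace (- w * struve_weight3 w) with (- (1 / 2) * (2 * w) * / (1 + w * w) * ((1 + w * w) * struve_weight3 w)); trivial.
  field. nra.
Qed.

Lemma exp_lim_aux (c : R) (p : R -> R) A B : 0 < c -> 0 <= A -> 0 <= B -> (forall w, 0 < w -> Rabs (p w) <= A + B * w) ->
  filterlim (fun w => p w * exp (- (c * w))) (Rbar_locally p_infty) (locally 0).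
Proof.
  intros Hc HA HB Hp. apply lim_infty_rate with (A / c + B * 2 / (c * c)). intros x Hx.
  rewrite Rminus_0_r, Rabs_mult, (Rabs_pos_eq (exp _)) by (left; apply exp_pos).
  generalize (pow_exp_le 1 (c * x) ltac:(nra)) (pow_exp_le 2 (c * x) ltac:(nra)) (exp_pos (- (c * x))). simpl. intros K1 K2 Pe.
  apply le_div. lra.
  apply Rle_trans with ((A + B * x) * exp (- (c * x)) * x). apply Rmult_le_compat_r. lra. apply Rmult_le_compat_r. lra. apply Hp; lra.
  replace ((A + B * x) * exp (- (c * x)) * x) with (A / c * (c * x * 1 * exp (- (c * x))) + B / (c * c) * (c * x * (c * x * 1) * exp (- (c * x)))) by (field; lra).
  assert (0 <= A / c) by (apply Rdiv_le_0_compat; lra). assert (0 <= B / (c * c)) by (apply Rdiv_le_0_compat; nra).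
  replace (B * 2 / (c * c)) with (B / (c * c) * 2) by (field; lra).
  apply Rplus_le_compat. apply (Rmult_le_compat_l (A / c)) in K1; lra. apply (Rmult_le_compat_l (B / (c * c))) in K2; lra.
Qed.

Lemma lim_zero_cont (F : R -> R) : continuous F 0 -> filterlim F (at_right 0) (locally (F 0)).
Proof.
  intros H. apply filterlim_filter_le_1 with (2 := H). apply filter_le_within.
Qed.

(** The total derivative of -sqrt(1 + w^2) e^(-2yw), integrated over the half line. In terms of g(y)
    = K_0(2y) this is Struve's equation g'' + g'/y + 4g = 4/(pi y). *)
Lemma struve_ode y : 0 < y ->
  2 * y * (lap struve_weight 2 y + lap struve_weight 0 y) - lap struve_weight 1 y = 1.
Proof.
  intros Hy.
  assert (Hw := struve_unit_weight).
  set (F := fun w => - ((1 + w * w) * struve_weight w * exp (- (2 * y * w)))).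
  assert (DF : forall w, is_derive F w (2 * y * (w ^ 2 * struve_weight w * exp (- (2 * y * w)) + w ^ 0 * struve_weight w * exp (- (2 * y * w))) - w ^ 1 * struve_weight w * exp (- (2 * y * w)))).
  { intros w. unfold F. evar_last.
    - apply (is_derive_opp (fun w => (1 + w * w) * struve_weight w * exp (- (2 * y * w)))).
      apply (is_derive_mult (fun w => (1 + w * w) * struve_weight w) (fun w => exp (- (2 * y * w)))).
      apply (is_derive_mult (fun w => 1 + w * w) struve_weight). auto_derive. trivial. reflexivity. apply is_derive_struve_weight. intros; apply Rmult_comm.
      auto_derive. trivial. reflexivity. intros; apply Rmult_comm.
    - unfold opp, plus, mult; simpl. rewrite (struve_weight_3 w). ring. }
  assert (H : has_int (fun w => 2 * y * (w ^ 2 * struve_weight w * exp (- (2 * y * w)) + w ^ 0 * struve_weight w * exp (- (2 * y * w))) - w ^ 1 * struve_weight w * exp (- (2 * y * w))) (0 - F 0)).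
  { apply has_int_FTC with F.
    - intros w _. apply DF.
    - intros x Hx. apply cont_minus. apply cont_scal. apply cont_plus; now apply lap_cont. now apply lap_cont.
    - apply lim_zero_cont. apply (cont_of_derive F 0 _ (DF 0)).
    - apply filterlim_ext with (fun w => (- ((1 + w * w) * struve_weight w)) * exp (- ((2 * y) * w))). intros; unfold F; ring.
      apply exp_lim_aux with 1 1; try lra. intros w Hw0. rewrite Rabs_Ropp.
      assert (E : (1 + w * w) * struve_weight w = sqrt (1 + w * w)).
      { unfold struve_weight. rewrite <- (Rpower_1 (1 + w * w)) at 1 by nra. rewrite <- Rpower_plus, <- Rpower_sqrt by nra. f_equal. field. }
      rewrite E, Rabs_pos_eq by apply sqrt_pos. rewrite <- (sqrt_square (1 + 1 * w)) by lra. apply sqrt_le_1_alt. nra. }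
  assert (E := has_int_unique _ _ _ H (has_int_minus _ _ _ _ (has_int_scal _ (2 * y) _ (has_int_plus _ _ _ _ (lap_correct _ 2 y Hw Hy) (lap_correct _ 0 y Hw Hy))) (lap_correct _ 1 y Hw Hy))).
  rewrite <- E. unfold F, struve_weight. rewrite !Rmult_0_r, Ropp_0, exp_0, Rplus_0_r.
  replace (Rpower 1 (- (1 / 2))) with 1. ring. unfold Rpower. rewrite ln_1, Rmult_0_r, exp_0. reflexivity.
Qed.

(** Integration by parts of e^(-2yw) extracts the leading term 1/(2y). It exhibits k as -1/pi times
    a Laplace transform of a nonnegative weight, from which its size can be read off. *)
Lemma struve_parts y : 0 < y -> 2 * y * lap struve_weight 0 y + lap struve_weight3 1 y = 1.
Proof.
  intros Hy.
  assert (Hw := struve_unit_weight). assert (Hw3 := struve_unit_weight3).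
  set (F := fun w => - (struve_weight w * exp (- (2 * y * w)))).
  assert (DF : forall w, is_derive F w (2 * y * (w ^ 0 * struve_weight w * exp (- (2 * y * w))) + w ^ 1 * struve_weight3 w * exp (- (2 * y * w)))).
  { intros w. unfold F. evar_last.
    - apply (is_derive_opp (fun w => struve_weight w * exp (- (2 * y * w)))).
      apply (is_derive_mult struve_weight (fun w => exp (- (2 * y * w)))).
      apply is_derive_struve_weight.
      auto_derive. trivial. reflexivity. intros; apply Rmult_comm.
    - unfold opp, plus, mult; simpl. ring. }
  assert (H : has_int (fun w => 2 * y * (w ^ 0 * struve_weight w * exp (- (2 * y * w))) + w ^ 1 * struve_weight3 w * exp (- (2 * y * w))) (0 - F 0)).
  { apply has_int_FTC with F.
    - intros w _. apply DF.
    - intros x Hx. apply cont_plus. apply cont_scal. now apply lap_cont. now apply lap_cont.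
    - apply lim_zero_cont. apply (cont_of_derive F 0 _ (DF 0)).
    - apply filterlim_ext with (fun w => (- struve_weight w) * exp (- ((2 * y) * w))). intros; unfold F; ring.
      apply exp_lim_aux with 1 0; try lra. intros w Hw0. rewrite Rabs_Ropp, Rabs_pos_eq. destruct Hw as (_ & Hw). specialize (Hw w). lra. apply Hw. }
  assert (E := has_int_unique _ _ _ H (has_int_plus _ _ _ _ (has_int_scal _ (2 * y) _ (lap_correct _ 0 y Hw Hy)) (lap_correct _ 1 y Hw3 Hy))).
  rewrite <- E. unfold F, struve_weight. rewrite !Rmult_0_r, Ropp_0, exp_0, Rplus_0_r.
  replace (Rpower 1 (- (1 / 2))) with 1. ring. unfold Rpower. rewrite ln_1, Rmult_0_r, exp_0. reflexivity.
Qed.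

Lemma lap_nonneg phi j y : unit_weight phi -> 0 < y -> 0 <= lap phi j y.
Proof.
  intros Hw Hy. apply Rle_trans with (Rabs (lap phi j y)). apply Rabs_pos.
  refine (has_int_le_abs _ _ _ _ _ _ _ (lap_correct _ j y Hw Hy) (lap_correct _ j y Hw Hy)); try now apply lap_cont.
  intros x Hx. rewrite Rabs_pos_eq. lra. destruct Hw as (_ & Hw). apply Rmult_le_pos. apply Rmult_le_pos. apply pow_le; lra. apply Hw. left; apply exp_pos.
Qed.

Lemma lap_le phi j y : unit_weight phi -> 0 < y -> lap phi j y <= INR (fact j) / (2 * y) ^ S j.
Proof.
  intros Hw Hy. apply Rle_trans with (Rabs (lap phi j y)). apply Rle_abs.
  refine (has_int_le_abs _ _ _ _ _ _ _ (lap_correct _ j y Hw Hy) (has_int_pow_exp_scale j (2 * y) ltac:(lra))).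
  - now apply lap_cont.
  - intros x Hx. apply cont_ex_derive. auto_derive. trivial.
  - intros x Hx. destruct Hw as (_ & Hw). specialize (Hw x). assert (Pe := exp_pos (- (2 * y * x))). assert (0 <= x ^ j) by (apply pow_le; lra).
    rewrite Rabs_pos_eq. apply Rmult_le_compat_r. lra. nra. apply Rmult_le_pos. nra. lra.
Qed.

Lemma StruveK0_lap y : 0 < y -> StruveK0 (2 * y) = 2 / PI * lap struve_weight 0 y.
Proof.
  intros Hy. unfold StruveK0. f_equal.
  apply (is_RInt_gen_unique (V := R_CompleteNormedModule)).
  assert (H := lap_correct _ 0 y struve_unit_weight Hy).
  set (f := fun w => w ^ 0 * struve_weight w * exp (- (2 * y * w))) in H.
  assert (Cf : forall w, continuous f w).
  { intros w. unfold f. apply cont_mult. apply cont_mult. apply cont_ex_derive; auto_derive; trivial. apply struve_unit_weight. apply cont_ex_derive; auto_derive; trivial. }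
  assert (Hf1 : forall w, 0 <= w -> Rabs (f w) <= 1).
  { intros w Hw. destruct struve_unit_weight as (_ & Hs). specialize (Hs w).
    assert (0 < exp (- (2 * y * w)) <= 1). { split. apply exp_pos. rewrite <- exp_0. destruct (Req_dec w 0). subst; rewrite Rmult_0_r, Ropp_0; lra. left. apply exp_increasing. nra. }
    unfold f. simpl pow. rewrite Rabs_pos_eq; nra. }
  (* [StruveK0] integrates from the point 0, whereas [has_int] approaches 0 from the right. The
     missing piece [0, a] costs at most a, because |f| <= 1. *)
  assert (Lim : forall eps, 0 < eps -> exists M, 0 < M /\ forall W, M < W -> Rabs (RInt f 0 W - lap struve_weight 0 y) < eps).
  { intros eps He. destruct (has_int_elim _ _ H (eps / 2) ltac:(lra)) as (d & M & Hd & HM & K).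
    exists M. split; trivial. intros W HW.
    set (a := Rmin (Rmin (d / 2) (eps / 4)) W).
    assert (Ha : 0 < a /\ a <= d / 2 /\ a <= eps / 4 /\ a <= W).
    { split. repeat apply Rmin_pos; lra. generalize (Rmin_l (Rmin (d / 2) (eps / 4)) W) (Rmin_r (Rmin (d / 2) (eps / 4)) W) (Rmin_l (d / 2) (eps / 4)) (Rmin_r (d / 2) (eps / 4)). unfold a; lra. }
    specialize (K a W ltac:(lra) HW).
    rewrite <- (RInt_Chasles_R f 0 a W) by (apply ex_RInt_cont; [lra|intros; apply Cf]).
    assert (B : Rabs (RInt f 0 a) <= (a - 0) * 1).
    { apply (norm_RInt_le_const (V := R_NormedModule) f 0 a). lra. intros x Hx. apply Hf1; lra.
      apply (RInt_correct (V := R_CompleteNormedModule)). apply ex_RInt_cont. lra. intros; apply Cf. }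
    replace (RInt f 0 a + RInt f a W - lap struve_weight 0 y) with (RInt f 0 a + (RInt f a W - lap struve_weight 0 y)) by ring.
    eapply Rle_lt_trans. apply Rabs_triang. lra. }
  intros P [eps HP].
  destruct (Lim eps (cond_pos eps)) as (M & HM & K).
  apply Filter_prod with (Q := fun a => a = 0) (R := fun b => M < b).
  reflexivity. now apply p_infty_gt.
  intros a b -> Hb. cbn [fst snd]. exists (RInt f (sinh 0) (sinh b)). split.
  - apply is_RInt_ext with (fun t => scal (cosh t) (f (sinh t))).
    + intros t _. unfold scal; simpl; unfold mult; simpl. unfold f, struve_weight. rewrite <- cosh_sqr.
      assert (Hc := cosh_ge_1 t). replace (Rpower (cosh t * cosh t) (- (1 / 2))) with (/ cosh t).
      replace (2 * y * sinh t) with (2 * y * sinh t) by ring. simpl. field. lra.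
      unfold Rpower. rewrite ln_mult by lra. replace (- (1 / 2) * (ln (cosh t) + ln (cosh t))) with (- ln (cosh t)) by field.
      rewrite exp_Ropp, exp_ln; trivial. lra.
    + apply (is_RInt_comp (V := R_CompleteNormedModule) f sinh cosh). intros; apply Cf. intros; split. apply is_derive_sinh.
      apply (cont_of_derive _ x _ (is_derive_cosh x)).
  - rewrite sinh_0. apply HP. apply K. apply Rlt_le_trans with (1 := Hb). apply sinh_ge. lra.
Qed.

Definition struve_g (y : R) : R := StruveK0 (2 * y).
Definition struve_dg (y : R) : R := - (4 / PI) * lap struve_weight 1 y.
Definition struve_k (y : R) : R := y * struve_g y - 1 / PI.

Lemma struve_g_derive y : 0 < y -> is_derive struve_g y (struve_dg y).
Proof.
  intros Hy. apply is_derive_ext_loc with (fun y => 2 / PI * lap struve_weight 0 y).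
  - exists (mkposreal y Hy). intros z Hz. unfold struve_g. rewrite StruveK0_lap; trivial.
    unfold ball in Hz; simpl in Hz; unfold AbsRing_ball, abs, minus, plus, opp in Hz; simpl in Hz. apply Rabs_def2 in Hz. lra.
  - replace (struve_dg y) with (2 / PI * (-2 * lap struve_weight 1 y)).
    apply is_derive_scal. apply lap_derive; trivial. apply struve_unit_weight.
    unfold struve_dg. field. apply PI_neq0.
Qed.

Lemma struve_dg_derive y : 0 < y -> is_derive struve_dg y (4 / (PI * y) - struve_dg y / y - 4 * struve_g y).
Proof.
  intros Hy. unfold struve_dg at 1.
  replace (4 / (PI * y) - struve_dg y / y - 4 * struve_g y) with (- (4 / PI) * (-2 * lap struve_weight 2 y)).
  apply is_derive_scal. apply lap_derive; trivial. apply struve_unit_weight.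
  unfold struve_g. rewrite StruveK0_lap by trivial. unfold struve_dg. generalize (struve_ode y Hy) PI_neq0. intros E HP.
  apply Rmult_eq_reg_l with (PI * y). 2: nra.
  transitivity (4 * (2 * y * lap struve_weight 2 y)). field; trivial.
  transitivity (4 * (1 + lap struve_weight 1 y - 2 * y * lap struve_weight 0 y)). f_equal. lra. field. lra.
Qed.

Lemma struve_k_lap y : 0 < y -> struve_k y = - (/ PI * lap struve_weight3 1 y).
Proof.
  intros Hy. unfold struve_k, struve_g. rewrite StruveK0_lap by trivial. generalize (struve_parts y Hy) PI_neq0. intros E HP.
  replace (lap struve_weight3 1 y) with (1 - 2 * y * lap struve_weight 0 y) by lra. field. trivial.
Qed.

(** Merges two bounds on the transform p: p <= 1 from the integration by parts, and p <= 1/(4 y^2)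
    from weight at most 1. Together p (1 + y^2) <= 5/4, and the factor 1/pi absorbs the excess over
    1. *)
Lemma struve_k_bound y : 0 < y -> Rabs (struve_k y) <= / (1 + y * y).
Proof.
  intros Hy. rewrite struve_k_lap by trivial. assert (HP := PI2_3_2).
  assert (A := lap_nonneg _ 1 y struve_unit_weight3 Hy). assert (B := lap_le _ 1 y struve_unit_weight3 Hy).
  assert (C := lap_nonneg _ 0 y struve_unit_weight Hy). assert (D := struve_parts y Hy).
  set (p := lap struve_weight3 1 y) in *.
  assert (p <= 1) by nra.
  assert (B' : p * (4 * (y * y)) <= 1). { replace (INR (fact 1) / (2 * y) ^ 2) with (1 / (4 * (y * y))) in B by (simpl; field; lra). apply Rle_div_r in B; nra. }
  assert (0 < / PI <= / 3). { split. apply Rinv_0_lt_compat; lra. apply Rinv_le_contravar; lra. }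
  rewrite Rabs_Ropp, Rabs_pos_eq by nra.
  apply Rmult_le_reg_r with (1 + y * y). nra. rewrite Rinv_l by nra.
  assert (p * (1 + y * y) <= 5 / 4) by nra. assert (0 <= p * (1 + y * y)) by nra.
  rewrite Rmult_assoc. nra.
Qed.

Lemma struve_dg_bound y : 0 < y -> Rabs (y * struve_dg y) <= 1.
Proof.
  intros Hy. unfold struve_dg. assert (HP := PI2_3_2).
  assert (A := lap_nonneg _ 1 y struve_unit_weight Hy).
  assert (C := lap_nonneg _ 0 y struve_unit_weight Hy). assert (D := struve_ode y Hy).
  assert (HM : 2 * y * lap struve_weight 1 y <= 1).
  { assert (K : Rabs (lap struve_weight 1 y) <= / (2 * y)).
    { replace (/ (2 * y)) with (INR (fact 0) / (2 * y) ^ 1) by (simpl; field; lra).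
      refine (has_int_le_abs _ _ _ _ _ _ _ (lap_correct _ 1 y struve_unit_weight Hy) (has_int_pow_exp_scale 0 (2 * y) ltac:(lra))).
      - apply lap_cont. apply struve_unit_weight.
      - intros x Hx. apply cont_ex_derive. auto_derive. trivial.
      - intros w Hw. assert (Pe := exp_pos (- (2 * y * w))).
        assert (W : 0 <= w * struve_weight w <= 1).
        { destruct struve_unit_weight as (_ & Hs). specialize (Hs w). split. nra.
          unfold struve_weight. replace (- (1 / 2)) with (- / 2) by field. rewrite Rpower_Ropp, Rpower_sqrt by nra.
          assert (w <= sqrt (1 + w * w)). { rewrite <- (sqrt_square w) at 1 by lra. apply sqrt_le_1_alt. nra. }
          apply div_le; lra. }
        simpl pow. rewrite Rmult_1_r, Rabs_pos_eq by nra. apply Rmult_le_compat_r; lra. }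
    rewrite Rabs_pos_eq in K by trivial. apply (Rmult_le_compat_l (2 * y)) in K; [|lra]. rewrite Rinv_r in K; lra. }
  replace (y * (- (4 / PI) * lap struve_weight 1 y)) with (- (2 / PI * (2 * y * lap struve_weight 1 y))) by (field; lra).
  assert (0 < / PI <= / 3). { split. apply Rinv_0_lt_compat; lra. apply Rinv_le_contravar; lra. }
  assert (0 <= 2 * y * lap struve_weight 1 y) by nra.
  unfold Rdiv. rewrite Rabs_Ropp, Rabs_pos_eq by nra. nra.
Qed.

(** Replacing the weight by its value 1 at w = 0 gives the main term 1/(4 y^2) of the transform, and
    the error w^2 gives O(y^(-4)). The nonzero limit -1/pi of y^2 g'(y) is what produces a boundary
    term at infinity in Duhamel's formula. *)
Lemma struve_dg_asymp y : 0 < y -> Rabs (y * y * struve_dg y + / PI) <= / (y * y).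
Proof.
  intros Hy. unfold struve_dg. assert (HP := PI2_3_2).
  assert (K : Rabs (lap struve_weight 1 y - INR (fact 1) / (2 * y) ^ 2) <= INR (fact 3) / (2 * y) ^ 4).
  { refine (has_int_le_abs _ _ _ _ _ _ _ (has_int_minus _ _ _ _ (lap_correct _ 1 y struve_unit_weight Hy) (has_int_pow_exp_scale 1 (2 * y) ltac:(lra))) (has_int_pow_exp_scale 3 (2 * y) ltac:(lra))).
    - intros x Hx. apply cont_minus. apply lap_cont; trivial. apply struve_unit_weight. apply cont_ex_derive; auto_derive; trivial.
    - intros x Hx. apply cont_ex_derive. auto_derive. trivial.
    - intros w Hw. assert (Pe := exp_pos (- (2 * y * w))).
      assert (W : 1 - w * w <= struve_weight w <= 1).
      { split; [|apply struve_unit_weight].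
        unfold struve_weight. replace (- (1 / 2)) with (- / 2) by field. rewrite Rpower_Ropp, Rpower_sqrt by nra.
        assert (0 < sqrt (1 + w * w)) by (apply sqrt_lt_R0; nra).
        assert (sqrt (1 + w * w) <= 1 + w * w). { rewrite <- (sqrt_square (1 + w * w)) at 2 by nra. apply sqrt_le_1_alt. nra. }
        rewrite <- (Rmult_1_l (/ _)). apply le_div; trivial.
        destruct (Rle_dec (1 - w * w) 0). nra. apply Rle_trans with ((1 - w * w) * (1 + w * w)). apply Rmult_le_compat_l; lra. nra. }
      replace (w ^ 1 * struve_weight w * exp (- (2 * y * w)) - w ^ 1 * exp (- (2 * y * w))) with (- (w * exp (- (2 * y * w)) * (1 - struve_weight w))) by (simpl; ring).
      rewrite Rabs_Ropp, Rabs_pos_eq. 2: apply Rmult_le_pos; nra.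
      replace (w ^ 3 * exp (- (2 * y * w))) with (w * exp (- (2 * y * w)) * (w * w)) by (simpl; ring). apply Rmult_le_compat_l; nra. }
  replace (INR (fact 1) / (2 * y) ^ 2) with (/ (4 * (y * y))) in K by (simpl; field; lra).
  replace (INR (fact 3) / (2 * y) ^ 4) with (6 / 16 / (y * y) * / (y * y)) in K by (simpl; field; lra).
  replace (y * y * (- (4 / PI) * lap struve_weight 1 y) + / PI) with (- (4 / PI * (y * y) * (lap struve_weight 1 y - / (4 * (y * y))))) by (field; lra).
  assert (0 < / PI <= / 3). { split. apply Rinv_0_lt_compat; lra. apply Rinv_le_contravar; lra. }
  assert (0 < 4 / PI * (y * y)). { unfold Rdiv. apply Rmult_lt_0_compat; nra. }
  rewrite Rabs_Ropp, Rabs_mult, (Rabs_pos_eq (4 / PI * (y * y))) by lra.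
  apply (Rmult_le_compat_l (4 / PI * (y * y))) in K; [|lra]. apply Rle_trans with (1 := K).
  replace (4 / PI * (y * y) * (6 / 16 / (y * y) * / (y * y))) with (3 / 2 * / PI * / (y * y)) by (field; lra).
  assert (0 < / (y * y)) by (apply Rinv_0_lt_compat; nra). rewrite <- (Rmult_1_l (/ (y * y))) at 2. apply Rmult_le_compat_r; lra.
Qed.

Lemma struve_k_derive y : 0 < y -> is_derive struve_k y (struve_g y + y * struve_dg y).
Proof.
  intros Hy. unfold struve_k. evar_last.
  apply (is_derive_minus (fun y => y * struve_g y) (fun _ => 1 / PI)).
  apply (is_derive_mult (fun y => y) struve_g). apply (is_derive_id (K := R_AbsRing)). now apply struve_g_derive. intros; apply Rmult_comm.
  apply (is_derive_const (V := R_NormedModule)).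
  unfold minus, plus, mult, opp, zero, one; simpl. ring.
Qed.

Lemma struve_k_cont y : 0 < y -> continuous struve_k y.
Proof. intros Hy. apply (cont_of_derive _ _ _ (struve_k_derive y Hy)). Qed.

(** * Integrals depending on a parameter *)

Definition cont2 (F : R -> R -> R) : Prop := forall x u, 0 < x -> continuity_2d_pt F x u.

Lemma cont2_fst F u : cont2 F -> cont_pos (fun x => F x u).
Proof.
  intros H x Hx. apply filterlim_locally. intros eps. destruct (H x u Hx eps) as (d & Hd).
  exists d. intros y Hy. apply (Hd y u). exact Hy. rewrite Rminus_eq_0, Rabs_R0. apply cond_pos.
Qed.

Lemma cont2_snd F x u : cont2 F -> 0 < x -> continuous (fun u => F x u) u.
Proof.
  intros H Hx. apply filterlim_locally. intros eps. destruct (H x u Hx eps) as (d & Hd).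
  exists d. intros y Hy. apply (Hd x y). rewrite Rminus_eq_0, Rabs_R0. apply cond_pos. exact Hy.
Qed.

Lemma RInt_param_cont_loc (K : R -> R -> R) a b u r : 0 < r -> a <= b ->
  (forall x v, a <= x <= b -> u - r <= v <= u + r -> continuity_2d_pt K x v) ->
  (forall v, u - r <= v <= u + r -> ex_RInt (fun x => K x v) a b) ->
  continuous (fun u => RInt (fun x => K x u) a b) u.
Proof.
  intros Hr Hab HK X. apply filterlim_locally. intros eps.
  assert (He : 0 < eps / (b - a + 1)) by (apply Rdiv_lt_0_compat; [apply cond_pos | lra]).
  destruct (uniform_continuity_2d K a b (u - r) (u + r) HK (mkposreal _ He)) as (d & Hd).
  assert (Hd' : 0 < Rmin d r) by (apply Rmin_pos; [apply cond_pos | lra]).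
  exists (mkposreal _ Hd'). intros v Hv.
  unfold ball in Hv; simpl in Hv; unfold AbsRing_ball, abs, minus, plus, opp in Hv; simpl in Hv.
  assert (Hv1 : Rabs (v - u) < d) by (apply Rlt_le_trans with (1 := Hv); apply Rmin_l).
  assert (Hv2 : Rabs (v - u) < r) by (apply Rlt_le_trans with (1 := Hv); apply Rmin_r).
  apply Rabs_def2 in Hv2.
  change (Rabs (RInt (fun x => K x v) a b - RInt (fun x => K x u) a b) < eps).
  rewrite <- RInt_minus_R by (apply X; lra).
  apply Rle_lt_trans with ((b - a) * (eps / (b - a + 1))).
  - apply (norm_RInt_le_const (V := R_NormedModule) (fun x => K x v - K x u) a b). lra.
    + intros x Hx. left. apply (Hd x u x v); try lra. rewrite Rminus_eq_0, Rabs_R0. apply cond_pos.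
    + apply (RInt_correct (V := R_CompleteNormedModule)). apply (ex_RInt_minus (V := R_NormedModule)); apply X; lra.
  - assert (P := cond_pos eps). replace ((b - a) * (eps / (b - a + 1))) with ((b - a) * eps / (b - a + 1)) by (field; lra).
    apply Rlt_div_l; nra.
Qed.

Lemma RInt_param_cont F a b u : cont2 F -> 0 < a -> a <= b -> continuous (fun u => RInt (fun x => F x u) a b) u.
Proof.
  intros HF Ha Hab. apply RInt_param_cont_loc with 1; trivial; try lra.
  - intros x v Hx _. apply HF. lra.
  - intros v _. apply cont_pos_ex_RInt; try lra. now apply cont2_fst.
Qed.

Lemma RInt_param_cont_fst F c d x : cont2 F -> 0 < x -> c <= d -> continuous (fun x => RInt (fun u => F x u) c d) x.
Proof.
  intros HF Hx Hcd. apply (RInt_param_cont_loc (fun u x => F x u)) with (x / 2); trivial; try lra.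
  - intros u v _ Hv eps. destruct (HF v u ltac:(lra) eps) as (e & He). exists e. intros u' v' Hu' Hv'. now apply He.
  - intros v Hv. apply ex_RInt_cont; trivial. intros u _. apply cont2_snd; trivial. lra.
Qed.

Lemma locally_pos x : 0 < x -> locally x (fun y => 0 < y).
Proof.
  intros Hx. exists (mkposreal x Hx). intros y Hy.
  unfold ball in Hy; simpl in Hy; unfold AbsRing_ball, abs, minus, plus, opp in Hy; simpl in Hy. apply Rabs_def2 in Hy. lra.
Qed.

Lemma derive_RInt_param (f df : R -> R -> R) c d x : c <= d -> 0 < x ->
  (forall x u, 0 < x -> is_derive (fun x => f x u) x (df x u)) -> cont2 df ->
  (forall x u, 0 < x -> continuous (fun u => f x u) u) ->
  is_derive (fun x => RInt (fun u => f x u) c d) x (RInt (fun u => df x u) c d).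
Proof.
  intros Hcd Hx Hd Hc Hf.
  rewrite (RInt_ext_R (fun u => df x u) (fun u => Derive (fun x => f x u) x) c d Hcd).
  2: { intros u _. symmetry. apply is_derive_unique. now apply Hd. }
  apply (is_derive_RInt_param f c d x).
  - apply filter_imp with (2 := locally_pos x Hx). intros y Hy u _. eexists. now apply Hd.
  - intros u _. apply continuity_2d_pt_ext_loc with df. 2: now apply Hc.
    exists (mkposreal x Hx). intros y v Hy _. simpl in Hy. symmetry. apply is_derive_unique. apply Hd. apply Rabs_def2 in Hy. lra.
  - apply filter_imp with (2 := locally_pos x Hx). intros y Hy. apply ex_RInt_cont; trivial. intros u _. now apply Hf.
Qed.

(** The right-hand side, as a function of the upper limit b, vanishes at b = a and may be
    differentiated under the integral; its derivative is the integrand of the left-hand side. *)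
Lemma Fubini F a b c d : cont2 F -> 0 < a -> a <= b -> c <= d ->
  RInt (fun x => RInt (fun u => F x u) c d) a b = RInt (fun u => RInt (fun x => F x u) a b) c d.
Proof.
  intros HF Ha Hab Hcd.
  assert (HD : forall x u, 0 < x -> is_derive (fun x => RInt (fun z => F z u) a x) x (F x u)).
  { intros x u Hx. apply (is_derive_RInt (fun z => F z u) _ a x).
    - apply filter_imp with (2 := locally_pos x Hx). intros y Hy. apply (RInt_correct (V := R_CompleteNormedModule)).
      apply cont_pos_ex_RInt; trivial. now apply cont2_fst.
    - now apply cont2_fst. }
  assert (HC : forall x u, 0 < x -> continuous (fun u => RInt (fun z => F z u) a x) u).
  { intros x u Hx. destruct (Rle_dec a x).
    - now apply RInt_param_cont.
    - apply continuous_ext with (fun u => - RInt (fun z => F z u) x a).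
      intros v. apply (opp_RInt_swap (V := R_CompleteNormedModule)). apply cont_pos_ex_RInt; trivial. now apply cont2_fst.
      apply (continuous_opp (fun u => RInt (fun z => F z u) x a)). apply RInt_param_cont; trivial. lra. }
  assert (E : is_RInt (fun x => RInt (fun u => F x u) c d) a b
    (RInt (fun u => RInt (fun x => F x u) a b) c d - RInt (fun u => RInt (fun x => F x u) a a) c d)).
  { apply (RInt_FTC (fun x => RInt (fun u => RInt (fun z => F z u) a x) c d)); trivial.
    - intros x Hx. apply (derive_RInt_param (fun x u => RInt (fun z => F z u) a x)); trivial. lra.
    - intros x Hx. apply RInt_param_cont_fst; trivial. lra. }
  rewrite (is_RInt_unique (V := R_CompleteNormedModule) _ _ _ _ E).
  replace (RInt (fun u => RInt (fun x => F x u) a a) c d) with 0. apply Rminus_0_r.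
  symmetry. transitivity (RInt (fun u : R => 0) c d). apply RInt_ext_R; trivial. intros u _. apply (RInt_point (V := R_CompleteNormedModule)).
  transitivity (scal (d - c) 0). apply (RInt_const (V := R_CompleteNormedModule)). unfold scal; simpl; unfold mult; simpl. ring.
Qed.

Lemma cont2_mult F G : cont2 F -> cont2 G -> cont2 (fun x u => F x u * G x u).
Proof. intros HF HG x u Hx. apply continuity_2d_pt_mult; auto. Qed.

Lemma cont2_plus F G : cont2 F -> cont2 G -> cont2 (fun x u => F x u + G x u).
Proof. intros HF HG x u Hx. apply continuity_2d_pt_plus; auto. Qed.

Lemma cont2_minus F G : cont2 F -> cont2 G -> cont2 (fun x u => F x u - G x u).
Proof. intros HF HG x u Hx. apply continuity_2d_pt_minus; auto. Qed.

Lemma cont2_of_fst f : cont_pos f -> cont2 (fun x u => f x).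
Proof.
  intros Hf x u Hx. apply (continuity_1d_2d_pt_comp f (fun x u => x)). apply continuity_pt_filterlim. now apply Hf.
  apply continuity_2d_pt_id1.
Qed.

Lemma cont2_of_snd f : (forall u, continuous f u) -> cont2 (fun x u => f u).
Proof.
  intros Hf x u Hx. apply (continuity_1d_2d_pt_comp f (fun x u => u)). apply continuity_pt_filterlim. apply Hf.
  apply continuity_2d_pt_id2.
Qed.

Lemma cont2_comp_pos f G : cont_pos f -> cont2 G -> (forall x u, 0 < x -> 0 < G x u) -> cont2 (fun x u => f (G x u)).
Proof.
  intros Hf HG HP x u Hx. apply (continuity_1d_2d_pt_comp f G). apply continuity_pt_filterlim. apply Hf. now apply HP. now apply HG.
Qed.

Lemma cont2_comp f G : (forall x, continuous f x) -> cont2 G -> cont2 (fun x u => f (G x u)).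
Proof.
  intros Hf HG x u Hx. apply (continuity_1d_2d_pt_comp f G). apply continuity_pt_filterlim. apply Hf. now apply HG.
Qed.

Lemma cont2_ext F G : (forall x u, F x u = G x u) -> cont2 F -> cont2 G.
Proof. intros E HF x u Hx. apply continuity_2d_pt_ext with (1 := E). now apply HF. Qed.

(** * The Mellin transform of the kernel *)

Lemma struve_weight_le_inv w : 0 < w -> 0 < struve_weight w <= / w.
Proof.
  intros Hw. split. apply Rpower_pos.
  unfold struve_weight. replace (- (1 / 2)) with (- / 2) by field. rewrite Rpower_Ropp, Rpower_sqrt by nra.
  apply Rinv_le_contravar; trivial. rewrite <- (sqrt_square w) at 1 by lra. apply sqrt_le_1_alt. nra.
Qed.

Lemma struve_weight_ge w : 1 - w * w <= struve_weight w.
Proof.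
  unfold struve_weight. replace (- (1 / 2)) with (- / 2) by field. rewrite Rpower_Ropp, Rpower_sqrt by nra.
  assert (0 < sqrt (1 + w * w)) by (apply sqrt_lt_R0; nra).
  assert (sqrt (1 + w * w) <= 1 + w * w). { rewrite <- (sqrt_square (1 + w * w)) at 2 by nra. apply sqrt_le_1_alt. nra. }
  rewrite <- (Rmult_1_l (/ _)). apply le_div; trivial.
  destruct (Rle_dec (1 - w * w) 0). nra. apply Rle_trans with ((1 - w * w) * (1 + w * w)). apply Rmult_le_compat_l; lra. nra.
Qed.

(** Dropping the exponential leaves the majorant w (1 + w^2)^(-3/2), with primitive -(1 +
    w^2)^(-1/2). The resulting truncation error is uniform in y and can be integrated over y. *)
Lemma lap_weight3_tail y a b : 0 < y -> 0 < a -> a <= b ->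
  Rabs (RInt (fun w => w ^ 1 * struve_weight3 w * exp (- (2 * y * w))) a b - lap struve_weight3 1 y) <= a * a + / b.
Proof.
  intros Hy Ha Hab.
  destruct (has_int_dom (fun w => w ^ 1 * struve_weight3 w * exp (- (2 * y * w))) (fun w => w * struve_weight3 w) (fun w => - struve_weight w) (-1) 0) as (l & H1 & H2 & H3).
  - apply lap_cont. apply struve_unit_weight3.
  - intros x Hx. apply cont_mult. apply continuous_id. apply struve_unit_weight3.
  - intros w Hw. destruct struve_unit_weight3 as (_ & Hs). specialize (Hs w). assert (Pe := exp_pos (- (2 * y * w))).
    assert (exp (- (2 * y * w)) <= 1). { rewrite <- exp_0. left. apply exp_increasing. nra. }
    rewrite pow_1, Rabs_pos_eq. rewrite <- (Rmult_1_r (w * struve_weight3 w)) at 2. apply Rmult_le_compat_l; nra. apply Rmult_le_pos; nra.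
  - intros w Hw. replace (w * struve_weight3 w) with (- (- w * struve_weight3 w)) by ring. apply (is_derive_opp struve_weight). apply is_derive_struve_weight.
  - apply lim_zero_rate with 1. intros x Hx. replace (- struve_weight x - -1) with (1 - struve_weight x) by ring.
    generalize (struve_weight_ge x) (proj2 struve_unit_weight x). intros. rewrite Rabs_pos_eq; nra.
  - apply lim_infty_rate with 1. intros x Hx. generalize (struve_weight_le_inv x ltac:(lra)). intros. rewrite Rminus_0_r, Rabs_Ropp, Rabs_pos_eq by lra. unfold Rdiv. lra.
  - rewrite <- (has_int_unique _ _ _ H1 (lap_correct _ 1 y struve_unit_weight3 Hy)).
    apply Rle_trans with (1 := H3 a b Ha Hab).
    generalize (struve_weight_ge a) (struve_weight_le_inv b ltac:(lra)). lra.
Qed.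

Lemma lap_cont_y phi j : unit_weight phi -> cont_pos (lap phi j).
Proof. intros Hphi y Hy. apply (cont_of_derive _ _ _ (lap_derive phi j y Hphi Hy)). Qed.

(** Exchange of two improper integrals. The orders are swapped on a compact rectangle, the tails in
    w are removed uniformly in y, and the tails in y remain integrable against w (1 +
    w^2)^(-3/2). *)
Lemma mellin_struve (h gi : R -> R) N : cont_pos h -> (forall y, 0 < y -> Rabs (h y) <= 1) -> cont_pos gi ->
  (forall w, 0 < w -> has_int (fun y => h y * exp (- (2 * y * w))) (gi w)) ->
  has_int (fun w => w * struve_weight3 w * gi w) N ->
  has_int (fun y => h y * lap struve_weight3 1 y) N.
Proof.
  intros Ch Bh Cg Hg HN.
  set (s3 := struve_weight3) in *.
  assert (Cs3 : forall w, continuous s3 w) by apply struve_unit_weight3.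
  assert (Bs3 : forall w, 0 <= s3 w <= 1) by apply struve_unit_weight3.
  set (F := fun y w => h y * (w ^ 1 * s3 w * exp (- (2 * y * w)))).
  assert (CF : cont2 F).
  { apply cont2_mult. now apply cont2_of_fst. apply cont2_mult.
    - apply (cont2_of_snd (fun w => w ^ 1 * s3 w)). intros u. apply cont_mult; trivial. apply cont_ex_derive. auto_derive. trivial.
    - apply (cont2_comp exp). intros x. apply continuous_exp.
      apply (cont2_ext (fun x u => (-2 * x) * u)). intros; ring. apply cont2_mult.
      apply cont2_of_fst. intros x _. apply cont_scal, continuous_id. apply cont2_of_snd. intros; apply continuous_id. }
  (* The truncation [e, Y] in y is fixed here; the truncation [a, b] in w is auxiliary and chosen so
     fine that its cost over an interval of length Y - e stays below eps. *)
  assert (Main : forall e Y, 0 < e -> e <= Y -> Rabs (RInt (fun y => h y * lap s3 1 y) e Y - N) <= e + / Y).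
  { intros e Y He HY. apply le_epsilon. intros eps Heps.
    destruct (has_int_elim _ _ HN (eps / 2) ltac:(lra)) as (d & M & Hd & HM & K).
    set (q := eps / (4 * (Y - e + 1))).
    assert (Hq : 0 < q) by (apply Rdiv_lt_0_compat; lra).
    set (a := Rmin (Rmin (d / 2) q) 1). set (b := Rmax (Rmax M (/ q)) 1 + 1).
    assert (Ha : 0 < a /\ a <= d / 2 /\ a <= q /\ a <= 1).
    { split. repeat apply Rmin_pos; lra. generalize (Rmin_l (Rmin (d / 2) q) 1) (Rmin_r (Rmin (d / 2) q) 1) (Rmin_l (d / 2) q) (Rmin_r (d / 2) q). unfold a; lra. }
    assert (Hb : M < b /\ / q < b /\ 1 < b).
    { generalize (Rmax_l (Rmax M (/ q)) 1) (Rmax_r (Rmax M (/ q)) 1) (Rmax_l M (/ q)) (Rmax_r M (/ q)). unfold b; lra. }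
    assert (Hbq : / b <= q). { rewrite <- (Rinv_inv q). apply Rinv_le_contravar. now apply Rinv_0_lt_compat. lra. }
    specialize (K a b ltac:(lra) ltac:(lra)).
    set (g := fun w => RInt (fun y => h y * exp (- (2 * y * w))) e Y).
    assert (Swap : RInt (fun y => h y * RInt (fun w => w ^ 1 * s3 w * exp (- (2 * y * w))) a b) e Y = RInt (fun w => w * s3 w * g w) a b).
    { transitivity (RInt (fun y => RInt (fun w => F y w) a b) e Y).
      - apply RInt_ext_R; trivial. intros y Hy. unfold F. rewrite RInt_scal_R; trivial.
        apply ex_RInt_cont. lra. intros w _. apply cont_mult. apply cont_mult; trivial. apply cont_ex_derive; auto_derive; trivial. apply cont_ex_derive; auto_derive; trivial.
      - rewrite Fubini by (trivial; lra). apply RInt_ext_R. lra. intros w Hw. unfold g.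
        rewrite <- RInt_scal_R. apply RInt_ext_R; trivial. intros y Hy. unfold F. simpl. ring.
        apply cont_pos_ex_RInt; try lra. intros y Hy. apply cont_mult. now apply Ch. apply cont_ex_derive; auto_derive; trivial. }
    assert (Cg2 : forall w, continuous g w).
    { intros w. apply (RInt_param_cont (fun y w => h y * exp (- (2 * y * w))) e Y w); trivial.
      apply cont2_mult. now apply cont2_of_fst. apply (cont2_comp exp). intros x. apply continuous_exp.
      apply (cont2_ext (fun x u => (-2 * x) * u)). intros; ring. apply cont2_mult.
      apply cont2_of_fst. intros x _. apply cont_scal, continuous_id. apply cont2_of_snd. intros; apply continuous_id. }
    (* The part of the y-integral below e costs at most e, the part above Y at most e^(-2Yw)/(2w).
       The singularity 1/w is cancelled by the factor w of the weight. *)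
    assert (Dg : forall w, 0 < w -> Rabs (g w - gi w) <= e + exp (- (2 * Y * w)) / (2 * w)).
    { intros w Hw.
      destruct (has_int_dom (fun y => h y * exp (- (2 * y * w))) (fun y => exp (- (2 * y * w))) (fun y => - (exp (- (2 * y * w)) / (2 * w))) (- (1 / (2 * w))) 0) as (l & H1 & H2 & H3).
      - intros y Hy. apply cont_mult. now apply Ch. apply cont_ex_derive; auto_derive; trivial.
      - intros y Hy. apply cont_ex_derive; auto_derive; trivial.
      - intros y Hy. rewrite Rabs_mult, (Rabs_pos_eq (exp _)) by (left; apply exp_pos). rewrite <- (Rmult_1_l (exp _)) at 2. apply Rmult_le_compat_r. left; apply exp_pos. now apply Bh.
      - intros y Hy. auto_derive. trivial. field. lra.
      - replace (- (1 / (2 * w))) with (- (exp (- (2 * 0 * w)) / (2 * w))). apply (lim_zero_cont (fun y => - (exp (- (2 * y * w)) / (2 * w)))). apply cont_ex_derive; auto_derive; trivial.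
        rewrite Rmult_0_r, Rmult_0_l, Ropp_0, exp_0. reflexivity.
      - apply filterlim_ext with (fun y => (fun _ => - / (2 * w)) y * exp (- (2 * w * y))). intros y. cbv beta. replace (2 * w * y) with (2 * y * w) by ring. field. lra.
        apply exp_lim_aux with (/ (2 * w)) 0; try lra. left. apply Rinv_0_lt_compat; lra. intros x Hx. rewrite Rabs_Ropp, Rabs_pos_eq. lra. left. apply Rinv_0_lt_compat; lra.
      - rewrite (has_int_unique _ _ _ H1 (Hg w Hw)) in H3. apply Rle_trans with (1 := H3 e Y He HY).
        assert ((1 - exp (- (2 * e * w))) / (2 * w) <= e). { apply div_le. lra. generalize (exp_ineq1_le (- (2 * e * w))). lra. }
        unfold Rdiv in *. lra. }
    assert (X1 : ex_RInt (fun w => w * s3 w * g w) a b).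
    { apply cont_pos_ex_RInt; try lra. intros w _. apply cont_mult; trivial. apply cont_mult; trivial. apply continuous_id. }
    assert (X2 : ex_RInt (fun w => w * s3 w * gi w) a b).
    { apply cont_pos_ex_RInt; try lra. intros w Hw. apply cont_mult. apply cont_mult; trivial. apply continuous_id. now apply Cg. }
    assert (B2 : Rabs (RInt (fun w => w * s3 w * g w) a b - RInt (fun w => w * s3 w * gi w) a b) <= e + / Y).
    { rewrite <- RInt_minus_R by trivial.
      assert (FT : is_RInt (fun w => e * (w * s3 w) + / 2 * exp (- (2 * Y * w))) a b
         ((- (e * struve_weight b) - / (4 * Y) * exp (- (2 * Y * b))) - (- (e * struve_weight a) - / (4 * Y) * exp (- (2 * Y * a))))).
      { apply (RInt_FTC (fun w => - (e * struve_weight w) - / (4 * Y) * exp (- (2 * Y * w)))). lra.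
        - intros w _. replace (e * (w * s3 w) + / 2 * exp (- (2 * Y * w))) with (- (e * (- w * s3 w)) - (- / 2 * exp (- (2 * Y * w)))) by ring.
          apply (is_derive_minus (fun w => - (e * struve_weight w)) (fun w => / (4 * Y) * exp (- (2 * Y * w)))).
          apply (is_derive_opp (fun w => e * struve_weight w)). apply is_derive_scal. apply is_derive_struve_weight.
          auto_derive. trivial. field. lra.
        - intros w _. apply cont_plus. apply cont_scal. apply cont_mult; trivial. apply continuous_id. apply cont_ex_derive; auto_derive; trivial. }
      apply Rle_trans with (RInt (fun w => e * (w * s3 w) + / 2 * exp (- (2 * Y * w))) a b).
      - apply RInt_abs_le. lra. apply (ex_RInt_minus (V := R_NormedModule)); trivial. eexists; apply FT.
        intros w Hw. rewrite <- Rmult_minus_distr_l, Rabs_mult, Rabs_pos_eq by (apply Rmult_le_pos; [lra | apply Bs3]).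
        apply Rle_trans with (w * s3 w * (e + exp (- (2 * Y * w)) / (2 * w))). apply Rmult_le_compat_l. apply Rmult_le_pos; [lra | apply Bs3]. apply Dg; lra.
        replace (w * s3 w * (e + exp (- (2 * Y * w)) / (2 * w))) with (e * (w * s3 w) + s3 w * (/ 2 * exp (- (2 * Y * w)))) by (field; lra).
        apply Rplus_le_compat_l. rewrite <- (Rmult_1_l (/ 2 * exp _)) at 2. apply Rmult_le_compat_r. generalize (exp_pos (- (2 * Y * w))); lra. apply Bs3.
      - rewrite (is_RInt_unique (V := R_CompleteNormedModule) _ _ _ _ FT).
        generalize (proj2 struve_unit_weight a) (proj2 struve_unit_weight b) (exp_pos (- (2 * Y * b))). intros S1 S2 P1.
        assert (P2 : exp (- (2 * Y * a)) <= 1). { rewrite <- exp_0. left. apply exp_increasing. nra. }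
        assert (P3 : 0 < / (4 * Y) <= / Y). { split. apply Rinv_0_lt_compat; lra. apply Rinv_le_contravar; lra. }
        generalize (exp_pos (- (2 * Y * a))). intros P4. nra. }
    assert (B1 : Rabs (RInt (fun y => h y * lap s3 1 y) e Y - RInt (fun y => h y * RInt (fun w => w ^ 1 * s3 w * exp (- (2 * y * w))) a b) e Y) <= eps / 2).
    { assert (X3 : ex_RInt (fun y => h y * lap s3 1 y) e Y).
      { apply cont_pos_ex_RInt; try lra. intros y Hy. apply cont_mult. now apply Ch. apply lap_cont_y; trivial. apply struve_unit_weight3. }
      assert (X4 : ex_RInt (fun y => h y * RInt (fun w => w ^ 1 * s3 w * exp (- (2 * y * w))) a b) e Y).
      { apply ex_RInt_ext with (fun y => RInt (fun w => F y w) a b).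
        - intros y _. unfold F. rewrite RInt_scal_R; trivial.
          apply ex_RInt_cont. lra. intros w _. apply cont_mult. apply cont_mult; trivial. apply cont_ex_derive; auto_derive; trivial. apply cont_ex_derive; auto_derive; trivial.
        - apply cont_pos_ex_RInt; try lra. intros y Hy. apply RInt_param_cont_fst; trivial. lra. }
      rewrite <- RInt_minus_R by trivial.
      apply Rle_trans with ((Y - e) * (2 * q)).
      - apply (norm_RInt_le_const (V := R_NormedModule) (fun y => h y * lap s3 1 y - h y * RInt (fun w => w ^ 1 * s3 w * exp (- (2 * y * w))) a b) e Y). trivial.
        + intros y Hy. unfold norm; simpl; unfold abs; simpl. rewrite <- Rmult_minus_distr_l, Rabs_mult, Rabs_minus_sym.
          rewrite <- (Rmult_1_l (2 * q)). apply Rmult_le_compat; try apply Rabs_pos. apply Bh; lra.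
          generalize (lap_weight3_tail y a b ltac:(lra) ltac:(lra) ltac:(lra)). simpl. fold s3. intros T. apply Rle_trans with (1 := T). nra.
        + apply (RInt_correct (V := R_CompleteNormedModule)). apply (ex_RInt_minus (V := R_NormedModule)); trivial.
      - unfold q. replace ((Y - e) * (2 * (eps / (4 * (Y - e + 1))))) with ((eps / 2) * ((Y - e) / (Y - e + 1))) by (field; lra).
        rewrite <- (Rmult_1_r (eps / 2)) at 2. apply Rmult_le_compat_l. lra. apply div_le; lra. }
    rewrite Swap in B1.
    set (i1 := RInt (fun y => h y * lap s3 1 y) e Y) in *. set (i2 := RInt (fun w => w * s3 w * g w) a b) in *. set (i3 := RInt (fun w => w * s3 w * gi w) a b) in *.
    replace (i1 - N) with ((i1 - i2) + (i2 - i3) + (i3 - N)) by ring.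
    eapply Rle_trans. apply Rabs_triang. eapply Rle_trans. apply Rplus_le_compat_r. apply Rabs_triang. lra. }
  apply has_int_intro.
  - intros y Hy. apply cont_mult. now apply Ch. apply lap_cont_y; trivial. apply struve_unit_weight3.
  - intros eps He. exists (Rmin (eps / 2) 1), (Rmax (2 / eps) 1).
    assert (0 < 2 / eps) by (apply Rdiv_lt_0_compat; lra).
    split. apply Rmin_pos; lra. split. apply Rlt_le_trans with (2 := Rmax_r _ _); lra.
    intros a b Ha Hb. generalize (Rmin_l (eps / 2) 1) (Rmin_r (eps / 2) 1) (Rmax_l (2 / eps) 1) (Rmax_r (2 / eps) 1). intros.
    apply Rle_lt_trans with (1 := Main a b ltac:(lra) ltac:(lra)).
    assert (/ b < eps / 2). { replace (eps / 2) with (/ (2 / eps)) by (field; lra). apply Rinv_lt_contravar. apply Rmult_lt_0_compat; lra. lra. }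
    lra.
Qed.

(* Mellin transform of [struve_k] at 1 + i s; the factor [E] is 2^(-i s). *)
Lemma mellin_struve_k s z b : gam 0 s z -> beta_int (3 / 2) (- s) b ->
  let N := Cmult (RtoC (- / (2 * PI))) (Cmult (Cmult (cos (- (s * ln 2)), sin (- (s * ln 2))) z) b) in
  has_int (fun y => cos (s * ln y) * struve_k y) (fst N) /\ has_int (fun y => sin (s * ln y) * struve_k y) (snd N).
Proof.
  intros (Z1 & Z2) (B1 & B2) N.
  set (p := fst z) in *. set (q := snd z) in *.
  set (c2 := cos (s * ln 2)). set (d2 := sin (s * ln 2)).
  (* By scaling, the integral of y^(is) e^(-2yw) is (2w)^(-1-is) Gamma(1 + is); [G1] and [G2] are
     its real and imaginary part. Integrating w^(-is) against the weight then gives b_(3/2). *)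
  assert (G1 : forall w, 0 < w -> has_int (fun y => cos (s * ln y) * exp (- (2 * y * w))) (/ (2 * w) * (cos (s * ln (2 * w)) * p + sin (s * ln (2 * w)) * q))).
  { intros w Hw. set (B := s * ln (2 * w)).
    assert (H := fun A => has_int_scale _ (2 * w) _ ltac:(lra) A (has_int_plus _ _ _ _ (has_int_scal _ (cos B) _ Z1) (has_int_scal _ (sin B) _ Z2))).
    apply has_int_ext with (2 := H ltac:(cont_by_derive)). intros y Hy. cbv beta. rewrite !(ln_mult (2 * w)) by lra.
    replace (s * (ln (2 * w) + ln y)) with (B + s * ln y) by (unfold B; ring). rewrite cos_plus, sin_plus.
    replace (2 * y * w) with (2 * w * y) by ring. generalize (sin2_cos2 B). unfold Rsqr. intros E. simpl.
    transitivity ((sin B * sin B + cos B * cos B) * cos (s * ln y) * exp (- (2 * w * y))). ring. rewrite E; ring. }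
  assert (G2 : forall w, 0 < w -> has_int (fun y => sin (s * ln y) * exp (- (2 * y * w))) (/ (2 * w) * (cos (s * ln (2 * w)) * q - sin (s * ln (2 * w)) * p))).
  { intros w Hw. set (B := s * ln (2 * w)).
    assert (H := fun A => has_int_scale _ (2 * w) _ ltac:(lra) A (has_int_minus _ _ _ _ (has_int_scal _ (cos B) _ Z2) (has_int_scal _ (sin B) _ Z1))).
    apply has_int_ext with (2 := H ltac:(cont_by_derive)). intros y Hy. cbv beta. rewrite !(ln_mult (2 * w)) by lra.
    replace (s * (ln (2 * w) + ln y)) with (B + s * ln y) by (unfold B; ring). rewrite cos_plus, sin_plus.
    replace (2 * y * w) with (2 * w * y) by ring. generalize (sin2_cos2 B). unfold Rsqr. intros E. simpl.
    transitivity ((sin B * sin B + cos B * cos B) * sin (s * ln y) * exp (- (2 * w * y))). ring. rewrite E; ring. }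
  assert (K : forall w, 0 < w -> cos (s * ln (2 * w)) = c2 * cos (s * ln w) - d2 * sin (s * ln w) /\ sin (s * ln (2 * w)) = d2 * cos (s * ln w) + c2 * sin (s * ln w)).
  { intros w Hw. rewrite ln_mult, Rmult_plus_distr_l, cos_plus, sin_plus by lra. now split. }
  assert (HPI := PI_RGT_0).
  assert (HB : forall A B, has_int (fun w => struve_weight3 w * (A * cos (s * ln w) + B * sin (s * ln w))) (A * fst b - B * snd b)).
  { intros A B. apply has_int_ext with (2 := has_int_minus _ _ _ _ (has_int_scal _ A _ B1) (has_int_scal _ B _ B2)).
    intros w Hw. cbv beta. rewrite <- Ropp_mult_distr_l, cos_neg, sin_neg. unfold struve_weight3. ring. }
  split.
  - assert (M := mellin_struve (fun y => cos (s * ln y)) (fun w => / (2 * w) * (cos (s * ln (2 * w)) * p + sin (s * ln (2 * w)) * q)) (/ 2 * ((c2 * p + d2 * q) * fst b - (c2 * q - d2 * p) * snd b)) ltac:(cont_by_derive) (fun y _ => Rabs_cos_le (s * ln y)) ltac:(cont_by_derive) G1).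
    replace (fst N) with (- / PI * (/ 2 * ((c2 * p + d2 * q) * fst b - (c2 * q - d2 * p) * snd b))).
    + refine (has_int_ext _ _ _ _ (has_int_scal _ (- / PI) _ (M _))).
      * intros y Hy. cbv beta. rewrite (struve_k_lap y Hy). ring.
      * eapply has_int_ext. 2: apply (has_int_scal _ (/ 2) _ (HB (c2 * p + d2 * q) (c2 * q - d2 * p))).
        intros w Hw. destruct (K w Hw) as (K1 & K2). cbv beta. rewrite K1, K2. field. lra.
    + unfold N, Cmult, RtoC. cbn [fst snd]. rewrite cos_neg, sin_neg. fold c2 d2 p q. field. lra.
  - assert (M := mellin_struve (fun y => sin (s * ln y)) (fun w => / (2 * w) * (cos (s * ln (2 * w)) * q - sin (s * ln (2 * w)) * p)) (/ 2 * ((c2 * q - d2 * p) * fst b - (- (d2 * q) - c2 * p) * snd b)) ltac:(cont_by_derive) (fun y _ => Rabs_sin_le (s * ln y)) ltac:(cont_by_derive) G2).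
    replace (snd N) with (- / PI * (/ 2 * ((c2 * q - d2 * p) * fst b - (- (d2 * q) - c2 * p) * snd b))).
    + refine (has_int_ext _ _ _ _ (has_int_scal _ (- / PI) _ (M _))).
      * intros y Hy. cbv beta. rewrite (struve_k_lap y Hy). ring.
      * eapply has_int_ext. 2: apply (has_int_scal _ (/ 2) _ (HB (c2 * q - d2 * p) (- (d2 * q) - c2 * p))).
        intros w Hw. destruct (K w Hw) as (K1 & K2). cbv beta. rewrite K1, K2. field. lra.
    + unfold N, Cmult, RtoC. cbn [fst snd]. rewrite cos_neg, sin_neg. fold c2 d2 p q. field. lra.
Qed.

(** * Bessel functions of imaginary order *)

Lemma CV_radius_fact (a : nat -> R) : (forall n, Rabs (a n) <= / INR (fact n)) -> CV_radius a = p_infty.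
Proof.
  intros H. apply Rbar_le_antisym. now destruct (CV_radius a).
  destruct (CV_radius_bounded a) as (Hub & _).
  assert (K : forall r, 0 <= r -> Rbar_le r (CV_radius a)).
  { intros r Hr. apply Hub. exists (exp r). intros n.
    rewrite Rabs_mult, <- RPow_abs, (Rabs_pos_eq r) by trivial.
    generalize (pow_exp_le n r Hr) (INR_fact_lt_0 n) (exp_pos (- r)) (exp_pos r) (pow_le r n Hr). intros H1 H2 H3 H4 H5.
    apply Rle_trans with (/ INR (fact n) * r ^ n). now apply Rmult_le_compat_r.
    assert (E : exp (- r) * exp r = 1) by (rewrite <- exp_plus, Rplus_opp_l; apply exp_0).
    apply Rle_trans with (/ INR (fact n) * (r ^ n * exp (- r)) * exp r).
    - apply Req_le. transitivity (/ INR (fact n) * r ^ n * (exp (- r) * exp r)). rewrite E; ring. ring.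
    - rewrite <- (Rmult_1_l (exp r)) at 2. apply Rmult_le_compat_r. lra.
      apply Rle_trans with (/ INR (fact n) * INR (fact n)). apply Rmult_le_compat_l; trivial. left; now apply Rinv_0_lt_compat.
      rewrite Rinv_l; lra. }
  destruct (CV_radius a) as [r| |]; simpl; trivial.
  - specialize (K (Rabs r + 1) ltac:(generalize (Rabs_pos r); lra)). simpl in K. generalize (Rle_abs r). lra.
  - exact (K 0 (Rle_refl 0)).
Qed.

(* Coefficients of [sum_k (-1)^k t^k / (k! (1 + i tau)_k)]. *)
Fixpoint bes_coef (tau : R) (k : nat) : C :=
  match k with
  | O => RtoC 1
  | S j => Copp (Cdiv (bes_coef tau j) (Cmult (RtoC (INR (S j))) (INR (S j), tau)))
  end.

Lemma bes_den_neq tau k : (INR (S k), tau) <> RtoC 0.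
Proof. intros E. injection E. intros _ H. apply (not_0_INR (S k)) in H; trivial. lia. Qed.

Lemma INR_S_neq k : RtoC (INR (S k)) <> RtoC 0.
Proof. intros E. injection E. intros H. apply (not_0_INR (S k)) in H; trivial. lia. Qed.

Lemma bes_coef_rec tau k : Cmult (RtoC (INR (S k))) (Cmult (INR (S k), tau) (bes_coef tau (S k))) = Copp (bes_coef tau k).
Proof.
  cbn [bes_coef]. field. split. apply bes_den_neq. apply INR_S_neq.
Qed.

Lemma bes_coef_bound tau k : Cmod (bes_coef tau k) <= / INR (fact k).
Proof.
  induction k as [|k IH].
  - simpl. rewrite Cmod_1, Rinv_1. lra.
  - assert (E := f_equal Cmod (bes_coef_rec tau k)). rewrite Cmod_opp, 2!Cmod_mult, Cmod_R in E.
    assert (HS : 1 <= INR (S k)) by (rewrite S_INR; generalize (pos_INR k); lra).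
    rewrite Rabs_pos_eq in E by lra.
    assert (H1 : 1 <= Cmod (INR (S k), tau)). { apply Rle_trans with (2 := Rabs_fst_le_Cmod _). cbn [fst]. rewrite Rabs_pos_eq; lra. }
    assert (P := Cmod_ge_0 (bes_coef tau (S k))). assert (Hf := INR_fact_lt_0 k).
    change (fact (S k)) with ((S k) * fact k)%nat. rewrite mult_INR, Rinv_mult.
    apply Rmult_le_reg_l with (INR (S k)). lra.
    rewrite <- Rmult_assoc, Rinv_r, Rmult_1_l by lra.
    apply Rle_trans with (2 := IH). rewrite <- E. apply Rmult_le_compat_l. lra. nra.
Qed.

Definition bes_re tau k := fst (bes_coef tau k).
Definition bes_im tau k := snd (bes_coef tau k).

Lemma bes_rec_re tau k : INR (S k) * (INR (S k) * bes_re tau (S k) - tau * bes_im tau (S k)) = - bes_re tau k.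
Proof.
  assert (E := f_equal fst (bes_coef_rec tau k)). unfold bes_re, bes_im. unfold Cmult, RtoC, Copp in E. cbn [fst snd] in E. rewrite <- E. ring.
Qed.

Lemma bes_rec_im tau k : INR (S k) * (INR (S k) * bes_im tau (S k) + tau * bes_re tau (S k)) = - bes_im tau k.
Proof.
  assert (E := f_equal snd (bes_coef_rec tau k)). unfold bes_re, bes_im. unfold Cmult, RtoC, Copp in E. cbn [fst snd] in E. rewrite <- E. ring.
Qed.

Lemma bes_re_radius tau : CV_radius (bes_re tau) = p_infty.
Proof. apply CV_radius_fact. intros n. apply Rle_trans with (2 := bes_coef_bound tau n). apply Rabs_fst_le_Cmod. Qed.

Lemma bes_im_radius tau : CV_radius (bes_im tau) = p_infty.
Proof. apply CV_radius_fact. intros n. apply Rle_trans with (2 := bes_coef_bound tau n). apply Rabs_snd_le_Cmod. Qed.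

(** One real component of the equation t F'' + (1 + i tau) F' + F = 0. It is stated for an arbitrary
    pair of sequences: exchanging them and changing the sign of tau yields the other component. *)
Lemma PSeries_lin_ode (a b : nat -> R) tau t : CV_radius a = p_infty -> CV_radius b = p_infty ->
  (forall k, INR (S k) * (INR (S k) * a (S k) - tau * b (S k)) = - a k) ->
  t * PSeries (PS_derive (PS_derive a)) t + PSeries (PS_derive a) t - tau * PSeries (PS_derive b) t = - PSeries a t.
Proof.
  intros Ha Hb H.
  assert (X : forall c x, CV_radius c = p_infty -> ex_pseries c x).
  { intros c x Hc. apply CV_radius_inside. rewrite Hc. exact I. }
  assert (Xa : CV_radius (PS_derive a) = p_infty) by now rewrite CV_radius_derive.
  assert (Xb : CV_radius (PS_derive b) = p_infty) by now rewrite CV_radius_derive.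
  assert (Xaa : CV_radius (PS_derive (PS_derive a)) = p_infty) by now rewrite CV_radius_derive.
  rewrite <- PSeries_incr_1.
  rewrite <- PSeries_scal.
  rewrite <- PSeries_plus.
  2: { apply ex_pseries_incr_1. now apply X. } 2: now apply X.
  rewrite <- PSeries_minus.
  2: { apply (ex_pseries_plus (K := R_AbsRing) (V := R_NormedModule)). apply ex_pseries_incr_1. now apply X. now apply X. }
  2: { apply (ex_pseries_scal (K := R_AbsRing) (V := R_NormedModule)). apply Rmult_comm. now apply X. }
  rewrite <- PSeries_opp. apply PSeries_ext. intros n.
  unfold PS_minus, PS_plus, PS_opp, PS_scal, PS_incr_1, PS_derive.
  rewrite <- H. destruct n as [|n].
  - unfold minus, plus, opp, scal, zero; cbn -[INR]; unfold mult; cbn -[INR]. change (INR 1) with 1. ring.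
  - unfold minus, plus, opp, scal; cbn -[INR]; unfold mult; cbn -[INR]. rewrite !(S_INR (S n)). ring.
Qed.

Lemma PSeries_is_derive (a : nat -> R) t : CV_radius a = p_infty -> is_derive (PSeries a) t (PSeries (PS_derive a) t).
Proof. intros Ha. apply is_derive_PSeries. rewrite Ha. exact I. Qed.

Lemma PSeries_at_0 (a : nat -> R) : PSeries a 0 = a 0%nat.
Proof. apply PSeries_0. Qed.

Lemma linear_near_0 (f g : R -> R) : (forall t, is_derive f t (g t)) -> (forall t, continuous g t) ->
  exists C, 0 <= C /\ forall t, 0 <= t <= 1 -> Rabs (g t) <= C /\ Rabs (f t - f 0) <= C * t.
Proof.
  intros Hf Hg.
  destruct (continuity_ab_maj (fun t => Rabs (g t)) 0 1) as (m & Hm & _). lra.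
  { intros c _. apply continuity_pt_filterlim. apply (continuous_comp g Rabs). apply Hg. apply continuous_Rabs. }
  exists (Rabs (g m)). split. apply Rabs_pos. intros t Ht. split. apply Hm; lra.
  destruct (MVT_gen f 0 t g) as (c & Hc & E).
  - intros x _. apply Hf.
  - intros x _. apply continuity_pt_filterlim. apply (cont_of_derive f x _ (Hf x)).
  - rewrite E, Rabs_mult, Rminus_0_r, (Rabs_pos_eq t) by lra. apply Rmult_le_compat_r. lra. apply Hm.
    rewrite Rmin_left, Rmax_right in Hc by lra. lra.
Qed.

Lemma is_series_C (a : nat -> C) (l : C) :
  is_series (fun n => fst (a n)) (fst l) -> is_series (fun n => snd (a n)) (snd l) ->
  @is_series R_AbsRing C_R_NormedModule a l.
Proof.
  intros H1 H2. unfold is_series.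
  apply filterlim_ext with (fun n => (sum_n (fun k => fst (a k)) n, sum_n (fun k => snd (a k)) n)).
  - intros n. induction n as [|n IH].
    + rewrite !sum_O. symmetry. apply surjective_pairing.
    + rewrite !sum_Sn, <- IH. rewrite (surjective_pairing (a (S n))). reflexivity.
  - rewrite (surjective_pairing l). intros P [e He].
    change (eventually (fun n => P (sum_n (fun k => fst (a k)) n, sum_n (fun k => snd (a k)) n))).
    apply (filter_imp (F := eventually) (fun n => ball (fst l) e (sum_n (fun k => fst (a k)) n) /\ ball (snd l) e (sum_n (fun k => snd (a k)) n))).
    + intros n (K1 & K2). apply He. split; assumption.
    + apply filter_and. exact (H1 _ (locally_ball (fst l) e)). exact (H2 _ (locally_ball (snd l) e)).
Qed.

Lemma CSeries_unique (a : nat -> C) (l : C) : @is_series R_AbsRing C_R_NormedModule a l -> CSeries a = l.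
Proof.
  intros H. apply (iota_unique (V := C_R_CompleteNormedModule)); trivial.
  intros y Hy. exact (filterlim_locally_unique (V := C_R_NormedModule) _ _ _ Hy H).
Qed.

(** Identifies the coefficient (-1)^k / (k! Gamma(k + 1 + i tau)) of the Bessel series: the value
    Gamma(1 + i tau) = z factors out of all terms, and the rest satisfies the recursion of
    [bes_coef]. *)
Lemma bes_coef_prod tau (z : C) k : z <> 0%C ->
  Cmult (RtoC ((-1) ^ k)) (Cinv (Cmult (RtoC (INR (fact k))) (Cmult (RtoC (INR (fact k))) (prodC (fun j => tau / INR (S j)) z k)))) = Cmult (Cinv z) (bes_coef tau k).
Proof.
  intros Hz.
  assert (Hp : forall k, prodC (fun j => tau / INR (S j)) z k <> 0%C).
  { intros j E. apply Hz. apply Cmod_eq_0. generalize (Cmod_prodC_ge (fun j => tau / INR (S j)) z j) (Cmod_ge_0 z). rewrite E, Cmod_0. lra. }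
  assert (Hf : forall k, RtoC (INR (fact k)) <> 0%C). { intros j E. injection E. apply INR_fact_neq_0. }
  induction k as [|k IH].
  - simpl. field. trivial.
  - assert (E : bes_coef tau k = Cmult z (Cmult (RtoC ((-1) ^ k)) (Cinv (Cmult (RtoC (INR (fact k))) (Cmult (RtoC (INR (fact k))) (prodC (fun j => tau / INR (S j)) z k)))))).
    { rewrite IH. field. trivial. }
    cbn [bes_coef]. rewrite E.
    change (fact (S k)) with ((S k) * fact k)%nat. rewrite mult_INR, RtoC_mult.
    assert (HS := INR_S_neq k). assert (HD := bes_den_neq tau k).
    cbn [prodC pow]. rewrite RtoC_mult.
    replace ((INR (S k), tau) : C) with (Cmult (RtoC (INR (S k))) (1, tau / INR (S k))) in *.
    2: { assert (INR (S k) <> 0) by (apply not_0_INR; lia). unfold Cmult, RtoC; cbn [fst snd]. f_equal; field; trivial. }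
    assert (H1 : ((1, tau / INR (S k)) : C) <> 0%C). { intros E1. injection E1. lra. }
    replace (RtoC (-1)) with (Copp (RtoC 1)) by (unfold Copp, RtoC; simpl; f_equal; ring).
    set (f := RtoC (INR (fact k))) in *. set (s := RtoC (INR (S k))) in *.
    field. repeat split; trivial; try apply Hp; apply Hf.
Qed.

Lemma BesselJ_series tau z x : gam 0 tau z -> 0 < x ->
  BesselJ (0, tau) x = Cmult (Cmult (Cinv z) (cos (tau * ln (x / 2)), sin (tau * ln (x / 2))))
    (PSeries (bes_re tau) (x * x / 4), PSeries (bes_im tau) (x * x / 4)).
Proof.
  intros Hz Hx. assert (Hz0 := gam_neq_0 _ _ Hz).
  set (t := x * x / 4). set (c := Cmult (Cinv z) (cos (tau * ln (x / 2)), sin (tau * ln (x / 2)))).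
  unfold BesselJ. apply CSeries_unique.
  assert (E : forall k, Cdiv (Cmult (RtoC ((-1) ^ k)) (cpow (x / 2) (Cplus (RtoC (2 * INR k)) (0, tau))))
     (Cmult (RtoC (INR (fact k))) (CGamma (Cplus (RtoC (INR k + 1)) (0, tau)))) = Cmult c (t ^ k * bes_re tau k, t ^ k * bes_im tau k)).
  { intros k. rewrite (gam_CGamma k tau _ (gam_prod _ _ k Hz)).
    assert (Ec : cpow (x / 2) (Cplus (RtoC (2 * INR k)) (0, tau)) = Cmult (RtoC (t ^ k)) (cos (tau * ln (x / 2)), sin (tau * ln (x / 2)))).
    { unfold cpow, cexp.
      assert (E1 : Cmult (Cplus (RtoC (2 * INR k)) (0, tau)) (RtoC (ln (x / 2))) = (INR k * (2 * ln (x / 2)), tau * ln (x / 2))).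
      { unfold Cmult, Cplus, RtoC; simpl. f_equal; ring. }
      rewrite E1. unfold Re, Im. cbn [fst snd].
      replace (exp (INR k * (2 * ln (x / 2)))) with (t ^ k).
      unfold Cmult, RtoC; cbn [fst snd]. f_equal; ring.
      replace (2 * ln (x / 2)) with (ln t). rewrite <- (Rpower_pow k t). reflexivity. unfold t; nra.
      unfold t. replace (x * x / 4) with (x / 2 * (x / 2)) by field. rewrite ln_mult by lra. ring. }
    rewrite Ec. unfold Cdiv.
    transitivity (Cmult (Cmult (RtoC (t ^ k)) (cos (tau * ln (x / 2)), sin (tau * ln (x / 2)))) (Cmult (RtoC ((-1) ^ k)) (Cinv (Cmult (RtoC (INR (fact k))) (Cmult (RtoC (INR (fact k))) (prodC (fun j => tau / INR (S j)) z k)))))). ring.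
    rewrite bes_coef_prod by trivial. unfold c.
    replace ((t ^ k * bes_re tau k, t ^ k * bes_im tau k) : C) with (Cmult (RtoC (t ^ k)) (bes_coef tau k)). ring.
    rewrite (surjective_pairing (bes_coef tau k)). unfold bes_re, bes_im, Cmult, RtoC; cbn [fst snd]. f_equal; ring. }
  assert (S1 : forall a, CV_radius a = p_infty -> is_series (fun k => t ^ k * a k) (PSeries a t)).
  { intros a Ha. apply is_series_ext with (fun k => a k * t ^ k). intros; apply Rmult_comm. apply is_pseries_R. apply PSeries_correct. apply CV_radius_inside. rewrite Ha. exact I. }
  assert (Sr := S1 _ (bes_re_radius tau)). assert (Si := S1 _ (bes_im_radius tau)).
  apply is_series_C.
  - apply is_series_ext with (fun k => fst c * (t ^ k * bes_re tau k) - snd c * (t ^ k * bes_im tau k)).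
    intros k. rewrite E. reflexivity.
    apply (is_series_minus (V := R_NormedModule)); apply (is_series_scal (V := R_NormedModule)); trivial.
  - apply is_series_ext with (fun k => fst c * (t ^ k * bes_im tau k) + snd c * (t ^ k * bes_re tau k)).
    intros k. rewrite E. reflexivity.
    apply (is_series_plus (V := R_NormedModule)); apply (is_series_scal (V := R_NormedModule)); trivial.
Qed.

(* [bessel_pair tau c Jr Ji Dr Di]: J = Jr + i Ji solves Bessel's equation of order i tau, D = x J', and J ~ c (x/2)^(i tau) at 0. *)
Record bessel_pair (tau : R) (c : C) (Jr Ji Dr Di : R -> R) : Prop := {
  bp_Jr : forall x, 0 < x -> is_derive Jr x (Dr x / x);
  bp_Ji : forall x, 0 < x -> is_derive Ji x (Di x / x);
  bp_Dr : forall x, 0 < x -> is_derive Dr x (- (tau * tau + x * x) * Jr x / x);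
  bp_Di : forall x, 0 < x -> is_derive Di x (- (tau * tau + x * x) * Ji x / x);
  bp_near : exists K, 0 <= K /\ forall x, 0 < x < 1 ->
    Rabs (Jr x - (fst c * cos (tau * ln (x / 2)) - snd c * sin (tau * ln (x / 2)))) <= K * (x * x) /\
    Rabs (Ji x - (fst c * sin (tau * ln (x / 2)) + snd c * cos (tau * ln (x / 2)))) <= K * (x * x) /\
    Rabs (Dr x + tau * Ji x) <= K * (x * x) /\ Rabs (Di x - tau * Jr x) <= K * (x * x)
}.

Lemma bessel_pair_ex tau z : gam 0 tau z -> exists Jr Ji Dr Di, bessel_pair tau (Cinv z) Jr Ji Dr Di /\
  forall x, 0 < x -> BesselJ (0, tau) x = (Jr x, Ji x).
Proof.
  intros Hz. set (c := Cinv z). set (p := fst c). set (q := snd c).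
  set (P := PSeries (bes_re tau)). set (Q := PSeries (bes_im tau)).
  set (P1 := PSeries (PS_derive (bes_re tau))). set (Q1 := PSeries (PS_derive (bes_im tau))).
  set (P2 := PSeries (PS_derive (PS_derive (bes_re tau)))). set (Q2 := PSeries (PS_derive (PS_derive (bes_im tau)))).
  assert (Rr := bes_re_radius tau). assert (Ri := bes_im_radius tau).
  assert (Rr1 : CV_radius (PS_derive (bes_re tau)) = p_infty) by now rewrite CV_radius_derive.
  assert (Ri1 : CV_radius (PS_derive (bes_im tau)) = p_infty) by now rewrite CV_radius_derive.
  assert (DP : forall t, is_derive P t (P1 t)) by (intros; now apply PSeries_is_derive).
  assert (DQ : forall t, is_derive Q t (Q1 t)) by (intros; now apply PSeries_is_derive).
  assert (DP1 : forall t, is_derive P1 t (P2 t)) by (intros; now apply PSeries_is_derive).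
  assert (DQ1 : forall t, is_derive Q1 t (Q2 t)) by (intros; now apply PSeries_is_derive).
  assert (O1 : forall t, t * P2 t + P1 t - tau * Q1 t = - P t).
  { intros t. apply PSeries_lin_ode; trivial. apply bes_rec_re. }
  assert (O2 : forall t, t * Q2 t + Q1 t + tau * P1 t = - Q t).
  { intros t. generalize (PSeries_lin_ode (bes_im tau) (bes_re tau) (- tau) t Ri Rr). intros K.
    fold Q P Q1 P1 Q2 in K. rewrite <- K. ring. intros k. rewrite <- bes_rec_im. ring. }
  (* e (u + i v), with e = c (x/2)^(i tau) *)
  set (er := fun x => p * cos (tau * ln (x / 2)) - q * sin (tau * ln (x / 2))).
  set (ei := fun x => p * sin (tau * ln (x / 2)) + q * cos (tau * ln (x / 2))).
  assert (Der : forall x, 0 < x -> is_derive er x (- tau * ei x / x)).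
  { intros x Hx. unfold er, ei. auto_derive. repeat split; lra. unfold Rdiv. field. lra. }
  assert (Dei : forall x, 0 < x -> is_derive ei x (tau * er x / x)).
  { intros x Hx. unfold er, ei. auto_derive. repeat split; lra. unfold Rdiv. field. lra. }
  set (sq := fun x : R => x * x / 4).
  assert (Cmp : forall f df x, is_derive f (sq x) df -> is_derive (fun x => f (sq x)) x (x / 2 * df)).
  { intros f df x H. apply (is_derive_comp f sq x df (x / 2)); trivial. unfold sq. auto_derive. trivial. field. }
  assert (Mul : forall f g df dg x, is_derive f x df -> is_derive g x dg -> is_derive (fun x => f x * g x) x (df * g x + f x * dg)).
  { intros f g df dg x Hf Hg. apply (is_derive_mult f g); trivial. intros; apply Rmult_comm. }
  set (U := fun x => P (sq x)). set (V := fun x => Q (sq x)).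
  (* theta (u + i v) = 2 t (P1 + i Q1) *)
  set (U1 := fun x => 2 * sq x * P1 (sq x)). set (V1 := fun x => 2 * sq x * Q1 (sq x)).
  assert (DU : forall x, 0 < x -> is_derive U x (U1 x / x)).
  { intros x Hx. replace (U1 x / x) with (x / 2 * P1 (sq x)). apply Cmp. apply DP. unfold U1, sq. field. lra. }
  assert (DV : forall x, 0 < x -> is_derive V x (V1 x / x)).
  { intros x Hx. replace (V1 x / x) with (x / 2 * Q1 (sq x)). apply Cmp. apply DQ. unfold V1, sq. field. lra. }
  assert (Dsq : forall x, is_derive (fun x => 2 * sq x) x x).
  { intros x. unfold sq. auto_derive. trivial. field. }
  assert (DU1 : forall x, 0 < x -> is_derive U1 x ((2 * tau * V1 x - x * x * U x) / x)).
  { intros x Hx. evar_last. unfold U1. apply (Mul (fun x => 2 * sq x) (fun x => P1 (sq x))). apply Dsq. apply Cmp. apply DP1.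
    cbv beta. generalize (O1 (sq x)). intros E. unfold V1, U.
    replace (P (sq x)) with (- (sq x * P2 (sq x) + P1 (sq x) - tau * Q1 (sq x))) by lra.
    unfold sq. field. lra. }
  assert (DV1 : forall x, 0 < x -> is_derive V1 x ((- 2 * tau * U1 x - x * x * V x) / x)).
  { intros x Hx. evar_last. unfold V1. apply (Mul (fun x => 2 * sq x) (fun x => Q1 (sq x))). apply Dsq. apply Cmp. apply DQ1.
    cbv beta. generalize (O2 (sq x)). intros E. unfold U1, V.
    replace (Q (sq x)) with (- (sq x * Q2 (sq x) + Q1 (sq x) + tau * P1 (sq x))) by lra.
    unfold sq. field. lra. }
  set (Jr := fun x => er x * U x - ei x * V x). set (Ji := fun x => er x * V x + ei x * U x).
  (* With e = c (x/2)^(i tau) and theta = x d/dx one has theta (e F) = e (theta + i tau) F, so that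
     D = e (A + i B). *)
  set (A := fun x => U1 x - tau * V x). set (B := fun x => V1 x + tau * U x).
  set (Dr := fun x => er x * A x - ei x * B x). set (Di := fun x => er x * B x + ei x * A x).
  assert (DA : forall x, 0 < x -> is_derive A x ((tau * V1 x - x * x * U x) / x)).
  { intros x Hx. evar_last. apply (is_derive_minus U1 (fun x => tau * V x)). now apply DU1. apply is_derive_scal. now apply DV.
    unfold minus, plus, opp; simpl. field. lra. }
  assert (DB : forall x, 0 < x -> is_derive B x ((- tau * U1 x - x * x * V x) / x)).
  { intros x Hx. evar_last. apply (is_derive_plus V1 (fun x => tau * U x)). now apply DV1. apply is_derive_scal. now apply DU.
    unfold plus; simpl. field. lra. }
  exists Jr, Ji, Dr, Di. split. split.
  - intros x Hx. evar_last. apply (is_derive_minus (fun x => er x * U x) (fun x => ei x * V x)); apply Mul; auto.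
    unfold minus, plus, opp; simpl. unfold Dr, A, B. field. lra.
  - intros x Hx. evar_last. apply (is_derive_plus (fun x => er x * V x) (fun x => ei x * U x)); apply Mul; auto.
    unfold plus; simpl. unfold Di, A, B. field. lra.
  - intros x Hx. evar_last. apply (is_derive_minus (fun x => er x * A x) (fun x => ei x * B x)); apply Mul; auto.
    unfold minus, plus, opp; simpl. unfold Jr, A, B. field. lra.
  - intros x Hx. evar_last. apply (is_derive_plus (fun x => er x * B x) (fun x => ei x * A x)); apply Mul; auto.
    unfold plus; simpl. unfold Ji, A, B. field. lra.
  - destruct (linear_near_0 P P1 DP (fun t => cont_of_derive _ _ _ (DP1 t))) as (K1 & HK1 & H1).
    destruct (linear_near_0 Q Q1 DQ (fun t => cont_of_derive _ _ _ (DQ1 t))) as (K2 & HK2 & H2).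
    assert (P0 : P 0 = 1). { unfold P. rewrite PSeries_at_0. reflexivity. }
    assert (Q0 : Q 0 = 0). { unfold Q. rewrite PSeries_at_0. reflexivity. }
    set (M := Rabs p + Rabs q). assert (HM : 0 <= M) by (unfold M; generalize (Rabs_pos p) (Rabs_pos q); lra).
    assert (Br : forall x, Rabs (er x) <= M).
    { intros x. unfold er, M, Rminus. eapply Rle_trans. apply Rabs_triang. rewrite Rabs_Ropp, 2!Rabs_mult.
      apply Rplus_le_compat; (rewrite <- Rmult_1_r; apply Rmult_le_compat); try apply Rabs_pos; try lra; try apply Rabs_cos_le; try apply Rabs_sin_le. }
    assert (Bi : forall x, Rabs (ei x) <= M).
    { intros x. unfold ei, M. eapply Rle_trans. apply Rabs_triang. rewrite 2!Rabs_mult.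
      apply Rplus_le_compat; (rewrite <- Rmult_1_r; apply Rmult_le_compat); try apply Rabs_pos; try lra; try apply Rabs_cos_le; try apply Rabs_sin_le. }
    assert (Comb : forall x a b s, Rabs a <= s -> Rabs b <= s -> Rabs (er x * a - ei x * b) <= 2 * M * s /\ Rabs (er x * a + ei x * b) <= 2 * M * s).
    { intros x a b s Ha Hb. assert (G1 : Rabs (er x * a) <= M * s) by (rewrite Rabs_mult; apply Rmult_le_compat; try apply Rabs_pos; auto).
      assert (G2 : Rabs (ei x * b) <= M * s) by (rewrite Rabs_mult; apply Rmult_le_compat; try apply Rabs_pos; auto).
      split. unfold Rminus. eapply Rle_trans. apply Rabs_triang. rewrite Rabs_Ropp. lra. eapply Rle_trans. apply Rabs_triang. lra. }
    set (K := K1 + K2).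
    exists (2 * M * K). split. unfold K. nra.
    intros x Hx. assert (Ht : 0 <= sq x <= 1) by (unfold sq; nra). assert (Ht2 : sq x <= x * x / 2) by (unfold sq; nra).
    assert (Hxx : 0 <= x * x) by nra.
    destruct (H1 (sq x) Ht) as (N1 & N2). destruct (H2 (sq x) Ht) as (N3 & N4). rewrite P0 in N2. rewrite Q0, Rminus_0_r in N4.
    assert (Es : sq x = x * x / 4) by reflexivity.
    assert (BU : Rabs (U x - 1) <= K * (x * x)). { apply Rle_trans with (1 := N2). unfold K. nra. }
    assert (BV : Rabs (V x) <= K * (x * x)). { apply Rle_trans with (1 := N4). unfold K. nra. }
    assert (BU1 : Rabs (U1 x) <= K * (x * x)).
    { unfold U1. rewrite Rabs_mult, (Rabs_pos_eq (2 * sq x)) by lra. apply Rle_trans with (2 * sq x * K1). apply Rmult_le_compat_l; lra. unfold K. rewrite Es. nra. }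
    assert (BV1 : Rabs (V1 x) <= K * (x * x)).
    { unfold V1. rewrite Rabs_mult, (Rabs_pos_eq (2 * sq x)) by lra. apply Rle_trans with (2 * sq x * K2). apply Rmult_le_compat_l; lra. unfold K. rewrite Es. nra. }
    replace (2 * M * K * (x * x)) with (2 * M * (K * (x * x))) by ring.
    repeat split.
    + replace (Jr x - _) with (er x * (U x - 1) - ei x * V x) by (unfold Jr, er, p, q; ring). now apply Comb.
    + replace (Ji x - _) with (er x * V x + ei x * (U x - 1)) by (unfold Ji, ei, p, q; ring). now apply Comb.
    + replace (Dr x + tau * Ji x) with (er x * U1 x - ei x * V1 x) by (unfold Dr, A, B, Ji; ring). now apply Comb.
    + replace (Di x - tau * Jr x) with (er x * V1 x + ei x * U1 x) by (unfold Di, A, B, Jr; ring). now apply Comb.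
  - intros x Hx. rewrite (BesselJ_series tau z x Hz Hx). fold P Q c. change (x * x / 4) with (sq x). unfold Jr, Ji, er, ei, U, V, p, q.
    destruct c as (c1, c2). unfold Cmult. cbn [fst snd]. f_equal; ring.
Qed.

(** * The square of the Bessel function *)

Lemma nonpos_derive_le (F f : R -> R) a b : a <= b ->
  (forall x, a <= x <= b -> is_derive F x (f x)) -> (forall x, a <= x <= b -> f x <= 0) -> F b <= F a.
Proof.
  intros Hab HF Hf.
  assert (K : - F a <= - F b).
  { apply (nonneg_derive_le (fun x => - F x) (fun x => - f x) a b Hab).
    intros x Hx. apply (is_derive_opp F). now apply HF. intros x Hx. specialize (Hf x Hx). lra. }
  lra.
Qed.

(* The energy of [sqrt x J], written in terms of J and D = x J'. *)
Lemma bessel_energy tau (J D : R -> R) :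
  (forall x, 0 < x -> is_derive J x (D x / x)) ->
  (forall x, 0 < x -> is_derive D x (- (tau * tau + x * x) * J x / x)) ->
  exists C, 0 <= C /\ forall x, 1 <= x -> x * (J x * J x) <= C /\ D x * D x <= C * x.
Proof.
  intros HJ HD.
  (* The function y = sqrt x J solves y'' + (1 + b/x^2) y = 0. The energy N = y'^2 + (1 + b/x^2) y^2
     has derivative -2b y^2/x^3, hence is nonincreasing; here y' = (D + J/2) / sqrt x. *)
  set (b := 1 / 4 + tau * tau). assert (Hb : 0 < b) by (unfold b; nra).
  set (N := fun x => x * (J x * J x) * (1 + b / (x * x)) + (D x + J x / 2) * (D x + J x / 2) / x).
  assert (DN : forall x, 0 < x -> is_derive N x (- 2 * b * (J x * J x) / (x * x))).
  { intros x Hx.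
    assert (Mul : forall (f g : R -> R) (df dg : R), is_derive f x df -> is_derive g x dg -> is_derive (fun x => f x * g x) x (df * g x + f x * dg)).
    { intros f g df dg Hf Hg. apply (is_derive_mult f g); trivial. intros; apply Rmult_comm. }
    assert (DH : is_derive (fun x => D x + J x / 2) x (- (tau * tau + x * x) * J x / x + D x / x / 2)).
    { apply (is_derive_plus D (fun x => J x / 2)). now apply HD.
      apply is_derive_ext with (fun x => / 2 * J x). intros t. unfold Rdiv. apply Rmult_comm.
      replace (D x / x / 2) with (/ 2 * (D x / x)) by (unfold Rdiv; ring). apply is_derive_scal. now apply HJ. }
    evar_last.
    - apply (is_derive_plus (fun x => x * (J x * J x) * (1 + b / (x * x))) (fun x => (D x + J x / 2) * (D x + J x / 2) / x)).
      + eapply (Mul (fun x => x * (J x * J x)) (fun x => 1 + b / (x * x)) _ (- 2 * b / (x * x * x))).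
        * eapply (Mul (fun x => x) (fun x => J x * J x) 1). apply (is_derive_id (K := R_AbsRing)). apply Mul; now apply HJ.
        * auto_derive. nra. field. lra.
      + eapply (Mul (fun x => (D x + J x / 2) * (D x + J x / 2)) (fun x => / x) _ (- / (x * x))).
        * apply Mul; exact DH.
        * auto_derive. lra. field. lra.
    - unfold plus; simpl. unfold b. field. lra. }
  assert (HN : forall x, 1 <= x -> N x <= N 1).
  { intros x Hx. apply (nonpos_derive_le N (fun x => - 2 * b * (J x * J x) / (x * x))); trivial.
    - intros y Hy. apply DN. lra.
    - intros y Hy. assert (0 <= b * (J y * J y) / (y * y)). { apply Rdiv_le_0_compat. assert (0 <= J y * J y) by nra. nra. nra. }
      unfold Rdiv in *. nra. }
  assert (HN1 : 0 <= N 1).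
  { unfold N. apply Rplus_le_le_0_compat.
    - apply Rmult_le_pos. generalize (Rle_0_sqr (J 1)). unfold Rsqr. lra. assert (0 <= b / (1 * 1)) by (apply Rdiv_le_0_compat; lra). lra.
    - apply Rdiv_le_0_compat. apply Rle_0_sqr. lra. }
  exists (3 * N 1). split. lra. intros x Hx. specialize (HN x Hx). unfold N at 1 in HN.
  assert (P1 : 0 <= J x * J x) by nra. assert (P2 : 0 <= (D x + J x / 2) * (D x + J x / 2)) by (generalize (Rle_0_sqr (D x + J x / 2)); unfold Rsqr; trivial).
  assert (P3 : 0 <= b / (x * x)) by (apply Rdiv_le_0_compat; nra).
  assert (P4 : 0 <= (D x + J x / 2) * (D x + J x / 2) / x) by (apply Rdiv_le_0_compat; lra).
  assert (P5 : 0 <= x * (J x * J x)) by nra.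
  assert (A1 : x * (J x * J x) <= N 1) by nra.
  assert (A2 : (D x + J x / 2) * (D x + J x / 2) / x <= N 1) by nra.
  apply Rle_div_l in A2; [|lra].
  split. lra.
  assert (A3 : J x * J x <= N 1 * x) by nra.
  generalize (Rle_0_sqr (D x + J x)). unfold Rsqr. nra.
Qed.

(* W = Im J^2, T = x W', and S = Im (2 D^2 + 2 tau^2 J^2): a closed linear system. *)
Record sq_sol (tau : R) (W T S : R -> R) (C : R) : Prop := {
  ss_W : forall x, 0 < x -> is_derive W x (T x / x);
  ss_T : forall x, 0 < x -> is_derive T x ((S x - 4 * (tau * tau) * W x - 2 * (x * x) * W x) / x);
  ss_S : forall x, 0 < x -> is_derive S x (- 2 * x * T x);
  ss_C : 0 <= C;
  ss_Wb : forall x, 0 < x -> Rabs (W x) <= C;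
  ss_Tb : forall x, 0 < x -> Rabs (T x) <= C;
  ss_S0 : forall x, 0 < x < 1 -> Rabs (S x) <= C * (x * x);
  ss_Winf : forall x, 1 <= x -> Rabs (x * W x) <= C;
  ss_Sinf : forall x, 1 <= x -> Rabs ((S x + 2 * (x * x) * W x) / x) <= C
}.

Lemma Rabs_mult_le_sq a b A : a * a <= A -> b * b <= A -> Rabs (a * b) <= A.
Proof.
  intros Ha Hb. apply Rabs_le. generalize (Rle_0_sqr (a + b)) (Rle_0_sqr (a - b)). unfold Rsqr. nra.
Qed.

(** The differential relations follow by squaring Bessel's equation. Bounds on (0, 1) come from the
    behaviour of J at 0, bounds on [1, oo) from the energy: J^2 = O(1/x), D^2 = O(x), so J D stays
    bounded. *)
Lemma bessel_sq tau c Jr Ji Dr Di : bessel_pair tau c Jr Ji Dr Di ->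
  exists C, sq_sol tau (fun x => 2 * Jr x * Ji x) (fun x => 2 * (Jr x * Di x + Ji x * Dr x)) (fun x => 4 * Dr x * Di x + 4 * (tau * tau) * (Jr x * Ji x)) C
   /\ forall x, 0 < x -> Rabs (2 * Jr x * Ji x - snd (Cmult (Cmult c c) (cos (2 * tau * ln (x / 2)), sin (2 * tau * ln (x / 2))))) <= C * (x * x) / (1 + x * x).
Proof.
  intros [H1 H2 H3 H4 (K & HK & HN)].
  destruct (bessel_energy tau Jr Dr H1 H3) as (C1 & HC1 & E1).
  destruct (bessel_energy tau Ji Di H2 H4) as (C2 & HC2 & E2).
  set (A := C1 + C2). assert (HA : 0 <= A) by (unfold A; lra).
  assert (EE : forall x, 1 <= x -> Jr x * Jr x <= A / x /\ Ji x * Ji x <= A / x /\ Dr x * Dr x <= A * x /\ Di x * Di x <= A * x).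
  { intros x Hx. destruct (E1 x Hx) as (a1 & a2). destruct (E2 x Hx) as (b1 & b2). unfold A.
    repeat split; try (apply le_div; nra); nra. }
  set (p := fst c) in *. set (q := snd c) in *.
  set (er := fun x => p * cos (tau * ln (x / 2)) - q * sin (tau * ln (x / 2))) in *.
  set (ei := fun x => p * sin (tau * ln (x / 2)) + q * cos (tau * ln (x / 2))) in *.
  set (M := Rabs p + Rabs q). assert (HM : 0 <= M) by (unfold M; generalize (Rabs_pos p) (Rabs_pos q); lra).
  assert (Br : forall x, Rabs (er x) <= M).
  { intros x. unfold er, M, Rminus. eapply Rle_trans. apply Rabs_triang. rewrite Rabs_Ropp, 2!Rabs_mult.
    apply Rplus_le_compat; (rewrite <- Rmult_1_r; apply Rmult_le_compat); try apply Rabs_pos; try lra; try apply Rabs_cos_le; try apply Rabs_sin_le. }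
  assert (Bi : forall x, Rabs (ei x) <= M).
  { intros x. unfold ei, M. eapply Rle_trans. apply Rabs_triang. rewrite 2!Rabs_mult.
    apply Rplus_le_compat; (rewrite <- Rmult_1_r; apply Rmult_le_compat); try apply Rabs_pos; try lra; try apply Rabs_cos_le; try apply Rabs_sin_le. }
  set (B := M + K + Rabs tau * (M + K) + K).
  assert (Ht := Rabs_pos tau).
  assert (NB : forall x, 0 < x < 1 -> Rabs (Jr x) <= M + K /\ Rabs (Ji x) <= M + K /\ Rabs (Dr x) <= B /\ Rabs (Di x) <= B).
  { intros x Hx. destruct (HN x Hx) as (N1 & N2 & N3 & N4). assert (Hxx : 0 <= x * x <= 1) by nra.
    fold (er x) in N1. fold (ei x) in N2.
    assert (KK : K * (x * x) <= K) by nra.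
    assert (J1 : Rabs (Jr x) <= M + K). { replace (Jr x) with (er x + (Jr x - er x)) by ring. eapply Rle_trans. apply Rabs_triang. generalize (Br x). lra. }
    assert (J2 : Rabs (Ji x) <= M + K). { replace (Ji x) with (ei x + (Ji x - ei x)) by ring. eapply Rle_trans. apply Rabs_triang. generalize (Bi x). lra. }
    assert (0 <= M + K) by lra.
    assert (Hm : 0 <= Rabs tau * (M + K)) by nra.
    split; trivial. split; trivial. split.
    - replace (Dr x) with ((Dr x + tau * Ji x) + - (tau * Ji x)) by ring. eapply Rle_trans. apply Rabs_triang. rewrite Rabs_Ropp, Rabs_mult.
      assert (Rabs tau * Rabs (Ji x) <= Rabs tau * (M + K)) by (apply Rmult_le_compat_l; trivial). unfold B. lra.
    - replace (Di x) with ((Di x - tau * Jr x) + tau * Jr x) by ring. eapply Rle_trans. apply Rabs_triang. rewrite Rabs_mult.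
      assert (Rabs tau * Rabs (Jr x) <= Rabs tau * (M + K)) by (apply Rmult_le_compat_l; trivial). unfold B. lra. }
  assert (HB : M + K <= B) by (unfold B; nra). assert (HB0 : 0 <= B) by lra.
  assert (PM : forall a b x y, Rabs a <= x -> Rabs b <= y -> Rabs (a * b) <= x * y).
  { intros a b x y Ha Hb. rewrite Rabs_mult. apply Rmult_le_compat; trivial; apply Rabs_pos. }
  assert (PP : forall a b x y, Rabs a <= x -> Rabs b <= y -> Rabs (a + b) <= x + y).
  { intros a b x y Ha Hb. eapply Rle_trans. apply Rabs_triang. lra. }
  set (C := 4 * (B * B) + 4 * (tau * tau) * A + 12 * A + 8 * B * K * (1 + Rabs tau) + 4 * M * M).
  assert (HBB : 0 <= B * B) by nra. assert (HMM : 0 <= M * M) by nra. assert (Htt : 0 <= tau * tau) by nra.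
  assert (HBK : 0 <= 8 * B * K * (1 + Rabs tau)). { assert (0 <= B * K) by nra. nra. }
  assert (HtA : 0 <= tau * tau * A) by nra.
  assert (HC : 0 <= C) by (unfold C; lra).
  assert (J1inf : forall x, 1 <= x -> Rabs (Jr x * Ji x) <= A / x). { intros x Hx. destruct (EE x Hx) as (a1 & a2 & _). now apply Rabs_mult_le_sq. }
  assert (Dinf : forall x, 1 <= x -> Rabs (Dr x * Di x) <= A * x). { intros x Hx. destruct (EE x Hx) as (_ & _ & a1 & a2). now apply Rabs_mult_le_sq. }
  assert (JDinf : forall j d x, 1 <= x -> j * j <= A / x -> d * d <= A * x -> Rabs (j * d) <= A).
  { intros j d x Hx Hj Hd. assert (Hs : (j * d) * (j * d) <= A * A).
    { replace (j * d * (j * d)) with ((j * j) * (d * d)) by ring. replace (A * A) with (A / x * (A * x)) by (field; lra).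
      apply Rmult_le_compat; nra. }
    apply Rabs_le. split; nra. }
  assert (Ax : forall x, 1 <= x -> A / x <= A). { intros x Hx. apply div_le. lra. nra. }
  exists C. split; [split|].
  - intros x Hx. evar_last. apply (is_derive_mult (fun x => 2 * Jr x) Ji). apply is_derive_scal. now apply H1. now apply H2. intros; apply Rmult_comm.
    unfold plus, mult; simpl. field. lra.
  - intros x Hx. evar_last. apply is_derive_scal. apply (is_derive_plus (fun x => Jr x * Di x) (fun x => Ji x * Dr x)).
    apply (is_derive_mult Jr Di). now apply H1. now apply H4. intros; apply Rmult_comm.
    apply (is_derive_mult Ji Dr). now apply H2. now apply H3. intros; apply Rmult_comm.
    unfold plus, mult; simpl. field. lra.
  - intros x Hx. evar_last. apply (is_derive_plus (fun x => 4 * Dr x * Di x) (fun x => 4 * (tau * tau) * (Jr x * Ji x))).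
    apply (is_derive_mult (fun x => 4 * Dr x) Di). apply is_derive_scal. now apply H3. now apply H4. intros; apply Rmult_comm.
    apply is_derive_scal. apply (is_derive_mult Jr Ji). now apply H1. now apply H2. intros; apply Rmult_comm.
    unfold plus, mult; simpl. field. lra.
  - exact HC.
  - intros x Hx. rewrite Rmult_assoc, Rabs_mult, (Rabs_pos_eq 2) by lra. destruct (Rlt_dec x 1).
    + destruct (NB x ltac:(lra)) as (n1 & n2 & _). assert (Z := PM _ _ _ _ (Rle_trans _ _ _ n1 HB) (Rle_trans _ _ _ n2 HB)). unfold C. lra.
    + assert (Z := J1inf x ltac:(lra)). assert (Z2 := Ax x ltac:(lra)). unfold C. lra.
  - intros x Hx. rewrite Rabs_mult, (Rabs_pos_eq 2) by lra. destruct (Rlt_dec x 1).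
    + destruct (NB x ltac:(lra)) as (n1 & n2 & n3 & n4). assert (Z := PP _ _ _ _ (PM _ _ _ _ (Rle_trans _ _ _ n1 HB) n4) (PM _ _ _ _ (Rle_trans _ _ _ n2 HB) n3)). unfold C. lra.
    + destruct (EE x ltac:(lra)) as (a1 & a2 & a3 & a4).
      assert (Z := PP _ _ _ _ (JDinf _ _ x ltac:(lra) a1 a4) (JDinf _ _ x ltac:(lra) a2 a3)). unfold C. lra.
  - intros x Hx. destruct (HN x Hx) as (_ & _ & N3 & N4). destruct (NB x Hx) as (n1 & n2 & n3 & n4).
    (* Near 0 one has D = i tau J + O(x^2), so the leading terms of D^2 + tau^2 J^2 cancel; the
       rewriting displays the two small factors. *)
    replace (4 * Dr x * Di x + 4 * (tau * tau) * (Jr x * Ji x)) with (4 * (Di x * (Dr x + tau * Ji x) + - (tau * (Ji x * (Di x - tau * Jr x))))) by ring.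
    rewrite Rabs_mult, (Rabs_pos_eq 4) by lra.
    assert (Z1 := PM _ _ _ _ n4 N3).
    assert (Z2 := PM tau _ _ _ (Rle_refl _) (PM _ _ _ _ (Rle_trans _ _ _ n2 HB) N4)).
    rewrite <- Rabs_Ropp in Z2. assert (Z := PP _ _ _ _ Z1 Z2).
    assert (0 <= x * x) by nra.
    apply Rle_trans with (8 * B * K * (1 + Rabs tau) * (x * x)).
    + assert (0 <= B * K * (x * x)) by (apply Rmult_le_pos; nra). nra.
    + apply Rmult_le_compat_r; trivial. unfold C. lra.
  - intros x Hx. assert (Z := J1inf x Hx). replace (x * (2 * Jr x * Ji x)) with (2 * x * (Jr x * Ji x)) by ring.
    rewrite Rabs_mult, (Rabs_pos_eq (2 * x)) by lra. apply Rle_trans with (2 * x * (A / x)). apply Rmult_le_compat_l; lra.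
    replace (2 * x * (A / x)) with (2 * A) by (field; lra). unfold C. lra.
  - intros x Hx. assert (Z := J1inf x Hx). assert (Z2 := Dinf x Hx). assert (Z3 := Ax x Hx).
    unfold Rdiv at 1. rewrite Rabs_mult, (Rabs_pos_eq (/ x)) by (left; apply Rinv_0_lt_compat; lra).
    apply div_le. lra.
    replace (4 * Dr x * Di x + 4 * (tau * tau) * (Jr x * Ji x) + 2 * (x * x) * (2 * Jr x * Ji x)) with (4 * (Dr x * Di x) + (4 * (tau * tau) + 4 * (x * x)) * (Jr x * Ji x)) by ring.
    eapply Rle_trans. apply Rabs_triang. rewrite (Rabs_mult 4), (Rabs_mult (4 * (tau * tau) + 4 * (x * x))), (Rabs_pos_eq 4), (Rabs_pos_eq (4 * (tau * tau) + 4 * (x * x))) by nra.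
    assert (Y : (4 * (tau * tau) + 4 * (x * x)) * Rabs (Jr x * Ji x) <= 4 * (tau * tau) * A * x + 4 * A * x).
    { apply Rle_trans with ((4 * (tau * tau) + 4 * (x * x)) * (A / x)). apply Rmult_le_compat_l; trivial. nra.
      replace ((4 * (tau * tau) + 4 * (x * x)) * (A / x)) with (4 * (tau * tau) * (A / x) + 4 * A * x) by (field; lra).
      assert (4 * (tau * tau) * (A / x) <= 4 * (tau * tau) * A) by (apply Rmult_le_compat_l; lra).
      assert (4 * (tau * tau) * A * 1 <= 4 * (tau * tau) * A * x) by (apply Rmult_le_compat_l; lra). lra. }
    unfold C. apply Rle_trans with ((4 * (tau * tau) * A + 8 * A) * x). lra. apply Rmult_le_compat_r; lra.
  - intros x Hx.
    replace (snd _) with (2 * er x * ei x).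
    2: { unfold er, ei. replace (2 * tau * ln (x / 2)) with (tau * ln (x / 2) + tau * ln (x / 2)) by ring. rewrite cos_plus, sin_plus.
         destruct c as (c1, c2). unfold p, q, Cmult. cbn [fst snd]. ring. }
    assert (Hxx : 0 < x * x) by nra.
    destruct (Rlt_dec x 1).
    + destruct (HN x ltac:(lra)) as (N1 & N2 & _). fold (er x) in N1. fold (ei x) in N2. destruct (NB x ltac:(lra)) as (n1 & n2 & n3 & n4).
      replace (2 * Jr x * Ji x - 2 * er x * ei x) with (2 * ((Jr x - er x) * Ji x + er x * (Ji x - ei x))) by ring.
      rewrite Rabs_mult, (Rabs_pos_eq 2) by lra.
      assert (Z := PP _ _ _ _ (PM _ _ _ _ N1 (Rle_trans _ _ _ n2 HB)) (PM _ _ _ _ (Br x) N2)).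
      apply le_div. lra.
      assert (0 <= K * (x * x)) by nra.
      assert (Y : 2 * Rabs ((Jr x - er x) * Ji x + er x * (Ji x - ei x)) <= 4 * B * K * (x * x)).
      { assert (M * (K * (x * x)) <= B * (K * (x * x))) by (apply Rmult_le_compat_r; lra). lra. }
      assert (Y2 : 0 <= 4 * B * K) by nra.
      apply Rle_trans with (4 * B * K * (x * x) * 2). apply Rmult_le_compat; try nra. apply Rmult_le_pos. lra. apply Rabs_pos.
      replace (4 * B * K * (x * x) * 2) with (8 * B * K * (x * x)) by ring. apply Rmult_le_compat_r. lra.
      assert (8 * B * K <= 8 * B * K * (1 + Rabs tau)) by nra. unfold C. lra.
    + assert (Z := J1inf x ltac:(lra)). assert (Z2 := Ax x ltac:(lra)).
      assert (Z3 := PM _ _ _ _ (Br x) (Bi x)).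
      apply Rle_trans with (2 * A + 2 * (M * M)).
      * replace (2 * Jr x * Ji x - 2 * er x * ei x) with (2 * (Jr x * Ji x) + - (2 * (er x * ei x))) by ring. eapply Rle_trans. apply Rabs_triang.
        rewrite Rabs_Ropp, !(Rabs_mult 2), (Rabs_pos_eq 2) by lra. lra.
      * apply le_div. lra. apply Rle_trans with ((2 * A + 2 * (M * M)) * (2 * (x * x))). apply Rmult_le_compat_l; nra.
        replace ((2 * A + 2 * (M * M)) * (2 * (x * x))) with ((4 * A + 4 * (M * M)) * (x * x)) by ring. apply Rmult_le_compat_r. lra. unfold C. lra.
Qed.

(** * Duhamel's formula for the index integral *)

Definition kern_dk (y : R) : R := struve_g y + y * struve_dg y.

(* [kern_bd c x] is a primitive in x of W times the operator (d/du)^2 + 4 tau^2 applied to 2 sinh u k(x cosh u), divided by 2 sinh u, with c = cosh u. *)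
Definition kern_bd (W T S : R -> R) (c x : R) : R :=
  x * W x * (2 * struve_k (x * c) + / PI + (x * c) * (x * c) * struve_dg (x * c))
  - x * T x * struve_k (x * c) - x / 4 * struve_dg (x * c) * (S x + 2 * (x * x) * W x).

(** The operator (d/du)^2 + 4 tau^2 applied to 2 sinh u k(x cosh u) and divided by 2 sinh u, with c
    = cosh u and with k'' eliminated by Struve's equation: k'' = g' + 4/pi - 4 y g. *)
Definition kern_op (tau c x : R) : R :=
  (1 + 4 * (tau * tau)) * struve_k (x * c) + 3 * c * x * kern_dk (x * c)
  + (c * c - 1) * (x * x) * (struve_dg (x * c) + 4 / PI - 4 * (x * c) * struve_g (x * c)).

Lemma kern_dk_derive y : 0 < y -> is_derive kern_dk y (struve_dg y + 4 / PI - 4 * y * struve_g y).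
Proof.
  intros Hy. unfold kern_dk. evar_last.
  apply (is_derive_plus struve_g (fun y => y * struve_dg y)). now apply struve_g_derive.
  apply (is_derive_mult (fun y => y) struve_dg). apply (is_derive_id (K := R_AbsRing)). now apply struve_dg_derive. intros; apply Rmult_comm.
  unfold plus, mult, one; simpl. field. split. apply PI_neq0. lra.
Qed.

(** With theta = x d/dx and y = xc, Struve's equation turns the operator into ((theta + 1)^2 + 4
    tau^2 + 4 x^2) k - x^2 g'. Two integrations by parts move (theta + 1)^2 onto W as theta^2 W,
    leaving (S + 2x^2 W) k - x^2 W g'. This is exact, because (S + 2x^2 W)' = 4xW and (y g')' = -4k.
    The three summands of [kern_bd] are the boundary terms so produced. *)
Lemma kern_bd_derive tau W T S C c x : sq_sol tau W T S C -> 0 < c -> 0 < x ->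
  is_derive (kern_bd W T S c) x (W x * kern_op tau c x).
Proof.
  intros HS Hc Hx.
  assert (Hy : 0 < x * c) by nra.
  assert (DW := ss_W _ _ _ _ _ HS x Hx). assert (DT := ss_T _ _ _ _ _ HS x Hx). assert (DS := ss_S _ _ _ _ _ HS x Hx).
  assert (Mul : forall (f g : R -> R) (df dg : R), is_derive f x df -> is_derive g x dg -> is_derive (fun x => f x * g x) x (df * g x + f x * dg)).
  { intros f g df dg Hf Hg. apply (is_derive_mult f g); trivial. intros; apply Rmult_comm. }
  assert (Dxc : is_derive (fun x => x * c) x c) by (auto_derive; trivial; ring).
  assert (Cmp : forall (f : R -> R) df, is_derive f (x * c) df -> is_derive (fun x => f (x * c)) x (c * df)).
  { intros f df H. apply (is_derive_comp f (fun x => x * c)); trivial. }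
  assert (Dk := Cmp _ _ (struve_k_derive _ Hy)). assert (Dg := Cmp _ _ (struve_dg_derive _ Hy)).
  assert (Dx : is_derive (fun x : R => x) x 1) by apply (is_derive_id (K := R_AbsRing)).
  assert (A1 : is_derive (fun x => x * W x * (2 * struve_k (x * c) + / PI + (x * c) * (x * c) * struve_dg (x * c))) x
    ((1 * W x + x * (T x / x)) * (2 * struve_k (x * c) + / PI + (x * c) * (x * c) * struve_dg (x * c))
     + x * W x * (2 * (c * (struve_g (x * c) + x * c * struve_dg (x * c))) + ((c * (x * c) + (x * c) * c) * struve_dg (x * c) + (x * c) * (x * c) * (c * (4 / (PI * (x * c)) - struve_dg (x * c) / (x * c) - 4 * struve_g (x * c))))))).
  { apply (Mul (fun x => x * W x)). now apply Mul.
    apply (is_derive_plus (fun x => 2 * struve_k (x * c) + / PI) (fun x => (x * c) * (x * c) * struve_dg (x * c))).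
    - replace (2 * (c * (struve_g (x * c) + x * c * struve_dg (x * c)))) with (2 * (c * (struve_g (x * c) + x * c * struve_dg (x * c))) + 0) by ring.
      apply (is_derive_plus (fun x => 2 * struve_k (x * c)) (fun _ => / PI)). now apply is_derive_scal. apply (is_derive_const (V := R_NormedModule)).
    - apply (Mul (fun x => x * c * (x * c)) (fun x => struve_dg (x * c))); trivial. now apply (Mul (fun x => x * c) (fun x => x * c)). }
  assert (A2 : is_derive (fun x => x * T x * struve_k (x * c)) x
    ((1 * T x + x * ((S x - 4 * (tau * tau) * W x - 2 * (x * x) * W x) / x)) * struve_k (x * c) + x * T x * (c * (struve_g (x * c) + x * c * struve_dg (x * c))))).
  { apply (Mul (fun x => x * T x) (fun x => struve_k (x * c))); trivial. now apply Mul. }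
  assert (A3 : is_derive (fun x => x / 4 * struve_dg (x * c) * (S x + 2 * (x * x) * W x)) x
    ((/ 4 * struve_dg (x * c) + x / 4 * (c * (4 / (PI * (x * c)) - struve_dg (x * c) / (x * c) - 4 * struve_g (x * c)))) * (S x + 2 * (x * x) * W x)
     + x / 4 * struve_dg (x * c) * (- 2 * x * T x + (4 * x * W x + 2 * (x * x) * (T x / x))))).
  { apply (Mul (fun x => x / 4 * struve_dg (x * c)) (fun x => S x + 2 * (x * x) * W x)).
    apply (Mul (fun x => x / 4) (fun x => struve_dg (x * c))); trivial. auto_derive. trivial. field.
    apply (is_derive_plus S (fun x => 2 * (x * x) * W x)); trivial. apply (Mul (fun x => 2 * (x * x)) W); trivial. auto_derive. trivial. ring. }
  evar_last. unfold kern_bd. apply (is_derive_minus (fun x => x * W x * (2 * struve_k (x * c) + / PI + (x * c) * (x * c) * struve_dg (x * c)) - x * T x * struve_k (x * c))).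
  apply (is_derive_minus _ _ _ _ _ A1 A2). exact A3.
  unfold minus, plus, opp; simpl. unfold kern_op, kern_dk, struve_k. field. repeat split; try lra. apply PI_neq0.
Qed.

Lemma kern_ode tau x u : 0 < x ->
  is_derive (fun u => 2 * cosh u * struve_k (x * cosh u) + 2 * sinh u * (x * sinh u * kern_dk (x * cosh u))) u
    (2 * sinh u * kern_op tau (cosh u) x - 4 * (tau * tau) * (2 * sinh u * struve_k (x * cosh u))) /\
  is_derive (fun u => 2 * sinh u * struve_k (x * cosh u)) u (2 * cosh u * struve_k (x * cosh u) + 2 * sinh u * (x * sinh u * kern_dk (x * cosh u))).
Proof.
  intros Hx. assert (Hc := cosh_ge_1 u). assert (Hy : 0 < x * cosh u) by nra.
  assert (Mul : forall (f g : R -> R) (df dg : R), is_derive f u df -> is_derive g u dg -> is_derive (fun x => f x * g x) u (df * g u + f u * dg)).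
  { intros f g df dg Hf Hg. apply (is_derive_mult f g); trivial. intros; apply Rmult_comm. }
  assert (Cmp : forall (f : R -> R) df, is_derive f (x * cosh u) df -> is_derive (fun u => f (x * cosh u)) u (x * sinh u * df)).
  { intros f df H. apply (is_derive_comp f (fun u => x * cosh u)); trivial. auto_derive. trivial. ring. }
  assert (Dk := Cmp _ _ (struve_k_derive _ Hy)). fold (kern_dk (x * cosh u)) in Dk. assert (Ddk := Cmp _ _ (kern_dk_derive _ Hy)).
  assert (D2c : is_derive (fun u => 2 * cosh u) u (2 * sinh u)) by (auto_derive; trivial; ring).
  assert (D2s : is_derive (fun u => 2 * sinh u) u (2 * cosh u)) by (auto_derive; trivial; ring).
  assert (Dxs : is_derive (fun u => x * sinh u) u (x * cosh u)) by (auto_derive; trivial; ring).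
  split.
  - evar_last. apply (is_derive_plus (fun u => 2 * cosh u * struve_k (x * cosh u)) (fun u => 2 * sinh u * (x * sinh u * kern_dk (x * cosh u)))).
    apply (Mul _ _ _ _ D2c Dk). exact (Mul _ _ _ _ D2s (Mul _ _ _ _ Dxs Ddk)).
    unfold plus; simpl. unfold kern_op. rewrite cosh_sqr. ring.
  - evar_last. apply (Mul _ _ _ _ D2s Dk). ring.
Qed.

Lemma cont2_cosh : cont2 (fun x u => x * cosh u).
Proof.
  apply cont2_mult. apply cont2_of_fst. intros x _; apply continuous_id. apply cont2_of_snd.
  intros u. apply (cont_of_derive _ _ _ (is_derive_cosh u)).
Qed.

Lemma cosh_arg_pos x u : 0 < x -> 0 < x * cosh u.
Proof. intros Hx. generalize (cosh_ge_1 u). nra. Qed.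

Lemma struve_g_cont : cont_pos struve_g.
Proof. intros y Hy. apply (cont_of_derive _ _ _ (struve_g_derive y Hy)). Qed.

Lemma struve_dg_cont : cont_pos struve_dg.
Proof. intros y Hy. apply (cont_of_derive _ _ _ (struve_dg_derive y Hy)). Qed.

Lemma cont2_kern_op tau : cont2 (fun x u => kern_op tau (cosh u) x).
Proof.
  assert (Ck : cont2 (fun x u => struve_k (x * cosh u))) by (apply cont2_comp_pos; [exact struve_k_cont | exact cont2_cosh | exact cosh_arg_pos]).
  assert (Cg : cont2 (fun x u => struve_g (x * cosh u))) by (apply cont2_comp_pos; [exact struve_g_cont | exact cont2_cosh | exact cosh_arg_pos]).
  assert (Cd : cont2 (fun x u => struve_dg (x * cosh u))) by (apply cont2_comp_pos; [exact struve_dg_cont | exact cont2_cosh | exact cosh_arg_pos]).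
  assert (Cc : cont2 (fun x u => cosh u)) by (apply cont2_of_snd; intros u; apply (cont_of_derive _ _ _ (is_derive_cosh u))).
  assert (Cx : cont2 (fun x u => x)) by (apply cont2_of_fst; intros x _; apply continuous_id).
  assert (CC : forall a, cont2 (fun x u => a)) by (intros a; apply cont2_of_snd; intros; apply continuous_const).
  unfold kern_op, kern_dk.
  repeat first [assumption | apply CC | apply cont2_minus | apply cont2_plus | apply cont2_mult].
Qed.

Definition duhamel_term (tau U : R) (W T S : R -> R) (x : R) : R :=
  RInt (fun u => sin (2 * tau * (U - u)) * (2 * sinh u) * kern_bd W T S (cosh u) x) 0 U.

(** Integrating H'' + 4 tau^2 H against the oscillator kernel sin(2 tau (U - u)) recovers 2 tau H(U)
    up to the initial data H(0) = 0 and H'(0) = 2 k(x). The exact x-derivative lets the outer d/dx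
    act on [kern_bd] alone. *)
Lemma duhamel_term_derive tau U W T S C x : sq_sol tau W T S C -> 0 <= U -> 0 < x ->
  is_derive (duhamel_term tau U W T S) x (W x * (2 * tau * (2 * sinh U * struve_k (x * cosh U)) - 2 * sin (2 * tau * U) * struve_k x)).
Proof.
  intros HS HU Hx.
  assert (Csn : forall u, continuous (fun u => sin (2 * tau * (U - u)) * (2 * sinh u)) u) by (intros u; apply cont_ex_derive; auto_derive; trivial).
  assert (CW : cont_pos W) by (intros y Hy; apply (cont_of_derive _ _ _ (ss_W _ _ _ _ _ HS y Hy))).
  assert (CT : cont_pos T) by (intros y Hy; apply (cont_of_derive _ _ _ (ss_T _ _ _ _ _ HS y Hy))).
  assert (CS : cont_pos S) by (intros y Hy; apply (cont_of_derive _ _ _ (ss_S _ _ _ _ _ HS y Hy))).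
  assert (CF : cont2 (fun x u => sin (2 * tau * (U - u)) * (2 * sinh u) * (W x * kern_op tau (cosh u) x))).
  { apply cont2_mult. now apply (cont2_of_snd (fun u => sin (2 * tau * (U - u)) * (2 * sinh u))).
    apply cont2_mult. now apply cont2_of_fst. apply cont2_kern_op. }
  assert (D : is_derive (duhamel_term tau U W T S) x (RInt (fun u => sin (2 * tau * (U - u)) * (2 * sinh u) * (W x * kern_op tau (cosh u) x)) 0 U)).
  { apply (derive_RInt_param (fun x u => sin (2 * tau * (U - u)) * (2 * sinh u) * kern_bd W T S (cosh u) x)
       (fun x u => sin (2 * tau * (U - u)) * (2 * sinh u) * (W x * kern_op tau (cosh u) x))); trivial.
    - intros y u Hy. apply is_derive_scal. apply (kern_bd_derive tau W T S C); trivial. generalize (cosh_ge_1 u); lra.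
    - intros y u Hy.
      assert (Ck : continuous (fun u => y * cosh u) u) by (apply cont_ex_derive; auto_derive; trivial).
      assert (Hp := cosh_arg_pos y u Hy).
      apply cont_mult. apply Csn. unfold kern_bd.
      assert (K1 : continuous (fun u => struve_k (y * cosh u)) u) by (apply (continuous_comp (fun u => y * cosh u) struve_k); trivial; now apply struve_k_cont).
      assert (K2 : continuous (fun u => struve_dg (y * cosh u)) u) by (apply (continuous_comp (fun u => y * cosh u) struve_dg); trivial; now apply struve_dg_cont).
      apply cont_minus. apply cont_minus.
      + apply cont_mult. apply continuous_const. apply cont_plus. apply cont_plus. apply cont_mult; trivial. apply continuous_const. apply continuous_const.
        apply cont_mult; trivial. now apply cont_mult.
      + apply cont_mult; trivial. apply continuous_const.
      + apply cont_mult. apply cont_mult; trivial. apply continuous_const. apply continuous_const. }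
  replace (W x * (2 * tau * (2 * sinh U * struve_k (x * cosh U)) - 2 * sin (2 * tau * U) * struve_k x)) with
   (RInt (fun u => sin (2 * tau * (U - u)) * (2 * sinh u) * (W x * kern_op tau (cosh u) x)) 0 U); trivial.
  apply is_RInt_unique.
  set (H := fun u => 2 * sinh u * struve_k (x * cosh u)).
  set (dH := fun u => 2 * cosh u * struve_k (x * cosh u) + 2 * sinh u * (x * sinh u * kern_dk (x * cosh u))).
  (* Lagrange's identity: this is a u-primitive of W sin(2 tau (U - u)) (H'' + 4 tau^2 H), the
     derivatives of sine and cosine cancelling the mixed terms. *)
  set (phi := fun u => W x * (sin (2 * tau * (U - u)) * dH u + 2 * tau * (cos (2 * tau * (U - u)) * H u))).
  replace (W x * (2 * tau * (2 * sinh U * struve_k (x * cosh U)) - 2 * sin (2 * tau * U) * struve_k x)) with (phi U - phi 0).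
  2: { unfold phi, dH, H. rewrite Rminus_eq_0, Rminus_0_r, sinh_0, cosh_0, Rmult_0_r, sin_0, cos_0, (Rmult_1_r x). ring. }
  apply (RInt_FTC phi); trivial.
  - intros u Hu. destruct (kern_ode tau x u Hx) as (K1 & K2). fold dH in K1. fold H in K2. fold (dH u) in K2. fold (H u) in K1.
    unfold phi. evar_last. apply is_derive_scal.
    apply (is_derive_plus (fun u => sin (2 * tau * (U - u)) * dH u) (fun u => 2 * tau * (cos (2 * tau * (U - u)) * H u))).
    apply (is_derive_mult (fun u => sin (2 * tau * (U - u))) dH). auto_derive. trivial. reflexivity. exact K1. intros; apply Rmult_comm.
    apply is_derive_scal. apply (is_derive_mult (fun u => cos (2 * tau * (U - u))) H). auto_derive. trivial. reflexivity. exact K2. intros; apply Rmult_comm.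
    unfold plus, mult; simpl. change (U + - u) with (U - u). ring.
  - intros u Hu. apply (cont2_snd _ x u CF Hx).
Qed.

Lemma kern_bd_zero tau W T S C c x : sq_sol tau W T S C -> 1 <= c -> 0 < x < 1 ->
  Rabs (kern_bd W T S c x) <= C * (5 + c) * x.
Proof.
  intros HS Hc Hx. assert (HC := ss_C _ _ _ _ _ HS).
  assert (BW := ss_Wb _ _ _ _ _ HS x ltac:(lra)). assert (BT := ss_Tb _ _ _ _ _ HS x ltac:(lra)). assert (BS := ss_S0 _ _ _ _ _ HS x Hx).
  assert (Hy : 0 < x * c) by nra.
  assert (Bk := struve_k_bound _ Hy). assert (Bd := struve_dg_bound _ Hy).
  assert (Bk1 : Rabs (struve_k (x * c)) <= 1). { apply Rle_trans with (1 := Bk). rewrite <- Rinv_1. apply Rinv_le_contravar; nra. }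
  set (k := struve_k (x * c)) in *. set (d := struve_dg (x * c)) in *.
  assert (HP : 0 < / PI <= 1). { assert (P := PI2_3_2). split. apply Rinv_0_lt_compat; lra. rewrite <- Rinv_1. apply Rinv_le_contravar; lra. }
  assert (PP : forall a b p q, Rabs a <= p -> Rabs b <= q -> Rabs (a + b) <= p + q).
  { intros a b p q Ha Hb. eapply Rle_trans. apply Rabs_triang. lra. }
  assert (PM : forall a b p q, Rabs a <= p -> Rabs b <= q -> Rabs (a * b) <= p * q).
  { intros a b p q Ha Hb. rewrite Rabs_mult. apply Rmult_le_compat; trivial; apply Rabs_pos. }
  assert (Rx : Rabs x <= x) by (rewrite Rabs_pos_eq; lra).
  assert (A1 : Rabs (2 * k + / PI + x * c * (x * c) * d) <= 3 + c).
  { replace (x * c * (x * c) * d) with (x * c * (x * c * d)) by ring.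
    apply Rle_trans with (2 * 1 + 1 + x * c * 1). 2: nra.
    apply PP. apply PP. apply PM; trivial. rewrite Rabs_pos_eq; lra. rewrite Rabs_pos_eq; lra. apply PM; trivial. rewrite Rabs_pos_eq; lra. }
  assert (A2 := PM _ _ _ _ (PM _ _ _ _ Rx BW) A1).
  assert (A3 := PM _ _ _ _ (PM _ _ _ _ Rx BT) Bk1).
  assert (A4 : Rabs (x / 4 * d * (S x + 2 * (x * x) * W x)) <= C * x).
  { replace (x / 4 * d * (S x + 2 * (x * x) * W x)) with ((/ (4 * c)) * (x * c * d) * (S x + 2 * (x * x) * W x)) by (field; lra).
    assert (Rc : Rabs (/ (4 * c)) <= / 4). { rewrite Rabs_pos_eq. apply Rinv_le_contravar; lra. left; apply Rinv_0_lt_compat; lra. }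
    assert (Rxx : Rabs (2 * (x * x)) <= 2 * (x * x)) by (rewrite Rabs_pos_eq; nra).
    apply Rle_trans with (/ 4 * 1 * (C * (x * x) + 2 * (x * x) * C)). apply PM. apply PM; trivial. apply PP; trivial. apply PM; trivial.
    assert (Z : x * x <= x) by nra. assert (C * (x * x) <= C * x) by (apply Rmult_le_compat_l; trivial). assert (0 <= C * x) by (apply Rmult_le_pos; lra). lra. }
  unfold kern_bd. fold k d. unfold Rminus.
  apply Rle_trans with (x * C * (3 + c) + x * C * 1 + C * x). 2: apply Req_le; ring.
  apply PP. apply PP; trivial. rewrite Rabs_Ropp; trivial. rewrite Rabs_Ropp; trivial.
Qed.

(** As y^2 g'(y) -> -1/pi, the bracket multiplying x W tends to 0, whereas the last summand of
    [kern_bd] keeps the bounded mean (S + 2x^2 W)/x with the factor 1/(4 pi c^2). *)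
Lemma kern_bd_infty tau W T S C c x : sq_sol tau W T S C -> 1 <= c -> 1 <= x ->
  Rabs (kern_bd W T S c x - (S x + 2 * (x * x) * W x) / x / (4 * PI * (c * c))) <= 5 * C / x.
Proof.
  intros HS Hc Hx. assert (HC := ss_C _ _ _ _ _ HS).
  assert (BW := ss_Winf _ _ _ _ _ HS x Hx). assert (BT := ss_Tb _ _ _ _ _ HS x ltac:(lra)). assert (BS := ss_Sinf _ _ _ _ _ HS x Hx).
  assert (Hy : 0 < x * c) by nra. assert (Hyx : x <= x * c) by nra.
  assert (Bk := struve_k_bound _ Hy). assert (Bd := struve_dg_asymp _ Hy).
  assert (Hxx : / (x * x) <= / x). { apply Rinv_le_contravar; nra. }
  assert (Hxx0 : 0 < / (x * x)) by (apply Rinv_0_lt_compat; nra).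
  assert (Bk1 : Rabs (struve_k (x * c)) <= / (x * x)). { apply Rle_trans with (1 := Bk). apply Rinv_le_contravar; nra. }
  assert (Bd1 : Rabs (x * c * (x * c) * struve_dg (x * c) + / PI) <= / (x * x)). { apply Rle_trans with (1 := Bd). apply Rinv_le_contravar; nra. }
  set (k := struve_k (x * c)) in *. set (d := struve_dg (x * c)) in *. set (sg := (S x + 2 * (x * x) * W x) / x) in *.
  assert (PP : forall a b p q, Rabs a <= p -> Rabs b <= q -> Rabs (a + b) <= p + q).
  { intros a b p q Ha Hb. eapply Rle_trans. apply Rabs_triang. lra. }
  assert (PM : forall a b p q, Rabs a <= p -> Rabs b <= q -> Rabs (a * b) <= p * q).
  { intros a b p q Ha Hb. rewrite Rabs_mult. apply Rmult_le_compat; trivial; apply Rabs_pos. }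
  assert (HP := PI_RGT_0).
  replace (kern_bd W T S c x - sg / (4 * PI * (c * c))) with
   (x * W x * (2 * k + (x * c * (x * c) * d + / PI)) + - (T x * (x * k)) + - (/ (4 * (c * c)) * (sg * (x * c * (x * c) * d + / PI)))).
  2: { unfold kern_bd, sg. fold k d. field. repeat split; lra. }
  apply Rle_trans with (C * (2 * / (x * x) + / (x * x)) + C * (x * / (x * x)) + 1 * (C * / (x * x))).
  - apply PP. apply PP.
    + apply PM; trivial. apply PP; trivial. apply PM; trivial. rewrite Rabs_pos_eq; lra.
    + rewrite Rabs_Ropp. apply PM; trivial. apply PM; trivial. rewrite Rabs_pos_eq; lra.
    + rewrite Rabs_Ropp. apply PM; trivial. 2: now apply PM. rewrite Rabs_pos_eq. rewrite <- Rinv_1. apply Rinv_le_contravar; nra. left; apply Rinv_0_lt_compat; nra.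
  - replace (x * / (x * x)) with (/ x) by (field; lra). unfold Rdiv.
    assert (C * / (x * x) <= C * / x) by (apply Rmult_le_compat_l; lra). lra.
Qed.

(** Response, up to the factor 2 tau, of the oscillator of frequency 2 tau to the forcing sinh u /
    cosh^2 u. That forcing is 2 sinh u times the residue 1/cosh^2 u of the boundary term at
    infinity, up to a constant. *)
Definition sech_sin (tau U : R) : R := RInt (fun u => sin (2 * tau * (U - u)) * sinh u / (cosh u * cosh u)) 0 U.

Lemma sech_sin_cont tau U u : continuous (fun u => sin (2 * tau * (U - u)) * sinh u / (cosh u * cosh u)) u.
Proof. apply cont_ex_derive. auto_derive. generalize (cosh_ge_1 u). nra. Qed.

Lemma kern_bd_cont tau W T S C x : sq_sol tau W T S C -> 0 < x -> forall u, continuous (fun u => kern_bd W T S (cosh u) x) u.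
Proof.
  intros HS Hx u.
  assert (Ck : continuous (fun u => x * cosh u) u) by (apply cont_ex_derive; auto_derive; trivial).
  assert (Hp := cosh_arg_pos x u Hx).
  assert (K1 : continuous (fun u => struve_k (x * cosh u)) u) by (apply (continuous_comp (fun u => x * cosh u) struve_k); trivial; now apply struve_k_cont).
  assert (K2 : continuous (fun u => struve_dg (x * cosh u)) u) by (apply (continuous_comp (fun u => x * cosh u) struve_dg); trivial; now apply struve_dg_cont).
  unfold kern_bd. apply cont_minus. apply cont_minus.
  + apply cont_mult. apply continuous_const. apply cont_plus. apply cont_plus. apply cont_mult; trivial. apply continuous_const. apply continuous_const.
    apply cont_mult; trivial. now apply cont_mult.
  + apply cont_mult; trivial. apply continuous_const.
  + apply cont_mult. apply cont_mult; trivial. apply continuous_const. apply continuous_const.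
Qed.

Lemma sq_int_ex tau W T S C u : sq_sol tau W T S C -> exists l, has_int (fun x => W x * struve_k (x * cosh u)) l /\
  forall a b, 0 < a -> a <= b -> Rabs (RInt (fun x => W x * struve_k (x * cosh u)) a b - l) <= C * a + C / b.
Proof.
  intros HS. assert (HC := ss_C _ _ _ _ _ HS).
  destruct (has_int_atan (fun x => W x * struve_k (x * cosh u)) C HC) as (l & H1 & _ & H3).
  - intros x Hx. apply cont_mult. apply (cont_of_derive _ _ _ (ss_W _ _ _ _ _ HS x Hx)).
    apply (continuous_comp (fun x => x * cosh u) struve_k). apply cont_ex_derive; auto_derive; trivial. apply struve_k_cont. now apply cosh_arg_pos.
  - intros x Hx. rewrite Rabs_mult. assert (Hp := cosh_arg_pos x u Hx). assert (Hc := cosh_ge_1 u).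
    unfold Rdiv. apply Rmult_le_compat; try apply Rabs_pos. apply (ss_Wb _ _ _ _ _ HS x Hx).
    apply Rle_trans with (1 := struve_k_bound _ Hp). apply Rinv_le_contravar. nra.
    assert (x <= x * cosh u) by nra. nra.
  - exists l. now split.
Qed.

(** The fundamental theorem on [e, X]: the lower boundary term vanishes with e, and the upper one
    leaves the mean at X times [sech_sin] up to O(1/X). The point X stays free because convergence
    of the mean is not yet known; the bound depends on U but not on X. *)
Lemma duhamel_limit tau W T S C U l l0 : sq_sol tau W T S C -> 0 <= U ->
  has_int (fun x => W x * struve_k (x * cosh U)) l -> has_int (fun x => W x * struve_k (x * cosh 0)) l0 ->
  exists B, forall X, 1 <= X ->
  Rabs (2 * tau * (2 * sinh U * l) - 2 * sin (2 * tau * U) * l0 - (S X + 2 * (X * X) * W X) / X / (2 * PI) * sech_sin tau U) <= B / X.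
Proof.
  intros HS HU Hl Hl0. assert (HC := ss_C _ _ _ _ _ HS). assert (HP := PI_RGT_0).
  destruct (sq_int_ex _ _ _ _ _ U HS) as (l' & H1 & H1b). rewrite (has_int_unique _ _ _ H1 Hl) in H1b. clear l' H1.
  destruct (sq_int_ex _ _ _ _ _ 0 HS) as (l' & H1 & H0b). rewrite (has_int_unique _ _ _ H1 Hl0) in H0b. clear l' H1.
  assert (Hs : 0 <= sinh U). { apply Rle_trans with U; trivial. now apply sinh_ge. }
  assert (Hss : forall u, 0 <= u <= U -> 0 <= sinh u <= sinh U).
  { intros u Hu. split. apply Rle_trans with u. lra. now apply sinh_ge. destruct (Req_dec u U). subst; lra. left. apply sinh_lt. lra. }
  assert (Hcc : forall u, 0 <= u <= U -> 1 <= cosh u <= cosh U).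
  { intros u Hu. split. apply cosh_ge_1. apply (nonneg_derive_le cosh sinh u U). lra. intros; apply is_derive_cosh. intros v Hv. apply Hss. lra. }
  set (sg := fun X => (S X + 2 * (X * X) * W X) / X).
  set (A0 := 2 * Rabs tau * (2 * sinh U) * C + 2 * C).
  assert (HA0 : 0 <= A0). { unfold A0. assert (0 <= Rabs tau * sinh U) by (apply Rmult_le_pos; [apply Rabs_pos | trivial]). assert (0 <= Rabs tau * sinh U * C) by (apply Rmult_le_pos; trivial). lra. }
  set (B1 := U * (2 * sinh U * (C * (5 + cosh U)))).
  assert (HB1 : 0 <= B1). { unfold B1. assert (Hc := cosh_ge_1 U). apply Rmult_le_pos; trivial. apply Rmult_le_pos. lra. apply Rmult_le_pos; lra. }
  exists (A0 + U * (2 * sinh U * (5 * C))). intros X HX.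
  assert (Cf : forall x, 0 < x -> forall u, continuous (fun u => sin (2 * tau * (U - u)) * (2 * sinh u) * kern_bd W T S (cosh u) x) u).
  { intros x Hx u. apply cont_mult. apply cont_ex_derive; auto_derive; trivial. now apply (kern_bd_cont tau W T S C). }
  assert (Main : forall e, 0 < e < 1 -> Rabs (2 * tau * (2 * sinh U * l) - 2 * sin (2 * tau * U) * l0 - sg X / (2 * PI) * sech_sin tau U) <= (A0 + U * (2 * sinh U * (5 * C))) / X + (A0 + B1) * e).
  { intros e He.
    set (k1 := fun x => W x * struve_k (x * cosh U)). set (k0 := fun x => W x * struve_k (x * cosh 0)).
    assert (Cw : cont_pos W) by (intros y Hy; apply (cont_of_derive _ _ _ (ss_W _ _ _ _ _ HS y Hy))).
    assert (Ck1 : forall v, cont_pos (fun x => W x * struve_k (x * cosh v))).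
    { intros v x Hx. apply cont_mult. now apply Cw. apply (continuous_comp (fun x => x * cosh v) struve_k). apply cont_ex_derive; auto_derive; trivial. apply struve_k_cont. now apply cosh_arg_pos. }
    assert (EQ : 2 * tau * (2 * sinh U) * RInt k1 e X - 2 * sin (2 * tau * U) * RInt k0 e X = duhamel_term tau U W T S X - duhamel_term tau U W T S e).
    { assert (FT : is_RInt (fun x => 2 * tau * (2 * sinh U) * k1 x - 2 * sin (2 * tau * U) * k0 x) e X (duhamel_term tau U W T S X - duhamel_term tau U W T S e)).
      { apply (RInt_FTC (duhamel_term tau U W T S)). lra.
        - intros x Hx. evar_last. apply (duhamel_term_derive tau U W T S C); trivial. lra.
          unfold k1, k0. rewrite cosh_0, Rmult_1_r. ring.
        - intros x Hx. apply cont_minus; apply cont_scal; apply Ck1; lra. }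
      rewrite <- (is_RInt_unique (V := R_CompleteNormedModule) _ _ _ _ FT).
      rewrite RInt_minus_R, !RInt_scal_R; trivial; try (apply cont_pos_ex_RInt; try lra; apply Ck1).
      apply cont_pos_ex_RInt; try lra. intros x Hx. apply cont_scal. now apply Ck1.
      apply cont_pos_ex_RInt; try lra. intros x Hx. apply cont_scal. now apply Ck1. }
    assert (P0 : Rabs (duhamel_term tau U W T S e) <= B1 * e).
    { unfold B1. replace (U * (2 * sinh U * (C * (5 + cosh U))) * e) with ((U - 0) * (2 * sinh U * (C * (5 + cosh U) * e))) by ring.
      apply (norm_RInt_le_const (V := R_NormedModule) (fun u => sin (2 * tau * (U - u)) * (2 * sinh u) * kern_bd W T S (cosh u) e) 0 U). trivial.
      - intros u Hu. unfold norm; simpl; unfold abs; simpl. rewrite 2!Rabs_mult. destruct (Hss u Hu). destruct (Hcc u Hu). rewrite (Rabs_pos_eq (2 * sinh u)) by lra.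
        apply Rmult_le_compat; try apply Rabs_pos. apply Rmult_le_pos. apply Rabs_pos. lra.
        + rewrite <- (Rmult_1_l (2 * sinh U)). apply Rmult_le_compat; try apply Rabs_pos; try lra. apply Rabs_sin_le.
        + apply Rle_trans with (1 := kern_bd_zero tau W T S C (cosh u) e HS ltac:(lra) He). apply Rmult_le_compat_r. lra. apply Rmult_le_compat_l; lra.
      - apply (RInt_correct (V := R_CompleteNormedModule)). apply ex_RInt_cont; trivial. intros u _. apply Cf. lra. }
    assert (PX : Rabs (duhamel_term tau U W T S X - sg X / (2 * PI) * sech_sin tau U) <= U * (2 * sinh U * (5 * C)) / X).
    { unfold sech_sin. rewrite <- RInt_scal_R by (apply ex_RInt_cont; trivial; intros; apply sech_sin_cont).
      unfold duhamel_term. rewrite <- RInt_minus_R.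
      2: { apply ex_RInt_cont; trivial. intros u _. apply Cf. lra. }
      2: { apply ex_RInt_cont; trivial. intros u _. apply cont_scal. apply sech_sin_cont. }
      replace (U * (2 * sinh U * (5 * C)) / X) with ((U - 0) * (2 * sinh U * (5 * C / X))) by (field; lra).
      apply (norm_RInt_le_const (V := R_NormedModule) (fun u => sin (2 * tau * (U - u)) * (2 * sinh u) * kern_bd W T S (cosh u) X - sg X / (2 * PI) * (sin (2 * tau * (U - u)) * sinh u / (cosh u * cosh u))) 0 U). trivial.
      - intros u Hu. unfold norm; simpl; unfold abs; simpl. destruct (Hss u Hu). destruct (Hcc u Hu).
        replace (sin (2 * tau * (U - u)) * (2 * sinh u) * kern_bd W T S (cosh u) X - sg X / (2 * PI) * (sin (2 * tau * (U - u)) * sinh u / (cosh u * cosh u)))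
          with (sin (2 * tau * (U - u)) * (2 * sinh u) * (kern_bd W T S (cosh u) X - sg X / (4 * PI * (cosh u * cosh u)))) by (field; lra).
        rewrite 2!Rabs_mult, (Rabs_pos_eq (2 * sinh u)) by lra.
        apply Rmult_le_compat; try apply Rabs_pos. apply Rmult_le_pos. apply Rabs_pos. lra.
        + rewrite <- (Rmult_1_l (2 * sinh U)). apply Rmult_le_compat; try apply Rabs_pos; try lra. apply Rabs_sin_le.
        + apply (kern_bd_infty tau W T S C); trivial.
      - apply (RInt_correct (V := R_CompleteNormedModule)). apply (ex_RInt_minus (V := R_NormedModule)).
        apply ex_RInt_cont; trivial. intros u _. apply Cf. lra.
        apply ex_RInt_cont; trivial. intros u _. apply cont_scal. apply sech_sin_cont. }
    specialize (H1b e X ltac:(lra) ltac:(lra)). specialize (H0b e X ltac:(lra) ltac:(lra)). fold k1 in H1b. fold k0 in H0b.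
    set (i1 := RInt k1 e X) in *. set (i0 := RInt k0 e X) in *.
    replace (2 * tau * (2 * sinh U * l) - 2 * sin (2 * tau * U) * l0 - sg X / (2 * PI) * sech_sin tau U) with
     ((duhamel_term tau U W T S X - sg X / (2 * PI) * sech_sin tau U) + - duhamel_term tau U W T S e + (- (2 * tau * (2 * sinh U)) * (i1 - l) + 2 * sin (2 * tau * U) * (i0 - l0))).
    2: { replace (duhamel_term tau U W T S X) with (2 * tau * (2 * sinh U) * i1 - 2 * sin (2 * tau * U) * i0 + duhamel_term tau U W T S e) by lra. ring. }
    assert (Q1 : Rabs (- (2 * tau * (2 * sinh U)) * (i1 - l)) <= 2 * Rabs tau * (2 * sinh U) * (C * e + C / X)).
    { rewrite Rabs_mult, Rabs_Ropp, 2!Rabs_mult, (Rabs_pos_eq 2), (Rabs_pos_eq (2 * sinh U)) by lra.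
      apply Rmult_le_compat_l; trivial. assert (0 <= Rabs tau * sinh U) by (apply Rmult_le_pos; [apply Rabs_pos | trivial]). lra. }
    assert (Q2 : Rabs (2 * sin (2 * tau * U) * (i0 - l0)) <= 2 * (C * e + C / X)).
    { rewrite 2!Rabs_mult, (Rabs_pos_eq 2) by lra. generalize (Rabs_sin_le (2 * tau * U)) (Rabs_pos (sin (2 * tau * U))) (Rabs_pos (i0 - l0)). intros.
      apply Rle_trans with (2 * 1 * (C * e + C / X)). apply Rmult_le_compat; lra. lra. }
    eapply Rle_trans. apply Rabs_triang. eapply Rle_trans. apply Rplus_le_compat_r. apply Rabs_triang. rewrite Rabs_Ropp.
    eapply Rle_trans. apply Rplus_le_compat_l. apply Rabs_triang.
    apply Rle_trans with (U * (2 * sinh U * (5 * C)) / X + B1 * e + (2 * Rabs tau * (2 * sinh U) * (C * e + C / X) + 2 * (C * e + C / X))). lra.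
    apply Req_le. unfold A0. field. lra. }
  apply le_epsilon. intros eps Heps.
  set (e := Rmin (1 / 2) (eps / (A0 + B1 + 1))).
  assert (He : 0 < e < 1). { split. apply Rmin_pos. lra. apply Rdiv_lt_0_compat; lra. apply Rle_lt_trans with (1 := Rmin_l _ _). lra. }
  apply Rle_trans with (1 := Main e He). apply Rplus_le_compat_l.
  apply Rle_trans with ((A0 + B1 + 1) * (eps / (A0 + B1 + 1))). 2: apply Req_le; field; lra.
  apply Rmult_le_compat; try lra. apply Rmin_r.
Qed.

(** * The index integral *)

(** The Mellin transform of k rescaled by c. The two factors 1/Gamma(1 + i tau) cancel the square of
    Gamma(1 + i tau) supplied by [gam_beta_const], so that only a real constant and the phase
    (2c)^(2i tau) remain. *)
Lemma leading_int tau z c : gam 0 tau z -> 0 < c ->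
  has_int (fun x => snd (Cmult (Cmult (Cinv z) (Cinv z)) (cos (2 * tau * ln (x / 2)), sin (2 * tau * ln (x / 2)))) * struve_k (c * x))
    (sin (2 * tau * ln (2 * c)) / (2 * PI * cosh (PI * tau) * c)).
Proof.
  intros Hz Hc. assert (Hz0 := gam_neq_0 _ _ Hz). assert (HP := PI_RGT_0). assert (Hch := cosh_ge_1 (PI * tau)).
  destruct (gam_ex 0 (2 * tau)) as (z2 & Hz2).
  destruct (beta_ex (3 / 2) (- (2 * tau))) as (b & Hb). lra.
  assert (HQ := gam_beta_const tau z z2 b Hz Hz2 Hb).
  destruct (mellin_struve_k (2 * tau) z2 b Hz2 Hb) as (M1 & M2).
  rewrite HQ in M1, M2. clear HQ.
  set (N := Cmult (RtoC (- / (2 * PI))) (Cmult (RtoC (/ cosh (PI * tau))) (Cmult z z))) in *.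
  set (L := - (2 * tau * ln (2 * c))).
  set (a := Cmult (Cmult (Cinv z) (Cinv z)) (cos L, sin L)).
  assert (Ea : snd (Cmult a N) = sin (2 * tau * ln (2 * c)) / (2 * PI * cosh (PI * tau))).
  { replace (Cmult a N) with (Cmult (RtoC (- / (2 * PI) * / cosh (PI * tau))) (cos L, sin L)).
    - unfold L. rewrite cos_neg, sin_neg. unfold Cmult, RtoC; cbn [fst snd]. field. split; lra.
    - unfold a, N. rewrite RtoC_mult. field. trivial. }
  assert (H := has_int_plus _ _ _ _ (has_int_scal _ (fst a) _ M2) (has_int_scal _ (snd a) _ M1)).
  assert (Hs := fun A => has_int_scale _ c _ Hc A H).
  replace (sin (2 * tau * ln (2 * c)) / (2 * PI * cosh (PI * tau) * c)) with (/ c * (fst a * snd N + snd a * fst N)).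
  - apply has_int_ext with (2 := Hs ltac:(intros x Hx; apply cont_plus; apply cont_scal; (apply cont_mult; [apply cont_ex_derive; auto_derive; assumption | now apply struve_k_cont]))).
    intros x Hx. cbv beta.
    replace (Cmult (Cmult (Cinv z) (Cinv z)) (cos (2 * tau * ln (x / 2)), sin (2 * tau * ln (x / 2)))) with (Cmult a (cos (2 * tau * ln (c * x)), sin (2 * tau * ln (c * x)))).
    + unfold Cmult at 1. cbn [fst snd]. ring.
    + unfold a. rewrite <- Cmult_assoc, cis_add.
      replace (L + 2 * tau * ln (c * x)) with (2 * tau * ln (x / 2)). reflexivity.
      unfold L. rewrite (ln_mult 2 c), (ln_mult c x), ln_div by lra. ring.
  - transitivity (/ c * snd (Cmult a N)). unfold Cmult at 1. cbn [fst snd]. reflexivity. rewrite Ea. field. repeat split; lra.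
Qed.

(** For large c = cosh U the kernel concentrates near x = 0. Replacing W by its leading part costs
    O(x^2/(1+x^2)) against |k(xc)| <= 1/(x^2 c^2), hence O(c^(-2)) in the integral and O(1/c) after
    multiplication by 2 sinh U. Finally ln(2c) = U + O(e^(-2U)) and sinh U / c = 1 + O(1/c). *)
Lemma sq_int_asymp tau z W T S C : gam 0 tau z -> 0 <= tau -> sq_sol tau W T S C ->
  (forall x, 0 < x -> Rabs (W x - snd (Cmult (Cmult (Cinv z) (Cinv z)) (cos (2 * tau * ln (x / 2)), sin (2 * tau * ln (x / 2))))) <= C * (x * x) / (1 + x * x)) ->
  exists A, forall U l, 0 < U -> has_int (fun x => W x * struve_k (x * cosh U)) l ->
    Rabs (2 * sinh U * l - sin (2 * tau * U) / (PI * cosh (PI * tau))) <= A / U.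
Proof.
  intros Hz Htau HS Hnear. assert (HC := ss_C _ _ _ _ _ HS). assert (HP := PI_RGT_0). assert (Hch := cosh_ge_1 (PI * tau)).
  set (ka := / (PI * cosh (PI * tau))).
  assert (Hka : 0 < ka) by (apply Rinv_0_lt_compat; nra).
  set (w0 := fun x => snd (Cmult (Cmult (Cinv z) (Cinv z)) (cos (2 * tau * ln (x / 2)), sin (2 * tau * ln (x / 2))))) in *.
  exists (C * PI + ka * (1 + 2 * tau)). intros U l HU Hl.
  set (c := cosh U). assert (Hc : 1 <= c) by apply cosh_ge_1.
  assert (HcU : U <= c). { apply Rle_trans with (sinh U). apply sinh_ge; lra. unfold c, cosh, sinh. generalize (exp_pos (- U)). lra. }
  assert (Hsc : 0 < sinh U <= c). { split. apply Rlt_le_trans with (2 := sinh_ge U ltac:(lra)); trivial. unfold c, cosh, sinh. generalize (exp_pos (- U)). lra. }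
  assert (M := leading_int tau z c Hz ltac:(lra)). fold w0 in M.
  set (m := sin (2 * tau * ln (2 * c)) / (2 * PI * cosh (PI * tau) * c)) in *.
  assert (Cw : cont_pos (fun x => W x * struve_k (x * c))).
  { intros x Hx. apply cont_mult. apply (cont_of_derive _ _ _ (ss_W _ _ _ _ _ HS x Hx)).
    apply (continuous_comp (fun x => x * c) struve_k). apply cont_ex_derive; auto_derive; trivial. apply struve_k_cont. nra. }
  assert (Cw0 : cont_pos (fun x => w0 x * struve_k (c * x))).
  { intros x Hx. apply cont_mult.
    - unfold w0. generalize (Cmult (Cinv z) (Cinv z)). intros (a1, a2). unfold Cmult. cbn [fst snd].
      apply cont_ex_derive. auto_derive. repeat split; lra.
    - apply (continuous_comp (fun x => c * x) struve_k). apply cont_ex_derive; auto_derive; trivial. apply struve_k_cont. nra. }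
  assert (E : Rabs (l - m) <= C / (c * c) * (PI / 2)).
  { destruct (has_int_atan (fun x => W x * struve_k (x * c) - w0 x * struve_k (c * x)) (C / (c * c))) as (d & D1 & D2 & _).
    - apply Rdiv_le_0_compat; nra.
    - intros x Hx. apply cont_minus. now apply Cw. now apply Cw0.
    - intros x Hx. rewrite (Rmult_comm c x), <- Rmult_minus_distr_r, Rabs_mult.
      assert (Hxc : 0 < x * c) by nra. assert (Hx2 : 0 < x * x) by nra. assert (Hc2 : 0 < c * c) by nra.
      assert (Bk : Rabs (struve_k (x * c)) <= / (x * x * (c * c))).
      { apply Rle_trans with (1 := struve_k_bound _ Hxc). apply Rinv_le_contravar; nra. }
      apply Rle_trans with (C * (x * x) / (1 + x * x) * / (x * x * (c * c))).
      apply Rmult_le_compat; try apply Rabs_pos; trivial. now apply Hnear.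
      apply Req_le. field. repeat split; nra.
    - rewrite <- (has_int_unique _ _ _ D1 (has_int_minus _ _ _ _ Hl M)). exact D2. }
  assert (E1 : Rabs (2 * sinh U * (l - m)) <= C * PI / c).
  { rewrite Rabs_mult, (Rabs_pos_eq (2 * sinh U)) by lra.
    apply Rle_trans with (2 * c * (C / (c * c) * (PI / 2))). apply Rmult_le_compat; try lra. apply Rabs_pos.
    apply Req_le. field. lra. }
  set (th := 2 * tau * ln (2 * c)).
  assert (Em : 2 * sinh U * m = ka * (sinh U / c * sin th)).
  { unfold m, ka. fold th. field. repeat split; lra. }
  assert (E2 : Rabs (sin th - sin (2 * tau * U)) <= 2 * tau / c).
  { apply Rle_trans with (1 := sin_lip _ _). unfold th. rewrite <- Rmult_minus_distr_l, Rabs_mult, Rabs_pos_eq by lra.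
    unfold Rdiv. apply Rmult_le_compat_l. lra.
    assert (Ec : 2 * c = exp U * (1 + exp (- U) * exp (- U))).
    { unfold c, cosh. assert (exp U * exp (- U) = 1) by (rewrite <- exp_plus, Rplus_opp_r; apply exp_0).
      transitivity (exp U + (exp U * exp (- U)) * exp (- U)). rewrite H. field. ring. }
    assert (Pe := exp_pos (- U)). assert (Pe1 : exp (- U) < 1). { rewrite <- exp_0. apply exp_increasing. lra. }
    rewrite Ec, ln_mult, ln_exp by (try apply exp_pos; nra).
    replace (U + ln (1 + exp (- U) * exp (- U)) - U) with (ln (1 + exp (- U) * exp (- U))) by ring.
    assert (L1 : ln (1 + exp (- U) * exp (- U)) <= exp (- U) * exp (- U)).
    { rewrite <- (ln_exp (exp (- U) * exp (- U))) at 2. apply ln_le. nra. generalize (exp_ineq1_le (exp (- U) * exp (- U))). lra. }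
    assert (L0 : 0 <= ln (1 + exp (- U) * exp (- U))). { rewrite <- ln_1. apply ln_le; nra. }
    rewrite Rabs_pos_eq by trivial. apply Rle_trans with (1 := L1).
    assert (exp (- U) * c <= 1). { unfold c, cosh. assert (exp U * exp (- U) = 1) by (rewrite <- exp_plus, Rplus_opp_r; apply exp_0). nra. }
    apply Rmult_le_reg_r with c. lra. rewrite Rinv_l by lra. nra. }
  assert (E3 : Rabs (sinh U / c - 1) <= 1 / c).
  { replace (sinh U / c - 1) with (- ((c - sinh U) / c)) by (field; lra). rewrite Rabs_Ropp, Rabs_pos_eq.
    unfold Rdiv. apply Rmult_le_compat_r. left; apply Rinv_0_lt_compat; lra. unfold c, cosh, sinh.
    assert (Pe1 : exp (- U) < 1). { rewrite <- exp_0. apply exp_increasing. lra. } lra.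
    apply Rdiv_le_0_compat; lra. }
  replace (2 * sinh U * l - sin (2 * tau * U) / (PI * cosh (PI * tau))) with
    (2 * sinh U * (l - m) + ka * ((sinh U / c - 1) * sin th + (sin th - sin (2 * tau * U)))).
  2: { transitivity (2 * sinh U * l - 2 * sinh U * m + ka * (sinh U / c * sin th) - ka * sin (2 * tau * U)). ring. rewrite Em. unfold ka, Rdiv. ring. }
  eapply Rle_trans. apply Rabs_triang. rewrite (Rabs_mult ka), (Rabs_pos_eq ka) by lra.
  assert (E4 : Rabs ((sinh U / c - 1) * sin th + (sin th - sin (2 * tau * U))) <= 1 / c + 2 * tau / c).
  { eapply Rle_trans. apply Rabs_triang. apply Rplus_le_compat; trivial. rewrite Rabs_mult. rewrite <- (Rmult_1_r (1 / c)).
    apply Rmult_le_compat; try apply Rabs_pos; trivial. apply Rabs_sin_le. }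
  apply Rle_trans with ((C * PI + ka * (1 + 2 * tau)) / c).
  - apply Rle_trans with (C * PI / c + ka * (1 / c + 2 * tau / c)). apply Rplus_le_compat; trivial. apply Rmult_le_compat_l; lra.
    apply Req_le. field. lra.
  - unfold Rdiv. apply Rmult_le_compat_l. assert (0 <= C * PI) by nra. nra. apply Rinv_le_contravar; lra.
Qed.

(** At U = m pi / tau one has sin(2 tau U) = 0 and cos(2 tau U) = 1. An integration by parts turns
    [sech_sin] into -2 tau times the integral of cos(2 tau u)/cosh u, and w = e^(-u) identifies that
    with twice the half-line integral of b_1. So [sech_sin] stays away from 0 where the sine
    vanishes. *)
Lemma sech_sin_lower tau m : 0 < tau ->
  let U := INR m * PI / tau in 1 <= INR m ->
  - (2 * tau) * (PI / (2 * cosh (PI * tau))) - 4 * tau * exp (- U) <= sech_sin tau U <= - (2 * tau) * (PI / (2 * cosh (PI * tau))) + 4 * tau * exp (- U).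
Proof.
  intros Ht U Hm. assert (HP := PI2_3_2). assert (Hch := cosh_ge_1 (PI * tau)).
  assert (HU : 0 < U). { unfold U. apply Rdiv_lt_0_compat; nra. }
  assert (E2 : 2 * tau * U = 0 + 2 * INR m * PI) by (unfold U; field; lra).
  assert (Es : sin (2 * tau * U) = 0) by (rewrite E2, sin_period; apply sin_0).
  assert (Ec : cos (2 * tau * U) = 1) by (rewrite E2, cos_period; apply cos_0).
  assert (A1 : sech_sin tau U = - (2 * tau) * RInt (fun u => cos (2 * tau * u) / cosh u) 0 U).
  { assert (Cc : forall u, continuous (fun u => cos (2 * tau * u) / cosh u) u).
    { intros u. apply cont_ex_derive. auto_derive. generalize (cosh_ge_1 u); lra. }
    assert (FT : is_RInt (fun u => - (sin (2 * tau * u) * sinh u / (cosh u * cosh u)) + 2 * tau * (cos (2 * tau * u) / cosh u)) 0 U (sin (2 * tau * U) / cosh U - sin (2 * tau * 0) / cosh 0)).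
    { apply (RInt_FTC (fun u => sin (2 * tau * u) / cosh u)). lra.
      - intros u _. auto_derive. generalize (cosh_ge_1 u); lra. field. generalize (cosh_ge_1 u); lra.
      - intros u _. apply cont_ex_derive. auto_derive. generalize (cosh_ge_1 u). intros. repeat split; nra. }
    apply (is_RInt_unique (V := R_CompleteNormedModule)) in FT.
    rewrite Es, Rmult_0_r, sin_0 in FT. rewrite RInt_plus_R, RInt_scal_R in FT.
    2: { apply ex_RInt_cont. lra. intros; apply Cc. }
    2: { apply ex_RInt_cont. lra. intros u _. apply cont_ex_derive. auto_derive. generalize (cosh_ge_1 u). nra. }
    2: { apply ex_RInt_cont. lra. intros; apply cont_scal; apply Cc. }
    replace (sech_sin tau U) with (RInt (fun u => - (sin (2 * tau * u) * sinh u / (cosh u * cosh u))) 0 U).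
    unfold Rdiv in FT at 2 3. lra.
    unfold sech_sin. apply RInt_ext_R. lra. intros u _. replace (2 * tau * (U - u)) with (2 * tau * U - 2 * tau * u) by ring.
    rewrite sin_minus, Es, Ec. unfold Rdiv. ring. }
  assert (He : 0 < exp (- U) < 1). { split. apply exp_pos. rewrite <- exp_0. apply exp_increasing. lra. }
  assert (A2 : RInt (fun u => cos (2 * tau * u) / cosh u) 0 U = 2 * RInt (fun w => cos (2 * tau * ln w) / (1 + w * w)) (exp (- U)) 1).
  { set (f := fun w => cos (2 * tau * ln w) / (1 + w * w)).
    assert (Cf : forall x, 0 < x -> continuous f x). { intros x Hx. unfold f. apply cont_ex_derive. auto_derive. split; nra. }
    assert (K := RInt_comp (V := R_CompleteNormedModule) f (fun u => exp (- u)) (fun u => - exp (- u)) 0 U).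
    cbv beta in K. rewrite Ropp_0, exp_0 in K.
    rewrite <- (opp_RInt_swap (V := R_CompleteNormedModule) f 1 (exp (- U))).
    2: { apply (ex_RInt_continuous (V := R_CompleteNormedModule)). intros x. rewrite Rmin_right, Rmax_left by lra. intros Hx. apply Cf. lra. }
    rewrite <- K.
    - transitivity (RInt (fun u => -2 * (- exp (- u) * f (exp (- u)))) 0 U).
      + apply RInt_ext_R. lra. intros u Hu. unfold f. rewrite ln_exp. rewrite <- Ropp_mult_distr_r, cos_neg.
        unfold cosh. assert (Q : exp u * exp (- u) = 1) by (rewrite <- exp_plus, Rplus_opp_r; apply exp_0).
        assert (Pu := exp_pos u). assert (Pu' := exp_pos (- u)).
        apply Rmult_eq_reg_r with ((exp u + exp (- u)) * (1 + exp (- u) * exp (- u))). 2: nra.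
        field_simplify; try nra. replace (2 * cos (2 * tau * u) * exp (- u) ^ 2 + 2 * cos (2 * tau * u)) with (2 * cos (2 * tau * u) * (exp (- u) * exp (- u) + exp u * exp (- u))) by (rewrite Q; ring). ring.
      + rewrite RInt_scal_R. unfold opp; simpl. unfold scal; simpl; unfold mult; simpl. ring.
        apply ex_RInt_cont. lra. intros u Hu. apply cont_mult. apply cont_ex_derive; auto_derive; trivial.
        apply (continuous_comp (fun u => exp (- u)) f). apply cont_ex_derive; auto_derive; trivial. apply Cf. apply exp_pos.
    - intros x _. apply Cf. apply exp_pos.
    - intros x _. split. auto_derive. trivial. ring. apply cont_ex_derive; auto_derive; trivial. }
  assert (H := half_beta_one (2 * tau) (exp (- U)) He).
  rewrite A1, A2. replace (2 * tau * (PI / 2)) with (PI * tau) in H by field.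
  set (i := RInt (fun w => cos (2 * tau * ln w) / (1 + w * w)) (exp (- U)) 1) in *.
  replace (PI / (2 * cosh (PI * tau))) with (2 * (PI / (4 * cosh (PI * tau)))) by (field; lra).
  set (q := PI / (4 * cosh (PI * tau))) in *. apply Rabs_le_between in H. split; nra.
Qed.

(** Duhamel's formula leaves two unknowns: the mean at infinity and the value l0 at U = 0. Zeros of
    sin(2 tau U) eliminate the mean, and then maxima of the same sine determine l0 from the
    asymptotics in U. *)
Lemma index_integral tau z W T S C U l : gam 0 tau z -> 0 < tau -> sq_sol tau W T S C ->
  (forall x, 0 < x -> Rabs (W x - snd (Cmult (Cmult (Cinv z) (Cinv z)) (cos (2 * tau * ln (x / 2)), sin (2 * tau * ln (x / 2))))) <= C * (x * x) / (1 + x * x)) ->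
  0 <= U -> has_int (fun x => W x * struve_k (x * cosh U)) l ->
  2 * sinh U * l = sin (2 * tau * U) / (PI * cosh (PI * tau)).
Proof.
  intros Hz Ht HS Hnear HU Hl. assert (HP := PI2_3_2). assert (Hch := cosh_ge_1 (PI * tau)).
  destruct (sq_int_asymp tau z W T S C Hz ltac:(lra) HS Hnear) as (A & HA).
  destruct (sq_int_ex tau W T S C 0 HS) as (l0 & Hl0 & _).
  set (sg := fun X => (S X + 2 * (X * X) * W X) / X / (2 * PI)).
  (* The mean term sg tends to 0: test against U = m PI / tau with m large. *)
  assert (Sg : forall eps, 0 < eps -> exists X0, 1 <= X0 /\ forall X, X0 <= X -> Rabs (sg X) <= eps).
  { intros eps He.
    set (q := PI / (2 * cosh (PI * tau))). assert (Hq : 0 < q) by (apply Rdiv_lt_0_compat; lra).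
    (* need m with 4 tau exp(-U) <= tau q and 2 tau A / U <= eps tau q / 2 *)
    set (V := 4 / q + 4 * Rabs A / (eps * q) + 1).
    assert (HV1 : 0 < 4 / q) by (apply Rdiv_lt_0_compat; lra).
    assert (HV2 : 0 <= 4 * Rabs A / (eps * q)). { apply Rdiv_le_0_compat. generalize (Rabs_pos A); lra. nra. }
    destruct (nfloor_ex (V * tau)) as (N & _ & HN). { apply Rmult_le_pos; unfold V; lra. }
    set (Um := INR (N + 1) * PI / tau).
    assert (HNN : 1 <= INR (N + 1)). { rewrite plus_INR. simpl (INR 1). generalize (pos_INR N); lra. }
    assert (HUm : V <= Um).
    { unfold Um. apply le_div; trivial. rewrite plus_INR. simpl (INR 1). assert (0 <= INR N) by apply pos_INR. nra. }
    assert (HUm0 : 0 < Um) by (unfold V in HUm; lra).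
    assert (HR := sech_sin_lower tau (N + 1) Ht HNN). cbv zeta in HR. fold Um in HR. fold q in HR.
    assert (HE : exp (- Um) <= q / 4).
    { generalize (pow_exp_le 1 Um ltac:(lra)) (exp_pos (- Um)). simpl. intros K Pe.
      apply Rmult_le_reg_l with (4 / q). lra. replace (4 / q * (q / 4)) with 1 by (field; lra).
      apply Rle_trans with (Um * 1 * exp (- Um)); trivial. rewrite Rmult_1_r. apply Rmult_le_compat_r. lra. unfold V in HUm. lra. }
    destruct (sq_int_ex tau W T S C Um HS) as (lm & Hlm & _).
    assert (AA := HA Um lm HUm0 Hlm).
    assert (Es : sin (2 * tau * Um) = 0).
    { replace (2 * tau * Um) with (0 + 2 * INR (N + 1) * PI) by (unfold Um; field; lra). rewrite sin_period; apply sin_0. }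
    rewrite Es in AA. unfold Rdiv in AA at 1. rewrite Rmult_0_l, Rminus_0_r in AA.
    destruct (duhamel_limit tau W T S C Um lm l0 HS ltac:(lra) Hlm Hl0) as (B & HB).
    exists (Rmax 1 (2 * Rabs B / (eps * (tau * q)))). split. apply Rmax_l. intros X HX.
    assert (HX1 : 1 <= X) by (apply Rle_trans with (2 := HX); apply Rmax_l).
    assert (HX2 : 2 * Rabs B / (eps * (tau * q)) <= X) by (apply Rle_trans with (2 := HX); apply Rmax_r).
    specialize (HB X HX1). fold (sg X) in HB. rewrite Es in HB.
    assert (HtQ : 0 < tau * q) by nra.
    assert (B1 : B / X <= eps * (tau * q) / 2).
    { apply div_le. lra. apply Rle_trans with (1 := Rle_abs B). apply Rle_div_l in HX2; [lra | apply Rmult_lt_0_compat; lra]. }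
    assert (B2 : A / Um <= eps * q / 4).
    { apply div_le. lra. apply Rle_trans with (1 := Rle_abs A).
      assert (HV3 : 4 * Rabs A / (eps * q) <= Um) by (unfold V in HUm; lra). apply (proj1 (Rle_div_l _ _ _ (Rmult_lt_0_compat _ _ He Hq))) in HV3. lra. }
    assert (B3 : tau * q <= Rabs (sech_sin tau Um)). { rewrite Rabs_left1; nra. }
    assert (B4 : Rabs (sg X) * Rabs (sech_sin tau Um) <= eps * (tau * q)).
    { rewrite <- Rabs_mult.
      replace (sg X * sech_sin tau Um) with (- (2 * tau * (2 * sinh Um * lm) - 2 * 0 * l0 - sg X * sech_sin tau Um) + 2 * tau * (2 * sinh Um * lm)) by ring.
      eapply Rle_trans. apply Rabs_triang. rewrite Rabs_Ropp, (Rabs_mult (2 * tau)), (Rabs_pos_eq (2 * tau)) by lra.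
      assert (2 * tau * Rabs (2 * sinh Um * lm) <= 2 * tau * (eps * q / 4)) by (apply Rmult_le_compat_l; lra). lra. }
    apply Rmult_le_reg_r with (tau * q); trivial. apply Rle_trans with (2 := B4). apply Rmult_le_compat_l; trivial. apply Rabs_pos. }
  (* With the mean tending to 0, letting X grow for a fixed U leaves only the multiple of sin(2 tau
     U). *)
  assert (Key : forall U l, 0 <= U -> has_int (fun x => W x * struve_k (x * cosh U)) l -> tau * (2 * sinh U * l) = sin (2 * tau * U) * l0).
  { intros V lv HV Hlv. destruct (duhamel_limit tau W T S C V lv l0 HS HV Hlv Hl0) as (B & HB).
    apply cond_eq. intros eps He.
    set (r := Rabs (sech_sin tau V) + 1). assert (Hr : 0 < r) by (unfold r; generalize (Rabs_pos (sech_sin tau V)); lra).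
    destruct (Sg (eps / (2 * r))) as (X0 & HX0 & HX). apply Rdiv_lt_0_compat; lra.
    set (X := Rmax X0 (4 * Rabs B / eps)).
    assert (H1 : X0 <= X) by apply Rmax_l. assert (H2 : 4 * Rabs B / eps <= X) by apply Rmax_r.
    specialize (HX X H1). specialize (HB X ltac:(lra)). fold (sg X) in HB.
    assert (B1 : B / X <= eps / 4). { apply div_le. lra. apply Rle_trans with (1 := Rle_abs B). apply Rle_div_l in H2; lra. }
    assert (B2 : Rabs (sg X * sech_sin tau V) <= eps / 2).
    { rewrite Rabs_mult. apply Rle_trans with (eps / (2 * r) * r). apply Rmult_le_compat; try apply Rabs_pos; trivial. unfold r; lra. apply Req_le. field. lra. }
    replace (tau * (2 * sinh V * lv) - sin (2 * tau * V) * l0) with (/ 2 * ((2 * tau * (2 * sinh V * lv) - 2 * sin (2 * tau * V) * l0 - sg X * sech_sin tau V) + sg X * sech_sin tau V)) by field.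
    rewrite Rabs_mult, (Rabs_pos_eq (/ 2)) by lra.
    assert (Rabs ((2 * tau * (2 * sinh V * lv) - 2 * sin (2 * tau * V) * l0 - sg X * sech_sin tau V) + sg X * sech_sin tau V) <= eps / 4 + eps / 2).
    { eapply Rle_trans. apply Rabs_triang. lra. }
    lra. }
  (* At U = m pi / tau + pi/(4 tau) the sine is 1, so the value of tau 2 sinh U l is l0 for every m,
     while its limit as m grows is known. *)
  assert (L0 : l0 = tau / (PI * cosh (PI * tau))).
  { apply cond_eq. intros eps He.
    destruct (nfloor_ex (2 * (Rabs A * (tau * tau)) / eps)) as (N & _ & HN). { apply Rdiv_le_0_compat; trivial. generalize (Rabs_pos A). nra. }
    set (Um := INR (N + 1) * PI / tau + PI / (4 * tau)).
    assert (HNN : 1 <= INR (N + 1)). { rewrite plus_INR. simpl (INR 1). generalize (pos_INR N); lra. }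
    assert (HUm : INR (N + 1) / tau <= Um).
    { unfold Um. assert (0 < PI / (4 * tau)) by (apply Rdiv_lt_0_compat; lra). assert (INR (N + 1) / tau <= INR (N + 1) * PI / tau).
      unfold Rdiv. apply Rmult_le_compat_r. left; now apply Rinv_0_lt_compat. nra. lra. }
    assert (HUm1 : 0 < INR (N + 1) / tau) by (apply Rdiv_lt_0_compat; lra).
    destruct (sq_int_ex tau W T S C Um HS) as (lm & Hlm & _).
    assert (K := Key Um lm ltac:(lra) Hlm). assert (AA := HA Um lm ltac:(lra) Hlm).
    assert (Es : sin (2 * tau * Um) = 1).
    { replace (2 * tau * Um) with (PI / 2 + 2 * INR (N + 1) * PI) by (unfold Um; field; lra). rewrite sin_period; apply sin_PI2. }
    rewrite Es, Rmult_1_l in K. rewrite Es in AA.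
    rewrite <- K. replace (tau * (2 * sinh Um * lm) - tau / (PI * cosh (PI * tau))) with (tau * (2 * sinh Um * lm - 1 / (PI * cosh (PI * tau)))) by (field; lra).
    rewrite Rabs_mult, (Rabs_pos_eq tau) by lra.
    apply Rle_lt_trans with (tau * (A / Um)). apply Rmult_le_compat_l; lra.
    replace (tau * (A / Um)) with (tau * A / Um) by (unfold Rdiv; ring). apply Rlt_div_l. lra.
    apply Rle_lt_trans with (tau * Rabs A). apply Rmult_le_compat_l. lra. apply Rle_abs.
    apply Rlt_le_trans with (eps * (INR (N + 1) / tau)). 2: apply Rmult_le_compat_l; lra.
    replace (eps * (INR (N + 1) / tau)) with (eps * INR (N + 1) / tau) by (unfold Rdiv; ring).
    apply (proj1 (Rlt_div_r _ _ _ Ht)). rewrite plus_INR. simpl (INR 1). apply (proj1 (Rlt_div_l _ _ _ He)) in HN. generalize (Rabs_pos A). intros.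
    assert (0 <= Rabs A * (tau * tau)) by nra. lra. }
  assert (K := Key U l HU Hl). rewrite L0 in K.
  apply Rmult_eq_reg_l with tau. 2: lra. rewrite K. field. lra.
Qed.

(** * Parseval's identity *)

(** The sum of the first n terms, empty for n = 0, in contrast to the inclusive [sum_f_R0] and
    [sum_n]; Cesaro means need this partial sum of index 0. *)
Fixpoint psum (a : nat -> R) (n : nat) : R := match n with O => 0 | S m => psum a m + a m end.

Lemma ex_RInt_all (f : R -> R) a b : (forall x, continuous f x) -> ex_RInt f a b.
Proof. intros H. apply (ex_RInt_continuous (V := R_CompleteNormedModule)). intros; apply H. Qed.

Lemma psum_cont (f : nat -> R -> R) n x : (forall k x, continuous (f k) x) -> continuous (fun x => psum (fun k => f k x) n) x.
Proof.
  intros H. induction n as [|n IH]; simpl. apply continuous_const. apply cont_plus; [exact IH | apply H].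
Qed.

Lemma RInt_psum (f : nat -> R -> R) n a b : (forall k x, continuous (f k) x) ->
  RInt (fun x => psum (fun k => f k x) n) a b = psum (fun k => RInt (f k) a b) n.
Proof.
  intros H. induction n as [|n IH]; simpl.
  - transitivity (scal (b - a) 0). apply (RInt_const (V := R_CompleteNormedModule)). unfold scal; simpl; unfold mult; simpl. ring.
  - rewrite <- IH. rewrite <- (RInt_plus_R (fun x => psum (fun k => f k x) n) (f n)). reflexivity.
    apply ex_RInt_all. intros; now apply psum_cont. apply ex_RInt_all. apply H.
Qed.

Lemma RInt_shift (f : R -> R) c a b : (forall x, continuous f x) -> RInt (fun x => f (x + c)) a b = RInt f (a + c) (b + c).
Proof.
  intros Hf.
  assert (K := RInt_comp_lin (V := R_CompleteNormedModule) f 1 c a b (ex_RInt_all f _ _ Hf)).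
  rewrite 2!Rmult_1_l in K. rewrite <- K. apply (RInt_ext (V := R_CompleteNormedModule)). intros x _. unfold scal; simpl; unfold mult; simpl. rewrite 2!Rmult_1_l. reflexivity.
Qed.

Lemma RInt_periodic (f : R -> R) c : (forall x, continuous f x) -> (forall x, f (x + 2 * PI) = f x) ->
  RInt f (- PI + c) (PI + c) = RInt f (- PI) PI.
Proof.
  intros Hf HP.
  assert (E1 : RInt f (- PI + c) (- PI) + RInt f (- PI) (PI + c) = RInt f (- PI + c) (PI + c)) by (apply RInt_Chasles_R; now apply ex_RInt_all).
  assert (E2 : RInt f (- PI) PI + RInt f PI (PI + c) = RInt f (- PI) (PI + c)) by (apply RInt_Chasles_R; now apply ex_RInt_all).
  assert (E3 : RInt f PI (PI + c) = RInt f (- PI) (- PI + c)).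
  { assert (K := RInt_shift f (2 * PI) (- PI) (- PI + c) Hf).
    replace (- PI + 2 * PI) with PI in K by ring. replace (- PI + c + 2 * PI) with (PI + c) in K by ring. rewrite <- K.
    apply (RInt_ext (V := R_CompleteNormedModule)). intros x _. apply HP. }
  assert (E4 : RInt f (- PI + c) (- PI) + RInt f (- PI) (- PI + c) = RInt f (- PI + c) (- PI + c)) by (apply RInt_Chasles_R; now apply ex_RInt_all).
  assert (E5 : RInt f (- PI + c) (- PI + c) = 0) by apply (RInt_point (V := R_CompleteNormedModule)).
  lra.
Qed.

Lemma RInt_odd_zero (f : R -> R) a : (forall x, continuous f x) -> (forall x, f (- x) = - f x) -> RInt f (- a) a = 0.
Proof.
  intros Hf Ho.
  assert (K := RInt_comp_lin (V := R_CompleteNormedModule) f (-1) 0 (- a) a (ex_RInt_all f _ _ Hf)).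
  replace (-1 * - a + 0) with a in K by ring. replace (-1 * a + 0) with (- a) in K by ring.
  rewrite (RInt_ext (V := R_CompleteNormedModule) _ f) in K.
  2: { intros x _. unfold scal; simpl; unfold mult; simpl. replace (-1 * x + 0) with (- x) by ring. rewrite Ho. ring. }
  assert (K2 := opp_RInt_swap (V := R_CompleteNormedModule) f (- a) a (ex_RInt_all f _ _ Hf)).
  unfold opp in K2; simpl in K2.
  assert (E : - RInt f (- a) a = RInt f (- a) a) by (rewrite K2; symmetry; exact K). lra.
Qed.

(** * Dirichlet and Fejer kernels *)

Definition dirichlet (M : nat) (s : R) : R := 1 + psum (fun k => 2 * cos (INR (S k) * s)) M.
(** Not averaged: the integral over a period is 2 pi N, and the division by N takes place where the
    kernel is applied. *)
Definition fejer (N : nat) (s : R) : R := psum (fun M => dirichlet M s) N.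

Lemma dirichlet_tele M s : (1 - cos s) * dirichlet M s = cos (INR M * s) - cos (INR (S M) * s).
Proof.
  induction M as [|M IH].
  - unfold dirichlet. simpl. rewrite Rmult_0_l, cos_0, Rmult_1_l. ring.
  - assert (E : dirichlet (S M) s = dirichlet M s + 2 * cos (INR (S M) * s)) by (unfold dirichlet; cbn [psum]; ring).
    rewrite E, Rmult_plus_distr_l, IH.
    set (a := INR (S M) * s).
    replace (INR M * s) with (a - s) by (unfold a; rewrite S_INR; ring).
    replace (INR (S (S M)) * s) with (a + s) by (unfold a; rewrite (S_INR (S M)); ring).
    rewrite cos_minus, cos_plus. ring.
Qed.

(** The products (1 - cos s) [dirichlet M s] are differences of consecutive cosines and telescope.
    Positivity of the kernel and the bound on s^2 [fejer] both follow from this identity. *)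
Lemma fejer_tele N s : (1 - cos s) * fejer N s = 1 - cos (INR N * s).
Proof.
  induction N as [|N IH].
  - unfold fejer. simpl. rewrite Rmult_0_l, cos_0. ring.
  - unfold fejer in *. cbn [psum]. rewrite Rmult_plus_distr_l, IH, dirichlet_tele. ring.
Qed.

Lemma sqr_le_one_minus_cos s : - PI <= s <= PI -> s * s <= 8 * (1 - cos s).
Proof.
  intros Hs. replace s with (2 * (s / 2)) at 3 by field. rewrite cos_2a_sin.
  assert (K : Rabs (s / 2) / 2 <= Rabs (sin (s / 2))).
  { destruct (Rle_dec 0 s).
    - rewrite Rabs_pos_eq by lra. generalize (sin_ge_half (s / 2) ltac:(lra)). intros. rewrite Rabs_pos_eq; lra.
    - rewrite Rabs_left by lra. generalize (sin_ge_half (- (s / 2)) ltac:(lra)). rewrite sin_neg. intros. rewrite Rabs_left1; lra. }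
  assert (K2 : Rabs (s / 2) / 2 * (Rabs (s / 2) / 2) <= Rabs (sin (s / 2)) * Rabs (sin (s / 2))).
  { assert (0 <= Rabs (s / 2)) by apply Rabs_pos. apply Rmult_le_compat; lra. }
  replace (Rabs (s / 2) / 2 * (Rabs (s / 2) / 2)) with (Rabs (s / 2) * Rabs (s / 2) / 4) in K2 by field.
  rewrite <- 2!Rabs_mult in K2. rewrite Rabs_pos_eq in K2 by nra. rewrite Rabs_pos_eq in K2 by nra. nra.
Qed.

Lemma dirichlet_at_0 M : 0 <= dirichlet M 0.
Proof.
  unfold dirichlet. induction M as [|M IH]; cbn [psum]. lra. rewrite Rmult_0_r, cos_0. lra.
Qed.

Lemma fejer_nonneg N s : - PI <= s <= PI -> 0 <= fejer N s.
Proof.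
  intros Hs. destruct (Req_dec s 0) as [->|H].
  - unfold fejer. induction N as [|N IH]; simpl. lra. generalize (dirichlet_at_0 N). lra.
  - generalize (sqr_le_one_minus_cos s Hs) (fejer_tele N s) (COS_bound (INR N * s)). intros A B C.
    assert (0 < s * s) by (destruct (Rtotal_order s 0) as [?|[?|?]]; nra).
    apply Rmult_le_reg_l with (1 - cos s). lra. rewrite Rmult_0_r, B. lra.
Qed.

Lemma fejer_sqr N s : - PI <= s <= PI -> s * s * fejer N s <= 16.
Proof.
  intros Hs. generalize (sqr_le_one_minus_cos s Hs) (fejer_tele N s) (COS_bound (INR N * s)) (fejer_nonneg N s Hs). intros A B C D.
  apply Rle_trans with (8 * (1 - cos s) * fejer N s). now apply Rmult_le_compat_r. lra.
Qed.

Lemma dirichlet_cont M s : continuous (dirichlet M) s.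
Proof.
  unfold dirichlet. apply cont_plus. apply continuous_const. apply (psum_cont (fun k s => 2 * cos (INR (S k) * s))).
  intros k x. apply cont_ex_derive. auto_derive. trivial.
Qed.

Lemma fejer_cont M s : continuous (fejer M) s.
Proof. apply (psum_cont dirichlet). apply dirichlet_cont. Qed.

Lemma RInt_cos_zero n : RInt (fun s => cos (INR (S n) * s)) (- PI) PI = 0.
Proof.
  assert (Hn : 0 < INR (S n)) by (apply lt_0_INR; lia). assert (HP := PI_RGT_0). set (m := INR (S n)) in *.
  assert (E : sin (m * PI) = 0). { unfold m. clear. induction n as [|n IH]. simpl. rewrite Rmult_1_l. apply sin_PI.
    rewrite S_INR, Rmult_plus_distr_r, Rmult_1_l, neg_sin, IH. ring. }
  rewrite (is_RInt_unique (V := R_CompleteNormedModule) _ _ _ (sin (m * PI) / m - sin (m * - PI) / m)).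
  - rewrite <- Ropp_mult_distr_r, sin_neg, E. eq_in_R. field. lra.
  - apply (RInt_FTC (fun s => sin (m * s) / m)). lra.
    + intros x _. auto_derive. trivial. field. lra.
    + intros x _. apply cont_ex_derive. auto_derive. trivial.
Qed.

Lemma RInt_dirichlet M : RInt (dirichlet M) (- PI) PI = 2 * PI.
Proof.
  unfold dirichlet. rewrite RInt_plus_R.
  - rewrite RInt_psum by (intros k x; apply cont_ex_derive; auto_derive; trivial).
    assert (E : psum (fun k => RInt (fun s => 2 * cos (INR (S k) * s)) (- PI) PI) M = 0).
    { induction M as [|M IH]; cbn [psum]. reflexivity. rewrite IH, RInt_scal_R, RInt_cos_zero. ring.
      apply ex_RInt_all. intros x. apply cont_ex_derive. auto_derive. trivial. }
    rewrite E. assert (E2 : RInt (fun _ : R => 1) (- PI) PI = scal (PI - - PI) 1) by apply (RInt_const (V := R_CompleteNormedModule)).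
    unfold scal in E2; simpl in E2; unfold mult in E2; simpl in E2. rewrite E2. eq_in_R. ring.
  - apply ex_RInt_all. intros; apply continuous_const.
  - apply ex_RInt_all. intros x. apply (psum_cont (fun k s => 2 * cos (INR (S k) * s))). intros; apply cont_ex_derive; auto_derive; trivial.
Qed.

Lemma RInt_fejer N : RInt (fejer N) (- PI) PI = 2 * PI * INR N.
Proof.
  unfold fejer. rewrite RInt_psum by (intros; apply dirichlet_cont).
  induction N as [|N IH]; cbn [psum]. simpl; ring. rewrite IH, RInt_dirichlet, S_INR. eq_in_R; ring.
Qed.

(** The Lipschitz bound is phrased for increments |s| <= pi at an arbitrary base point, the form in
    which convolutions over [-pi, pi] use it. *)
Definition periodic_lip (phi : R -> R) (L : R) : Prop :=
  0 <= L /\ (forall u, phi (u + 2 * PI) = phi u) /\ forall u s, Rabs s <= PI -> Rabs (phi (u + s) - phi u) <= L * Rabs s.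

Lemma periodic_lip_cont phi L u : periodic_lip phi L -> continuous phi u.
Proof.
  intros (HL & _ & H). apply filterlim_locally. intros eps.
  assert (Hd : 0 < Rmin 1 (eps / (L + 1))) by (apply Rmin_pos; [lra | apply Rdiv_lt_0_compat; [apply cond_pos | lra]]).
  exists (mkposreal _ Hd). intros v Hv.
  unfold ball in *; simpl in *; unfold AbsRing_ball, abs, minus, plus, opp in *; simpl in *.
  assert (h1 : Rabs (v + - u) < 1) by (apply Rlt_le_trans with (1 := Hv); apply Rmin_l).
  assert (h2 : Rabs (v + - u) < eps / (L + 1)) by (apply Rlt_le_trans with (1 := Hv); apply Rmin_r).
  assert (HP := PI2_3_2). specialize (H u (v + - u) ltac:(lra)). replace (u + (v + - u)) with v in H by ring.
  apply Rle_lt_trans with (1 := H). apply (proj2 (Rlt_div_r _ _ _ (ltac:(lra) : L + 1 > 0))) in h2.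
  generalize (Rabs_pos (v + - u)). nra.
Qed.

(* Averages of the Dirichlet convolutions are Fejer convolutions, which converge uniformly for Lipschitz functions. *)
Lemma fejer_approx phi L N u : periodic_lip phi L -> (1 <= N)%nat ->
  Rabs (RInt (fun s => phi (u + s) * fejer N s) (- PI) PI / INR N - 2 * PI * phi u) <= 20 * L * PI / sqrt (INR N).
Proof.
  intros Hphi HN. assert (HP := PI_RGT_0).
  assert (Cphi : forall u, continuous phi u) by (intros; now apply periodic_lip_cont with L).
  destruct Hphi as (HL & Hper & Hlip).
  assert (HN0 : 0 < INR N) by (apply lt_0_INR; lia).
  set (r := sqrt (INR N)). assert (Hr : 0 < r) by now apply sqrt_lt_R0.
  assert (Hrr : r * r = INR N) by (apply sqrt_sqrt; lra).
  assert (Cf : forall s, continuous (fun s => phi (u + s) * fejer N s) s).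
  { intros s. apply cont_mult. apply (continuous_comp (fun s => u + s) phi). apply cont_plus. apply continuous_const. apply continuous_id. apply Cphi. apply fejer_cont. }
  assert (E : RInt (fun s => phi (u + s) * fejer N s) (- PI) PI - phi u * (2 * PI * INR N) = RInt (fun s => phi (u + s) * fejer N s - phi u * fejer N s) (- PI) PI).
  { rewrite RInt_minus_R, RInt_scal_R, RInt_fejer. reflexivity. apply ex_RInt_all; apply fejer_cont. now apply ex_RInt_all.
    apply ex_RInt_all. intros; apply cont_scal; apply fejer_cont. }
  assert (B : Rabs (RInt (fun s => phi (u + s) * fejer N s - phi u * fejer N s) (- PI) PI) <= RInt (fun s => L / (2 * r) * fejer N s + L * 8 * r) (- PI) PI).
  { apply RInt_abs_le. lra.
    - apply ex_RInt_all. intros s. apply cont_minus. apply Cf. apply cont_scal; apply fejer_cont.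
    - apply ex_RInt_all. intros s. apply cont_plus. apply cont_scal; apply fejer_cont. apply continuous_const.
    - intros s Hs. rewrite <- Rmult_minus_distr_r, Rabs_mult. generalize (fejer_nonneg N s Hs) (fejer_sqr N s Hs). intros F1 F2.
      rewrite (Rabs_pos_eq (fejer N s)) by trivial.
      apply Rle_trans with (L * Rabs s * fejer N s). apply Rmult_le_compat_r; trivial. apply Hlip. apply Rabs_le. lra.
      (* With r = sqrt N both parts contribute order sqrt N: the constant against the mass 2 pi N,
         and the quadratic term against s^2 [fejer] <= 16. Division by N gives the rate 1/sqrt N. *)
      assert (Q : Rabs s <= / (2 * r) + r / 2 * (s * s)).
      { rewrite <- (Rabs_pos_eq (s * s)) by nra. rewrite Rabs_mult. set (a := Rabs s).
        assert (Q0 : 0 < / r) by now apply Rinv_0_lt_compat.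
        assert (Q2 : 0 <= / r * Rsqr (1 - r * a)) by (apply Rmult_le_pos; [lra | apply Rle_0_sqr]).
        replace (/ r * Rsqr (1 - r * a)) with (/ r - 2 * a + r * (a * a)) in Q2 by (unfold Rsqr; field; lra).
        replace (/ (2 * r)) with (/ r / 2) by (field; lra). lra. }
      apply Rle_trans with (L * (/ (2 * r) + r / 2 * (s * s)) * fejer N s). apply Rmult_le_compat_r; trivial. now apply Rmult_le_compat_l.
      replace (L * (/ (2 * r) + r / 2 * (s * s)) * fejer N s) with (L / (2 * r) * fejer N s + L * (r / 2) * (s * s * fejer N s)) by (field; lra).
      apply Rplus_le_compat_l. assert (0 <= L * (r / 2)) by nra. apply Rle_trans with (L * (r / 2) * 16). now apply Rmult_le_compat_l. lra. }
  rewrite RInt_plus_R, RInt_scal_R, RInt_fejer in B.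
  2: apply ex_RInt_all; apply fejer_cont. 2: apply ex_RInt_all; intros; apply cont_scal; apply fejer_cont. 2: apply ex_RInt_all; intros; apply continuous_const.
  assert (E2 : RInt (fun _ : R => L * 8 * r) (- PI) PI = scal (PI - - PI) (L * 8 * r)) by apply (RInt_const (V := R_CompleteNormedModule)).
  unfold scal in E2; simpl in E2; unfold mult in E2; simpl in E2. rewrite E2 in B.
  set (i := RInt (fun s => phi (u + s) * fejer N s) (- PI) PI) in *.
  replace (i / INR N - 2 * PI * phi u) with ((i - phi u * (2 * PI * INR N)) / INR N) by (field; lra).
  unfold Rdiv at 1. rewrite Rabs_mult, (Rabs_pos_eq (/ INR N)) by (left; now apply Rinv_0_lt_compat).
  rewrite E. apply (div_le _ _ (INR N)); trivial. apply Rle_trans with (1 := B).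
  rewrite <- Hrr. apply Rle_trans with (17 * L * PI * r). apply Req_le. field. lra.
  replace (20 * L * PI / r * (r * r)) with (20 * L * PI * r) by (field; lra).
  apply Rmult_le_compat_r. lra. apply Rmult_le_compat_r. lra. lra.
Qed.

(** * Fourier coefficients and convolutions with the kernels *)

Definition cos_coef (f : R -> R) (n : nat) : R := RInt (fun u => f u * cos (INR n * u)) (- PI) PI.
Definition sin_coef (f : R -> R) (n : nat) : R := RInt (fun u => f u * sin (INR n * u)) (- PI) PI.

Lemma trig_period n u : cos (INR n * (u + 2 * PI)) = cos (INR n * u) /\ sin (INR n * (u + 2 * PI)) = sin (INR n * u).
Proof.
  replace (INR n * (u + 2 * PI)) with (INR n * u + 2 * INR n * PI) by ring. split. apply cos_period. apply sin_period.
Qed.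

Lemma conv_cos phi L n u : periodic_lip phi L ->
  RInt (fun s => phi (u + s) * cos (INR n * s)) (- PI) PI = cos (INR n * u) * cos_coef phi n + sin (INR n * u) * sin_coef phi n.
Proof.
  intros Hphi. assert (Cphi : forall u, continuous phi u) by (intros; now apply periodic_lip_cont with L). destruct Hphi as (_ & Hper & _).
  set (f := fun v => phi v * cos (INR n * (v - u))).
  assert (Cf : forall v, continuous f v) by (intros v; apply cont_mult; trivial; apply cont_ex_derive; auto_derive; trivial).
  transitivity (RInt f (- PI + u) (PI + u)).
  { rewrite <- RInt_shift by trivial. apply (RInt_ext (V := R_CompleteNormedModule)). intros s _. unfold f. do 2 f_equal; ring. }
  rewrite RInt_periodic; trivial.
  2: { intros v. unfold f. rewrite Hper. f_equal. replace (v + 2 * PI - u) with (v - u + 2 * PI) by ring. apply trig_period. }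
  unfold cos_coef, sin_coef. rewrite <- 2!RInt_scal_R, <- RInt_plus_R.
  - apply (RInt_ext (V := R_CompleteNormedModule)). intros v _. unfold f. rewrite Rmult_minus_distr_l, cos_minus. cbn. ring.
  - apply ex_RInt_all. intros v. apply cont_scal. apply cont_mult; trivial. apply cont_ex_derive; auto_derive; trivial.
  - apply ex_RInt_all. intros v. apply cont_scal. apply cont_mult; trivial. apply cont_ex_derive; auto_derive; trivial.
  - apply ex_RInt_all. intros v. apply cont_mult; trivial. apply cont_ex_derive; auto_derive; trivial.
  - apply ex_RInt_all. intros v. apply cont_mult; trivial. apply cont_ex_derive; auto_derive; trivial.
Qed.

Lemma conv_dirichlet phi L M u : periodic_lip phi L ->
  RInt (fun s => phi (u + s) * dirichlet M s) (- PI) PI =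
  cos_coef phi 0 + psum (fun k => 2 * (cos (INR (S k) * u) * cos_coef phi (S k) + sin (INR (S k) * u) * sin_coef phi (S k))) M.
Proof.
  intros Hphi. assert (Cphi : forall u, continuous phi u) by (intros; now apply periodic_lip_cont with L).
  assert (Cu : forall s, continuous (fun s => phi (u + s)) s).
  { intros s. apply (continuous_comp (fun s => u + s) phi). apply cont_plus. apply continuous_const. apply continuous_id. apply Cphi. }
  induction M as [|M IH].
  - cbn [psum]. rewrite Rplus_0_r.
    transitivity (cos (INR 0 * u) * cos_coef phi 0 + sin (INR 0 * u) * sin_coef phi 0).
    + rewrite <- (conv_cos phi L) by trivial. apply (RInt_ext (V := R_CompleteNormedModule)). intros s _. unfold dirichlet. simpl. rewrite Rmult_0_l, cos_0, Rplus_0_r. reflexivity.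
    + simpl. rewrite Rmult_0_l, cos_0, sin_0. ring.
  - cbn [psum]. rewrite <- Rplus_assoc, <- IH, <- (conv_cos phi L) by trivial.
    rewrite <- RInt_scal_R, <- RInt_plus_R.
    + apply (RInt_ext (V := R_CompleteNormedModule)). intros s _. unfold dirichlet. cbn [psum]. cbn -[INR]. ring.
    + apply ex_RInt_all. intros s. apply cont_mult; trivial. apply dirichlet_cont.
    + apply ex_RInt_all. intros s. apply cont_scal. apply cont_mult; trivial. apply cont_ex_derive; auto_derive; trivial.
    + apply ex_RInt_all. intros s. apply cont_mult; trivial. apply cont_ex_derive; auto_derive; trivial.
Qed.

(** The convolution acts on the periodic factor [phi]; oddness of [H] then removes the constant and
    all cosine terms of the partial sum. *)
Lemma odd_dirichlet H phi L M : (forall u, continuous H u) -> (forall u, H (- u) = - H u) -> periodic_lip phi L ->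
  RInt (fun u => H u * RInt (fun s => phi (u + s) * dirichlet M s) (- PI) PI) (- PI) PI =
  psum (fun k => 2 * (sin_coef H (S k) * sin_coef phi (S k))) M.
Proof.
  intros CH OH Hphi.
  rewrite (RInt_ext (V := R_CompleteNormedModule) _ (fun u => H u * (cos_coef phi 0 + psum (fun k => 2 * (cos (INR (S k) * u) * cos_coef phi (S k) + sin (INR (S k) * u) * sin_coef phi (S k))) M))).
  2: { intros u _. now rewrite (conv_dirichlet phi L). }
  assert (Ct : forall k u, continuous (fun u => 2 * (cos (INR (S k) * u) * cos_coef phi (S k) + sin (INR (S k) * u) * sin_coef phi (S k))) u).
  { intros k u. apply cont_ex_derive. auto_derive. trivial. }
  assert (Cc : forall n u, continuous (fun u => H u * cos (INR n * u)) u).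
  { intros n u. apply cont_mult; trivial. apply cont_ex_derive. auto_derive. trivial. }
  assert (Cs : forall n u, continuous (fun u => H u * sin (INR n * u)) u).
  { intros n u. apply cont_mult; trivial. apply cont_ex_derive. auto_derive. trivial. }
  induction M as [|M IH]; cbn [psum].
  - rewrite (RInt_ext (V := R_CompleteNormedModule) _ (fun u => cos_coef phi 0 * H u)) by (intros; cbn; ring).
    rewrite RInt_scal_R by now apply ex_RInt_all. rewrite RInt_odd_zero by trivial. eq_in_R; ring.
  - rewrite <- IH.
    assert (O : RInt (fun u => H u * cos (INR (S M) * u)) (- PI) PI = 0).
    { apply RInt_odd_zero. apply Cc. intros u. rewrite OH, <- Ropp_mult_distr_r, cos_neg. ring. }
    transitivity (RInt (fun u => H u * (cos_coef phi 0 + psum (fun k => 2 * (cos (INR (S k) * u) * cos_coef phi (S k) + sin (INR (S k) * u) * sin_coef phi (S k))) M)) (- PI) PI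
      + (2 * cos_coef phi (S M) * RInt (fun u => H u * cos (INR (S M) * u)) (- PI) PI + 2 * sin_coef phi (S M) * RInt (fun u => H u * sin (INR (S M) * u)) (- PI) PI)).
    + rewrite <- 2!RInt_scal_R, <- 2!RInt_plus_R.
      * apply (RInt_ext (V := R_CompleteNormedModule)). intros u _. cbn -[INR]. ring.
      * apply ex_RInt_all. intros u. apply cont_mult; trivial. apply cont_plus. apply continuous_const. now apply psum_cont.
      * apply ex_RInt_all. intros u. apply cont_plus; apply cont_scal. apply Cc. apply Cs.
      * apply ex_RInt_all. intros u. apply cont_scal. apply Cc.
      * apply ex_RInt_all. intros u. apply cont_scal. apply Cs.
      * apply ex_RInt_all. apply Cs.
      * apply ex_RInt_all. apply Cc.
    + rewrite O. change (RInt (fun u => H u * sin (INR (S M) * u)) (- PI) PI) with (sin_coef H (S M)). eq_in_R. ring.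
Qed.

(** A shift by pi/m, with m the frequency, changes the sign of sin(m u). Averaging the coefficient
    with its shifted form puts the increment of [phi] over pi/m under the integral. *)
Lemma sin_coef_lip phi L n : periodic_lip phi L -> Rabs (sin_coef phi (S n)) <= PI * PI * L / INR (S n).
Proof.
  intros Hphi. assert (Cphi : forall u, continuous phi u) by (intros; now apply periodic_lip_cont with L). destruct Hphi as (HL & Hper & Hlip).
  assert (HP := PI_RGT_0). assert (Hm : 1 <= INR (S n)) by (rewrite S_INR; generalize (pos_INR n); lra).
  set (m := INR (S n)) in *. set (d := PI / m).
  assert (Hd : 0 < d <= PI). { unfold d. split. apply Rdiv_lt_0_compat; lra. apply div_le; nra. }
  set (f := fun u => phi u * sin (m * u)).
  assert (Cf : forall u, continuous f u) by (intros u; apply cont_mult; trivial; apply cont_ex_derive; auto_derive; trivial).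
  assert (E : sin_coef phi (S n) = RInt (fun u => - (phi (u + d) * sin (m * u))) (- PI) PI).
  { unfold sin_coef. fold m. fold f. rewrite <- (RInt_periodic f d) by (trivial; intros u; unfold f; rewrite Hper; f_equal; unfold m; apply trig_period).
    rewrite <- RInt_shift by trivial. apply (RInt_ext (V := R_CompleteNormedModule)). intros u _. unfold f.
    replace (m * (u + d)) with (m * u + PI) by (unfold d; field; lra). rewrite neg_sin. cbn. ring. }
  assert (Cg : forall u, continuous (fun u => - (phi (u + d) * sin (m * u))) u).
  { intros u. apply (continuous_opp (fun u => phi (u + d) * sin (m * u))). apply cont_mult. apply (continuous_comp (fun u => u + d) phi). apply cont_plus. apply continuous_id. apply continuous_const. apply Cphi.
    apply cont_ex_derive; auto_derive; trivial. }
  assert (E2 : 2 * sin_coef phi (S n) = RInt (fun u => f u + - (phi (u + d) * sin (m * u))) (- PI) PI).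
  { rewrite RInt_plus_R by now apply ex_RInt_all. rewrite <- E. unfold sin_coef. fold m. fold f. ring. }
  assert (B : Rabs (2 * sin_coef phi (S n)) <= (PI - - PI) * (L * d)).
  { rewrite E2. apply (norm_RInt_le_const (V := R_NormedModule) (fun u => f u + - (phi (u + d) * sin (m * u))) (- PI) PI). lra.
    - intros u _. unfold norm; simpl; unfold abs; simpl. unfold f.
      replace (phi u * sin (m * u) + - (phi (u + d) * sin (m * u))) with (- ((phi (u + d) - phi u) * sin (m * u))) by ring.
      rewrite Rabs_Ropp, Rabs_mult. rewrite <- (Rmult_1_r (L * d)). apply Rmult_le_compat; try apply Rabs_pos.
      apply Rle_trans with (1 := Hlip u d ltac:(rewrite Rabs_pos_eq; lra)). rewrite Rabs_pos_eq; lra. apply Rabs_sin_le.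
    - apply (RInt_correct (V := R_CompleteNormedModule)). apply ex_RInt_all. intros u. now apply cont_plus. }
  rewrite Rabs_mult, (Rabs_pos_eq 2) in B by lra.
  replace (PI * PI * L / m) with (PI * (L * d)) by (unfold d; field; lra). lra.
Qed.

Lemma cont_bounded (f : R -> R) a b : a <= b -> (forall x, continuous f x) -> exists M, 0 <= M /\ forall x, a <= x <= b -> Rabs (f x) <= M.
Proof.
  intros Hab Hf. destruct (continuity_ab_maj (fun t => Rabs (f t)) a b Hab) as (m & Hm & _).
  { intros c _. apply continuity_pt_filterlim. apply (continuous_comp f Rabs). apply Hf. apply continuous_Rabs. }
  exists (Rabs (f m)). split. apply Rabs_pos. exact Hm.
Qed.

(** Integration by parts. The endpoint values at -pi and pi are kept and estimated, because [H] is
    not assumed periodic; they are already of order 1/n. *)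
Lemma sin_coef_C1 (H dH : R -> R) : (forall u, is_derive H u (dH u)) -> (forall u, continuous dH u) ->
  exists C, 0 <= C /\ forall n, Rabs (sin_coef H (S n)) <= C / INR (S n).
Proof.
  intros HD HC. assert (HP := PI_RGT_0).
  destruct (cont_bounded H (- PI) PI ltac:(lra) (fun x => cont_of_derive _ _ _ (HD x))) as (M & HM & BM).
  destruct (cont_bounded dH (- PI) PI ltac:(lra) HC) as (M' & HM' & BM').
  exists (2 * M + 2 * PI * M'). split. nra. intros n.
  assert (Hm : 1 <= INR (S n)) by (rewrite S_INR; generalize (pos_INR n); lra). set (m := INR (S n)) in *.
  assert (FT : is_RInt (fun u => H u * sin (m * u) - dH u * (cos (m * u) / m)) (- PI) PI (- (H PI * (cos (m * PI) / m)) - - (H (- PI) * (cos (m * - PI) / m)))).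
  { apply (RInt_FTC (fun u => - (H u * (cos (m * u) / m)))). lra.
    - intros u _. evar_last. apply (is_derive_opp (fun u => H u * (cos (m * u) / m))).
      apply (is_derive_mult H (fun u => cos (m * u) / m)). apply HD. auto_derive. trivial. reflexivity. intros; apply Rmult_comm.
      unfold opp, plus, mult; simpl. field. lra.
    - intros u _. apply cont_minus; apply cont_mult. apply (cont_of_derive _ _ _ (HD u)). apply cont_ex_derive; auto_derive; trivial. apply HC. apply cont_ex_derive; auto_derive; lra. }
  apply (is_RInt_unique (V := R_CompleteNormedModule)) in FT.
  rewrite RInt_minus_R in FT.
  2: { apply ex_RInt_all. intros u. apply cont_mult. apply (cont_of_derive _ _ _ (HD u)). apply cont_ex_derive; auto_derive; trivial. }
  2: { apply ex_RInt_all. intros u. apply cont_mult. apply HC. apply cont_ex_derive; auto_derive; lra. }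
  assert (Bt : forall x M0 t, Rabs x <= M0 -> Rabs (x * (cos t / m)) <= M0 / m).
  { intros x M0 t Hx. unfold Rdiv. rewrite 2!Rabs_mult, (Rabs_pos_eq (/ m)) by (left; apply Rinv_0_lt_compat; lra). rewrite <- Rmult_assoc.
    apply Rmult_le_compat_r. left; apply Rinv_0_lt_compat; lra. rewrite <- (Rmult_1_r M0). apply Rmult_le_compat; try apply Rabs_pos; trivial. apply Rabs_cos_le. }
  assert (B2 : Rabs (RInt (fun u => dH u * (cos (m * u) / m)) (- PI) PI) <= (PI - - PI) * (M' / m)).
  { apply (norm_RInt_le_const (V := R_NormedModule) (fun u => dH u * (cos (m * u) / m)) (- PI) PI). lra.
    - intros u Hu. unfold norm; simpl; unfold abs; simpl. apply Bt. now apply BM'.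
    - apply (RInt_correct (V := R_CompleteNormedModule)). apply ex_RInt_all. intros u. apply cont_mult. apply HC. apply cont_ex_derive; auto_derive; lra. }
  assert (B3 := Bt (H PI) M (m * PI) (BM PI ltac:(lra))). assert (B4 := Bt (H (- PI)) M (m * - PI) (BM (- PI) ltac:(lra))).
  unfold sin_coef. fold m.
  set (i2 := RInt (fun u => dH u * (cos (m * u) / m)) (- PI) PI) in *. set (e1 := H PI * (cos (m * PI) / m)) in *. set (e2 := H (- PI) * (cos (m * - PI) / m)) in *.
  set (i1 := RInt (fun u => H u * sin (m * u)) (- PI) PI) in *.
  replace i1 with (- e1 + e2 + i2) by (transitivity (- e1 - - e2 + i2); [ring | rewrite <- FT; ring]).
  eapply Rle_trans. apply Rabs_triang. eapply Rle_trans. apply Rplus_le_compat_r. apply Rabs_triang. rewrite Rabs_Ropp.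
  replace ((2 * M + 2 * PI * M') / m) with (M / m + M / m + (PI - - PI) * (M' / m)) by (field; lra). lra.
Qed.

(** Comparison with the telescoping series of 2C (1/m - 1/(m+1)), valid since m + 1 <= 2m for m >=
    1. *)
Lemma ex_series_inv_sqr (a : nat -> R) C : 0 <= C -> (forall n, Rabs (a n) <= C / (INR (S n) * INR (S n))) -> ex_series a.
Proof.
  intros HC Ha.
  apply (ex_series_le (V := R_CompleteNormedModule) a (fun n => 2 * C * (/ INR (S n) - / INR (S (S n))))).
  - intros n. apply Rle_trans with (1 := Ha n). assert (Hm : 1 <= INR (S n)) by (rewrite S_INR; generalize (pos_INR n); lra).
    rewrite (S_INR (S n)). set (m := INR (S n)) in *.
    replace (2 * C * (/ m - / (m + 1))) with (2 * C / (m * (m + 1))) by (field; lra).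
    apply div_le. nra. replace (2 * C / (m * (m + 1)) * (m * m)) with (C * (2 * m / (m + 1))) by (field; lra).
    rewrite <- (Rmult_1_r C) at 1. apply Rmult_le_compat_l; trivial. apply le_div; lra.
  - exists (2 * C * (1 - 0)). apply (is_series_scal (V := R_NormedModule) (2 * C) (fun n => / INR (S n) - / INR (S (S n))) (1 - 0)).
    unfold is_series. apply filterlim_ext with (fun n => 1 - / INR (S (S n))).
    + intros n. induction n as [|n IH]. rewrite sum_O. simpl. field. rewrite sum_Sn, <- IH. unfold plus; cbn -[INR]. eq_in_R. ring.
    + assert (K : is_lim_seq (fun n => 1 - / INR (S (S n))) (1 - 0)).
      { apply is_lim_seq_minus'. apply is_lim_seq_const.
        assert (K0 : is_lim_seq (fun n => / INR n) 0).
        { replace (Finite 0) with (Rbar_inv p_infty) by reflexivity. apply is_lim_seq_inv. apply is_lim_seq_INR. discriminate. }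
        apply (is_lim_seq_incr_n (fun n => / INR n) 2) in K0.
        apply is_lim_seq_ext with (2 := K0). intros n. do 2 f_equal. lia. }
      exact K.
Qed.

Lemma psum_sum_n a n : psum a (S n) = sum_n a n.
Proof. induction n as [|n IH]. rewrite sum_O. simpl. ring. rewrite sum_Sn, <- IH. reflexivity. Qed.

Lemma psum_sum_f_R0 a n : psum a (S n) = sum_f_R0 a n.
Proof. induction n as [|n IH]. simpl. ring. rewrite tech5, <- IH. reflexivity. Qed.

Lemma psum_scal c a n : psum (fun k => c * a k) n = c * psum a n.
Proof. induction n as [|n IH]; simpl. ring. rewrite IH. ring. Qed.

(** The product of two coefficients of size O(1/n) is summable, so the series has some sum. By
    Cesaro's theorem its averaged partial sums have the same limit, and these averages are integrals
    of [H] against Fejer means of [phi], which converge uniformly. *)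
Lemma parseval_odd (H dH phi : R -> R) L : (forall u, is_derive H u (dH u)) -> (forall u, continuous dH u) -> (forall u, H (- u) = - H u) ->
  periodic_lip phi L ->
  is_series (fun k => / PI * (sin_coef H (S k) * sin_coef phi (S k))) (RInt (fun u => H u * phi u) (- PI) PI).
Proof.
  intros HD HC OH Hphi. assert (HP := PI_RGT_0).
  assert (Cphi : forall u, continuous phi u) by (intros; now apply periodic_lip_cont with L).
  assert (CH : forall u, continuous H u) by (intros u; apply (cont_of_derive _ _ _ (HD u))).
  set (t := fun k => / PI * (sin_coef H (S k) * sin_coef phi (S k))). set (I := RInt (fun u => H u * phi u) (- PI) PI).
  assert (Ex : ex_series t).
  { destruct (sin_coef_C1 H dH HD HC) as (C & HC0 & HC1). assert (HL := proj1 Hphi).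
    assert (HLP : 0 <= PI * PI * L) by (apply Rmult_le_pos; nra).
    apply ex_series_inv_sqr with (/ PI * (C * (PI * PI * L))).
    - apply Rmult_le_pos. left; now apply Rinv_0_lt_compat. now apply Rmult_le_pos.
    - intros n. unfold t. assert (Hm : 0 < INR (S n)) by (apply lt_0_INR; lia).
      rewrite 2!Rabs_mult, (Rabs_pos_eq (/ PI)) by (left; now apply Rinv_0_lt_compat).
      replace (/ PI * (C * (PI * PI * L)) / (INR (S n) * INR (S n))) with (/ PI * (C / INR (S n) * (PI * PI * L / INR (S n)))) by (field; lra).
      apply Rmult_le_compat_l. left; now apply Rinv_0_lt_compat.
      apply Rmult_le_compat; try apply Rabs_pos. apply HC1. now apply sin_coef_lip. }
  destruct Ex as (l & Hl). replace I with l; trivial.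
  assert (Hs : Un_cv (fun n => psum t n) l).
  { apply is_lim_seq_Reals. apply is_lim_seq_incr_1. apply is_lim_seq_ext with (sum_n t). intros n. symmetry. apply psum_sum_n. exact Hl. }
  (* The average runs over [psum t 0], ..., [psum t (n-1)], that is over the n Dirichlet kernels
     that make up [fejer n]; the first one contributes 0 since [H] is odd. *)
  assert (Hc := Cesaro_1 _ _ Hs).
  assert (Hc2 : Un_cv (fun n => sum_f_R0 (fun n => psum t n) (Init.Nat.pred n) / INR n) I).
  { destruct (cont_bounded H (- PI) PI ltac:(lra) CH) as (M & HM & BM).
    assert (Est : forall n, (1 <= n)%nat -> Rabs (sum_f_R0 (fun n => psum t n) (Init.Nat.pred n) / INR n - I) <= M * (20 * L * PI) * / sqrt (INR n)).
    { intros n Hn. assert (Hn0 : 0 < INR n) by (apply lt_0_INR; lia).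
      assert (Hr : 0 < sqrt (INR n)) by now apply sqrt_lt_R0.
      assert (E : 2 * PI * sum_f_R0 (fun n => psum t n) (Init.Nat.pred n) = RInt (fun u => H u * RInt (fun s => phi (u + s) * fejer n s) (- PI) PI) (- PI) PI).
      { destruct n as [|n]; [lia|]. simpl Init.Nat.pred. rewrite <- psum_sum_f_R0. rewrite <- psum_scal.
        transitivity (psum (fun M => RInt (fun u => H u * RInt (fun s => phi (u + s) * dirichlet M s) (- PI) PI) (- PI) PI) (S n)).
        - clear - OH Hphi CH HP. generalize (S n). intros m. induction m as [|m IH]; cbn [psum]; trivial. rewrite IH. f_equal.
          rewrite (odd_dirichlet H phi L) by trivial. rewrite <- psum_scal. clear. induction m as [|m IH]; cbn [psum]; trivial. rewrite IH. f_equal. unfold t. field. apply PI_neq0.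
        - assert (Cd : forall k u, continuous (fun u => H u * RInt (fun s => phi (u + s) * dirichlet k s) (- PI) PI) u).
          { intros k u. apply cont_mult; trivial.
            apply continuous_ext with (fun u => cos_coef phi 0 + psum (fun k => 2 * (cos (INR (S k) * u) * cos_coef phi (S k) + sin (INR (S k) * u) * sin_coef phi (S k))) k).
            intros v. now rewrite (conv_dirichlet phi L). apply cont_plus. apply continuous_const. apply (psum_cont (fun k u => 2 * (cos (INR (S k) * u) * cos_coef phi (S k) + sin (INR (S k) * u) * sin_coef phi (S k)))).
            intros; apply cont_ex_derive; auto_derive; trivial. }
          rewrite <- (RInt_psum (fun k u => H u * RInt (fun s => phi (u + s) * dirichlet k s) (- PI) PI)) by trivial.
          apply (RInt_ext (V := R_CompleteNormedModule)). intros u _.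
          assert (Cu : forall s, continuous (fun s => phi (u + s)) s).
          { intros s. apply (continuous_comp (fun s => u + s) phi). apply cont_plus. apply continuous_const. apply continuous_id. apply Cphi. }
          rewrite (psum_scal (H u) (fun k => RInt (fun s => phi (u + s) * dirichlet k s) (- PI) PI)). eq_in_R. f_equal.
          rewrite <- (RInt_psum (fun k s => phi (u + s) * dirichlet k s)). apply (RInt_ext (V := R_CompleteNormedModule)). intros s _. eq_in_R. unfold fejer. rewrite psum_scal. reflexivity.
          intros k s. apply cont_mult; trivial. apply dirichlet_cont. }
      set (g := fun u => RInt (fun s => phi (u + s) * fejer n s) (- PI) PI) in *.
      assert (Cg : forall u, continuous g u).
      { intros u. apply continuous_ext with (fun u => psum (fun M => cos_coef phi 0 + psum (fun k => 2 * (cos (INR (S k) * u) * cos_coef phi (S k) + sin (INR (S k) * u) * sin_coef phi (S k))) M) n).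
        - intros v. unfold g.
          assert (Cu : forall s, continuous (fun s => phi (v + s)) s).
          { intros s. apply (continuous_comp (fun s => v + s) phi). apply cont_plus. apply continuous_const. apply continuous_id. apply Cphi. }
          transitivity (psum (fun M => RInt (fun s => phi (v + s) * dirichlet M s) (- PI) PI) n).
          clear - Hphi. induction n as [|n IH]; cbn [psum]; trivial. rewrite IH. f_equal. symmetry. now apply (conv_dirichlet phi L).
          rewrite <- (RInt_psum (fun k s => phi (v + s) * dirichlet k s)). apply (RInt_ext (V := R_CompleteNormedModule)). intros s _. unfold fejer. eq_in_R. rewrite psum_scal. reflexivity.
          intros k s. apply cont_mult; trivial. apply dirichlet_cont.
        - apply (psum_cont (fun M u => cos_coef phi 0 + psum (fun k => 2 * (cos (INR (S k) * u) * cos_coef phi (S k) + sin (INR (S k) * u) * sin_coef phi (S k))) M)).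
          intros k x. apply cont_plus. apply continuous_const. apply (psum_cont (fun k u => 2 * (cos (INR (S k) * u) * cos_coef phi (S k) + sin (INR (S k) * u) * sin_coef phi (S k)))).
          intros; apply cont_ex_derive; auto_derive; trivial. }
      assert (E2 : 2 * PI * (sum_f_R0 (fun n => psum t n) (Init.Nat.pred n) / INR n - I) = RInt (fun u => H u * (/ INR n * g u - 2 * PI * phi u)) (- PI) PI).
      { transitivity (/ INR n * (2 * PI * sum_f_R0 (fun n => psum t n) (Init.Nat.pred n)) - 2 * PI * I). field; lra.
        rewrite E. unfold I. rewrite <- 2!RInt_scal_R, <- RInt_minus_R.
        - apply (RInt_ext (V := R_CompleteNormedModule)). intros u _. cbn -[INR]. ring.
        - apply ex_RInt_all. intros u. apply cont_scal. now apply cont_mult.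
        - apply ex_RInt_all. intros u. apply cont_scal. now apply cont_mult.
        - apply ex_RInt_all. intros u. now apply cont_mult.
        - apply ex_RInt_all. intros u. now apply cont_mult. }
      assert (B : Rabs (2 * PI * (sum_f_R0 (fun n => psum t n) (Init.Nat.pred n) / INR n - I)) <= (PI - - PI) * (M * (20 * L * PI / sqrt (INR n)))).
      { rewrite E2. apply (norm_RInt_le_const (V := R_NormedModule) (fun u => H u * (/ INR n * g u - 2 * PI * phi u)) (- PI) PI). lra.
        - intros u Hu. unfold norm; simpl; unfold abs; simpl. rewrite Rabs_mult. apply Rmult_le_compat; try apply Rabs_pos. now apply BM.
          rewrite (Rmult_comm (/ INR n)). now apply fejer_approx.
        - apply (RInt_correct (V := R_CompleteNormedModule)). apply ex_RInt_all. intros u. apply cont_mult; trivial. apply cont_minus; now apply cont_scal. }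
      rewrite Rabs_mult, (Rabs_pos_eq (2 * PI)) in B by lra.
      apply Rmult_le_reg_l with (2 * PI). lra. apply Rle_trans with (1 := B). apply Req_le. field. lra. }
    intros eps He.
    set (Q := M * (20 * L * PI)). assert (HQ : 0 <= Q). { unfold Q. apply Rmult_le_pos; trivial. apply Rmult_le_pos; [|lra]. generalize (proj1 Hphi); lra. }
    destruct (nfloor_ex ((Q + 1) * (Q + 1) / (eps * eps))) as (N & _ & HN). { apply Rdiv_le_0_compat; nra. }
    exists (S N). intros n Hn. unfold Rdist. apply Rle_lt_trans with (1 := Est n ltac:(lia)). fold Q.
    assert (Hn1 : INR N + 1 <= INR n) by (rewrite <- S_INR; apply le_INR; lia).
    assert (Hn0 : 0 < INR n) by (generalize (pos_INR N); lra).
    assert (Hr : 0 < sqrt (INR n)) by now apply sqrt_lt_R0.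
    apply (proj2 (Rlt_div_l Q eps _ Hr)).
    apply Rlt_trans with (Q + 1). lra.
    assert (Hee : eps * eps > 0) by nra.
    apply (proj1 (Rlt_div_l _ _ _ Hee)) in HN.
    apply Rsqr_incrst_0; try nra. unfold Rsqr.
    replace (eps * sqrt (INR n) * (eps * sqrt (INR n))) with (eps * eps * (sqrt (INR n) * sqrt (INR n))) by ring.
    rewrite sqrt_sqrt by lra. nra. }
  exact (UL_sequence _ _ _ Hc Hc2).
Qed.

(** * The expansion *)

Lemma periodic_IZR (phi : R -> R) k u : (forall u, phi (u + 2 * PI) = phi u) -> phi (u + 2 * PI * IZR k) = phi u.
Proof.
  intros Hp.
  assert (Hn : forall n u, phi (u + 2 * PI * INR n) = phi u).
  { intros n. induction n as [|n IH]; intros v. simpl. f_equal. ring.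
    rewrite S_INR. replace (v + 2 * PI * (INR n + 1)) with (v + 2 * PI * INR n + 2 * PI) by ring. now rewrite Hp. }
  destruct (Z.le_ge_cases 0 k) as [Hk|Hk].
  - rewrite <- (Z2Nat.id k Hk), <- INR_IZR_INZ. apply Hn.
  - rewrite <- (Hn (Z.to_nat (- k))). rewrite INR_IZR_INZ, Z2Nat.id by lia. rewrite opp_IZR. f_equal. ring.
Qed.

(** Translate the base point into [-pi, pi]. If the increment then leaves the interval, split it at
    the endpoint that is crossed: the values at -pi and pi agree, and the two pieces have total
    length |s|. *)
Lemma periodic_lip_intro (phi : R -> R) L : 0 <= L -> (forall u, phi (u + 2 * PI) = phi u) ->
  (forall u v, - PI <= u <= PI -> - PI <= v <= PI -> Rabs (phi u - phi v) <= L * Rabs (u - v)) -> periodic_lip phi L.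
Proof.
  intros HL Hp Hlip. split; trivial. split; trivial. intros u s Hs. assert (HP := PI_RGT_0).
  destruct (archimed ((u + PI) / (2 * PI))) as (A1 & A2). set (k := up ((u + PI) / (2 * PI))) in *.
  assert (HPP : 2 * PI > 0) by lra.
  apply (proj1 (Rlt_div_l _ _ _ HPP)) in A1.
  assert (A3 : (IZR k - 1) * (2 * PI) <= u + PI).
  { replace (u + PI) with ((u + PI) / (2 * PI) * (2 * PI)) by (field; lra). apply Rmult_le_compat_r; lra. }
  rewrite <- (periodic_IZR phi (1 - k) (u + s) Hp), <- (periodic_IZR phi (1 - k) u Hp).
  rewrite minus_IZR. set (v := u + 2 * PI * (1 - IZR k)).
  replace (u + s + 2 * PI * (1 - IZR k)) with (v + s) by (unfold v; ring).
  assert (Hv : - PI <= v <= PI) by (unfold v; lra). clearbody v. clear A1 A2 A3.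
  assert (Hpi : phi (- PI) = phi PI) by (rewrite <- Hp; f_equal; ring).
  apply Rabs_le_between in Hs.
  destruct (Rlt_dec PI (v + s)) as [H|H]; [|destruct (Rlt_dec (v + s) (- PI)) as [H'|H']].
  - replace (phi (v + s)) with (phi (v + s - 2 * PI)) by (rewrite <- Hp; f_equal; ring).
    generalize (Hlip (v + s - 2 * PI) (- PI) ltac:(lra) ltac:(lra)) (Hlip PI v ltac:(lra) ltac:(lra)).
    rewrite Hpi, (Rabs_pos_eq (v + s - 2 * PI - - PI)), (Rabs_pos_eq (PI - v)), (Rabs_pos_eq s) by lra. intros B1 B2.
    replace (phi (v + s - 2 * PI) - phi v) with ((phi (v + s - 2 * PI) - phi PI) + (phi PI - phi v)) by ring.
    eapply Rle_trans. apply Rabs_triang. lra.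
  - rewrite <- (Hp (v + s)).
    generalize (Hlip (v + s + 2 * PI) PI ltac:(lra) ltac:(lra)) (Hlip (- PI) v ltac:(lra) ltac:(lra)).
    rewrite Hpi, (Rabs_left1 (v + s + 2 * PI - PI)), (Rabs_left1 (- PI - v)), (Rabs_left1 s) by lra. intros B1 B2.
    replace (phi (v + s + 2 * PI) - phi v) with ((phi (v + s + 2 * PI) - phi PI) + (phi PI - phi v)) by ring.
    eapply Rle_trans. apply Rabs_triang. lra.
  - replace s with (v + s - v) at 2 by ring. apply Hlip; lra.
Qed.

Definition hker (x u : R) : R := 2 * sinh u * struve_k (x * cosh u).

(** The bracket is k(x cosh u) / cosh u, and sinh(2u) = 2 sinh u cosh u restores the missing
    factor. *)
Lemma kern_hker x u : kern x u * sinh (2 * u) = hker x u.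
Proof.
  unfold kern, hker, struve_k, struve_g. generalize (cosh_ge_1 u). intros Hc.
  assert (E : sinh (2 * u) = 2 * sinh u * cosh u).
  { unfold sinh, cosh. replace (2 * u) with (u + u) by ring. rewrite Ropp_plus_distr, 2!exp_plus. field. }
  rewrite E. replace (2 * x * cosh u) with (2 * (x * cosh u)) by ring. assert (HP := PI_neq0). field. split; lra.
Qed.

Lemma hker_odd x u : hker x (- u) = - hker x u.
Proof. unfold hker. unfold sinh, cosh. rewrite Ropp_involutive. rewrite (Rplus_comm (exp (- u))). field. Qed.

Definition hker' (x u : R) : R := 2 * cosh u * struve_k (x * cosh u) + 2 * sinh u * (x * sinh u * kern_dk (x * cosh u)).

Lemma hker_derive x u : 0 < x -> is_derive (hker x) u (hker' x u).
Proof. intros Hx. exact (proj2 (kern_ode 0 x u Hx)). Qed.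

Lemma hker'_cont x u : 0 < x -> continuous (hker' x) u.
Proof. intros Hx. apply (cont_of_derive _ _ _ (proj1 (kern_ode 0 x u Hx))). Qed.

Lemma hker_cont2 : cont2 hker.
Proof.
  apply (cont2_mult (fun x u => 2 * sinh u) (fun x u => struve_k (x * cosh u))).
  - apply (cont2_of_snd (fun u => 2 * sinh u)). intros u. apply cont_ex_derive. auto_derive. trivial.
  - apply cont2_comp_pos; [exact struve_k_cont | exact cont2_cosh | exact cosh_arg_pos].
Qed.

(** Fubini on truncations of the x-integral, followed by the limit. The exchange is legitimate
    because the tail bound C a + C/b of the index integral does not depend on u, as cosh u >= 1. *)
Lemma sq_sol_int_kernel tau W T S C kappa (phi : R -> R) : sq_sol tau W T S C ->
  (forall u l, 0 <= u -> has_int (fun x => W x * struve_k (x * cosh u)) l -> 2 * sinh u * l = kappa * sin (2 * tau * u)) ->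
  (forall u, continuous phi u) ->
  has_int (fun x => W x * RInt (fun u => hker x u * phi u) (- PI) PI) (kappa * RInt (fun u => phi u * sin (2 * tau * u)) (- PI) PI).
Proof.
  intros HS HI Cphi. assert (HP := PI_RGT_0). assert (HC := ss_C _ _ _ _ _ HS).
  assert (CW : cont_pos W) by (intros x Hx; apply (cont_of_derive _ _ _ (ss_W _ _ _ _ _ HS x Hx))).
  assert (CF : cont2 (fun x u => hker x u * phi u)) by (apply cont2_mult; [apply hker_cont2 | now apply (cont2_of_snd phi)]).
  assert (CWF : cont2 (fun x u => W x * (hker x u * phi u))) by (apply cont2_mult; trivial; now apply (cont2_of_fst W)).
  assert (Cs : forall u, continuous (fun u => kappa * (phi u * sin (2 * tau * u))) u).
  { intros u. apply cont_scal. apply cont_mult; trivial. apply cont_ex_derive. auto_derive. trivial. }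
  destruct (cont_bounded (fun u => 2 * sinh u * phi u) (- PI) PI ltac:(lra)) as (D & HD & BD).
  { intros u. apply cont_mult; trivial. apply cont_ex_derive. auto_derive. trivial. }
  (* The index integral is known for u >= 0 only; negative u follow because sinh and the sine are
     odd while k(x cosh u) is even in u. *)
  assert (Ptw : forall u a b, - PI <= u <= PI -> 0 < a -> a <= b ->
    Rabs (RInt (fun x => W x * (hker x u * phi u)) a b - kappa * (phi u * sin (2 * tau * u))) <= D * (C * a + C / b)).
  { intros u a b Hu Ha Hab. destruct (sq_int_ex tau W T S C u HS) as (l & Hl & Bl).
    assert (El : 2 * sinh u * l = kappa * sin (2 * tau * u)).
    { destruct (Rle_dec 0 u) as [H|H]. now apply HI.
      assert (K := HI (- u) l ltac:(lra)). unfold cosh, sinh in K. rewrite Ropp_involutive, (Rplus_comm (exp (- u))) in K.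
      specialize (K Hl). rewrite <- Ropp_mult_distr_r, sin_neg in K. unfold sinh. lra. }
    rewrite (RInt_ext_R _ (fun x => (2 * sinh u * phi u) * (W x * struve_k (x * cosh u))) a b Hab) by (intros; unfold hker; ring).
    rewrite RInt_scal_R.
    2: { apply cont_pos_ex_RInt; [|lra|lra]. apply (cont2_fst (fun x u => W x * struve_k (x * cosh u)) u).
      apply cont2_mult. now apply (cont2_of_fst W). apply cont2_comp_pos; [exact struve_k_cont | exact cont2_cosh | exact cosh_arg_pos]. }
    replace (kappa * (phi u * sin (2 * tau * u))) with ((2 * sinh u * phi u) * l) by (transitivity (2 * sinh u * l * phi u); [ring | rewrite El; ring]).
    rewrite <- Rmult_minus_distr_l, Rabs_mult. apply Rmult_le_compat; try apply Rabs_pos. now apply BD. now apply Bl. }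
  apply has_int_intro.
  { intros x Hx. apply cont_mult. now apply CW. apply RInt_param_cont_fst; trivial. lra. }
  intros eps He. set (Q := 2 * PI * D * C). assert (HQ : 0 <= Q) by (unfold Q; apply Rmult_le_pos; trivial; apply Rmult_le_pos; lra).
  assert (Hd : 0 < eps / (2 * (Q + 1))) by (apply Rdiv_lt_0_compat; lra).
  exists (Rmin 1 (eps / (2 * (Q + 1)))), (Rmax 1 (2 * (Q + 1) / eps)).
  split. now apply Rmin_pos; [lra|]. split. apply Rlt_le_trans with 1; [lra | apply Rmax_l].
  intros a b (Ha0 & Ha) Hb.
  assert (Ha1 : a < 1) by (apply Rlt_le_trans with (1 := Ha); apply Rmin_l).
  assert (Ha2 : a < eps / (2 * (Q + 1))) by (apply Rlt_le_trans with (1 := Ha); apply Rmin_r).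
  assert (Hb1 : 1 < b) by (apply Rle_lt_trans with (2 := Hb); apply Rmax_l).
  assert (Hb2 : 2 * (Q + 1) / eps < b) by (apply Rle_lt_trans with (2 := Hb); apply Rmax_r).
  assert (Hab : a <= b) by lra.
  assert (E1 : RInt (fun x => W x * RInt (fun u => hker x u * phi u) (- PI) PI) a b = RInt (fun u => RInt (fun x => W x * (hker x u * phi u)) a b) (- PI) PI).
  { rewrite <- (Fubini (fun x u => W x * (hker x u * phi u))) by (trivial; lra).
    apply RInt_ext_R; trivial. intros x Hx. symmetry. apply RInt_scal_R. apply ex_RInt_all. intros u. apply (cont2_snd _ x u CF). lra. }
  rewrite E1, <- RInt_scal_R.
  2: { apply ex_RInt_all. intros u. apply cont_mult; trivial. apply cont_ex_derive. auto_derive. trivial. }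
  rewrite <- RInt_minus_R.
  2: { apply ex_RInt_cont. lra. intros u _. now apply (RInt_param_cont (fun x u => W x * (hker x u * phi u))). }
  2: { now apply ex_RInt_all. }
  assert (B := norm_RInt_le_const (V := R_NormedModule) (fun u => RInt (fun x => W x * (hker x u * phi u)) a b - kappa * (phi u * sin (2 * tau * u))) (- PI) PI
    (RInt (fun u => RInt (fun x => W x * (hker x u * phi u)) a b - kappa * (phi u * sin (2 * tau * u))) (- PI) PI) (D * (C * a + C / b)) ltac:(lra)).
  eapply Rle_lt_trans. apply B.
  - intros u Hu. now apply Ptw.
  - apply (RInt_correct (V := R_CompleteNormedModule)). apply ex_RInt_all. intros u. apply cont_minus; trivial. now apply (RInt_param_cont (fun x u => W x * (hker x u * phi u))).
  - replace ((PI - - PI) * (D * (C * a + C / b))) with (Q * a + Q / b) by (unfold Q; field; lra).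
    assert (T1 : Q * a < eps / 2).
    { assert (H2 : 2 * (Q + 1) > 0) by lra. apply (proj2 (Rlt_div_r a eps _ H2)) in Ha2. nra. }
    assert (T2 : Q / b <= eps / 2).
    { apply (proj1 (Rlt_div_l _ _ _ He)) in Hb2. apply (Rmult_le_reg_r b). lra. replace (Q / b * b) with Q by (field; lra). nra. }
    lra.
Qed.

Lemma f_of_eq (psi : R -> C) x : (forall u, continuous (fun u => fst (psi u)) u) -> (forall u, continuous (fun u => snd (psi u)) u) -> 0 < x ->
  f_of psi x = (RInt (fun u => hker x u * fst (psi u)) (- PI) PI, RInt (fun u => hker x u * snd (psi u)) (- PI) PI).
Proof.
  intros C1 C2 Hx. apply RInt_C.
  - intros u. unfold Cmult, RtoC; cbn [fst snd]. rewrite <- kern_hker. destruct (psi u) as [p q]; cbn [fst snd]. f_equal; eq_in_R; ring.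
  - apply ex_RInt_all. intros u. apply cont_mult; trivial. apply (cont2_snd _ x u hker_cont2 Hx).
  - apply ex_RInt_all. intros u. apply cont_mult; trivial. apply (cont2_snd _ x u hker_cont2 Hx).
Qed.

(** The Bessel order i n/2 means tau = n/2, so the frequency 2 tau of the index integral is exactly
    n and a sine coefficient of [psi] appears. *)
Lemma a_coef_eq (psi : R -> C) n : (forall u, continuous (fun u => fst (psi u)) u) -> (forall u, continuous (fun u => snd (psi u)) u) -> (0 < n)%nat ->
  let Cr := 2 / PI * / sinh (PI * INR n) in
  a_coef psi n = (Cr * sin_coef (fun u => fst (psi u)) n, Cr * sin_coef (fun u => snd (psi u)) n).
Proof.
  intros C1 C2 Hn Cr. unfold Cr. clear Cr. assert (Hn0 : 0 < INR n) by (apply lt_0_INR; lia). assert (HP := PI_RGT_0).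
  set (tau := INR n / 2). assert (Ht : 0 < tau) by (unfold tau; lra).
  destruct (gam_ex 0 tau) as (z & Hz).
  destruct (bessel_pair_ex tau z Hz) as (Jr & Ji & Dr & Di & HB & EB).
  destruct (bessel_sq _ _ _ _ _ _ HB) as (C & HS & Hnear).
  assert (HI : forall u l, 0 <= u -> has_int (fun x => 2 * Jr x * Ji x * struve_k (x * cosh u)) l ->
    2 * sinh u * l = / (PI * cosh (PI * tau)) * sin (2 * tau * u)).
  { intros u l Hu Hl. rewrite (index_integral tau z _ _ _ C u l Hz Ht HS Hnear Hu Hl). unfold Rdiv. ring. }
  assert (K1 := sq_sol_int_kernel _ _ _ _ _ _ (fun u => fst (psi u)) HS HI C1).
  assert (K2 := sq_sol_int_kernel _ _ _ _ _ _ (fun u => snd (psi u)) HS HI C2).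
  unfold a_coef. fold tau.
  erewrite RInt_gen_C; [| | exact K1 | exact K2].
  2: { intros x Hx. rewrite EB, f_of_eq by trivial. unfold Cmult, RtoC, Im; cbn [fst snd]. f_equal; ring. }
  (* The prefactor of a_n meets the constant of the index integral: sinh(pi n/2) cosh(pi n/2) =
     sinh(pi n)/2. This is where the weight sinh(pi n) of the expansion comes from. *)
  assert (Hk : / sinh (PI * INR n / 2) * / (PI * cosh (PI * tau)) = 2 / PI * / sinh (PI * INR n)).
  { unfold tau. replace (PI * (INR n / 2)) with (PI * INR n / 2) by field. set (y := PI * INR n / 2).
    assert (Hy : 0 < y) by (unfold y; nra).
    replace (PI * INR n) with (2 * y) by (unfold y; field).
    assert (E : sinh (2 * y) = 2 * sinh y * cosh y).
    { unfold sinh, cosh. replace (2 * y) with (y + y) by ring. rewrite Ropp_plus_distr, 2!exp_plus. field. }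
    rewrite E. assert (0 < sinh y) by (generalize (sinh_ge y ltac:(lra)); lra). generalize (cosh_ge_1 y). intros. field. lra. }
  rewrite <- Hk. unfold sin_coef. replace (2 * tau) with (INR n) by (unfold tau; field).
  unfold Cmult, RtoC; cbn [fst snd]. f_equal; ring.
Qed.

Lemma RInt_even (f : R -> R) a : (forall x, continuous f x) -> (forall x, f (- x) = f x) -> RInt f (- a) a = 2 * RInt f 0 a.
Proof.
  intros Hf Hev.
  assert (K := RInt_comp_lin (V := R_CompleteNormedModule) f (-1) 0 (- a) 0 (ex_RInt_all f _ _ Hf)).
  replace (-1 * - a + 0) with a in K by ring. replace (-1 * 0 + 0) with 0 in K by ring.
  rewrite (RInt_ext (V := R_CompleteNormedModule) _ (fun x => -1 * f x)) in K.
  2: { intros x _. unfold scal; simpl; unfold mult; simpl. replace (-1 * x + 0) with (- x) by ring. now rewrite Hev. }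
  rewrite RInt_scal_R in K by now apply ex_RInt_all.
  assert (K2 := opp_RInt_swap (V := R_CompleteNormedModule) f 0 a (ex_RInt_all f _ _ Hf)).
  unfold opp in K2; simpl in K2.
  assert (E : - RInt f 0 a = -1 * RInt f (- a) 0) by (rewrite K2; symmetry; exact K).
  rewrite <- (RInt_Chasles_R f (- a) 0 a) by now apply ex_RInt_all. lra.
Qed.

Lemma Omega_eq n x : 0 < x -> 2 * Omega n x = sin_coef (hker x) n.
Proof.
  intros Hx. unfold Omega, sin_coef. rewrite (RInt_even (fun u => hker x u * sin (INR n * u))).
  - f_equal. apply (RInt_ext (V := R_CompleteNormedModule)). intros u _. now rewrite kern_hker.
  - intros u. apply cont_mult. apply (cont2_snd _ x u hker_cont2 Hx). apply cont_ex_derive. auto_derive. trivial.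
  - intros u. rewrite hker_odd, <- Ropp_mult_distr_r, sin_neg. ring.
Qed.

Theorem theorem6 (psi : R -> C) (Cst : R) :
  (forall u, psi (u + 2 * PI) = psi u) ->
  0 < Cst ->
  (forall u v, - PI <= u <= PI -> - PI <= v <= PI ->
     Cmod (Cminus (psi u) (psi v)) <= Cst * Rabs (u - v)) ->
  forall x, 0 < x ->
    @is_series R_AbsRing C_R_NormedModule (fun k => Cmult (RtoC (sinh (PI * INR (S k)) * Omega (S k) x)) (a_coef psi (S k)))
              (f_of psi x).
Proof.
  intros Hper HC Hlip x Hx. assert (HP := PI_RGT_0).
  assert (L1 : periodic_lip (fun u => fst (psi u)) Cst).
  { apply periodic_lip_intro. lra. intros u. now rewrite Hper. intros u v Hu Hv.
    eapply Rle_trans. 2: now apply Hlip. exact (Rabs_fst_le_Cmod (Cminus (psi u) (psi v))). }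
  assert (L2 : periodic_lip (fun u => snd (psi u)) Cst).
  { apply periodic_lip_intro. lra. intros u. now rewrite Hper. intros u v Hu Hv.
    eapply Rle_trans. 2: now apply Hlip. exact (Rabs_snd_le_Cmod (Cminus (psi u) (psi v))). }
  assert (C1 := fun u => periodic_lip_cont _ _ u L1). assert (C2 := fun u => periodic_lip_cont _ _ u L2).
  assert (Ef : f_of psi x = (RInt (fun u => hker x u * fst (psi u)) (- PI) PI, RInt (fun u => hker x u * snd (psi u)) (- PI) PI)).
  { now apply f_of_eq. }
  assert (Et : forall k, Cmult (RtoC (sinh (PI * INR (S k)) * Omega (S k) x)) (a_coef psi (S k)) =
    (/ PI * (sin_coef (hker x) (S k) * sin_coef (fun u => fst (psi u)) (S k)), / PI * (sin_coef (hker x) (S k) * sin_coef (fun u => snd (psi u)) (S k)))).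
  { intros k. rewrite (a_coef_eq psi (S k) C1 C2 ltac:(lia)), <- Omega_eq by trivial.
    assert (Hy : 0 < PI * INR (S k)) by (apply Rmult_lt_0_compat; [lra | apply lt_0_INR; lia]).
    assert (Hs : 0 < sinh (PI * INR (S k))) by (generalize (sinh_ge _ (Rlt_le _ _ Hy)); lra).
    unfold Cmult, RtoC; cbn [fst snd]. f_equal; field; lra. }
  rewrite Ef. apply is_series_C; cbn [fst snd].
  - apply is_series_ext with (fun k => / PI * (sin_coef (hker x) (S k) * sin_coef (fun u => fst (psi u)) (S k))).
    intros k. now rewrite Et.
    apply (parseval_odd (hker x) (hker' x) _ Cst); trivial; intros u. now apply hker_derive. now apply hker'_cont. apply hker_odd.
  - apply is_series_ext with (fun k => / PI * (sin_coef (hker x) (S k) * sin_coef (fun u => snd (psi u)) (S k))).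
    intros k. now rewrite Et.
    apply (parseval_odd (hker x) (hker' x) _ Cst); trivial; intros u. now apply hker_derive. now apply hker'_cont. apply hker_odd.
Qed.
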